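(* Let $N$ be a squarefree positive integer. At $s=0$ we have the Laurent expansion \[ \sum_{p\in C(\Gamma_0(N))}E^{\mathrm{par}}_p(z,s)=1+\frac{1}{\sigma_0(N)}\sum_{c\mid N}\log\left(|\Delta(cz)|^{1/6}\mathrm{Im}(z)\right)\cdot s+O(s^2). \]
   Context: $C(\Gamma_0(N))$ is the set of cusps of $\Gamma_0(N)$. For a cusp $p$ with stabilizer $\Gamma_0(N)_p$ and scaling matrix $\sigma_p\in\mathrm{SL}_2(\mathbb{R})$ ($\sigma_p\infty=p$ and $\sigma_p\begin{pmatrix}1&1\\0&1\end{pmatrix}\sigma_p^{-1}$ generates $\Gamma_0(N)_p/\{\pm1\}$), $E^{\mathrm{par}}_p(z,s)=\sum_{M\in\Gamma_0(N)_p\backslash\Gamma_0(N)}\mathrm{Im}(\sigma_p^{-1}Mz)^s$ for $\mathrm{Re}(s)>1$, meromorphically continued in $s$. $\sigma_0(N)$ is the number of positive divisors of $N$, and $\Delta(z)=\eta(z)^{24}$ is the normalized cusp form of weight 12 for $\mathrm{SL}_2(\mathbb{Z})$. *)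

(* Defs.v *)
From HB Require Import structures.
From mathcomp Require Import all_boot all_order all_algebra complex.
From mathcomp Require Import all_classical all_reals all_analysis.
From mathcomp Require summability.
Set Implicit Arguments.
Unset Strict Implicit.
Unset Printing Implicit Defensive.
Import Order.TTheory GRing.Theory Num.Theory.
Import numFieldNormedType.Exports.
Local Open Scope classical_set_scope.
Local Open Scope ring_scope.

(* [R[i]^o] is the field [R[i]] viewed as a normed space over itself; this is
   the form on which MathComp-Analysis puts the usual topology. *)

Definition squarefree (n : nat) : Prop :=
  forall d : nat, (d ^ 2 %| n)%N -> d = 1%N.

(* Linear fractional action of 2x2 matrices on P^1(F); [None] is the point at
   infinity. *)
Definition mobP (F : fieldType) (g : 'M[F]_2) (x : option F) : option F :=
  match x with
  | Some u => if g 1 0 * u + g 1 1 == 0 then None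
              else Some ((g 0 0 * u + g 0 1) / (g 1 0 * u + g 1 1))
  | None => if g 1 0 == 0 then None else Some (g 0 0 / g 1 0)
  end.

Definition Gamma0 (N : nat) : set 'M[int]_2 :=
  [set M : 'M[int]_2 | \det M = 1 /\ (N%:Z %| M 1%R 0%R)%Z].

Definition actQ (M : 'M[int]_2) (p : option rat) : option rat :=
  mobP (map_mx intr M) p.

Definition stab (N : nat) (p : option rat) : set 'M[int]_2 :=
  [set M : 'M[int]_2 | Gamma0 N M /\ actQ M p = p].

Definition cusp_class (N : nat) (p : option rat) : set (option rat) :=
  [set actQ M p | M in Gamma0 N].

(* The set of cusps: the Gamma0(N)-orbits on P^1(Q). *)
Definition cusps (N : nat) : set (set (option rat)) := range (cusp_class N).

(* The right cosets (stab N p) M, M in Gamma0(N). *)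
Definition stab_cosets (N : nat) (p : option rat) : set (set 'M[int]_2) :=
  [set [set G *m M | G in stab N p] | M in Gamma0 N].

Section Analytic.
Variable R : realType.
Local Notation C := (R[i]^o).

Definition T1 : 'M[R]_2 := \matrix_(i < 2, j < 2) (i <= j)%N%:R.

(* [sg] is a scaling matrix of the cusp [p].  As -1 lies in the stabilizer,
   sg T1 sg^-1 generates stab/{1,-1} iff stab consists exactly of the matrices
   +/- (sg T1 sg^-1)^n with n in Z. *)
Definition is_scaling (N : nat) (p : option rat) (sg : 'M[R]_2) : Prop :=
  let g : 'M[R]_2 := sg *m T1 *m invmx sg in
  [/\ \det sg = 1,
      mobP sg None = omap (fun q : rat => ratr q) p
    & [set map_mx intr M | M in stab N p] =
      [set A : 'M[R]_2 | exists n : int, A = g ^ n \/ A = - g ^ n] ].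

Definition mobC (g : 'M[R]_2) (z : R[i]) : R[i] :=
  ((g 0 0)%:C%C * z + (g 0 1)%:C%C) / ((g 1 0)%:C%C * z + (g 1 1)%:C%C).

Definition cexp (w : R[i]) : R[i] :=
  ((expR (complex.Re w) * cos (complex.Im w)) +i*
   (expR (complex.Re w) * sin (complex.Im w)))%C.

(* y^s for y > 0 *)
Definition cpow (y : R) (s : R[i]) : R[i] := cexp (s * (ln y)%:C%C).

(* Unconditional convergence to [l] of the sum of [f] over the set [A]. *)
Definition has_sum (I : choiceType) (A : set I) (f : I -> C) (l : C) : Prop :=
  summability.partial_sum (fun i => if i \in A then f i else 0)
    @ summability.totally --> l.

(* The term attached to a coset: it does not depend on the element of the coset
   selected by [xget]. *)
Definition eis_term (sg : 'M[R]_2) (z s : R[i]) (K : set 'M[int]_2) : C :=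
  let M := xget 1%:M K in
  cpow (complex.Im (mobC (invmx sg *m map_mx intr M) z)) s.

(* The series defining the Eisenstein series converges and has value [l]. *)
Definition eis_series (N : nat) (p : option rat) (sg : 'M[R]_2)
    (z s : R[i]) (l : C) : Prop :=
  has_sum (stab_cosets N p) (eis_term sg z s) l.

(* Laurent expansion with finite principal part around every point.  The values
   at the (isolated) poles and removable singularities are unconstrained. *)
Definition meromorphic (f : C -> C) : Prop :=
  forall s0 : C, exists (k : nat) (a : nat -> C),
    \forall s \near s0^',
      series (fun n => a n * (s - s0) ^+ n) @ \oo --> (s - s0) ^+ k * f s.

(* The meromorphic continuation to the whole s-plane.  It is unique up to its
   values on a discrete set. *)
Definition Epar (N : nat) (p : option rat) (sg : 'M[R]_2) (z : R[i]) : C -> C :=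
  xget (fun=> 0) [set F : C -> C | meromorphic F /\
    forall s : C, 1 < complex.Re s -> eis_series N p sg z s (F s)].

Definition dedekind_eta (z : R[i]) : C :=
  cexp ((pi / 12)%:C%C * 'i%C * z) *
  lim ((fun n : nat => \prod_(1 <= k < n.+1)
          (1 - cexp ((2 * pi * k%:R)%:C%C * 'i%C * z)) : C) @ \oo).

Definition Delta (z : R[i]) : R[i] := dedekind_eta z ^+ 24.

(* |w| as an element of R (the library norm of R[i] takes values in R[i]) *)
Definition cmod (w : R[i]) : R := complex.Re `|w|.

End Analytic.

(* Main.v *)
(* For squarefree N the cusps of Gamma0(N) are classified by g = gcd(denominator, N), with
   g | N; the cusp of level g has width N/g, and its cosets correspond, up to sign, to the
   primitive vectors (c, d) with gcd(c, N) = g.  Hence its Eisenstein series is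
   (g y / N)^s / 2 times the sum of |cz + d|^(-2s) over these vectors.  Sorting by
   divisibility at a prime p not dividing M shows that the sum Y_M of all these series
   satisfies Y_{Mp}(z) = (Y_M(z) + Y_M(pz)) / (1 + p^s), so that everything reduces to
   level 1, where Y_1 is the ratio of the Epstein zeta function Z_z of the lattice Zz + Z
   to twice the Riemann zeta function at 2s, times y^s.

   The alternating sums of (-1)^n |mz + n|^(-2s) over (m, n), and of (-1)^n |n|^(-2s) over
   n, are entire, by iterated differences; splitting the lattice modulo 2 expresses Z_z
   through the alternating sums for z, z + 1 and -1/z.  Row by row the derivatives at 0 of
   the alternating sums are evaluated with the sine product.  This determines Z_z'(0) only
   up to an unknown term: with H(z) the sum of log|1 - e^(2 pi i m z)| over m >= 1,
   R(z) = Z_z'(0) + 4 H(z) + 2 log(2 pi) satisfies R(2z) = 2 R(z) and a transformation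
   law under z -> -1/z.  Therefore R(z) is the limit of -4 * 2^(-k) H(-1/(2^k z)), which
   is pi y / 3 by dominated convergence and the sum of inverse squares.  This is the
   Kronecker limit formula at s = 0. *)
Require Import Defs.
From HB Require Import structures.
From mathcomp Require Import all_boot all_order all_algebra complex.
From mathcomp Require Import all_classical all_reals all_analysis.
From mathcomp Require Import ring lra zify finmap.
Set Implicit Arguments.
Unset Strict Implicit.
Unset Printing Implicit Defensive.
Import Order.TTheory GRing.Theory Num.Theory.
Import numFieldNormedType.Exports.
Local Open Scope classical_set_scope.
Local Open Scope ring_scope.

(** * Complex modulus *)

(** The point s = 0 is reached from Re s > 1 without contour integrals or a functional equation: a
    unit shift reverses the sign in an alternating sum, and each difference of |w|^(-2s) gains a
    factor 1/|w|. Analyticity is carried by coefficient norms ([normal_series]), so that summing a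
    family of functions is an interchange in an absolutely convergent double sum. [Epar] is a choice
    among continuations whose values at isolated points are free; identities are therefore claimed
    on punctured neighbourhoods ([near_off]).

    The splitting modulo 2 alone would express Z_z'(0) through values of H at -1/z and -1/(2z) as
    well, so reading it off would presuppose the inversion law of eta. The duplication relation
    involves only z and 2z, at the price of an undetermined solution of R(2z) = 2 R(z); this is the
    origin of the unknown term.

    For a single cusp the recursion over the primes of N divides by 1 - p^(-2s), which vanishes at s
    = 0; for the sum over all cusps the divisor is 1 + p^s. Hence expansions at 0 are propagated
    only for the sum. *)

Section Complex.
Variable R : realType.
Local Notation C := R[i].
Implicit Types x y w : C.

Lemma cmodE x : (cmod x)%:C%C = `|x|.
Proof.
by rewrite /cmod normc_def.
Qed.

Lemma cmod_sqr x : cmod x ^+ 2 = complex.Re x ^+ 2 + complex.Im x ^+ 2.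
Proof.
by rewrite /cmod normc_def /= sqr_sqrtr// addr_ge0 ?sqr_ge0.
Qed.

Lemma cmod_ge0 x : 0 <= cmod x.
Proof. by rewrite /cmod normc_def /= sqrtr_ge0. Qed.

Lemma cmodM x y : cmod (x * y) = cmod x * cmod y.
Proof.
by apply: (@complexI R); rewrite rmorphM /= !cmodE normrM.
Qed.

Lemma cmodD x y : cmod (x + y) <= cmod x + cmod y.
Proof.
have := ler_normD x y; rewrite -!cmodE -rmorphD /=.
by rewrite lecR.
Qed.

Lemma cmodN x : cmod (- x) = cmod x.
Proof. by rewrite /cmod normrN. Qed.

Lemma cmodB x y : cmod (x - y) <= cmod x + cmod y.
Proof. by rewrite -(cmodN y) cmodD. Qed.

Lemma cmod_distC x y : cmod (x - y) = cmod (y - x).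
Proof. by rewrite -cmodN opprB. Qed.

Lemma cmod0 : cmod (0 : C) = 0.
Proof. by rewrite /cmod normr0. Qed.

Lemma cmod1 : cmod (1 : C) = 1.
Proof. by rewrite /cmod normr1. Qed.

Lemma cmod_real (r : R) : cmod r%:C%C = `|r|.
Proof. by apply: (@complexI R); rewrite cmodE normc_def /= expr0n addr0 sqrtr_sqr. Qed.

Lemma cmod_nat (n : nat) : cmod (n%:R : C) = n%:R.
Proof. by rewrite -(rmorph_nat (real_complex R)) cmod_real normr_nat. Qed.

Lemma cmod_eq0 x : (cmod x == 0) = (x == 0).
Proof.
by rewrite -(normr_eq0 x) -cmodE -(inj_eq (@complexI R)).
Qed.

Lemma cmod_gt0 x : (0 < cmod x) = (x != 0).
Proof. by rewrite lt_def cmod_ge0 andbT cmod_eq0. Qed.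

Lemma cmodX x n : cmod (x ^+ n) = cmod x ^+ n.
Proof. by elim: n => [|n IH]; rewrite ?expr0 ?cmod1// !exprS cmodM IH. Qed.

Lemma cmodV x : cmod x^-1 = (cmod x)^-1.
Proof.
by apply: (@complexI R); rewrite cmodE normfV -cmodE fmorphV.
Qed.

Lemma cmod_sum (I : Type) (r : seq I) (P : pred I) (F : I -> C) :
  cmod (\sum_(i <- r | P i) F i) <= \sum_(i <- r | P i) cmod (F i).
Proof.
elim/big_ind2 : _ => [|a b c d h1 h2|//]; first by rewrite cmod0.
exact: le_trans (cmodD _ _) (lerD h1 h2).
Qed.

Lemma cmod_prod (I : Type) (r : seq I) (P : pred I) (F : I -> C) :
  cmod (\prod_(i <- r | P i) F i) = \prod_(i <- r | P i) cmod (F i).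
Proof.
elim/big_ind2 : _ => [|a b c d h1 h2|//]; first by rewrite cmod1.
by rewrite cmodM h1 h2.
Qed.

Lemma cmod_Re x : `|complex.Re x| <= cmod x.
Proof. by have := normc_ge_Re x; rewrite -cmodE lecR. Qed.

Lemma cmod_Im x : `|complex.Im x| <= cmod x.
Proof.
rewrite -(@ler_pXn2r _ 2)// ?nnegrE ?cmod_ge0//.
by rewrite cmod_sqr real_normK ?num_real// lerDr sqr_ge0.
Qed.

Lemma cmod_le_ReIm x : cmod x <= `|complex.Re x| + `|complex.Im x|.
Proof.
rewrite -(@ler_pXn2r _ 2)// ?nnegrE ?cmod_ge0 ?addr_ge0//.
rewrite cmod_sqr sqrrD !real_normK ?num_real// addrAC lerDl.
by rewrite mulrn_wge0 ?mulr_ge0.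
Qed.

Lemma cmod_geB x y : cmod x - cmod y <= cmod (x + y).
Proof. by rewrite lerBlDr -(cmodN y); apply: le_trans (cmodD _ _); rewrite addrK. Qed.

End Complex.

(** * Unconditional sums *)

Section Sums.
Variable R : realType.
Local Notation C := R[i].

Definition sums (I : choiceType) (f : I -> C) (l : C) : Prop :=
  forall e : R, 0 < e -> exists J0 : {fset I}, forall J : {fset I},
    (J0 `<=` J)%fset -> cmod (\sum_(i <- J) f i - l) < e.

Definition bsum (I : choiceType) (f : I -> C) (M : R) : Prop :=
  forall J : {fset I}, \sum_(i <- J) cmod (f i) <= M.

Definition summ (I : choiceType) (f : I -> C) : Prop := exists M, bsum f M.

Definition tsum (I : choiceType) (f : I -> C) : C := xget 0 [set l | sums f l].

Section Basic.
Variable I : choiceType.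
Implicit Types (f g : I -> C) (J K : {fset I}).

Lemma fset_sumD (V : zmodType) (g : I -> V) J K : (J `<=` K)%fset ->
  \sum_(i <- K) g i = \sum_(i <- J) g i + \sum_(i <- (K `\` J)%fset) g i.
Proof.
move=> JK; rewrite -big_cat /=; apply: perm_big.
apply: uniq_perm => //.
  rewrite cat_uniq !fset_uniq /= andbT; apply/hasPn => x.
  by rewrite in_fsetD => /andP[].
move=> x; rewrite mem_cat in_fsetD.
by case: (boolP (x \in J)) => // xJ; rewrite (fsubsetP JK).
Qed.

Lemma fset_sum_le (g : I -> R) J K : (forall i, 0 <= g i) -> (J `<=` K)%fset ->
  \sum_(i <- J) g i <= \sum_(i <- K) g i.
Proof. by move=> g0 JK; rewrite (fset_sumD _ JK) lerDl sumr_ge0. Qed.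

Lemma bsum_ge0 f M : bsum f M -> 0 <= M.
Proof. by move=> /(_ fset0); rewrite big_seq_fset0. Qed.

Lemma bsum_le f M M' : bsum f M -> M <= M' -> bsum f M'.
Proof. by move=> h MM J; apply: le_trans (h J) MM. Qed.

Lemma bsum_mono f g M : bsum g M -> (forall i, cmod (f i) <= cmod (g i)) ->
  bsum f M.
Proof. by move=> h fg J; apply: le_trans (h J); apply: ler_sum => i _; apply: fg. Qed.

Lemma bsumD f g M N : bsum f M -> bsum g N -> bsum (fun i => f i + g i) (M + N).
Proof.
move=> h k J; apply: le_trans (lerD (h J) (k J)); rewrite -big_split /=.
by apply: ler_sum => i _; apply: cmodD.
Qed.

Lemma bsumZ (c : C) f M : bsum f M -> bsum (fun i => c * f i) (cmod c * M).
Proof.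
move=> h J; under eq_bigr do rewrite cmodM.
by rewrite -mulr_sumr ler_wpM2l ?cmod_ge0.
Qed.

Lemma summD f g : summ f -> summ g -> summ (fun i => f i + g i).
Proof. by move=> [M h] [N k]; exists (M + N); apply: bsumD. Qed.

Lemma summZ (c : C) f : summ f -> summ (fun i => c * f i).
Proof. by move=> [M h]; exists (cmod c * M); apply: bsumZ. Qed.

Lemma summ_mono f g : summ g -> (forall i, cmod (f i) <= cmod (g i)) -> summ f.
Proof. by move=> [M h] fg; exists M; apply: bsum_mono fg. Qed.

Lemma summ_restr f (P : pred I) : summ f -> summ (fun i => if P i then f i else 0).
Proof.
move=> sf; apply: summ_mono sf _ => i; case: ifP => // _.
by rewrite cmod0 cmod_ge0.
Qed.

(** A finite set whose partial sum is within [e] of the supremum leaves less than [e] for any finite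
    set disjoint from it. *)
Lemma bsum_tail f M : bsum f M -> forall e : R, 0 < e ->
  exists J0 : {fset I}, forall J, [disjoint J & J0]%fset ->
    \sum_(i <- J) cmod (f i) < e.
Proof.
move=> h e e0.
pose A := [set x : R | exists J : {fset I}, x = \sum_(i <- J) cmod (f i)].
have hA : has_sup A.
  split; first by exists (\sum_(i <- fset0) cmod (f i)), fset0.
  by exists M => _ [J ->].
have [_ [J0 ->] hJ0] := sup_adherent e0 hA.
exists J0 => J dJ.
have JJ : (J0 `<=` (J0 `|` J))%fset by rewrite fsubsetUl.
have : \sum_(i <- (J0 `|` J)%fset) cmod (f i) <= sup A.
  by apply: sup_upper_bound => //; exists (J0 `|` J)%fset.
rewrite (fset_sumD _ JJ).
have -> : ((J0 `|` J) `\` J0 = J)%fset.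
  rewrite fsetDUl fsetDv fset0U.
  by apply/fsetDidPl.
by rewrite addrC -lerBrDr => /le_lt_trans; apply; rewrite ltrBlDl -ltrBlDr.
Qed.

Lemma sums_unique f l l' : sums f l -> sums f l' -> l = l'.
Proof.
move=> h h'; apply/eqP; rewrite -subr_eq0 -cmod_eq0.
rewrite eq_le cmod_ge0 andbT; apply/ler_addgt0Pr => e e0; rewrite add0r.
have e2 : 0 < e / 2 by rewrite divr_gt0.
have [J hJ] := h _ e2; have [K hK] := h' _ e2.
have := hJ (J `|` K)%fset (fsubsetUl _ _).
have := hK (J `|` K)%fset (fsubsetUr _ _).
set s := \sum_(i <- _) _ => h1 h2.
have -> : l - l' = (s - l') - (s - l) by ring.
by apply: le_trans (cmodB _ _) _; rewrite (splitr e) lerD// ltW.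
Qed.

Lemma tsumE f l : sums f l -> tsum f = l.
Proof. move=> h; rewrite /tsum; apply: (sums_unique _ h).
by apply: (@xgetPex _ 0 [set l | sums f l]); exists l. Qed.

Lemma real_sum_exists (g : I -> R) M : (forall i, 0 <= g i) ->
  (forall J, \sum_(i <- J) g i <= M) -> exists S : R, forall e, 0 < e ->
  exists J0 : {fset I}, forall J, (J0 `<=` J)%fset -> `|\sum_(i <- J) g i - S| < e.
Proof.
move=> g0 h.
pose A := [set x : R | exists J : {fset I}, x = \sum_(i <- J) g i].
have hA : has_sup A.
  split; first by exists (\sum_(i <- fset0) g i), fset0.
  by exists M => _ [J ->].
exists (sup A) => e e0; have [_ [J0 ->] hJ0] := sup_adherent e0 hA.
exists J0 => J /(fset_sum_le g0) h1.
have h2 : \sum_(i <- J) g i <= sup A by apply: sup_upper_bound => //; exists J.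
rewrite ltr_norml; apply/andP; split; first by rewrite ltrBrDr addrC; apply: lt_le_trans h1.
by rewrite ltrBlDr; apply: le_lt_trans h2 _; rewrite ltrDr.
Qed.

Lemma summ_hs f : summ f -> sums f (tsum f).
Proof.
suff h : summ f -> exists l, sums f l by move=> /h [l hl]; rewrite (tsumE hl).
move=> [M h].
have b0 : forall J, \sum_(i <- J) cmod (f i) <= M by [].
(* Adding [cmod (f i)] makes real and imaginary parts nonnegative, so that three suprema exist; the
   sum [S0] of the moduli is subtracted at the end. *)
have posRe i : 0 <= complex.Re (f i) + cmod (f i).
  by rewrite -lerBlDr sub0r; have := cmod_Re (f i); rewrite ler_norml => /andP[].
have posIm i : 0 <= complex.Im (f i) + cmod (f i).
  by rewrite -lerBlDr sub0r; have := cmod_Im (f i); rewrite ler_norml => /andP[].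
have bRe J : \sum_(i <- J) (complex.Re (f i) + cmod (f i)) <= M + M.
  rewrite big_split lerD//; apply: le_trans (b0 J); apply: ler_sum => i _.
  exact: le_trans (ler_norm _) (cmod_Re _).
have bIm J : \sum_(i <- J) (complex.Im (f i) + cmod (f i)) <= M + M.
  rewrite big_split lerD//; apply: le_trans (b0 J); apply: ler_sum => i _.
  exact: le_trans (ler_norm _) (cmod_Im _).
have [S0 h0] := real_sum_exists (fun i => cmod_ge0 (f i)) b0.
have [S1 h1] := real_sum_exists posRe bRe.
have [S2 h2] := real_sum_exists posIm bIm.
exists ((S1 - S0) +i* (S2 - S0))%C => e e0.
have e4 : 0 < e / 4 by rewrite divr_gt0.
have [J0 k0] := h0 _ e4; have [J1 k1] := h1 _ e4; have [J2 k2] := h2 _ e4.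
exists (J0 `|` (J1 `|` J2))%fset => J; rewrite !fsubUset => /and3P[/k0 + /k1 + /k2].
rewrite !big_split /=.
have -> : \sum_(i <- J) f i =
  ((\sum_(i <- J) complex.Re (f i)) +i* (\sum_(i <- J) complex.Im (f i)))%C.
  by elim/big_ind3 : _ => [|a b c a' b' c' -> ->|i _] //; case: (f i).
move: (\sum_(i <- J) cmod (f i)) => a.
move: (\sum_(i <- J) complex.Re (f i)) => b'; move: (\sum_(i <- J) complex.Im (f i)) => c.
move=> h3 h4 h5; apply: le_lt_trans (cmod_le_ReIm _) _ => /=.
move: h3 h4 h5; rewrite !ltr_norml => /andP[? ?] /andP[? ?] /andP[? ?].
have H : forall u v : R, `|u| < e/2 -> `|v| < e/2 -> `|u| + `|v| < e by move=> u v; lra.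
by apply: H; rewrite ltr_norml; apply/andP; split; lra.
Qed.

Lemma sums_tail f M l : bsum f M -> sums f l -> cmod l <= M.
Proof.
move=> b h; apply/ler_addgt0Pr => e e0; have [J hJ] := h _ e0.
have := hJ J (fsubset_refl _); rewrite cmod_distC => hl.
have -> : l = (l - \sum_(i <- J) f i) + \sum_(i <- J) f i by ring.
apply: le_trans (cmodD _ _) _; rewrite addrC lerD ?(ltW hl)//.
exact: le_trans (cmod_sum _ _ _) (b J).
Qed.

Lemma cmod_tsum f M : bsum f M -> cmod (tsum f) <= M.
Proof. by move=> b; apply: (sums_tail b); apply: summ_hs; exists M. Qed.

Lemma sumsD f g a b : sums f a -> sums g b -> sums (fun i => f i + g i) (a + b).
Proof.
move=> h k e e0; have e2 : 0 < e / 2 by rewrite divr_gt0.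
have [J hJ] := h _ e2; have [K hK] := k _ e2.
exists (J `|` K)%fset => L; rewrite fsubUset => /andP[/hJ h1 /hK h2].
rewrite big_split /= opprD addrACA.
by apply: le_lt_trans (cmodD _ _) _; rewrite (splitr e) ltrD.
Qed.

Lemma sumsZ (c : C) f a : sums f a -> sums (fun i => c * f i) (c * a).
Proof.
move=> h e e0; have p : 0 < cmod c + 1 by rewrite ltr_wpDl// cmod_ge0.
have [J hJ] := h (e / (cmod c + 1)) (divr_gt0 e0 p).
exists J => K /hJ h1; rewrite -mulr_sumr -mulrBr cmodM.
rewrite -(divfK (lt0r_neq0 p) e) mulrC.
apply: le_lt_trans (_ : _ <= cmod (\sum_(i <- K) f i - a) * (cmod c + 1)) _.
  by rewrite ler_wpM2l ?cmod_ge0// lerDl.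
by rewrite ltr_pM2r.
Qed.

Lemma sums0 : sums (fun _ : I => 0) 0.
Proof. by move=> e e0; exists fset0 => J _; rewrite big1// subrr cmod0. Qed.

Lemma eq_sums f g l : f =1 g -> sums f l -> sums g l.
Proof. by move=> /funext ->. Qed.

Lemma tsumD f g : summ f -> summ g -> tsum (fun i => f i + g i) = tsum f + tsum g.
Proof. by move=> /summ_hs h /summ_hs k; apply: tsumE; apply: sumsD. Qed.

Lemma tsumZ c f : summ f -> tsum (fun i => c * f i) = c * tsum f.
Proof. by move=> /summ_hs h; apply: tsumE; apply: sumsZ. Qed.

Lemma eq_tsum f g : f =1 g -> tsum f = tsum g.
Proof. by move=> /funext ->. Qed.

Lemma sums_finite f (J : {fset I}) : (forall i, i \notin J -> f i = 0) ->
  sums f (\sum_(i <- J) f i).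
Proof.
move=> h e e0; exists J => K JK; rewrite (fset_sumD _ JK).
rewrite addrAC subrr add0r big_seq big1 ?cmod0// => i.
by rewrite in_fsetD => /andP[/h].
Qed.

Lemma sums_single f i0 : (forall i, i != i0 -> f i = 0) -> sums f (f i0).
Proof.
move=> h; have := @sums_finite f [fset i0]%fset; rewrite big_seq_fset1; apply.
by move=> i; rewrite inE => /h.
Qed.

Lemma tsum_finite (K : choiceType) (s : seq K) (F : K -> I -> C) :
  (forall k, k \in s -> summ (F k)) ->
  sums (fun i => \sum_(k <- s) F k i) (\sum_(k <- s) tsum (F k)).
Proof.
elim: s => [|k s IH] h.
  rewrite big_nil; apply: eq_sums sums0 => i /=; by rewrite big_nil.
rewrite big_cons; apply: (@eq_sums (fun i => F k i + \sum_(j <- s) F j i)).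
  by move=> i; rewrite big_cons.
apply: sumsD; first by apply: summ_hs; apply: h; rewrite inE eqxx.
by apply: IH => j js; apply: h; rewrite inE js orbT.
Qed.

End Basic.

(** Once a finite set [B] contains the image of a large finite set of indices, the terms not yet
    collected form a tail of [f]. The later rearrangements (reindexing, double sums, Cauchy
    products, grouping by gcd or by coset) are instances. *)
Lemma sums_fiber (I N : choiceType) (p : I -> N) (f : I -> C) (F : N -> C) (l : C) :
  summ f -> sums f l ->
  (forall n, sums (fun i => if p i == n then f i else 0) (F n)) -> sums F l.
Proof.
move=> [M b] hf hF e e0.
have e2 : 0 < e / 2 by rewrite divr_gt0.
have [J0 hJ0] := bsum_tail b e2.
exists [fset p i | i in J0]%fset => B hB.
have hB' : sums (fun i => if p i \in B then f i else 0) (\sum_(n <- B) F n).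
  have -> : \sum_(n <- B) F n =
      \sum_(n <- B) tsum (fun i => if p i == n then f i else 0).
    by apply: eq_bigr => n _; rewrite (tsumE (hF n)).
  apply: eq_sums (tsum_finite _) => [i /=|k _]; last by apply: summ_restr; exists M.
  case: ifPn => [pB|pB].
    rewrite (big_fsetD1 (p i))//= eqxx big_seq big1 ?addr0// => n.
    by rewrite in_fsetD1 eq_sym => /andP[/negPf ->].
  rewrite big_seq big1// => n nB; case: eqP => // h.
  by move: pB; rewrite h nB.
have := sumsD hB' (sumsZ (-1) hf); rewrite mulN1r => hd.
have bb : bsum (fun i => (if p i \in B then f i else 0) + -1 * f i) (e / 2).
  move=> J; apply: ltW; pose P i := p i \in B.
  apply: le_lt_trans (_ : _ <= \sum_(i <- [fset i in J | ~~ P i]%fset) cmod (f i)) _.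
    rewrite big_fset /= [X in _ <= X]big_mkcond /=.
    apply: ler_sum => i _; rewrite /P; case: ifP => /= _; first by rewrite mulN1r subrr cmod0.
    by rewrite add0r mulN1r cmodN.
  apply: hJ0; apply/fdisjointP => i; rewrite !inE /= => /andP[_]; apply: contra => iJ.
  by apply: (fsubsetP hB); apply/imfsetP; exists i.
by apply: le_lt_trans (sums_tail bb hd) _; rewrite ltr_pdivrMr// ltr_pMr// ltr1n.
Qed.

Definition rbs (I : choiceType) (g : I -> R) (B : R) : Prop :=
  forall J : {fset I}, \sum_(i <- J) g i <= B.

(** Injectivity is required only where [F] is positive, so [g] may be a truncated subtraction or a
    projection that collapses zeros of [F]. *)
Lemma rbs_comp (J K : choiceType) (F : K -> R) (f : J -> R) (g : K -> J) M :
  (forall j, 0 <= f j) ->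
  (forall k k', 0 < F k -> 0 < F k' -> g k = g k' -> k = k') ->
  (forall k, F k <= f (g k)) -> rbs f M -> rbs F M.
Proof.
move=> f0 inj le b L.
apply: le_trans (b [fset g k | k in [fset k in L | 0 < F k]]%fset).
rewrite big_imfset /=; last first.
  move=> k k'; rewrite !inE /= => /andP[_ h] /andP[_ h']; exact: inj.
rewrite big_fset /= [X in _ <= X]big_mkcond /=.
by apply: ler_sum => k _; case: ltP => // /le_trans h.
Qed.

Lemma bsum_comp (J K : choiceType) (F : K -> C) (f : J -> C) (g : K -> J) M :
  (forall k k', F k != 0 -> F k' != 0 -> g k = g k' -> k = k') ->
  (forall k, cmod (F k) <= cmod (f (g k))) -> bsum f M -> bsum F M.
Proof.
move=> inj le b.
apply: (@rbs_comp J K (fun k => cmod (F k)) (fun j => cmod (f j)) g) => //.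
  by move=> j; apply: cmod_ge0.
by move=> k k'; rewrite !cmod_gt0; apply: inj.
Qed.

Lemma rbs_pair (I J : choiceType) (f : I -> J -> R) (M : I -> R) B :
  (forall i j, 0 <= f i j) ->
  (forall i, rbs (f i) (M i)) -> rbs M B -> rbs (fun p => f p.1 p.2) B.
Proof.
move=> f0 hf hM P; pose P1 := [fset p.1 | p in P]%fset.
apply: le_trans (hM P1).
have -> : \sum_(p <- P) f p.1 p.2 =
    \sum_(i <- P1) \sum_(p <- P) (if p.1 == i then f i p.2 else 0).
  rewrite exchange_big /= big_seq [RHS]big_seq; apply: eq_bigr => p pP.
  have p1 : p.1 \in P1 by apply/imfsetP; exists p.
  rewrite (big_fsetD1 p.1)//= eqxx big_seq big1 ?addr0// => i.
  by rewrite in_fsetD1 eq_sym => /andP[/negPf ->].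
apply: ler_sum => i _.
have h : rbs (fun p : I * J => if p.1 == i then f i p.2 else 0) (M i).
  apply: (@rbs_comp J _ _ (f i) (fun p => p.2)) => // [[a b] [a' b'] /=|[a b] /=].
    by case: eqP => [->|_]; rewrite ?ltxx//; case: eqP => [->|_]; rewrite ?ltxx// => _ _ ->.
  by case: eqP.
exact: h P.
Qed.

Lemma bsum_pair (I J : choiceType) (f : I -> J -> C) (M : I -> R) B :
  (forall i, bsum (f i) (M i)) -> rbs M B -> bsum (fun p => f p.1 p.2) B.
Proof.
by move=> h; apply: (@rbs_pair I J (fun i j => cmod (f i j))) => // i j; apply: cmod_ge0.
Qed.

Lemma sums_embed (J K : choiceType) (h : J -> K) (f : J -> C) (F : K -> C) l :
  injective h -> summ f -> (forall j, F (h j) = f j) ->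
  (forall k, (forall j, h j != k) -> F k = 0) -> sums f l -> sums F l.
Proof.
move=> inj sf Fh F0 hf; apply: (sums_fiber (p := h) sf hf) => k.
have [[j <-]|nk] := pselect (exists j, h j = k).
  rewrite Fh; have := @sums_single _ (fun i => if h i == h j then f i else 0) j.
  rewrite eqxx; apply => i ij; case: eqP => // /inj ij'.
  by rewrite ij' eqxx in ij.
rewrite F0; last by move=> j; apply: contra_notN nk => /eqP; exists j.
apply: eq_sums (sums0 _) => j; case: eqP => // hj; by case: nk; exists j.
Qed.

Lemma sums_reindex (J K : choiceType) (h : J -> K) (F : K -> C) l :
  bijective h -> summ F -> sums F l -> sums (fun j => F (h j)) l.
Proof.
move=> [g hK gK] sF; apply: (@sums_embed K J g F) => //.
- exact: can_inj gK.
- by move=> j; rewrite gK.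
- by move=> k /(_ (h k)); rewrite hK eqxx.
Qed.

Lemma summ_inj (J K : choiceType) (h : J -> K) (F : K -> C) :
  injective h -> summ F -> summ (fun j => F (h j)).
Proof.
by move=> inj [M b]; exists M; apply: bsum_comp b => // k k' _ _; apply: inj.
Qed.

Lemma tsum_reindex (J K : choiceType) (h : J -> K) (F : K -> C) :
  bijective h -> summ F -> tsum (fun j => F (h j)) = tsum F.
Proof. by move=> b s; apply: tsumE; apply: sums_reindex => //; apply: summ_hs. Qed.

Lemma sums_pair1 (I J : choiceType) (f : I * J -> C) (g : I -> C) l : summ f ->
  (forall i, sums (fun j => f (i, j)) (g i)) -> sums f l -> sums g l.
Proof.
move=> sf hg hf; apply: (sums_fiber (p := fst) sf hf) => i.
apply: (@sums_embed J _ (fun j => (i, j)) (fun j => f (i, j))) => //.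
- by move=> j j' [].
- by apply: summ_inj sf => j j' [].
- by move=> j; rewrite eqxx.
- by move=> [a b] /(_ b) /=; case: (a =P i) => //= ->; rewrite eqxx.
Qed.

Lemma sums_pair2 (I J : choiceType) (f : I * J -> C) (g : J -> C) l : summ f ->
  (forall j, sums (fun i => f (i, j)) (g j)) -> sums f l -> sums g l.
Proof.
move=> sf hg hf; apply: (sums_fiber (p := snd) sf hf) => i.
apply: (@sums_embed I _ (fun j => (j, i)) (fun j => f (j, i))) => //.
- by move=> j j' [].
- by apply: summ_inj sf => j j' [].
- by move=> j; rewrite eqxx.
- by move=> [a b] /(_ a) /=; case: (b =P i) => //= ->; rewrite eqxx.
Qed.

Lemma bsum_mul (I J : choiceType) (f : I -> C) (g : J -> C) M N :
  bsum f M -> bsum g N -> bsum (fun p => f p.1 * g p.2) (M * N).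
Proof.
move=> bf bg; apply: (@bsum_pair _ _ (fun i j => f i * g j) (fun i => cmod (f i) * N)).
  by move=> i; apply: bsumZ.
move=> K; rewrite -mulr_suml ler_wpM2r//; exact: bsum_ge0 bg.
Qed.

Lemma sums_mul (I J : choiceType) (f : I -> C) (g : J -> C) a b :
  summ f -> summ g -> sums f a -> sums g b -> sums (fun p => f p.1 * g p.2) (a * b).
Proof.
move=> [M bf] [N bg] hf hg.
have s : summ (fun p : I * J => f p.1 * g p.2) by exists (M * N); apply: bsum_mul.
have h := summ_hs s.
suff -> : a * b = tsum (fun p : I * J => f p.1 * g p.2) by [].
have h1 : sums (fun i => f i * b) (tsum (fun p : I * J => f p.1 * g p.2)).
  by apply: (sums_pair1 s _ h) => i /=; apply: sumsZ.
apply: sums_unique h1; rewrite mulrC.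
by apply: (@eq_sums _ (fun i => b * f i)) => [i|]; [rewrite mulrC|apply: sumsZ].
Qed.

Definition cvgs (u : nat -> C) (l : C) : Prop :=
  forall e : R, 0 < e -> exists N, forall n, (N <= n)%N -> cmod (u n - l) < e.

Lemma big_fset_iota (V : nmodType) (f : nat -> V) n :
  \sum_(i <- [fset i in iota 0 n]%fset) f i = \sum_(0 <= i < n) f i.
Proof.
rewrite /index_iota subn0; apply: perm_big; apply: uniq_perm; rewrite ?iota_uniq//.
by move=> i; rewrite !inE.
Qed.

Lemma mem_fset_iota n i : (i \in [fset i in iota 0 n]%fset) = (i < n)%N.
Proof. by rewrite !inE mem_iota leq0n add0n. Qed.

Lemma sums_cvgs (f : nat -> C) l : sums f l -> cvgs (fun n => \sum_(0 <= i < n) f i) l.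
Proof.
move=> h e e0; have [J hJ] := h _ e0; exists (\max_(i <- J) i).+1 => n hn.
rewrite -big_fset_iota; apply: hJ; apply/fsubsetP => i iJ.
rewrite mem_fset_iota; apply: leq_trans hn; rewrite ltnS.
by apply: (@leq_bigmax_seq _ _ predT (fun i => i)).
Qed.

Lemma rbs_nat (g : nat -> R) M : (forall i, 0 <= g i) ->
  (forall n, \sum_(0 <= i < n) g i <= M) -> rbs g M.
Proof.
move=> g0 h J; apply: le_trans (h (\max_(i <- J) i).+1).
rewrite -big_fset_iota; apply: fset_sum_le => //; apply/fsubsetP => i iJ.
rewrite mem_fset_iota ltnS.
by apply: (@leq_bigmax_seq _ _ predT (fun i => i)).
Qed.

Lemma rbs_natP (g : nat -> R) M n : rbs g M -> \sum_(0 <= i < n) g i <= M.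
Proof. by move=> h; have := h [fset i in iota 0 n]%fset; rewrite big_fset_iota. Qed.

Lemma cvgs_unique u l l' : cvgs u l -> cvgs u l' -> l = l'.
Proof.
move=> h h'; apply/eqP; rewrite -subr_eq0 -cmod_eq0.
rewrite eq_le cmod_ge0 andbT; apply/ler_addgt0Pr => e e0; rewrite add0r.
have e2 : 0 < e / 2 by rewrite divr_gt0.
have [J hJ] := h _ e2; have [K hK] := h' _ e2.
have := hJ _ (leq_maxl J K); have := hK _ (leq_maxr J K).
set s := u _ => h1 h2.
have -> : l - l' = (s - l') - (s - l) by ring.
by apply: le_trans (cmodB _ _) _; rewrite (splitr e) lerD// ltW.
Qed.

Lemma summ_cvgs_hs (f : nat -> C) l : summ f ->
  cvgs (fun n => \sum_(0 <= i < n) f i) l -> sums f l.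
Proof. by move=> /summ_hs h hl; rewrite -(cvgs_unique (sums_cvgs h) hl). Qed.

End Sums.

(** * Complex exponential *)

Section Exponential.
Variable R : realType.
Local Notation C := R[i].
Implicit Types x y w : C.

Lemma rcvgP (u : nat -> R) (l : R) : u @ \oo --> l <->
  forall e : R, 0 < e -> exists N, forall n, (N <= n)%N -> `|u n - l| < e.
Proof.
split=> [/cvgrPdist_lt h e /h [N _ hN]|h].
  by exists N => n /hN /=; rewrite distrC.
apply/cvgrPdist_lt => e /h [N hN]; exists N => // n /hN.
by rewrite distrC.
Qed.

Lemma cvgs_ReIm (u v : nat -> R) (a b : R) : u @ \oo --> a -> v @ \oo --> b ->
  cvgs (fun n => (u n +i* v n)%C) (a +i* b)%C.
Proof.
move=> /rcvgP hu /rcvgP hv e e0.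
have e2 : 0 < e / 2 by rewrite divr_gt0.
have [N hN] := hu _ e2; have [K hK] := hv _ e2.
exists (maxn N K) => n; rewrite geq_max => /andP[/hN h /hK k].
by apply: le_lt_trans (cmod_le_ReIm _) _; rewrite (splitr e) ltrD.
Qed.

Lemma cvgs_Re u (l : C) : cvgs u l -> (fun n => complex.Re (u n)) @ \oo --> complex.Re l.
Proof.
move=> h; apply/rcvgP => e /h[N hN]; exists N => n /hN; apply: le_lt_trans.
by rewrite -raddfB cmod_Re.
Qed.

Lemma cvgs_cmod u (l : C) : cvgs u l -> (fun n => cmod (u n)) @ \oo --> cmod l.
Proof.
move=> h; apply/rcvgP => e /h[N hN]; exists N => n /hN; apply: le_lt_trans.
rewrite ler_norml; apply/andP; split.
  by rewrite lerNl opprB lerBlDr cmod_distC; apply: le_trans (cmodD _ _); rewrite subrK.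
by rewrite lerBlDr; apply: le_trans (cmodD _ _); rewrite subrK.
Qed.

Definition ecoef (w : C) (n : nat) : C := w ^+ n / (n`!)%:R.

Lemma bsum_ecoef w : bsum (ecoef w) (expR (cmod w)).
Proof.
apply: rbs_nat => [i|n]; first exact: cmod_ge0.
have -> : \sum_(0 <= i < n) cmod (ecoef w i) = series (exp_coeff (cmod w)) n.
  by apply: eq_bigr => i _; rewrite cmodM cmodX cmodV cmod_nat.
apply: nondecreasing_cvgn_le; last exact: is_cvg_series_exp_coeff.
by apply/nondecreasing_seqP => k; rewrite /series /= big_nat_recr//= lerDl exp_coeff_ge0// cmod_ge0.
Qed.

(** Cauchy product: the product family is fibred over [i + j]. *)
Lemma sums_nat_conv (f g : nat -> C) a b : summ f -> summ g -> sums f a -> sums g b ->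
  sums (fun n => \sum_(i < n.+1) f i * g (n - i)%N) (a * b).
Proof.
move=> [M bf] [N bg] hf hg.
have s : summ (fun p : nat * nat => f p.1 * g p.2) by exists (M * N); apply: bsum_mul.
have h := sums_mul (ex_intro _ M bf) (ex_intro _ N bg) hf hg.
apply: (sums_fiber (p := fun p : nat * nat => (p.1 + p.2)%N) s h) => n.
pose J := [fset (i, (n - i)%N) | i in [fset i in iota 0 n.+1]]%fset.
have := @sums_finite _ _ (fun i : nat * nat => if (i.1 + i.2 == n)%N then f i.1 * g i.2 else 0) J.
have -> : \sum_(i <- J) (if (i.1 + i.2 == n)%N then f i.1 * g i.2 else 0) =
    \sum_(i < n.+1) f i * g (n - i)%N.
  rewrite big_imfset; last by move=> i j _ _ [].
  rewrite big_fset_iota big_mkord; apply: eq_bigr => i _.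
  by rewrite /= subnKC ?eqxx// -ltnS.
apply => -[i j] hij /=; case: eqP => // h2; case/negP: hij.
apply/imfsetP; exists i; last by rewrite -h2 addKn.
by rewrite mem_fset_iota ltnS -h2 leq_addr.
Qed.

Lemma ecoefD x y n : \sum_(i < n.+1) ecoef x i * ecoef y (n - i)%N = ecoef (x + y) n.
Proof.
rewrite /ecoef exprDn_comm; last exact: mulrC.
rewrite mulr_suml; rewrite (reindex_inj rev_ord_inj) /=; apply: eq_bigr => i _.
have inz (k : nat) : (k`!)%:R != 0 :> C by rewrite pnatr_eq0 -lt0n fact_gt0.
have lein : (i <= n)%N by rewrite -ltnS.
rewrite subSS (subKn lein).
apply: (mulIf (inz n)); apply: (mulIf (inz i)); apply: (mulIf (inz (n - i)%N)).
rewrite mulfVK//.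
have -> : x ^+ (n - i) / ((n - i)`!)%:R * (y ^+ i / (i`!)%:R) * (n`!)%:R * (i`!)%:R * ((n - i)`!)%:R
  = x ^+ (n - i) * y ^+ i * (n`!)%:R * (((i`!)%:R / (i`!)%:R) * (((n - i)`!)%:R / ((n - i)`!)%:R)) by ring.
rewrite !divff// !mulr1 -(bin_fact lein) !natrM -mulr_natr; ring.
Qed.

Lemma sums_expD x y a b : sums (ecoef x) a -> sums (ecoef y) b -> sums (ecoef (x + y)) (a * b).
Proof.
move=> h k; apply: eq_sums (sums_nat_conv _ _ h k) => [n||]; first exact: ecoefD.
all: by eexists; apply: bsum_ecoef.
Qed.

Lemma cvg_series_exp (r : R) : series (exp_coeff r) @ \oo --> expR r.
Proof. exact: is_cvg_series_exp_coeff. Qed.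

Lemma sums_exp_real (r : R) : sums (ecoef r%:C%C) (expR r)%:C%C.
Proof.
apply: summ_cvgs_hs; first by eexists; apply: bsum_ecoef.
have hz : (fun _ : nat => 0 : R) @ \oo --> (0 : R) by exact: cvg_cst.
have := cvgs_ReIm (@cvg_series_exp r) hz.
congr cvgs; apply/funext => n.
have -> : (series (exp_coeff r) n +i* 0)%C = (series (exp_coeff r) n)%:C%C by [].
rewrite /series /= rmorph_sum; apply: eq_bigr => i _.
by rewrite /ecoef /exp_coeff /= -rmorphXn /= -(rmorph_nat (real_complex R)) -fmorphV -rmorphM.
Qed.

Lemma imag_exp (t : R) n : (0 +i* t)%C ^+ n =
  (((~~ odd n)%:R * (-1) ^+ n./2 * t ^+ n) +i* ((odd n)%:R * (-1) ^+ n./2 * t ^+ n))%C :> C.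
Proof.
elim: n => [|n IH]; first by rewrite !expr0 /= !mul0r !mulr1.
rewrite exprS IH /= uphalf_half.
have -> : forall a b c d : R, (a +i* b)%C * (c +i* d)%C = ((a * c - b * d) +i* (a * d + b * c))%C by [].
rewrite !mul0r !sub0r add0r; congr (_ +i* _)%C; case: (odd n) => /=; rewrite ?mul1r ?mul0r ?mulr0 ?oppr0 ?addn0 ?add1n ?add0n ?exprS//; ring.
Qed.

Lemma expi_coef (t : R) n :
  ecoef (0 +i* t)%C n = (cos_coeff t n +i* sin_coeff t n)%C.
Proof.
rewrite /ecoef imag_exp /cos_coeff /sin_coeff /= -(rmorph_nat (real_complex R)) -fmorphV /=.
have -> : forall a b c : R, (a +i* b)%C * c%:C%C = ((a * c) +i* (b * c))%C :> C.
  by move=> a b c; rewrite /real_complex_def /GRing.mul /= !mulr0 subr0 add0r.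
congr (_ +i* (_ / _))%C; case: n => // n /=.
by rewrite uphalf_half; case: (odd n) => /=; rewrite ?mul0r// add0n.
Qed.

Lemma sums_exp_imag (t : R) : sums (ecoef (0 +i* t)%C) (cos t +i* sin t)%C.
Proof.
apply: summ_cvgs_hs; first by eexists; apply: bsum_ecoef.
have hc : series (cos_coeff t) @ \oo --> cos t.
  by rewrite cos.unlock; exact: is_cvg_series_cos_coeff.
have hsn : series (sin_coeff t) @ \oo --> sin t.
  by rewrite sin.unlock; exact: is_cvg_series_sin_coeff.
have := cvgs_ReIm hc hsn.
congr cvgs; apply/funext => n; rewrite /series /=.
elim/big_ind3 : _ => // [a b c a' b' c' <- <-|i _]; first by [].
by rewrite expi_coef.
Qed.

(** [cexp] is defined through the real exponential, cosine and sine; multiplying the series for real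
    and for purely imaginary arguments identifies it with the power series, and the addition law
    follows by uniqueness of sums. *)
Lemma sums_exp w : sums (ecoef w) (cexp w).
Proof.
have := sums_expD (sums_exp_real (complex.Re w)) (sums_exp_imag (complex.Im w)).
have -> : (complex.Re w)%:C%C + (0 +i* complex.Im w)%C = w.
  by case: w => a b; rewrite /real_complex_def /GRing.add /= addr0 add0r.
by rewrite /real_complex_def /cexp /GRing.mul /= !mul0r subr0 addr0.
Qed.

Lemma cexpD x y : cexp (x + y) = cexp x * cexp y.
Proof. exact: sums_unique (sums_exp _) (sums_expD (sums_exp x) (sums_exp y)). Qed.

Lemma cexp_real (r : R) : cexp r%:C%C = (expR r)%:C%C.
Proof. exact: sums_unique (sums_exp _) (sums_exp_real r). Qed.

Lemma cexp0 : cexp (0 : C) = 1.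
Proof. by have := cexp_real 0; rewrite expR0. Qed.

Lemma cexpN x : cexp (- x) = (cexp x)^-1.
Proof.
have := cexpD x (- x); rewrite subrr cexp0 => h.
have nz : cexp x != 0 by apply: contra_eq_neq h => ->; rewrite mul0r oner_eq0.
by apply: (mulfI nz); rewrite -h divff.
Qed.

Lemma cexp_neq0 x : cexp x != 0.
Proof.
by have := cexpD x (- x); rewrite subrr cexp0 => h; apply: contra_eq_neq h => ->; rewrite mul0r oner_eq0.
Qed.

Lemma cmod_cexp w : cmod (cexp w) = expR (complex.Re w).
Proof.
apply: (@pexpIrn _ 2) => //; rewrite ?nnegrE ?cmod_ge0 ?expR_ge0//.
by rewrite cmod_sqr /cexp /= !exprMn -mulrDr cos2Dsin2 mulr1.
Qed.

Lemma cexpX w n : cexp w ^+ n = cexp (n%:R * w).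
Proof.
elim: n => [|n IH]; first by rewrite mul0r cexp0 expr0.
by rewrite exprS IH -cexpD -natr1 mulrDl mul1r addrC.
Qed.

Lemma cpow_neq0 (y : R) x : cpow y x != 0.
Proof. exact: cexp_neq0. Qed.

Lemma cpowM (a b : R) x : 0 < a -> 0 < b -> cpow (a * b) x = cpow a x * cpow b x.
Proof. by move=> a0 b0; rewrite /cpow lnM// rmorphD mulrDr cexpD. Qed.

Lemma cpow1l x : cpow (1 : R) x = 1.
Proof. by rewrite /cpow ln1 mulr0 cexp0. Qed.

Lemma cpow0r (y : R) : cpow y 0 = 1.
Proof. by rewrite /cpow mul0r cexp0. Qed.

End Exponential.

(** * Power series and meromorphic functions *)

Section PowerSeries.
Variable R : realType.
Local Notation C := R[i].

Definition repr (s0 : C) (r : R) (f : C -> C) (a : nat -> C) (M : R) : Prop :=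
  bsum (fun n => a n * (r ^+ n)%:C%C) M /\
  forall s, cmod (s - s0) <= r -> sums (fun n => a n * (s - s0) ^+ n) (f s).

(* [normal_series s0 r f M]: on the disc of centre [s0] and radius [r], [f] is a power
   series whose weighted l^1 norm is at most [M]. *)
Definition normal_series (s0 : C) (r : R) (f : C -> C) (M : R) : Prop :=
  exists a, repr s0 r f a M.

Section Disc.
Variables (s0 : C) (r : R).
Hypothesis r0 : 0 < r.
Implicit Types (f g : C -> C) (M N : R).

Lemma cmod_rn n : cmod (r ^+ n)%:C%C = r ^+ n.
Proof. by rewrite cmod_real ger0_norm// exprn_ge0// ltW. Qed.

Lemma repr_bsum f a M s : repr s0 r f a M -> cmod (s - s0) <= r ->
  bsum (fun n => a n * (s - s0) ^+ n) M.
Proof.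
move=> [b _] hs0'; apply: bsum_mono b _ => n.
rewrite !cmodM cmod_rn cmodX ler_wpM2l ?cmod_ge0//.
by rewrite lerXn2r// nnegrE ?cmod_ge0// ltW.
Qed.

Lemma normal_series_ge0 f M : normal_series s0 r f M -> 0 <= M.
Proof. by move=> [a [/bsum_ge0]]. Qed.

Lemma normal_series_le f M N : normal_series s0 r f M -> M <= N -> normal_series s0 r f N.
Proof. by move=> [a [b h]] MN; exists a; split=> //; apply: bsum_le b MN. Qed.

Lemma normal_series_ext f g M : (forall s, cmod (s - s0) <= r -> f s = g s) ->
  normal_series s0 r f M -> normal_series s0 r g M.
Proof.
move=> fg [a [b h]]; exists a; split=> // s sr; rewrite -fg//; exact: h.
Qed.

Lemma normal_series_bound f M s : normal_series s0 r f M -> cmod (s - s0) <= r -> cmod (f s) <= M.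
Proof. by move=> [a h] sr; apply: sums_tail (repr_bsum h sr) (h.2 s sr). Qed.

Lemma normal_series_cst (c : C) : normal_series s0 r (fun=> c) (cmod c).
Proof.
exists (fun n => if n == 0%N then c else 0); split=> [J|s sr].
  apply: le_trans (_ : _ <= \sum_(i <- [fset 0%N]%fset) cmod c) _; last by rewrite big_seq_fset1.
  apply: le_trans (_ : _ <= \sum_(i <- J | i == 0%N) cmod c) _.
    rewrite [X in _ <= X]big_mkcond; apply: ler_sum => -[|i] _ /=.
      by rewrite expr0 mulr1.
    by rewrite mul0r cmod0.
  rewrite big_seq_fset1 -big_filter big_const_seq.
  have : (count xpredT [seq i <- J | i == 0%N] <= 1)%N.
    by rewrite count_predT size_filter (count_uniq_mem 0%N (fset_uniq J)); case: (_ \in _).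
  by case: count => [|[|]]//= _; rewrite ?cmod_ge0// addr0.
have := @sums_single _ _ (fun n => (if n == 0%N then c else 0) * (s - s0) ^+ n) 0%N.
by rewrite /= mulr1; apply=> i /negPf ->; rewrite mul0r.
Qed.

Lemma normal_series_add f g M N : normal_series s0 r f M -> normal_series s0 r g N ->
  normal_series s0 r (fun s => f s + g s) (M + N).
Proof.
move=> [a [b h]] [a' [b' h']]; exists (fun n => a n + a' n); split.
  apply: (bsum_mono (bsumD b b')) => n; by rewrite mulrDl.
move=> s sr; apply: eq_sums (sumsD (h s sr) (h' s sr)) => n; by rewrite mulrDl.
Qed.

Lemma normal_series_scale (c : C) f M : normal_series s0 r f M -> normal_series s0 r (fun s => c * f s) (cmod c * M).
Proof.
move=> [a [b h]]; exists (fun n => c * a n); split.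
  by apply: (bsum_mono (bsumZ c b)) => n; rewrite mulrA.
by move=> s sr; apply: eq_sums (sumsZ c (h s sr)) => n; rewrite mulrA.
Qed.

Lemma normal_series_opp f M : normal_series s0 r f M -> normal_series s0 r (fun s => - f s) M.
Proof.
move=> /(normal_series_scale (-1)); rewrite cmodN cmod1 mul1r; apply: normal_series_ext => s _.
by rewrite mulN1r.
Qed.

Lemma normal_series_shift k f M : normal_series s0 r f M -> normal_series s0 r (fun s => (s - s0) ^+ k * f s) (r ^+ k * M).
Proof.
move=> [a [b h]].
have hE (u : C) n : (fun n => (if (n < k)%N then 0 else a (n - k)%N) * u ^+ n) (k + n)%N
    = u ^+ k * (a n * u ^+ n).
  by rewrite /= ltnNge leq_addr /= addKn exprD; ring.
have h0 (u : C) n : (forall j, (k + j)%N != n) ->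
    (if (n < k)%N then 0 else a (n - k)%N) * u ^+ n = 0.
  move=> H; case: ltnP => kn; rewrite ?mul0r//.
  by have := H (n - k)%N; rewrite subnKC ?eqxx.
exists (fun n => if (n < k)%N then 0 else a (n - k)%N); split.
  have b' := bsumZ (r ^+ k)%:C%C b; rewrite cmod_rn in b'.
  apply: (bsum_comp (g := fun n => (n - k)%N) _ _ b') => [n n'|n].
    case: ltnP => [_|kn]; rewrite ?mul0r ?eqxx//.
    case: ltnP => [_|kn']; rewrite ?mul0r ?eqxx// => _ _ e.
    by rewrite -(subnK kn) e subnK.
  case: ltnP => kn; first by rewrite mul0r cmod0 cmod_ge0.
  by rewrite mulrCA -rmorphM -exprD /= subnKC.
move=> s sr; apply: (@sums_embed _ _ _ (addn k) (fun n => (s - s0) ^+ k * (a n * (s - s0) ^+ n))).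
- exact: addnI.
- by apply: summZ; exists M; apply: (@repr_bsum f a).
- by move=> n; apply: hE.
- by move=> n /h0.
- by apply: sumsZ; apply: h.
Qed.

End Disc.

Lemma cmod_hs (I : choiceType) (f : I -> C) l L : sums f l ->
  sums (fun i => (cmod (f i))%:C%C) L -> cmod l <= complex.Re L.
Proof.
move=> h h'; apply/ler_addgt0Pr => e e0.
have e2 : 0 < e / 2 by rewrite divr_gt0.
have [J hJ] := h _ e2; have [K hK] := h' _ e2.
have := hJ _ (fsubsetUl J K); have := hK _ (fsubsetUr J K).
move: (_ `|` _)%fset => T h1 h2.
have h3 : cmod (\sum_(i <- T) f i) <= \sum_(i <- T) cmod (f i) by exact: cmod_sum.
have := cmod_Re (\sum_(i <- T) (cmod (f i))%:C%C - L).
rewrite raddfB /= raddf_sum /= => h4.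
have h5 : cmod l <= cmod (\sum_(i <- T) f i) + cmod (\sum_(i <- T) f i - l).
  by rewrite cmod_distC addrC; apply: le_trans (cmodD _ _); rewrite subrK.
move: h4; rewrite ler_norml => /andP[_ h4].
move: h1 h2 h3 h4 h5; move: (cmod _) => x; move: (cmod _) => y; move: (cmod _) => u.
move: (cmod l) (\sum_(i <- T) _) => v w; lra.
Qed.

(** The bound [B] itself has to survive the summation over [I]. Each column sum is dominated by that
    of the nonnegative array [g], and for finitely many columns the summation can be moved inside,
    where it runs over finite rectangles of [f]. *)
Lemma bsum_col (I J : choiceType) (f : I * J -> C) B :
  bsum f B -> bsum (fun j => tsum (fun i => f (i, j))) B.
Proof.
move=> b K.
have sf : summ f by exists B.
pose g (p : I * J) : C := (cmod (f p))%:C%C.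
have cg p : cmod (g p) = cmod (f p) by rewrite cmod_real ger0_norm// cmod_ge0.
have bg : bsum g B by move=> T; under eq_bigr do rewrite cg; exact: b.
have sg : summ g by exists B.
have sfj j : summ (fun i => f (i, j)) by apply: (@summ_inj _ _ _ (fun i => (i, j))) => // i i' [].
have sgj j : summ (fun i => g (i, j)) by apply: (@summ_inj _ _ _ (fun i => (i, j))) => // i i' [].
apply: le_trans (_ : _ <= \sum_(j <- K) complex.Re (tsum (fun i => g (i, j)))) _.
  by apply: ler_sum => j _; apply: cmod_hs (summ_hs (sfj j)) (summ_hs (sgj j)).
rewrite -(raddf_sum (@complex.Re R)) /=; apply: le_trans (ler_norm _) _.
apply: le_trans (cmod_Re _) _.
have h := @tsum_finite _ _ _ K (fun j i => g (i, j)) (fun k _ => sgj k).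
apply: sums_tail h => T.
under eq_bigr => i _.
  have -> : cmod (\sum_(k <- K) g (i, k)) = \sum_(k <- K) cmod (f (i, k)).
    rewrite /g -rmorph_sum /= cmod_real ger0_norm// sumr_ge0// => k _; exact: cmod_ge0.
  over.
have := b [fset p in allpairs pair T K]%fset.
apply: le_trans; rewrite (perm_big (allpairs pair T K)) /=; last first.
  apply: uniq_perm; first exact: fset_uniq.
    by apply: allpairs_uniq => [||[a c] [a' c']]; rewrite ?fset_uniq.
  by move=> p; rewrite inE.
by rewrite big_allpairs.
Qed.

(** A form of the Weierstrass theorem: the coefficients, weighted by powers of [r], form an
    absolutely summable array whose column sums are the coefficients of the limit. *)
Lemma normal_series_sum (I : choiceType) (s0 : C) (r : R) (f : I -> C -> C) (M : I -> R) B F :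
  0 < r -> (forall i, normal_series s0 r (f i) (M i)) -> rbs M B ->
  (forall s, cmod (s - s0) <= r -> sums (fun i => f i s) (F s)) -> normal_series s0 r F B.
Proof.
move=> r0 /choice[a ha] hM hF.
have b : bsum (fun p : I * nat => a p.1 p.2 * (r ^+ p.2)%:C%C) B.
  by apply: (@bsum_pair _ _ _ (fun i n => a i n * (r ^+ n)%:C%C) M) => // i; exact: (ha i).1.
have sa n : summ (fun i => a i n * (r ^+ n)%:C%C).
  by apply: (@summ_inj _ _ _ (fun i => (i, n)) (fun p : I * nat => a p.1 p.2 * (r ^+ p.2)%:C%C)) => [i i' []|] //; exists B.
have rn0 n : (r ^+ n)%:C%C != 0 :> C by rewrite -cmod_eq0 cmod_rn// gt_eqF// exprn_gt0.
have sa' n : summ (fun i => a i n).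
  apply: (@summ_mono _ _ _ (fun i => ((r ^+ n)%:C%C)^-1 * (a i n * (r ^+ n)%:C%C))).
    exact: summZ.
  by move=> i; rewrite mulrCA mulVf// mulr1.
exists (fun n => tsum (fun i => a i n)); split.
  apply: (bsum_mono (bsum_col b)) => n /=.
  rewrite mulrC -tsumZ//.
  rewrite le_eqVlt; apply/orP; left; apply/eqP; congr (cmod _); apply: eq_tsum => i; exact: mulrC.
move=> s sr.
have b' : bsum (fun p : I * nat => a p.1 p.2 * (s - s0) ^+ p.2) B.
  apply: (@bsum_pair _ _ _ (fun i n => a i n * (s - s0) ^+ n) M) => // i.
  exact: (repr_bsum r0 (ha i) sr).
have sb : summ (fun p : I * nat => a p.1 p.2 * (s - s0) ^+ p.2) by exists B.
have hl := summ_hs sb; move: (tsum _) hl => l hl.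
have h1 : sums (fun i => f i s) l.
  by apply: (sums_pair1 sb _ hl) => i /=; apply: (ha i).2.
rewrite (sums_unique (hF s sr) h1).
apply: (sums_pair2 sb _ hl) => n /=.
apply: (@eq_sums _ _ (fun i => (s - s0) ^+ n * a i n)) => [i|]; first exact: mulrC.
by rewrite mulrC; apply: sumsZ; apply: summ_hs.
Qed.

(** The product is the sum over [n] of [a n (s - s0)^n g], and multiplication by [(s - s0)^n] costs
    exactly [r^n]; the norm is thus submultiplicative. *)
Lemma normal_series_mul (s0 : C) (r : R) f g M N : 0 < r -> normal_series s0 r f M -> normal_series s0 r g N ->
  normal_series s0 r (fun s => f s * g s) (M * N).
Proof.
move=> r0 [a ha] hg.
apply: (@normal_series_sum nat s0 r (fun n s => a n * ((s - s0) ^+ n * g s))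
   (fun n => cmod (a n) * (r ^+ n * N))) => //.
- by move=> n; apply: normal_series_scale; apply: normal_series_shift.
- move=> J; under eq_bigr do rewrite mulrA.
  rewrite -mulr_suml ler_wpM2r ?(normal_series_ge0 hg)//.
  apply: le_trans (ha.1 J); apply: ler_sum => n _; by rewrite cmodM cmod_rn.
- move=> s sr; rewrite mulrC; apply: eq_sums (sumsZ (g s) (ha.2 s sr)) => n; ring.
Qed.

Lemma normal_series_exp (s0 : C) (r l : R) : 0 < r ->
  normal_series s0 r (fun s => cexp (s * l%:C%C)) (cmod (cexp (s0 * l%:C%C)) * expR (r * `|l|)).
Proof.
move=> r0; apply: (@normal_series_ext _ _ (fun s => cexp (s0 * l%:C%C) * cexp ((s - s0) * l%:C%C))).
  by move=> s _; rewrite -cexpD -mulrDl addrC subrK.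
apply: normal_series_scale; exists (fun n => ecoef l%:C%C n); split.
  have -> : r * `|l| = cmod ((r * l)%:C%C).
    by rewrite cmod_real normrM (gtr0_norm r0).
  apply: bsum_mono (bsum_ecoef _) _ => n.
  by rewrite /ecoef rmorphM exprMn rmorphXn mulrC mulrA.
move=> s sr; apply: eq_sums (sums_exp _) => n; rewrite /ecoef exprMn; ring.
Qed.

Lemma normal_series_id (s0 : C) (r : R) : 0 < r -> normal_series s0 r (fun s => s - s0) r.
Proof.
move=> r0; have := normal_series_shift r0 1 (normal_series_cst s0 r 1); rewrite cmod1 mulr1 expr1.
by apply: normal_series_ext => s _; rewrite mulr1 expr1.
Qed.

Lemma normal_series_var (s0 : C) (r : R) : 0 < r -> normal_series s0 r (fun s => s) (r + cmod s0).
Proof.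
move=> r0; apply: normal_series_ext (normal_series_add (normal_series_id s0 r0) (normal_series_cst s0 r s0)) => s _.
by rewrite subrK.
Qed.

Lemma normal_series_shrink (s0 : C) (r r' : R) f M : 0 < r' -> r' <= r -> normal_series s0 r f M -> normal_series s0 r' f M.
Proof.
move=> r'0 rr [a [b h]]; exists a; split; last by move=> s sr; apply: h; apply: le_trans rr.
apply: bsum_mono b _ => n; rewrite !cmodM !cmod_rn ?(lt_le_trans r'0)//.
rewrite ler_wpM2l ?cmod_ge0// lerXn2r ?nnegrE ?(ltW r'0)//.
exact: le_trans (ltW r'0) rr.
Qed.

End PowerSeries.

(** * Analytic and meromorphic germs *)

Section Meromorphic.
Variable R : realType.
Local Notation C := R[i].

Lemma sums_geo (x : C) : cmod x < 1 -> summ (fun n => x ^+ n) /\ sums (fun n => x ^+ n) (1 - x)^-1.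
Proof.
move=> x1.
have p : 0 < 1 - cmod x by rewrite subr_gt0.
have nx : 1 - x != 0.
  apply: contraTneq x1 => h; have -> : x = 1 - (1 - x) by ring.
  by rewrite h subr0 cmod1 ltxx.
have E (y : C) n : (1 - y) * \sum_(0 <= i < n) y ^+ i = 1 - y ^+ n.
  elim: n => [|n IH]; first by rewrite big_nil mulr0 subrr.
  by rewrite big_nat_recr//= mulrDr IH exprS; ring.
have s : summ (fun n => x ^+ n).
  exists ((1 - cmod x)^-1); apply: rbs_nat => [n|n]; first exact: cmod_ge0.
  rewrite -(ler_pM2l p) divff ?gt_eqF//.
  have := E (cmod x)%:C%C n; have -> : 1 - (cmod x)%:C%C = (1 - cmod x)%:C%C :> C by rewrite rmorphB rmorph1.
  have -> : \sum_(0 <= i < n) (cmod x)%:C%C ^+ i = (\sum_(0 <= i < n) cmod (x ^+ i))%:C%C :> C.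
    by rewrite rmorph_sum; apply: eq_bigr => i _; rewrite cmodX rmorphXn.
  rewrite -rmorphM -rmorphXn -(rmorph1 (real_complex R)) -rmorphB => /(@complexI R) ->.
  by rewrite lerBlDr lerDl exprn_ge0 ?cmod_ge0.
split=> //; apply: summ_cvgs_hs => // e e0.
have e1 : 0 < e * cmod (1 - x) by rewrite mulr_gt0// cmod_gt0.
have /rcvgP/(_ _ e1)[N hN] : (fun n => cmod x ^+ n) @ \oo --> 0.
  by apply: cvg_expr; rewrite ger0_norm ?cmod_ge0.
exists N => n /hN; rewrite subr0 ger0_norm ?exprn_ge0 ?cmod_ge0// => h.
have -> : \sum_(0 <= i < n) x ^+ i - (1 - x)^-1 = - (x ^+ n / (1 - x)).
  by apply: (mulfI nx); rewrite mulrBr E divff// mulrN mulrCA divff//; ring.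
by rewrite cmodN cmodM cmodX cmodV ltr_pdivrMr// cmod_gt0.
Qed.

Lemma rbs_half : rbs (fun n => (2^-1 : R) ^+ n) 2.
Proof.
apply: rbs_nat => [n|n]; first by rewrite exprn_ge0// invr_ge0.
suff -> : \sum_(0 <= i < n) (2^-1 : R) ^+ i = 2 - 2 * (2^-1) ^+ n.
  by rewrite lerBlDr lerDl mulr_ge0// exprn_ge0// invr_ge0.
elim: n => [|n IH]; first by rewrite big_nil expr0 mulr1 subrr.
by rewrite big_nat_recr//= IH exprS; field.
Qed.

Lemma repr0 (s0 : C) r f a M : 0 < r -> repr s0 r f a M -> a 0%N = f s0.
Proof.
move=> r0 [_ /(_ s0)]; rewrite subrr cmod0 => /(_ (ltW r0)) h.
apply: sums_unique h; have := @sums_single _ _ (fun n => a n * 0 ^+ n) 0%N.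
by rewrite expr0 mulr1; apply=> -[|i]//= _; rewrite expr0n mulr0.
Qed.

(** Dividing [f - f s0] by [s - s0] drops the leading coefficient; the quotient lives on the same
    disc and its norm grows at most by [1/r]. Two such divisions give the quadratic remainders in
    the expansions at 0. *)
Lemma repr_step (s0 : C) r f a M : 0 < r -> repr s0 r f a M ->
  exists v, repr s0 r v (fun n => a n.+1) (M / r) /\
    forall s, cmod (s - s0) <= r -> f s = f s0 + (s - s0) * v s.
Proof.
move=> r0 ra; have a0 := repr0 r0 ra; have [b h] := ra.
have b' : bsum (fun n => a n.+1 * (r ^+ n)%:C%C) (M / r).
  rewrite mulrC; apply: (bsum_comp (f := fun n => (r^-1)%:C%C * (a n * (r ^+ n)%:C%C)) (g := S)).
  - by move=> k k' _ _ [].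
  - by move=> n; rewrite mulrCA -rmorphM exprS mulKf ?gt_eqF.
  - have := bsumZ (r^-1)%:C%C b.
    by rewrite cmod_real ger0_norm// invr_ge0 ltW.
pose v s := tsum (fun n => a n.+1 * (s - s0) ^+ n).
have sv s : cmod (s - s0) <= r -> summ (fun n => a n.+1 * (s - s0) ^+ n).
  move=> sr; exists (M / r); apply: bsum_mono b' _ => n.
  rewrite !cmodM cmod_rn// cmodX ler_wpM2l ?cmod_ge0//.
  by rewrite lerXn2r// nnegrE ?cmod_ge0// ltW.
exists v; split; first by split=> // s sr; apply/summ_hs/sv.
move=> s sr; apply: sums_unique (h s sr) _.
pose F n : C := if n is n'.+1 then a n * (s - s0) ^+ n else 0.
pose G n : C := if n is n'.+1 then 0 else a n.
apply: (@eq_sums _ _ (fun n => G n + F n)).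
  by case=> [|n] /=; rewrite ?addr0 ?add0r ?expr0 ?mulr1.
apply: sumsD; first by rewrite -a0; apply: (@sums_single _ _ G 0%N) => -[|i].
apply: (@sums_embed _ _ _ S (fun n => (s - s0) * (a n.+1 * (s - s0) ^+ n))).
- by move=> i j [].
- exact/summZ/sv.
- by move=> j; rewrite /F exprS; ring.
- by case=> [//|n] /(_ n); rewrite eqxx.
- exact/sumsZ/summ_hs/sv.
Qed.

Lemma normal_series_step (s0 : C) r f M : 0 < r -> normal_series s0 r f M ->
  exists v, normal_series s0 r v (M / r) /\
    forall s, cmod (s - s0) <= r -> f s = f s0 + (s - s0) * v s.
Proof.
by move=> r0 [a /(repr_step r0)[v [h e]]]; exists v; split=> //; exists (fun n => a n.+1).
Qed.

Lemma normal_series_dich (s0 : C) r f M : 0 < r -> normal_series s0 r f M ->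
  (forall s, cmod (s - s0) <= r -> f s = 0) \/
  exists k v N, [/\ normal_series s0 r v N, v s0 != 0 &
    forall s, cmod (s - s0) <= r -> f s = (s - s0) ^+ k * v s].
Proof.
move=> r0 [a ha].
have [[n an]|na] := pselect (exists n, a n != 0); last first.
  left=> s sr; apply: sums_unique (ha.2 s sr) _; apply: (@eq_sums _ _ (fun=> 0)) => [n|]; last exact: sums0.
  suff -> : a n = 0 by rewrite mul0r.
  by apply/eqP/negPn/negP => h; apply: na; exists n.
right; elim: n a f M ha an => [|n IH] a f M ha an.
  exists 0%N, f, M; split; [by exists a| by rewrite -(repr0 r0 ha)|].
  by move=> s _; rewrite expr0 mul1r.
have [a0|a0] := eqVneq (a 0%N) 0; last first.
  exists 0%N, f, M; split; [by exists a| by rewrite -(repr0 r0 ha)|].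
  by move=> s _; rewrite expr0 mul1r.
have [v [hv e]] := repr_step r0 ha.
have [k [w [N [h1 h2 h3]]]] := IH _ _ _ hv an.
exists k.+1, w, N; split=> // s sr; rewrite e// -(repr0 r0 ha) a0 add0r h3//.
by rewrite exprS mulrA.
Qed.

Definition analytic_at (s0 : C) (f : C -> C) : Prop := exists r M, 0 < r /\ normal_series s0 r f M.

Lemma ana_cst s0 c : analytic_at s0 (fun=> c).
Proof. by exists 1, (cmod c); split=> //; apply: normal_series_cst. Qed.

Lemma ana_id s0 : analytic_at s0 (fun s => s).
Proof. by exists 1, (1 + cmod s0); split=> //; apply: normal_series_var. Qed.

Lemma ana_pair s0 f g : analytic_at s0 f -> analytic_at s0 g ->
  exists r M N, [/\ 0 < r, normal_series s0 r f M & normal_series s0 r g N].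
Proof.
move=> [r [M [r0 hf]]] [r' [N [r0' hg]]]; exists (Num.min r r'), M, N.
have m0 : 0 < Num.min r r' by rewrite lt_min r0.
by split=> //; [apply: normal_series_shrink hf|apply: normal_series_shrink hg] => //; rewrite ge_min lexx ?orbT.
Qed.

Lemma ana_add s0 f g : analytic_at s0 f -> analytic_at s0 g -> analytic_at s0 (fun s => f s + g s).
Proof.
by move=> h k; have [r [M [N [r0 hf hg]]]] := ana_pair h k; exists r, (M + N); split=> //; apply: normal_series_add.
Qed.

Lemma ana_mul s0 f g : analytic_at s0 f -> analytic_at s0 g -> analytic_at s0 (fun s => f s * g s).
Proof.
by move=> h k; have [r [M [N [r0 hf hg]]]] := ana_pair h k; exists r, (M * N); split=> //; apply: normal_series_mul.
Qed.

Lemma ana_pow s0 n : analytic_at s0 (fun s => (s - s0) ^+ n).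
Proof.
elim: n => [|n IH]; first exact: ana_cst.
have -> : (fun s => (s - s0) ^+ n.+1) = (fun s => (s - s0) * (s - s0) ^+ n).
  by apply/funext => s; rewrite exprS.
apply: ana_mul => //; apply: ana_add; [exact: ana_id|exact: ana_cst].
Qed.

Lemma ana_exp s0 (l : R) : analytic_at s0 (fun s => cexp (s * l%:C%C)).
Proof. by exists 1; eexists; split=> //; apply: normal_series_exp. Qed.

Lemma normal_series_iter (s0 : C) r f M n : 0 < r -> normal_series s0 r f M -> normal_series s0 r (fun s => f s ^+ n) (M ^+ n).
Proof.
move=> r0 h; elim: n => [|n IH].
  by have := normal_series_cst s0 r 1; rewrite cmod1; apply: normal_series_ext.
have := normal_series_mul r0 h IH; rewrite -exprS; apply: normal_series_ext => s _; by rewrite exprS.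
Qed.

Lemma ana_inv s0 f : analytic_at s0 f -> f s0 != 0 -> analytic_at s0 (fun s => (f s)^-1).
Proof.
move=> [r [M [r0 hf]]] nz; have [v [hv e]] := normal_series_step r0 hf.
set N := M / r in hv; have N0 := normal_series_ge0 hv.
pose c := f s0; pose K := N / cmod c.
have K0 : 0 <= K by rewrite divr_ge0// cmod_ge0.
(* Chosen so that the relative deviation [x] of [f] from [f s0] has norm at most 1/2 on the smaller
   disc; its geometric series then has norm at most 2. *)
pose r' := Num.min r (2 * (K + 1))^-1.
have r'0 : 0 < r' by rewrite lt_min r0 invr_gt0 mulr_gt0// ltr_wpDl.
have r'r : r' <= r by rewrite ge_min lexx.
pose x s := (- c^-1) * ((s - s0) * v s).
have hx : normal_series s0 r' x (2^-1).
  apply: normal_series_le (normal_series_scale (- c^-1) (normal_series_mul r'0 (normal_series_id s0 r'0) (normal_series_shrink r'0 r'r hv))) _.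
  rewrite cmodN cmodV mulrC -mulrA -/K.
  apply: le_trans (_ : _ <= r' * (K + 1)) _; first by rewrite ler_wpM2l ?ltW// ltrDl.
  have : r' <= (2 * (K + 1))^-1 by rewrite ge_min lexx orbT.
  rewrite -ler_pdivlMr ?ltr_wpDl// => /le_trans; apply.
  by rewrite invfM.
exists r', (cmod c^-1 * 2); split=> //.
apply: (@normal_series_ext _ _ _ (fun s => c^-1 * (1 - x s)^-1)).
  move=> s sr; rewrite -invfM; congr (_^-1); rewrite /x mulNr opprK mulrDr mulr1 mulrA divff// mul1r.
  by rewrite -e//; apply: le_trans sr r'r.
apply: normal_series_scale; apply: (@normal_series_sum _ nat s0 r' (fun n s => x s ^+ n) (fun n => 2^-1 ^+ n)) => //.
- by move=> n; apply: normal_series_iter.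
- exact: rbs_half.
- move=> s sr; apply: (sums_geo _).2; apply: le_lt_trans (normal_series_bound r'0 hx sr) _.
  by rewrite invf_lt1// ltr1n.
Qed.

Definition near_off (s0 : C) (P : C -> Prop) : Prop :=
  exists r : R, 0 < r /\ forall s, s != s0 -> cmod (s - s0) < r -> P s.

Lemma near_off_and s0 P Q : near_off s0 P -> near_off s0 Q -> near_off s0 (fun s => P s /\ Q s).
Proof.
move=> [r [r0 h]] [r' [r'0 h']]; exists (Num.min r r'); split; first by rewrite lt_min r0.
by move=> s ss; rewrite lt_min => /andP[a b]; split; [apply: h|apply: h'].
Qed.

Lemma near_off_mono s0 (P Q : C -> Prop) : (forall s, s != s0 -> P s -> Q s) -> near_off s0 P -> near_off s0 Q.
Proof. by move=> PQ [r [r0 h]]; exists r; split=> // s ss sr; apply: PQ => //; apply: h. Qed.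

Definition mero_at (s0 : C) (f : C -> C) : Prop :=
  exists k g, analytic_at s0 g /\ near_off s0 (fun s => (s - s0) ^+ k * f s = g s).

Definition mero (f : C -> C) : Prop := forall s0, mero_at s0 f.

Lemma mero0_ext s0 f g : near_off s0 (fun s => f s = g s) -> mero_at s0 f -> mero_at s0 g.
Proof.
move=> h [k [u [hu e]]]; exists k, u; split=> //.
by apply: near_off_mono (near_off_and h e) => s _ [<-].
Qed.

Lemma ana_mero0 s0 f : analytic_at s0 f -> mero_at s0 f.
Proof. by move=> h; exists 0%N, f; split=> //; exists 1; split=> // s _ _; rewrite mul1r. Qed.

Lemma mero0_mul s0 f g : mero_at s0 f -> mero_at s0 g -> mero_at s0 (fun s => f s * g s).
Proof.
move=> [k [u [hu e]]] [k' [u' [hu' e']]]; exists (k + k')%N, (fun s => u s * u' s).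
split; first exact: ana_mul.
by apply: near_off_mono (near_off_and e e') => s _ [<- <-]; rewrite exprD; ring.
Qed.

Lemma mero0_add s0 f g : mero_at s0 f -> mero_at s0 g -> mero_at s0 (fun s => f s + g s).
Proof.
move=> [k [u [hu e]]] [k' [u' [hu' e']]].
exists (k + k')%N, (fun s => (s - s0) ^+ k' * u s + (s - s0) ^+ k * u' s).
split; first by apply: ana_add; apply: ana_mul => //; apply: ana_pow.
by apply: near_off_mono (near_off_and e e') => s _ [<- <-]; rewrite exprD; ring.
Qed.

Lemma near_off_nz s0 f : analytic_at s0 f -> f s0 != 0 -> near_off s0 (fun s => f s != 0).
Proof.
move=> [r [M [r0 hf]]] nz; have [v [hv e]] := normal_series_step r0 hf.
have N0 := normal_series_ge0 hv; set N := M / r in hv N0.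
exists (Num.min r (cmod (f s0) / (N + 1))); split.
  by rewrite lt_min r0 divr_gt0 ?cmod_gt0 ?ltr_wpDl.
move=> s _; rewrite lt_min => /andP[sr]; rewrite ltr_pdivlMr ?ltr_wpDl// => h.
rewrite -cmod_gt0 e ?ltW//; apply: lt_le_trans (cmod_geB _ _); rewrite subr_gt0 cmodM.
apply: le_lt_trans h; rewrite ler_wpM2l ?cmod_ge0//.
by apply: le_trans (normal_series_bound r0 hv (ltW sr)) _; rewrite lerDl.
Qed.

Lemma mero0_dich s0 f : mero_at s0 f -> near_off s0 (fun s => f s = 0) \/
  exists k m v, [/\ analytic_at s0 v, v s0 != 0 & near_off s0 (fun s => (s - s0) ^+ k * f s = (s - s0) ^+ m * v s)].
Proof.
move=> [k [g [[r [M [r0 hg]]] e]]].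
have inr : near_off s0 (fun s => cmod (s - s0) <= r) by exists r; split=> // s _ /ltW.
have [h|[m [v [N [h1 h2 h3]]]]] := normal_series_dich r0 hg.
  left; apply: near_off_mono (near_off_and inr e) => s ss [sr]; rewrite (h s sr) => /eqP.
  by rewrite mulf_eq0 expf_eq0 subr_eq0 (negPf ss) andbF /= => /eqP.
right; exists k, m, v; split=> //; first by exists r, N.
by apply: near_off_mono (near_off_and inr e) => s ss [sr ->]; rewrite h3.
Qed.

Lemma mero0_inv s0 f : mero_at s0 f -> mero_at s0 (fun s => (f s)^-1).
Proof.
move=> /mero0_dich[h|[k [m [v [hv nz e]]]]].
  (* If [f] vanishes near [s0], so does its inverse, by the convention [0^-1 = 0]. *)
  apply: (@mero0_ext s0 (fun=> 0)); last exact: ana_mero0 (ana_cst _ _).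
  by apply: near_off_mono h => s _ ->; rewrite invr0.
exists m, (fun s => (s - s0) ^+ k * (v s)^-1); split.
  by apply: ana_mul; [exact: ana_pow|exact: ana_inv].
apply: near_off_mono (near_off_and e (near_off_nz hv nz)) => s ss [h vn].
have n0 : s - s0 != 0 by rewrite subr_eq0.
have n1 : (s - s0) ^+ k != 0 by rewrite expf_neq0.
have n2 : (s - s0) ^+ m != 0 by rewrite expf_neq0.
have fn : f s != 0 by apply: contra_eq_neq h => ->; rewrite mulr0 eq_sym mulf_neq0.
by apply/eqP; rewrite eqr_div// -h.
Qed.

Lemma mero0_nz s0 f : mero_at s0 f -> near_off s0 (fun s => f s = 0) \/ near_off s0 (fun s => f s != 0).
Proof.
move=> /mero0_dich[h|[k [m [v [hv nz e]]]]]; first by left.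
right; apply: near_off_mono (near_off_and e (near_off_nz hv nz)) => s ss [h vn].
by apply: contra_eq_neq h => ->; rewrite mulr0 eq_sym mulf_neq0// expf_neq0// subr_eq0.
Qed.

End Meromorphic.

(** * Meromorphic continuation, its uniqueness, and first-order expansions at 0 *)

Section Continuation.
Variable R : realType.
Local Notation C := R[i].

Lemma pos_complex (e : C) : 0 < e -> exists2 r : R, 0 < r & e = r%:C%C.
Proof.
by case: e => a b; rewrite ltcE /= => /andP[/eqP -> a0]; exists a.
Qed.

Lemma cvgsP (u : nat -> R[i]^o) (l : R[i]^o) : u @ \oo --> l <-> cvgs u l.
Proof.
split=> [/cvgrPdist_lt h e e0|h].
  have e0' : (0 : C) < e%:C%C by rewrite ltcR.
  have [N _ hN] := h _ e0'; exists N => n /hN /=.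
  by rewrite -cmodE ltcR cmod_distC.
apply/cvgrPdist_lt => e /pos_complex[r r0 ->]; have [N hN] := h _ r0.
exists N => // n /hN; rewrite cmod_distC => hn.
by rewrite -(@cmodE R) ltcR.
Qed.

Lemma pnP (s0 : R[i]^o) (P : R[i]^o -> Prop) : (\forall s \near s0^', P s) <-> near_off s0 P.
Proof.
split=> [|[r [r0 h]]].
  case=> e /= /pos_complex[r r0 ->] h; exists r; split=> // s ss sr.
  by apply: h => //; rewrite /ball_ /= -cmodE ltcR cmod_distC.
exists r%:C%C => /=; first by rewrite ltcR.
move=> s; rewrite /ball_ /= -(@cmodE R) ltcR cmod_distC => sr ss; exact: h.
Qed.

Lemma mero_meromorphic (f : C -> C) : mero f -> meromorphic (f : R[i]^o -> R[i]^o).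
Proof.
move=> h s0; have [k [g [[r [M [r0 [a [b ha]]]]] e]]] := h s0.
exists k, a; apply/pnP.
have inr : near_off s0 (fun s => cmod (s - s0) <= r) by exists r; split=> // s _ /ltW.
apply: near_off_mono (near_off_and inr e) => s ss [sr ->].
apply/cvgsP; exact: sums_cvgs (ha s sr).
Qed.

(** Abel's argument: [meromorphic] gives only pointwise convergence of a series off the centre.
    Convergence at distance [r/2] bounds the terms there, so the coefficients are absolutely
    summable at radius [r/4]. *)
Lemma meromorphic_mero (f : C -> C) : meromorphic (f : R[i]^o -> R[i]^o) -> mero f.
Proof.
move=> h s0; have [k [a /pnP[r [r0 hr]]]] := h s0.
exists k.
pose h0 := r / 2; have h00 : 0 < h0 by rewrite divr_gt0.
have ch0 : cmod h0%:C%C = h0 by rewrite cmod_real gtr0_norm.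
have ss0 : s0 + h0%:C%C != s0.
  have -> : (s0 + h0%:C%C == s0) = (s0 + h0%:C%C - s0 == 0) by rewrite subr_eq0.
  by rewrite addrC addKr -cmod_eq0 ch0 gt_eqF.
have sr0 : cmod (s0 + h0%:C%C - s0) < r.
  by rewrite addrC addKr ch0 /h0 ltr_pdivrMr// ltr_pMr// ltr1n.
have c0 := (cvgsP _ _).1 (hr _ ss0 sr0).
have {}c0 : cvgs (fun n => a n * h0%:C%C ^+ n) 0.
  have hE : s0 + h0%:C%C - s0 = h0%:C%C by ring.
  rewrite hE in c0.
  move=> e e0; have e2 : 0 < e / 2 by rewrite divr_gt0.
  have [N hN] := c0 _ e2; exists N => n hn.
  have h1 := hN _ hn; have h2 := hN _ (leqW hn).
  rewrite subr0; set l := _ * f _ in h1 h2.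
  have -> : a n * h0%:C%C ^+ n = (series (fun n => a n * h0%:C%C ^+ n) n.+1 - l)
     - (series (fun n => a n * h0%:C%C ^+ n) n - l).
    by rewrite /series /= big_nat_recr//=; ring.
  by apply: le_lt_trans (cmodB _ _) _; rewrite (splitr e) ltrD.
have [K hK] : exists K : R, forall n, cmod (a n * h0%:C%C ^+ n) <= K.
  have [N hN] := c0 _ ltr01.
  exists (1 + \sum_(0 <= i < N) cmod (a i * h0%:C%C ^+ i)) => n.
  have p0 m : 0 <= \sum_(0 <= i < m) cmod (a i * h0%:C%C ^+ i).
    by rewrite sumr_ge0// => i _; apply: cmod_ge0.
  have [Nn|nN] := leqP N n.
    by have := hN _ Nn; rewrite subr0 => /ltW /le_trans; apply; rewrite lerDl.
  apply: le_trans (_ : _ <= \sum_(0 <= i < N) cmod (a i * h0%:C%C ^+ i)) _; last by rewrite lerDr.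
  rewrite (bigD1_seq n) ?mem_index_iota ?iota_uniq//= lerDl sumr_ge0// => i _; exact: cmod_ge0.
pose r' := h0 / 2; have r'0 : 0 < r' by rewrite divr_gt0.
have b : bsum (fun n => a n * (r' ^+ n)%:C%C) (K * 2).
  apply: rbs_nat => [n|n]; first exact: cmod_ge0.
  have K0 : 0 <= K by apply: le_trans (cmod_ge0 _) (hK 0%N).
  apply: le_trans (_ : _ <= K * \sum_(0 <= i < n) 2^-1 ^+ i) _; last first.
    by rewrite ler_wpM2l//; apply: (rbs_natP _ (@rbs_half R)).
  rewrite mulr_sumr; apply: ler_sum => i _; rewrite /r' exprMn rmorphM mulrA cmodM rmorphXn.
  rewrite cmod_real ger0_norm ?exprn_ge0 ?invr_ge0//.
  by rewrite ler_wpM2r// exprn_ge0// invr_ge0.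
have sb s : cmod (s - s0) <= r' -> summ (fun n => a n * (s - s0) ^+ n).
  move=> sr; exists (K * 2); apply: bsum_mono b _ => n.
  rewrite !cmodM cmod_rn// cmodX ler_wpM2l ?cmod_ge0//.
  by rewrite lerXn2r// nnegrE ?cmod_ge0// ltW.
exists (fun s => tsum (fun n => a n * (s - s0) ^+ n)); split.
  exists r', (K * 2); split=> //; exists a; split=> // s sr; exact/summ_hs/sb.
exists r'; split=> // s ss sr.
have /cvgsP h1 : series (fun n => a n * (s - s0) ^+ n : R[i]^o) @ \oo --> ((s - s0) ^+ k * f s : R[i]^o).
  have r'r : r' < r by rewrite /r' /h0; lra.
  by apply: hr => //; apply: lt_trans sr _.
exact: cvgs_unique h1 (sums_cvgs (summ_hs (sb s (ltW sr)))).
Qed.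

Lemma near_off_near (s0 : C) P : near_off s0 P -> forall e : R, 0 < e ->
  exists s, [/\ s != s0, cmod (s - s0) < e & P s].
Proof.
move=> [r [r0 h]] e e0; pose d := Num.min r e / 2.
have d0 : 0 < d by rewrite divr_gt0// lt_min r0.
exists (s0 + d%:C%C).
have -> : s0 + d%:C%C - s0 = d%:C%C by ring.
have dm : d < Num.min r e by rewrite /d ltr_pdivrMr// ltr_pMr ?ltr1n// lt_min r0.
have cd : cmod d%:C%C = d by rewrite cmod_real gtr0_norm.
have ss : s0 + d%:C%C != s0 by rewrite -subr_eq0 addrC addKr -cmod_eq0 cd gt_eqF.
move: dm; rewrite lt_min => /andP[dr de].
split=> //; first by rewrite cd.
by apply: h => //; rewrite addrC addKr cd.
Qed.

Lemma near_off_false (s0 : C) : ~ near_off s0 (fun=> False).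
Proof. by move=> /near_off_near /(_ 1 ltr01)[s []]. Qed.

(* The set of parameters t for which h vanishes near t is open and closed on the real axis. *)
Lemma mero_identity (h : C -> C) : mero h ->
  (forall s, 1 < complex.Re s -> h s = 0) -> near_off 0 (fun s => h s = 0).
Proof.
move=> hm h0.
have di t : near_off t (fun s => h s = 0) \/ near_off t (fun s => h s != 0) by apply: mero0_nz.
pose A := [set t : R | 0 <= t <= 2 /\ near_off t%:C%C (fun s => h s != 0)].
have [a0|na] := di 0 => //.
exfalso.
have A0 : A 0 by split=> //; rewrite lexx ler0n.
have hA : has_sup A by split; [exists 0|exists 2 => t [/andP[]]].
set t := sup A.
have t0 : 0 <= t by apply: ub_le_sup => //; exact: hA.2.
have zero (u : R) : 0 <= u -> t < u -> near_off u%:C%C (fun s => h s = 0).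
  move=> u0 tu; have [//|nz] := di u%:C%C.
  have [u2|u2] := leP u 2.
    have : u <= t by apply: ub_le_sup; [exact: hA.2|split; rewrite ?u0].
    by rewrite leNgt tu.
  have l1 : (0:R) < 1 by [].
  have [s [ss sr]] := near_off_near nz l1.
  rewrite h0 ?eqxx//.
  have := le_lt_trans (cmod_Re _) sr; rewrite raddfB /= ltr_norml; lra.
have [z|nz] := di t%:C%C.
  have [r [r0 hr]] := z.
  have [u Au ut] := sup_adherent r0 hA.
  have [/andP[u0 u2] nu] := Au.
  have ut' : u <= t by apply: ub_le_sup => //; exact: hA.2.
  have [ue|une] := eqVneq u t.
    have nu' : near_off t%:C%C (fun s => h s != 0) by rewrite -ue.
    by apply: (@near_off_false t%:C%C); apply: near_off_mono (near_off_and z nu') => s _ [->]; rewrite eqxx.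
  have ult : u < t by rewrite lt_neqAle une.
  have p : 0 < Num.min (t - u) (r - (t - u)) by rewrite lt_min !subr_gt0 ult /=; rewrite -/t in ut; lra.
  have [s [ss sr]] := near_off_near nu p; move: sr; rewrite lt_min => /andP[s1 s2].
  rewrite hr ?eqxx//.
    apply: contraTneq s1 => ->; rewrite -rmorphB cmod_real ger0_norm ?subr_ge0//.
    by rewrite ltxx.
  have -> : s - t%:C%C = (s - u%:C%C) - (t - u)%:C%C by rewrite rmorphB; ring.
  apply: le_lt_trans (cmodB _ _) _; rewrite cmod_real ger0_norm ?subr_ge0//.
  by rewrite -ltrBrDr.
have [r [r0 hr]] := nz.
pose u := t + r / 2.
have tu : t < u by rewrite ltrDl divr_gt0.
have r2 : 0 < r / 2 by rewrite divr_gt0.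
have [s [ss sr sums]] := near_off_near (zero u (ltW (le_lt_trans t0 tu)) tu) r2.
have : h s != 0.
  apply: hr.
    apply: contraTneq sr => ->; rewrite -rmorphB cmod_real ltr0_norm ?subr_lt0//.
    by rewrite opprB /u addrAC subrr add0r ltxx.
  have -> : s - t%:C%C = (s - u%:C%C) + (u - t)%:C%C by rewrite rmorphB; ring.
  apply: le_lt_trans (cmodD _ _) _; rewrite cmod_real ger0_norm ?subr_ge0 ?(ltW tu)//.
  by rewrite -ltrBrDr; apply: lt_le_trans sr _; rewrite /u; lra.
by rewrite sums eqxx.
Qed.

(** The expansion [a + b s + O(s^2)] on a punctured neighbourhood of 0; the value at 0 stays free,
    since a meromorphic continuation is not constrained there. *)
Definition first_order (f : C -> C) (a b : C) : Prop :=
  exists K : R, near_off 0 (fun s => cmod (f s - a - b * s) <= K * cmod s ^+ 2).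

Lemma first_order_ext f g a b : near_off 0 (fun s => f s = g s) -> first_order f a b -> first_order g a b.
Proof. by move=> h [K k]; exists K; apply: near_off_mono (near_off_and h k) => s _ [<-]. Qed.

Lemma ana_fo f : analytic_at 0 f -> exists b, first_order f (f 0) b.
Proof.
move=> [r [M [r0 hf]]]; have [v [hv e]] := normal_series_step r0 hf.
have [w [hw e']] := normal_series_step r0 hv.
exists (v 0), (M / r / r), r; split=> // s _; rewrite subr0 => sr.
have sr' : cmod (s - 0) <= r by rewrite subr0 ltW.
rewrite e// e'// subr0.
have -> : f 0 + s * (v 0 + s * w s) - f 0 - v 0 * s = s ^+ 2 * w s by ring.
by rewrite cmodM cmodX mulrC ler_wpM2r ?exprn_ge0 ?cmod_ge0//; apply: normal_series_bound hw sr'.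
Qed.

Lemma first_order_unique f a b a' b' : first_order f a b -> first_order f a' b' -> a = a' /\ b = b'.
Proof.
move=> [K h] [K' h'].
have H : near_off 0 (fun s => cmod ((a - a') + (b - b') * s) <= (K + K') * cmod s ^+ 2).
  apply: near_off_mono (near_off_and h h') => s _ [h1 h2].
  have -> : (a - a') + (b - b') * s = (f s - a' - b' * s) - (f s - a - b * s) by ring.
  by apply: le_trans (cmodB _ _) _; rewrite addrC mulrDl lerD.
have aa : a - a' = 0.
  apply/eqP; rewrite -cmod_eq0 eq_le cmod_ge0 andbT; apply/ler_addgt0Pr => e e0; rewrite add0r.
  have p : 0 < `|K + K'| + cmod (b - b') + 1 by rewrite ltr_wpDl// addr_ge0// cmod_ge0.
  have q : 0 < Num.min 1 (e / (`|K + K'| + cmod (b - b') + 1)) by rewrite lt_min ltr01 divr_gt0.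
  have [s [_]] := near_off_near H q; rewrite subr0 lt_min ltr_pdivlMr// => /andP[s1 se] sums.
  apply: le_trans (ltW se).
  have -> : a - a' = (a - a' + (b - b') * s) - (b - b') * s by ring.
  apply: le_trans (cmodB _ _) _; apply: le_trans (lerD sums (lexx _)) _; rewrite cmodM.
  have s0 := cmod_ge0 s; have k0 := ler_norm (K + K'); have k1 := normr_ge0 (K + K').
  have b0 := cmod_ge0 (b - b').
  have s2 : cmod s ^+ 2 <= cmod s by rewrite expr2 ler_piMl// ltW.
  have : (K + K') * cmod s ^+ 2 <= `|K + K'| * cmod s.
    apply: le_trans (_ : _ <= `|K + K'| * cmod s ^+ 2) _.
      by rewrite ler_wpM2r// exprn_ge0.
    by rewrite ler_wpM2l.
  by rewrite mulrDr mulrDr mulr1; nra.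
split; first by apply/eqP; rewrite -subr_eq0 aa.
apply/eqP; rewrite -subr_eq0 -cmod_eq0 eq_le cmod_ge0 andbT.
apply/ler_addgt0Pr => e e0; rewrite add0r.
have p : 0 < `|K + K'| + 1 by rewrite ltr_wpDl.
have [s [ns]] := near_off_near H (divr_gt0 e0 p); rewrite subr0 ltr_pdivlMr// aa add0r cmodM expr2 mulrA => se.
rewrite ler_pM2r ?cmod_gt0// => sums.
apply: le_trans sums _; apply: le_trans (ltW se); rewrite mulrC ler_wpM2l ?cmod_ge0//.
by apply: le_trans (ler_norm _) _; rewrite lerDl.
Qed.

Lemma first_order_mul f g a b a' b' : first_order f a b -> first_order g a' b' ->
  first_order (fun s => f s * g s) (a * a') (a * b' + b * a').
Proof.
move=> [K h] [K' h'].
pose A := cmod a + cmod b + `|K|; pose B := `|K'|.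
have i1 : near_off (0:C) (fun s => cmod s <= 1) by exists 1; split=> // s _; rewrite subr0 => /ltW.
exists (cmod (b * b') + A * `|K'| + `|K| * (cmod a' + cmod b' + 0)).
apply: near_off_mono (near_off_and i1 (near_off_and h h')) => s _ [s1 [h1 h2]].
set u := f s - a - b * s in h1; set v := g s - a' - b' * s in h2.
have -> : f s * g s - a * a' - (a * b' + b * a') * s =
   b * b' * s ^+ 2 + f s * v + u * (a' + b' * s) by rewrite /u /v; ring.
have s0 := cmod_ge0 s.
have s2 : 0 <= cmod s ^+ 2 by rewrite exprn_ge0.
have s21 : cmod s ^+ 2 <= 1 by rewrite expr_le1.
have hu : cmod u <= `|K| * cmod s ^+ 2.
  by apply: le_trans h1 _; rewrite ler_wpM2r// ler_norm.
have hv : cmod v <= `|K'| * cmod s ^+ 2.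
  by apply: le_trans h2 _; rewrite ler_wpM2r// ler_norm.
have hf : cmod (f s) <= A.
  have -> : f s = a + b * s + u by rewrite /u; ring.
  apply: le_trans (cmodD _ _) _; apply: lerD; last first.
    by apply: le_trans hu _; rewrite ler_piMr.
  apply: le_trans (cmodD _ _) _; rewrite lerD2l cmodM ler_piMr ?cmod_ge0//.
have hg : cmod (a' + b' * s) <= cmod a' + cmod b'.
  by apply: le_trans (cmodD _ _) _; rewrite lerD2l cmodM ler_piMr ?cmod_ge0.
rewrite addr0 [X in _ <= X]mulrDl [X in _ <= X + _]mulrDl; apply: le_trans (cmodD _ _) _; apply: lerD.
  apply: le_trans (cmodD _ _) _; apply: lerD; first by rewrite cmodM cmodX.
  by rewrite cmodM -mulrA ler_pM ?cmod_ge0.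
by rewrite cmodM mulrAC ler_pM ?cmod_ge0.
Qed.

Lemma first_order_add f g a b a' b' : first_order f a b -> first_order g a' b' ->
  first_order (fun s => f s + g s) (a + a') (b + b').
Proof.
move=> [K h] [K' h']; exists (K + K'); apply: near_off_mono (near_off_and h h') => s _ [h1 h2].
have -> : f s + g s - (a + a') - (b + b') * s = (f s - a - b * s) + (g s - a' - b' * s) by ring.
by apply: le_trans (cmodD _ _) _; rewrite mulrDl lerD.
Qed.

Lemma first_order_cst c : first_order (fun=> c) c 0.
Proof. by exists 0; exists 1; split=> // s _ _; rewrite mul0r subr0 subrr cmod0 mul0r. Qed.

Lemma first_order_scale c f a b : first_order f a b -> first_order (fun s => c * f s) (c * a) (c * b).
Proof. by move=> h; have := first_order_mul (first_order_cst c) h; rewrite mul0r addr0. Qed.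

Lemma cexp_taylor (l : R) (s : C) : cmod s <= 1 ->
  cmod (cexp (s * l%:C%C) - 1 - l%:C%C * s) <= expR (`|l|) * cmod s ^+ 2.
Proof.
move=> s1.
have := sums_exp (s * l%:C%C).
have E n : ecoef (s * l%:C%C) n = ecoef l%:C%C n * s ^+ n by rewrite /ecoef exprMn; ring.
move=> h.
have h' : sums (fun n => if (n < 2)%N then 0 else ecoef (s * l%:C%C) n) (cexp (s * l%:C%C) - 1 - l%:C%C * s).
  have z0 := @sums_single R _ (fun n : nat => if n == 0%N then 1 else 0) 0%N.
  have z1 := @sums_single R _ (fun n : nat => if n == 1%N then l%:C%C * s else 0) 1%N.
  rewrite /= in z0 z1.
  have {}z0 := sumsZ (-1) (z0 (fun i h => ifN_eq _ _ h)); have {}z1 := sumsZ (-1) (z1 (fun i h => ifN_eq _ _ h)).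
  have := sumsD (sumsD h z0) z1; rewrite !mulN1r; apply: eq_sums => -[|[|n]] /=.
  - by rewrite /ecoef expr0 divr1; ring.
  - by rewrite /ecoef expr1 divr1; ring.
  - by rewrite !mulr0 !addr0.
apply: sums_tail h' => J.
apply: le_trans (_ : _ <= \sum_(i <- J) cmod (ecoef l%:C%C i) * cmod s ^+ 2) _.
  apply: ler_sum => -[|[|n]] _ /=.
  - by rewrite cmod0 mulr_ge0 ?cmod_ge0// exprn_ge0// cmod_ge0.
  - by rewrite cmod0 mulr_ge0 ?cmod_ge0// exprn_ge0// cmod_ge0.
  - rewrite E cmodM cmodX ler_wpM2l ?cmod_ge0// -addn2 addnC exprD.
    by rewrite ler_piMr ?exprn_ge0 ?cmod_ge0// exprn_ile1 ?cmod_ge0.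
rewrite -mulr_suml ler_wpM2r ?exprn_ge0 ?cmod_ge0//.
by have := bsum_ecoef l%:C%C J; rewrite cmod_real.
Qed.

Lemma first_order_exp (l : R) : first_order (fun s => cexp (s * l%:C%C)) 1 l%:C%C.
Proof.
exists (expR (`|l|)); exists 1; split=> // s _; rewrite subr0 => /ltW; exact: cexp_taylor.
Qed.

(** Some expansion of the inverse exists by analyticity; multiplying it by that of [f] and comparing
    with the constant 1 determines its coefficients. *)
Lemma first_order_inv f a b : analytic_at 0 f -> first_order f a b -> a != 0 -> first_order (fun s => (f s)^-1) a^-1 (- b / a ^+ 2).
Proof.
move=> hf h a0; have [b' h'] := ana_fo hf.
have [ea eb] := first_order_unique h h'; subst a b'.
have [c hc] := ana_fo (ana_inv hf a0).
have [K0 h1] := first_order_mul h hc.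
have h2 : first_order (fun=> 1) (f 0 / f 0) (f 0 * c + b / f 0).
  by apply: first_order_ext (first_order_mul h hc); apply: near_off_mono (near_off_nz hf a0) => s _ nz; rewrite divff.
have [_] := first_order_unique (first_order_cst 1) h2 => /esym/eqP; rewrite addr_eq0 => /eqP e.
have -> : - b / f 0 ^+ 2 = c by apply: (mulfI a0); rewrite e; field.
exact: hc.
Qed.

End Continuation.

(** * Finite differences *)

Section Differences.
Variable R : realType.
Local Notation C := R[i].

(** The operator [(1 - shift)^k], with this sign because it is paired with signs that the shift
    reverses: each difference doubles an alternating sum. *)
Fixpoint ndif (V : zmodType) (k : nat) (f : nat -> V) (n : nat) : V :=
  if k is k'.+1 then ndif k' f n - ndif k' f n.+1 else f n.

Lemma ndif_shift (V : zmodType) k (f : nat -> V) n :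
  ndif k (fun j => f j.+1) n = ndif k f n.+1.
Proof. by elim: k n => [|k IH] n //=; rewrite !IH. Qed.

Lemma ndif_ext (V : zmodType) k (f g : nat -> V) n :
  (forall j, (j <= n + k)%N -> f j = g j) -> ndif k f n = ndif k g n.
Proof.
elim: k n => [|k IH] n h /=; first by apply: h; rewrite addn0.
by rewrite !IH// => j hj; apply: h; [rewrite addSn -addnS in hj|rewrite addnS leqW].
Qed.

Lemma ndifD (V : zmodType) k (f g : nat -> V) n :
  ndif k (fun j => f j + g j) n = ndif k f n + ndif k g n.
Proof. by elim: k n => [|k IH] n //=; rewrite !IH opprD addrACA. Qed.

Lemma ndif0 (V : zmodType) k n : ndif k (fun=> 0 : V) n = 0.
Proof. by elim: k n => [|k IH] n //=; rewrite !IH subrr. Qed.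

Lemma ndifZ (A : pzRingType) k (c : A) (f : nat -> A) n :
  ndif k (fun j => c * f j) n = c * ndif k f n.
Proof. by elim: k n => [|k IH] n //=; rewrite !IH mulrBr. Qed.

Lemma ndif_sum (V : zmodType) k (I : Type) (r : seq I) (f : I -> nat -> V) n :
  ndif k (fun j => \sum_(i <- r) f i j) n = \sum_(i <- r) ndif k (f i) n.
Proof.
elim: r => [|i r IH].
  by rewrite big_nil -[RHS](ndif0 V k n); apply: ndif_ext => j _; rewrite big_nil.
rewrite big_cons -IH -ndifD; apply: ndif_ext => j _; by rewrite big_cons.
Qed.

Lemma ndifSr (V : zmodType) k (f : nat -> V) n :
  ndif k.+1 f n = ndif k (fun j => f j - f j.+1) n.
Proof. by elim: k n => [|k IH] n //; rewrite [LHS]/= -!/(ndif _.+1 _ _) !IH. Qed.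

Lemma ndif_poly k l n : (l < k)%N -> ndif k (fun j => j%:R ^+ l : R) n = 0.
Proof.
elim: k l n => // k IH l n lk; rewrite ndifSr.
have -> : ndif k (fun j => j%:R ^+ l - j.+1%:R ^+ l : R) n =
   ndif k (fun j => \sum_(i < l) - 'C(l, i)%:R * (j%:R ^+ i : R)) n.
  apply: ndif_ext => j _; rewrite -natr1 [j%:R + 1]addrC exprDn_comm; last exact: mulrC.
  rewrite big_ord_recr /= binn subnn expr0 mul1r mulr1n opprD addrC addrNK -sumrN.
  by apply: eq_bigr => i _; rewrite expr1n mul1r mulNr mulr_natl.
rewrite ndif_sum big1// => i _; rewrite ndifZ IH ?mulr0//.
by apply: leq_trans (ltn_ord i) _; rewrite -ltnS.
Qed.

Lemma ndif_le k (f : nat -> R) n B :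
  (forall j, (j <= n + k)%N -> `|f j| <= B) -> `|ndif k f n| <= 2 ^+ k * B.
Proof.
elim: k n => [|k IH] n h /=; first by rewrite mul1r; apply: h; rewrite addn0.
rewrite exprS -mulrA mulr_natl mulr2n; apply: le_trans (ler_normB _ _) _; apply: lerD.
  by apply: IH => j hj; apply: h; rewrite addnS leqW.
by apply: IH => j hj; apply: h; rewrite addnS -addSn.
Qed.

Lemma ndif_wn k (f : nat -> C -> C) n (s0 : C) (r : R) B :
  (forall j, (j <= n + k)%N -> normal_series s0 r (f j) B) ->
  normal_series s0 r (fun s => ndif k (fun j => f j s) n) (2 ^+ k * B).
Proof.
elim: k n => [|k IH] n h /=; first by rewrite mul1r; apply: h; rewrite addn0.
rewrite exprS -mulrA mulr_natl mulr2n; apply: normal_series_add.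
  by apply: IH => j hj; apply: h; rewrite addnS leqW.
by apply: normal_series_opp; apply: IH => j hj; apply: h; rewrite addnS -addSn.
Qed.

(** In the application [c] is the cosine of the argument of [w] and [t = j / |w|]; the bound [1/4]
    keeps [2 c t + t^2] within [3/4] of 0, where [ln (1 + u)] is under control. *)
Definition jbd (f : R -> R -> R) : Prop :=
  exists B, forall c t, `|c| <= 1 -> 0 <= t <= 4^-1 -> `|f c t| <= B.

(* [f c t] has a Taylor expansion of order [k] in [t], uniformly in [c]. *)
Fixpoint jet (k : nat) (f : R -> R -> R) : Prop :=
  jbd f /\ (if k is k'.+1 then exists (a : R -> R) (g : R -> R -> R),
    [/\ jbd (fun c _ => a c), jet k' g &
        forall c t, `|c| <= 1 -> 0 <= t <= 4^-1 -> f c t = a c + t * g c t] else True).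

Lemma jbd_add f g : jbd f -> jbd g -> jbd (fun c t => f c t + g c t).
Proof.
move=> [B h] [B' h']; exists (B + B') => c t c1 t1.
by apply: le_trans (ler_normD _ _) _; rewrite lerD ?h ?h'.
Qed.

Lemma jbd_mul f g : jbd f -> jbd g -> jbd (fun c t => f c t * g c t).
Proof.
move=> [B h] [B' h']; exists (B * B') => c t c1 t1.
by rewrite normrM ler_pM ?h ?h'.
Qed.

Lemma jbd_cst (b : R) : jbd (fun _ _ => b).
Proof. by exists `|b|. Qed.

Lemma jbd_t : jbd (fun _ t => t).
Proof. by exists 4^-1 => c t _ /andP[t0]; rewrite ger0_norm. Qed.

Lemma jet_bd k f : jet k f -> jbd f.
Proof. by case: k => [|k] []. Qed.

Lemma jet_ext k f g : (forall c t, `|c| <= 1 -> 0 <= t <= 4^-1 -> f c t = g c t) ->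
  jet k f -> jet k g.
Proof.
have e h : (forall c t, `|c| <= 1 -> 0 <= t <= 4^-1 -> f c t = h c t) -> jbd f -> jbd h.
  by move=> fh [B b]; exists B => c t c1 t1; rewrite -fh ?b.
case: k => [|k] fg /= [b]; first by split=> //; exact: e b.
move=> [a [h [h1 h2 h3]]]; split; first exact: e b.
by exists a, h; split=> // c t c1 t1; rewrite -fg// h3.
Qed.

Lemma jet_cst k (a : R -> R) : jbd (fun c _ => a c) -> jet k (fun c _ => a c).
Proof.
elim: k a => [|k IH] a ba /=; split=> //.
exists a, (fun _ _ => 0); split=> //; first by apply: IH; exact: jbd_cst.
by move=> c t _ _; rewrite mulr0 addr0.
Qed.

Lemma jet_add k f g : jet k f -> jet k g -> jet k (fun c t => f c t + g c t).
Proof.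
elim: k f g => [|k IH] f g /= [bf hf] [bg hg]; split=> //; try exact: jbd_add.
have [a [u [h1 h2 h3]]] := hf; have [a' [u' [h1' h2' h3']]] := hg.
exists (fun c => a c + a' c), (fun c t => u c t + u' c t); split; first exact: jbd_add.
  exact: IH.
by move=> c t c1 t1; rewrite h3// h3'//; ring.
Qed.

Lemma jet_weak k f : jet k.+1 f -> jet k f.
Proof.
elim: k f => [|k IH] f [bf]; first by move=> _; split.
move=> [a [u [h1 h2 h3]]]; split=> //; exists a, u; split=> //; exact: IH.
Qed.

Lemma jet_tS k f : jet k f -> jet k.+1 (fun c t => t * f c t).
Proof.
move=> h; split; first by apply: jbd_mul (jbd_t) (jet_bd h).
exists (fun=> 0), f; split=> //; first exact: jbd_cst.
by move=> c t _ _; rewrite add0r.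
Qed.

Lemma jet_t k f : jet k f -> jet k (fun c t => t * f c t).
Proof. by move=> /jet_tS/jet_weak. Qed.

Lemma jet_mul k f g : jet k f -> jet k g -> jet k (fun c t => f c t * g c t).
Proof.
elim: k f g => [|k IH] f g /= [bf hf] [bg hg]; split=> //; try exact: jbd_mul.
have [a [u [h1 h2 h3]]] := hf; have [a' [u' [h1' h2' h3']]] := hg.
exists (fun c => a c * a' c), (fun c t => a c * u' c t + a' c * u c t + t * (u c t * u' c t)).
split; first exact: jbd_mul.
  by apply: jet_add; [apply: jet_add; apply: IH => //; exact: jet_cst|apply: jet_t; exact: IH].
by move=> c t c1 t1; rewrite h3// h3'//; ring.
Qed.

Lemma jet_iter k f n : jet k f -> jet k (fun c t => f c t ^+ n).
Proof.
move=> h; elim: n => [|n IH]; first by apply: jet_ext (jet_cst k (jbd_cst 1)) => c t _ _; rewrite expr0.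
by apply: jet_ext (jet_mul h IH) => c t _ _; rewrite exprS.
Qed.

Lemma jet_tk k f : jbd f -> jet k (fun c t => t ^+ k * f c t).
Proof.
move=> h; elim: k => [|k IH]; first by split=> //; apply: jbd_mul => //; exact: (jbd_cst 1).
by apply: jet_ext (jet_tS IH) => c t _ _; rewrite exprS mulrA.
Qed.

Lemma jet_sum k (I : Type) (r : seq I) (f : I -> R -> R -> R) :
  (forall i, jet k (f i)) -> jet k (fun c t => \sum_(i <- r) f i c t).
Proof.
move=> h; elim: r => [|i r IH].
  by apply: jet_ext (jet_cst k (jbd_cst 0)) => c t _ _; rewrite big_nil.
by apply: jet_ext (jet_add (h i) IH) => c t _ _; rewrite big_cons.
Qed.

Lemma jet_expand k f : jet k f -> exists (a : nat -> R -> R) (g : R -> R -> R), jbd g /\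
  forall c t, `|c| <= 1 -> 0 <= t <= 4^-1 ->
    f c t = \sum_(l < k) a l c * t ^+ l + t ^+ k * g c t.
Proof.
elim: k f => [|k IH] f [bf].
  by move=> _; exists (fun _ _ => 0), f; split=> // c t _ _; rewrite big_ord0 add0r mul1r.
move=> [a [u [h1 h2 h3]]]; have [b [g [bg h4]]] := IH _ h2.
exists (fun l => if l is l'.+1 then b l' else a), g; split=> // c t c1 t1.
rewrite h3// h4// big_ord_recl expr0 mulr1 mulrDr addrA; congr (_ + _ + _).
  by rewrite mulr_sumr; apply: eq_bigr => i _ /=; rewrite exprS; ring.
by rewrite exprS mulrA.
Qed.

(** The [k]-th difference annihilates the Taylor polynomial of degree less than [k]; only the
    remainder, of size [(k e)^k], survives, uniformly in [c]. *)
Lemma ndif_jet k f : jet k f -> exists K, forall c e, `|c| <= 1 -> 0 <= e ->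
  k%:R * e <= 4^-1 -> `|ndif k (fun j => f c (j%:R * e)) 0| <= K * e ^+ k.
Proof.
move=> /jet_expand[a [g [[B hB] h]]]; exists (2 ^+ k * (k%:R ^+ k * B)) => c e c1 e0 ke.
have je j : (j <= 0 + k)%N -> 0 <= j%:R * e <= 4^-1.
  by move=> jk; rewrite mulr_ge0//=; apply: le_trans ke; rewrite ler_wpM2r// ler_nat.
have -> : ndif k (fun j => f c (j%:R * e)) 0 =
    ndif k (fun j => \sum_(l < k) (a l c * e ^+ l) * (j%:R ^+ l : R)
      + (j%:R * e) ^+ k * g c (j%:R * e)) 0.
  apply: ndif_ext => j jk; rewrite h ?je//; congr (_ + _).
  by apply: eq_bigr => l _; rewrite exprMn; ring.
rewrite ndifD ndif_sum big1 ?add0r; last by move=> l _; rewrite ndifZ ndif_poly ?mulr0.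
rewrite -!mulrA; apply: ndif_le => j jk.
rewrite normrM; apply: le_trans (_ : _ <= (k%:R * e) ^+ k * B) _; last first.
  by rewrite exprMn -mulrA [B * _]mulrC.
have /andP[j0 j4] := je _ jk.
apply: ler_pM => //; last by apply: hB => //; exact: je.
by rewrite ger0_norm ?exprn_ge0// lerXn2r ?nnegrE ?mulr_ge0// ler_wpM2r// ler_nat.
Qed.

End Differences.

(** * Taylor expansion of the logarithm *)

Section LogJet.
Variable R : realType.
Local Notation C := R[i].

Lemma mvt0 (g dg : R -> R) (a x : R) :
  (forall y : R, `|y| <= a -> is_derive y 1 g (dg y)) -> `|x| <= a ->
  exists2 y, `|y| <= `|x| & g x - g 0 = dg y * x.
Proof.
move=> h xa.
have cont (b c : R) : - a <= b -> c <= a -> {within `[b, c], continuous g}.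
  move=> ab ca; apply: derivable_within_continuous => y; rewrite in_itv /= => /andP[y1 y2].
  by apply: ex_derive; apply: h; rewrite ler_norml (le_trans ab y1) (le_trans y2 ca).
have der (b c : R) : - a <= b -> c <= a -> forall y, y \in `]b, c[%R -> is_derive y 1 g (dg y).
  move=> ab ca y; rewrite in_itv /= => /andP[y1 y2].
  by apply: h; rewrite ler_norml (le_trans ab (ltW y1)) (le_trans (ltW y2) ca).
have a0 : 0 <= a by apply: le_trans (normr_ge0 _) xa.
move: (xa); rewrite ler_norml => /andP[xa1 xa2].
have [x0|x0] := leP 0 x.
  have na0 : - a <= 0 by rewrite oppr_le0.
  have [y] := MVT_segment x0 (der _ _ na0 xa2) (cont _ _ na0 xa2).
  rewrite in_itv /= => /andP[y1 y2] e.
  by exists y; rewrite ?e ?subr0// !ger0_norm.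
have [y] := MVT_segment (ltW x0) (der _ _ xa1 a0) (cont _ _ xa1 a0).
rewrite in_itv /= => /andP[y1 y2] e; exists y; first by rewrite !ler0_norm// ?lerN2// ltW.
by apply: oppr_inj; rewrite opprB e sub0r mulrN.
Qed.

Lemma is_derive_ln1 (y : R) : 0 < 1 + y -> is_derive y 1 (fun u => ln (1 + u)) (1 + y)^-1.
Proof.
move=> y0; have d1 : is_derive y 1 (cst (1 : R) + @id R) (0 + 1) by exact: is_deriveD.
have := @is_derive1_comp _ (@ln R) (cst (1 : R) + @id R) y (1 + y)^-1 (0 + 1) (is_derive1_ln y0) d1.
by rewrite add0r mulr1.
Qed.

(** The derivative of [ln (1 + u) - p(u)] is [(-u)^k / (1 + u)], because [p'] is a finite geometric
    sum; the constant 4 bounds [1 / (1 + u)] for [|u| <= 3/4]. *)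
Lemma ln_taylor k : exists p : {poly R}, p.[0] = 0 /\
  forall u : R, `|u| <= 3 / 4 -> `|ln (1 + u) - p.[u]| <= 4 * `|u| ^+ k.+1.
Proof.
pose p : {poly R} := \sum_(j < k) ((-1) ^+ j / j.+1%:R) *: 'X^(j.+1).
have p0 : p.[0] = 0.
  by rewrite horner_sum big1// => j _; rewrite hornerZ hornerXn expr0n mulr0.
have dp u : (1 + u) * p^`().[u] = 1 - (- u) ^+ k.
  have -> : p^`() = \sum_(j < k) (-1) ^+ j *: 'X^j.
    rewrite /p raddf_sum; apply: eq_bigr => j _.
    rewrite -[LHS]/((((-1) ^+ j / j.+1%:R) *: 'X^(j.+1))^`()) derivZ derivXn /=.
    by rewrite -scalerMnr scalerMnl -mulr_natr mulfVK// pnatr_eq0.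
  rewrite horner_sum.
  elim: (k) => [|n IH]; first by rewrite big_ord0 mulr0 expr0 subrr.
  rewrite big_ord_recr /= mulrDr IH hornerZ hornerXn exprS -exprMn mulN1r; ring.
exists p; split=> // u u1.
pose dg (y : R) := (1 + y)^-1 - p^`().[y].
have pos (y : R) : `|y| <= 3 / 4 -> 4^-1 <= 1 + y.
  by rewrite ler_norml => /andP[? _]; lra.
have der (y : R) : `|y| <= 3 / 4 -> is_derive y 1 (fun u => ln (1 + u) - p.[u]) (dg y).
  move=> /pos y1; have y0 : 0 < 1 + y by apply: lt_le_trans y1.
  have d2 := is_derive_ln1 y0.
  exact: (@is_deriveB _ _ _ _ _ y 1 _ _ d2 (is_derive_poly p y)).
have [y yu] := mvt0 der u1; rewrite addr0 ln1 p0 subrr subr0 => ->.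
have y1 := pos _ (le_trans yu u1).
have y0 : 0 < 1 + y by apply: lt_le_trans y1.
have -> : dg y = (- y) ^+ k / (1 + y).
  by apply: (mulfI (lt0r_neq0 y0)); rewrite /dg mulrBr divff ?gt_eqF// dp; field; rewrite gt_eqF.
rewrite !normrM normrX normrN exprSr mulrA ler_wpM2r// mulrC ler_pM//.
  by rewrite normfV (gtr0_norm y0) invf_ple ?posrE ?invr_gt0.
by rewrite lerXn2r.
Qed.

(** With [c = Re w / |w|] and [t = j / |w|], the quotient [|w + j|^2 / |w|^2] is [1 + ucs c t]. *)
Definition ucs (c t : R) : R := 2 * c * t + t ^+ 2.

Lemma ucs_le (c t : R) : `|c| <= 1 -> 0 <= t <= 4^-1 -> `|ucs c t| <= 3 * t /\ `|ucs c t| <= 3 / 4.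
Proof.
move=> c1 /andP[t0 t4]; have h : `|ucs c t| <= 3 * t.
  apply: le_trans (ler_normD _ _) _; rewrite !normrM (ger0_norm (ler0n R 2)) (ger0_norm t0).
  have -> : 3 * t = 2 * 1 * t + t * 1 by ring.
  by apply: lerD; [rewrite ler_wpM2r// ler_wpM2l|rewrite ler_wpM2l//; lra].
by split=> //; apply: le_trans h _; lra.
Qed.

Lemma jet_ln k : jet k (fun c t => ln (1 + ucs c t)).
Proof.
have [p [p0 hp]] := ln_taylor k.
have ju : jet k ucs.
  have j2 : jet k (fun c (_ : R) => 2 * c).
    by apply: jet_cst; exists 2 => c _ c1 _; rewrite normrM (ger0_norm (ler0n R 2)) ler_piMr.
  have jt : jet k (fun (_ t : R) => t).
    apply: jet_ext (jet_t (jet_cst k (jbd_cst 1))) => c t _ _; by rewrite mulr1.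
  apply: jet_ext (jet_add (jet_mul j2 jt) (jet_mul jt jt)) => c t _ _; by rewrite /ucs expr2.
(* The remainder is exhibited as [t ^ k] times a bounded function; boundedness comes from
   [|ucs c t| <= 3 t], and at [t = 0] everything vanishes. *)
pose h (c t : R) := (ln (1 + ucs c t) - p.[ucs c t]) / t ^+ k.
apply: (@jet_ext _ _ (fun c t => p.[ucs c t] + t ^+ k * h c t)) => [c t c1 t1|].
  have [->|t0] := eqVneq t 0.
    by rewrite /h /ucs mulr0 expr0n addr0 addr0 ln1 p0 subr0 mul0r mulr0 addr0.
  by rewrite /h mulrCA divff ?expf_neq0// mulr1 addrC subrK.
apply: jet_add.
  apply: jet_ext (jet_sum (index_enum 'I_(size p)) (f := fun (i : 'I_(size p)) c t => p`_i * ucs c t ^+ i) _).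
    by move=> c t _ _; rewrite horner_coef.
  by move=> i; apply: jet_mul; [apply: jet_cst; exact: jbd_cst|apply: jet_iter].
apply: jet_tk; exists (4 * 3 ^+ k.+1) => c t c1 t1; rewrite /h normrM.
have /andP[t0 t4] := t1; have [u1 u2] := ucs_le c1 t1.
have [->|tn] := eqVneq t 0.
  by rewrite /ucs mulr0 expr0n addr0 addr0 ln1 p0 subr0 normr0 mul0r mulr_ge0// exprn_ge0.
have tp : 0 < t by rewrite lt_def tn.
rewrite normfV normrX (ger0_norm t0) ler_pdivrMr ?exprn_gt0//.
apply: le_trans (hp _ u2) _; rewrite -mulrA ler_wpM2l//.
apply: le_trans (_ : _ <= (3 * t) ^+ k.+1) _; first by rewrite lerXn2r ?nnegrE// mulr_ge0.
rewrite exprMn ler_wpM2l ?exprn_ge0// exprSr ler_piMr ?exprn_ge0//; lra.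
Qed.

Lemma ln_ucs_le (c t : R) : `|c| <= 1 -> 0 <= t <= 4^-1 -> `|ln (1 + ucs c t)| <= 12 * t.
Proof.
move=> c1 t1; have [u1 u2] := ucs_le c1 t1.
have der (y : R) : `|y| <= 3 / 4 -> is_derive y 1 (fun u => ln (1 + u)) (1 + y)^-1.
  rewrite ler_norml => /andP[y1 _]; have y0 : 0 < 1 + y by lra.
  exact: is_derive_ln1.
have [y yu] := mvt0 der u2; rewrite addr0 ln1 subr0 => ->.
have y1 : 4^-1 <= 1 + y by move: (le_trans yu u2); rewrite ler_norml => /andP[? _]; lra.
have y0 : 0 < 1 + y by lra.
rewrite normrM normfV (gtr0_norm y0).
have -> : 12 * t = 4 * (3 * t) by ring.
apply: ler_pM => //; first by rewrite invr_ge0 ltW.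
by rewrite invf_ple ?posrE ?invr_gt0.
Qed.

End LogJet.

(** * Differences of |w|^(-2s) along unit shifts *)

Section LTerm.
Variable R : realType.
Local Notation C := R[i].

Definition lnsq (w : C) : R := ln (cmod w ^+ 2).

(* [|w|^(-2 s)], with the value [0] at [w = 0]. *)
Definition lterm (w s : C) : C := if w == 0 then 0 else cexp (s * (- lnsq w)%:C%C).

Lemma cmod_cexp_le (s : C) (l : R) : cmod (cexp (s * l%:C%C)) <= expR (cmod s * `|l|).
Proof.
rewrite cmod_cexp ler_expR; case: s => a b /=; rewrite mulr0 subr0.
apply: le_trans (ler_norm _) _; rewrite normrM ler_wpM2r//.
exact: (cmod_Re (a +i* b)%C).
Qed.

Lemma normal_series_lterm (w s0 : C) r : 0 < r -> w != 0 -> normal_series s0 r (lterm w)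
  (cmod (cexp (s0 * (- lnsq w)%:C%C)) * expR (r * `|lnsq w|)).
Proof.
move=> r0 w0; have := normal_series_exp s0 (- lnsq w) r0; rewrite normrN.
by apply: normal_series_ext => s _; rewrite /lterm (negPf w0).
Qed.

(** From degree [k] on, [1/i!] is at most [1/(i - k)!], which extracts the factor [(rho |l|)^k] from
    the exponential series. *)
Lemma normal_series_exp_tail (s0 : C) (r l : R) k : 0 < r ->
  normal_series s0 r (fun s => cexp (s * l%:C%C) - \sum_(i < k) s ^+ i * ((l ^+ i / (i`!)%:R)%:C%C))
    (((r + cmod s0) * `|l|) ^+ k * expR ((r + cmod s0) * `|l|)).
Proof.
move=> r0; set rho := r + cmod s0.
have rho0 : 0 <= rho by rewrite addr_ge0 ?cmod_ge0// ltW.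
pose F (i : nat) (s : C) := if (i < k)%N then 0 else s ^+ i * ((l ^+ i / (i`!)%:R)%:C%C).
pose M (i : nat) := if (i < k)%N then 0 else rho ^+ i * (`|l| ^+ i / (i`!)%:R).
have hl (s : C) i : ecoef (s * l%:C%C) i = s ^+ i * ((l ^+ i / (i`!)%:R)%:C%C).
  by rewrite /ecoef exprMn rmorphM rmorphXn fmorphV rmorph_nat mulrA.
apply: (@normal_series_sum _ nat s0 r F M) => //.
- move=> i; rewrite /F /M; case: ltnP => _.
    by have := normal_series_cst s0 r 0; rewrite cmod0.
  have h := normal_series_scale (l ^+ i / (i`!)%:R)%:C%C (normal_series_iter i r0 (normal_series_var s0 r0)).
  rewrite cmod_real normrM normrX normfV normr_nat in h.
  by apply: normal_series_le (normal_series_ext _ h) _ => [s _|]; rewrite mulrC.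
- apply: (@rbs_comp _ _ _ _ (fun j => (rho * `|l|) ^+ k * cmod (ecoef (rho * `|l|)%:C%C j)) (fun i => (i - k)%N)).
  + by move=> j; rewrite mulr_ge0 ?cmod_ge0// exprn_ge0// mulr_ge0.
  + move=> i j; rewrite /M; case: ltnP => ik; rewrite ?ltxx//; case: ltnP => jk; rewrite ?ltxx// => _ _ e.
    by rewrite -(subnK ik) e subnK.
  + move=> i; rewrite /M; case: ltnP => ik.
      by rewrite mulr_ge0 ?cmod_ge0// exprn_ge0// mulr_ge0.
    rewrite /ecoef cmodM cmodV cmodX cmod_nat cmod_real (ger0_norm (mulr_ge0 rho0 (normr_ge0 l))).
    have -> : rho ^+ i * (`|l| ^+ i / (i`!)%:R) = (rho * `|l|) ^+ k * ((rho * `|l|) ^+ (i - k) / (i`!)%:R).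
      by rewrite [RHS]mulrA -exprD subnKC// exprMn mulrA.
    rewrite ler_wpM2l ?exprn_ge0 ?mulr_ge0//.
    rewrite ler_wpM2l ?exprn_ge0 ?mulr_ge0// lef_pV2 ?posrE ?ltr0n ?fact_gt0//.
    by rewrite ler_nat leq_fact// leq_subr.
  + move=> J; rewrite -mulr_sumr ler_wpM2l ?exprn_ge0 ?mulr_ge0//.
    by have := bsum_ecoef (rho * `|l|)%:C%C J; rewrite cmod_real (ger0_norm (mulr_ge0 rho0 (normr_ge0 l))).
- move=> s sr; have h := sums_exp (s * l%:C%C).
  have := @sums_finite _ _ (fun i => if (i < k)%N then s ^+ i * ((l ^+ i / (i`!)%:R)%:C%C) else 0) [fset i in iota 0 k]%fset.
  rewrite big_fset_iota big_mkord => h2.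
  have {}h2 := h2 _; rewrite (eq_bigr (fun i : 'I_k => s ^+ i * ((l ^+ i / (i`!)%:R)%:C%C))) in h2; last by move=> i _; rewrite ltn_ord.
  have {}h2 := sumsZ (-1) (h2 _); rewrite mulN1r in h2.
  apply: eq_sums (sumsD h (h2 _)) => [i|i]; last by rewrite mem_fset_iota => /negPf ->.
  by rewrite hl /F mulN1r; case: ltnP => _; rewrite ?subrr ?subr0.
Qed.

Definition ldif k (w s : C) : C := ndif k (fun j => lterm (w + j%:R) s) 0.

Lemma ldifS k w s : ldif k.+1 w s = ldif k w s - ldif k (w + 1) s.
Proof.
rewrite /ldif /=; congr (_ - _); rewrite -ndif_shift; apply: ndif_ext => j _.
by rewrite -natr1; congr lterm; ring.
Qed.

Lemma lterm_split (w : C) j : w != 0 ->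
  w + j%:R != 0 -> lnsq (w + j%:R) = lnsq w + ln (1 + ucs (complex.Re w / cmod w) (j%:R / cmod w)).
Proof.
move=> w0 wj0.
have c0 : 0 < cmod w by rewrite cmod_gt0.
have E : cmod (w + j%:R) ^+ 2 = cmod w ^+ 2 * (1 + ucs (complex.Re w / cmod w) (j%:R / cmod w)).
  have -> : cmod w ^+ 2 * (1 + ucs (complex.Re w / cmod w) (j%:R / cmod w)) =
     cmod w ^+ 2 + 2 * complex.Re w * j%:R + j%:R ^+ 2.
    by rewrite /ucs; field; rewrite gt_eqF.
  rewrite !cmod_sqr -(rmorph_nat (real_complex R)); case: (w) => a b /=; ring.
have p1 : 0 < cmod w ^+ 2 by rewrite exprn_gt0.
have p2 : 0 < cmod (w + j%:R) ^+ 2 by rewrite exprn_gt0// cmod_gt0.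
rewrite /lnsq E lnM// posrE; move: p2; rewrite E pmulr_rgt0//.
Qed.

Lemma ndif_C k (f : nat -> R) n : (ndif k f n)%:C%C = ndif k (fun j => (f j)%:C%C : C) n.
Proof. by elim: k n => [|k IH] n //=; rewrite rmorphB /= !IH. Qed.

(** Writing [|w + j|^(-2s)] as [|w|^(-2s) exp(-s v_j)] with [v_j = ln (1 + ucs c (j / |w|))], the
    exponential is expanded to order [k]. The differences of [v_j^i] are [O(|w|^-k)] by the jet
    estimate, and the tail is small because [v_j = O(1/|w|)]. The threshold [4 k + 1] gives
    [j / |w| <= 1/4] and keeps [w + j] away from 0. *)
Lemma ldif_big (s0 : C) (r : R) k : 0 < r -> exists K : R, forall w : C,
  4 * k%:R + 1 <= cmod w ->
  normal_series s0 r (ldif k w) (cmod (cexp (s0 * (- lnsq w)%:C%C)) * expR (r * `|lnsq w|) * (K / cmod w ^+ k)).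
Proof.
move=> r0; set rho := r + cmod s0.
have rho0 : 0 <= rho by rewrite addr_ge0 ?cmod_ge0// ltW.
have jets i : exists K : R, forall c e : R, `|c| <= 1 -> 0 <= e ->
  k%:R * e <= 4^-1 -> `|ndif k (fun j => ln (1 + ucs c (j%:R * e)) ^+ i) 0| <= K * e ^+ k.
  exact: (@ndif_jet R k (fun c t => ln (1 + ucs c t) ^+ i) (jet_iter i (jet_ln R k))).
have [K hK] := choice jets.
(* The first summand comes from the differences of the Taylor polynomial, the second from the
   exponential tail; [12] is the constant of [ln_ucs_le], and [3 = 12 / 4] bounds the logarithm
   itself. *)
exists (\sum_(i < k) rho ^+ i / (i`!)%:R * `|K i| + 2 ^+ k * ((rho * (12 * k%:R)) ^+ k * expR (rho * 3))).
move=> w wk.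
have c1 : 1 <= cmod w by apply: le_trans wk; rewrite lerDr mulr_ge0.
have c0 : 0 < cmod w by apply: lt_le_trans c1.
have w0 : w != 0 by rewrite -cmod_gt0.
pose e := (cmod w)^-1; pose c := complex.Re w / cmod w.
have hc : `|c| <= 1.
  by rewrite /c normrM normfV (gtr0_norm c0) ler_pdivrMr// mul1r cmod_Re.
have e0 : 0 <= e by rewrite invr_ge0 ltW.
have ke : k%:R * e <= 4^-1 by rewrite /e ler_pdivrMr// ler_pdivlMl//; lra.
have je j : (j <= k)%N -> 0 <= j%:R * e <= 4^-1.
  by move=> jk; rewrite mulr_ge0//=; apply: le_trans ke; rewrite ler_wpM2r// ler_nat.
pose v (j : nat) := ln (1 + ucs c (j%:R * e)).
have wj0 j : (j <= k)%N -> w + j%:R != 0.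
  move=> jk; rewrite -cmod_gt0; apply: lt_le_trans (cmod_geB _ _); rewrite subr_gt0 cmod_nat.
  apply: lt_le_trans wk; have : (j%:R : R) <= k%:R by rewrite ler_nat.
  have : (0 : R) <= k%:R by []. by lra.
pose P j s : C := \sum_(i < k) (- s) ^+ i * ((v j ^+ i / (i`!)%:R)%:C%C).
pose T j s : C := cexp (s * (- v j)%:C%C) - \sum_(i < k) s ^+ i * (((- v j) ^+ i / (i`!)%:R)%:C%C).
have E s : ldif k w s = lterm w s * (\sum_(i < k) (- s) ^+ i * ((ndif k (fun j => v j ^+ i) 0) / (i`!)%:R)%:C%C
     + ndif k (fun j => T j s) 0).
  have -> : \sum_(i < k) (- s) ^+ i * ((ndif k (fun j => v j ^+ i) 0) / (i`!)%:R)%:C%C = ndif k (fun j => P j s) 0.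
    rewrite /P ndif_sum; apply: eq_bigr => i _; rewrite ndifZ; congr (_ * _).
    rewrite rmorphM /= mulrC.
    have -> : ndif k (fun j => (v j ^+ i / (i`!)%:R)%:C%C : C) 0 = ndif k (fun j => ((i`!)%:R^-1)%:C%C * (v j ^+ i)%:C%C) 0.
      by apply: ndif_ext => j _; rewrite -rmorphM mulrC.
    rewrite ndifZ; congr (_ * _).
    exact: ndif_C.
  rewrite -ndifD -ndifZ; apply: ndif_ext => j jk.
  rewrite /lterm (negPf w0) (negPf (wj0 j jk)) (lterm_split w0 (wj0 j jk)).
  have -> : P j s + T j s = cexp (s * (- v j)%:C%C).
    rewrite /P /T addrC -addrA addrC [X in X + _](_ : _ = 0) ?add0r//.
    rewrite addrC; apply/eqP; rewrite subr_eq0; apply/eqP; apply: eq_bigr => i _.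
    by rewrite !rmorphM !rmorphXn rmorphN !mulrA -!exprMn mulNr mulrN.
  by rewrite -cexpD -mulrDr -rmorphD -opprD.
apply: (@normal_series_ext _ _ _ (fun s => lterm w s * (\sum_(i < k) (- s) ^+ i * ((ndif k (fun j => v j ^+ i) 0) / (i`!)%:R)%:C%C
     + ndif k (fun j => T j s) 0))) => [s _|]; first by rewrite E.
apply: normal_series_mul => //; first exact: normal_series_lterm.
rewrite mulrDl; apply: normal_series_add.
  rewrite mulr_suml.
  have : forall i : 'I_k, normal_series s0 r (fun s => (- s) ^+ i * ((ndif k (fun j => v j ^+ i) 0) / (i`!)%:R)%:C%C)
      (rho ^+ i / (i`!)%:R * `|K i| / cmod w ^+ k).
    move=> i.
    have h1 := normal_series_scale ((ndif k (fun j => v j ^+ i) 0) / (i`!)%:R)%:C%C (normal_series_iter i r0 (normal_series_opp (normal_series_var s0 r0))).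
    apply: normal_series_le (normal_series_ext _ h1) _ => [s _|]; first by rewrite mulrC.
    rewrite cmod_real normrM normfV normr_nat -/rho.
    have -> : rho ^+ i / (i`!)%:R * `|K i| / cmod w ^+ k = (`|K i| * e ^+ k) / (i`!)%:R * rho ^+ i.
      by rewrite /e exprVn; ring.
    rewrite ler_wpM2r ?exprn_ge0// ler_wpM2r ?invr_ge0//.
    apply: le_trans (hK i c e hc e0 ke) _.
    by rewrite ler_wpM2r ?exprn_ge0// ler_norm.
  elim: (index_enum _) => [|i l IH] hi.
    rewrite big_nil; have := normal_series_cst s0 r 0; rewrite cmod0.
    by apply: normal_series_ext => s _; rewrite big_nil.
  rewrite big_cons; apply: normal_series_ext (normal_series_add (hi i) (IH hi)) => s _; by rewrite big_cons.
rewrite -!mulrA; apply: ndif_wn => j jk; rewrite add0n in jk.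
have vj : `|v j| <= 12 * k%:R * e /\ `|v j| <= 3.
  have h : `|v j| <= 12 * (j%:R * e) by apply: ln_ucs_le => //; exact: je.
  split; first by apply: le_trans h _; rewrite -mulrA ler_wpM2l// ler_wpM2r// ler_nat.
  apply: le_trans h _; have := je j jk; lra.
apply: normal_series_le (normal_series_exp_tail s0 (- v j) k r0) _; rewrite -/rho normrN.
have -> : (rho * (12 * k%:R)) ^+ k * (expR (rho * 3) / cmod w ^+ k) = (rho * (12 * k%:R * e)) ^+ k * expR (rho * 3).
  by rewrite !exprMn /e exprVn; ring.
have [v1 v2] := vj.
apply: ler_pM; rewrite ?exprn_ge0 ?mulr_ge0 ?expR_ge0//.
  by rewrite lerXn2r ?nnegrE ?mulr_ge0// ler_wpM2l.
by rewrite ler_expR ler_wpM2l.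
Qed.

End LTerm.

(** * Alternating sums *)

Section GenericL.
Variable R : realType.
Local Notation C := R[i].
(** Two instances are intended: the lattice points [m z + n] and the integers [n], with shift
    [n + 1] and sign [(-1)^n]. The weight [mu] replaces [|pt|^2] in questions of convergence; for
    the lattice it is a product over the coordinates, so that its sums factor. *)
Variables (I : choiceType) (pt : I -> C) (sh : I -> I) (sgn : I -> C) (mu : I -> R) (c : R).
Hypothesis c0 : 0 < c.
Hypothesis pt_ge : forall i, pt i != 0 -> c <= cmod (pt i) ^+ 2.
Hypothesis pt_mu : forall i, c * mu i <= 1 + cmod (pt i) ^+ 2.
Hypothesis mu1 : forall i, 1 <= mu i.
Hypothesis mu_sum : forall e : R, 1 < e -> exists B, rbs (fun i => expR (- e * ln (mu i))) B.
Hypothesis sh_bij : bijective sh.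
Hypothesis pt_sh : forall i, pt (sh i) = pt i + 1.
Hypothesis sgn_sh : forall i, sgn (sh i) = - sgn i.
Hypothesis cmod_sgn : forall i, cmod (sgn i) = 1.

Lemma pt_shn i j : pt (iter j sh i) = pt i + j%:R.
Proof. by elim: j => [|j IH]; rewrite ?addr0//= pt_sh IH -natr1 addrA. Qed.

(** Far points obey the decay of [ldif_big], and there [|w|^2] is at least [c mu / 2]. At the
    remaining points [mu] is bounded, so a uniform bound for the terms, times a constant, dominates
    the same power of [mu]. *)
Lemma ldif_bound (s0 : C) (r : R) k : 0 < r -> 0 < complex.Re s0 - r + k%:R / 2 ->
  exists K, forall i, normal_series s0 r (ldif k (pt i))
    (K * expR (- (complex.Re s0 - r + k%:R / 2) * ln (mu i))).
Proof.
move=> r0; set e := complex.Re s0 - r + k%:R / 2 => e0.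
have [K hK] := ldif_big s0 k r0.
(* A point of modulus less than [4 k + 1], shifted by at most [k], stays within [B]. *)
pose B : R := 5 * k%:R + 1.
have B1 : 1 <= B by rewrite /B lerDr mulr_ge0.
have B2 : 0 < B ^+ 2 by rewrite exprn_gt0// (lt_le_trans _ B1).
pose M := (cmod s0 + r) * (`|ln c| + ln (B ^+ 2)).
pose K1 := `|K| * expR (- e * ln (c / 2)).
pose K2 := 2 ^+ k * expR M * expR (e * ln ((1 + B ^+ 2) / c)).
have K10 : 0 <= K1 by rewrite mulr_ge0 ?expR_ge0.
have K20 : 0 <= K2 by rewrite !mulr_ge0 ?expR_ge0 ?exprn_ge0.
exists (K1 + K2) => i.
have m0 : 0 < mu i by apply: lt_le_trans (mu1 i).
have [big|small] := leP (4 * k%:R + 1) (cmod (pt i)).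
  apply: normal_series_le (hK _ big) _.
  apply: le_trans (_ : _ <= K1 * expR (- e * ln (mu i))) _; last by rewrite ler_wpM2r ?expR_ge0// lerDl.
  have k0 : (0 : R) <= k%:R by [].
  have c1 : 1 <= cmod (pt i) by apply: le_trans big; rewrite lerDr mulr_ge0.
  have cp : 0 < cmod (pt i) by apply: lt_le_trans c1.
  have q0 : 0 < cmod (pt i) ^+ 2 by rewrite exprn_gt0.
  have lq0 : 0 <= lnsq (pt i) by rewrite /lnsq ln_ge0// exprn_ege1.
  rewrite cmod_cexp (ger0_norm lq0).
  have -> : complex.Re (s0 * (- lnsq (pt i))%:C%C) = - (complex.Re s0) * lnsq (pt i).
    by case: (s0) => a b /=; rewrite mulr0 subr0 mulrN mulNr.
  have kq : expR (k%:R / 2 * lnsq (pt i)) = cmod (pt i) ^+ k.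
    have -> : k%:R / 2 * lnsq (pt i) = k%:R * ln (cmod (pt i)).
      by rewrite /lnsq lnXn// -mulr_natr; field.
    by rewrite expRM_natl lnK.
  rewrite -expRD -kq -expRN mulrCA -expRD.
  apply: le_trans (_ : _ <= `|K| * expR (- e * lnsq (pt i))) _.
    have -> : - complex.Re s0 * lnsq (pt i) + r * lnsq (pt i) - k%:R / 2 * lnsq (pt i) = - e * lnsq (pt i).
      by rewrite /e; ring.
    by rewrite ler_wpM2r ?expR_ge0// ler_norm.
  rewrite /K1 -mulrA ler_wpM2l// -expRD ler_expR -mulrDr !mulNr lerN2 ler_wpM2l ?(ltW e0)//.
  rewrite -lnM ?posrE ?divr_gt0// /lnsq ler_ln ?posrE ?mulr_gt0 ?divr_gt0//.
  have q1 : 1 <= cmod (pt i) ^+ 2 by rewrite exprn_ege1.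
  have := pt_mu i; lra.
apply: (@normal_series_le _ _ _ _ (2 ^+ k * expR M)).
  apply: ndif_wn => j jk; rewrite add0n in jk.
  have [z|nz] := eqVneq (pt i + j%:R) 0.
    apply: (@normal_series_le _ _ _ _ 0); last exact: expR_ge0.
    have := normal_series_cst s0 r 0; rewrite cmod0; apply: normal_series_ext => s _.
    by rewrite /lterm z eqxx.
  apply: normal_series_le (normal_series_lterm s0 r0 nz) _.
  apply: le_trans (ler_wpM2r (expR_ge0 _) (cmod_cexp_le _ _)) _.
  rewrite -expRD ler_expR normrN -mulrDl ler_wpM2l ?addr_ge0 ?cmod_ge0 ?(ltW r0)//.
  have qc : c <= cmod (pt i + j%:R) ^+ 2 by rewrite -pt_shn; apply: pt_ge; rewrite pt_shn.
  have q0 : 0 < cmod (pt i + j%:R) ^+ 2 by apply: lt_le_trans qc.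
  have qB : cmod (pt i + j%:R) ^+ 2 <= B ^+ 2.
    rewrite lerXn2r ?nnegrE ?cmod_ge0 ?(le_trans ler01 B1)//.
    apply: le_trans (cmodD _ _) _; rewrite cmod_nat /B.
    have : (j%:R : R) <= k%:R by rewrite ler_nat.
    move: (ltW small); lra.
  have l1 : ln c <= lnsq (pt i + j%:R) by rewrite ler_ln ?posrE.
  have l2 : lnsq (pt i + j%:R) <= ln (B ^+ 2) by rewrite ler_ln ?posrE.
  have l3 : 0 <= ln (B ^+ 2) by rewrite ln_ge0// exprn_ege1.
  have l4 := ler_norm (- ln c); rewrite normrN in l4.
  rewrite ler_norml; apply/andP; split; [lra|].
  by have := normr_ge0 (ln c); lra.
apply: le_trans (_ : _ <= K2 * expR (- e * ln (mu i))) _; last by rewrite ler_wpM2r ?expR_ge0// lerDr.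
rewrite /K2 -mulrA ler_peMr ?mulr_ge0 ?expR_ge0 ?exprn_ge0//.
rewrite -expRD mulNr -mulrBr; apply: le_trans (expR_ge1Dx _); rewrite lerDl mulr_ge0 ?(ltW e0)//.
rewrite subr_ge0 ler_ln ?posrE ?divr_gt0//; last by rewrite ltr_wpDl// ler01.
rewrite ler_pdivlMr// mulrC; apply: le_trans (pt_mu i) _; rewrite lerD2l.
rewrite lerXn2r ?nnegrE ?cmod_ge0 ?(le_trans ler01 B1)//.
have k0 : (0 : R) <= k%:R by []. move: (ltW small); rewrite /B; lra.
Qed.

(* A shift by one reverses the sign, so the alternating sum of [f] equals [2^-k] times
   that of the [k]-th difference of [f], which converges absolutely for
   [Re s > 1 - k / 2]. *)
Definition Lk (k : nat) (s : C) : C :=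
  (2 ^+ k)^-1 * tsum (fun i => sgn i * ldif k (pt i) s).

Definition good (k : nat) (s : C) : Prop := 1 < complex.Re s + k%:R / 2.

Lemma goodS k s : good k s -> good k.+1 s.
Proof. by rewrite /good -[k.+1%:R]natr1; lra. Qed.

Lemma good_le k k' s : (k <= k')%N -> good k s -> good k' s.
Proof. by move=> /subnK <-; elim: (k' - k)%N => // n IH h; rewrite addSn; apply: goodS; apply: IH. Qed.

Lemma good_near k s0 : good k s0 -> exists r : R, 0 < r /\ 1 < complex.Re s0 - r + k%:R / 2.
Proof.
rewrite /good => h; exists ((complex.Re s0 + k%:R / 2 - 1) / 2); split; first by lra.
by lra.
Qed.

Lemma Lk_wn s0 r k : 0 < r -> 1 < complex.Re s0 - r + k%:R / 2 ->
  exists (M : I -> R) B, [/\ rbs M B, forall i, normal_series s0 r (fun s => sgn i * ldif k (pt i) s) (M i)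
    & forall s, cmod (s - s0) <= r -> summ (fun i => sgn i * ldif k (pt i) s)].
Proof.
move=> r0; set e := _ - _ + _ => e1.
have [K hK] := ldif_bound r0 (lt_trans ltr01 e1).
have [B hB] := mu_sum e1.
have hw i : normal_series s0 r (fun s => sgn i * ldif k (pt i) s) (`|K| * expR (- e * ln (mu i))).
  apply: normal_series_le (normal_series_scale (sgn i) (hK i)) _.
  by rewrite cmod_sgn mul1r ler_wpM2r ?expR_ge0// ler_norm.
have hr : rbs (fun i => `|K| * expR (- e * ln (mu i))) (`|K| * B).
  by move=> J; rewrite -mulr_sumr ler_wpM2l.
exists (fun i => `|K| * expR (- e * ln (mu i))), (`|K| * B); split=> // s sr.
exists (`|K| * B) => J; apply: le_trans (hr J); apply: ler_sum => i _.
by have := normal_series_bound r0 (hw i) sr.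
Qed.

Lemma Lk_summ k s : good k s -> summ (fun i => sgn i * ldif k (pt i) s).
Proof.
move=> /good_near[r [r0 h]]; have [M [B [_ _]]] := Lk_wn r0 h; apply.
by rewrite subrr cmod0 ltW.
Qed.

Lemma Lk_ana k s0 : good k s0 -> exists r B, 0 < r /\ normal_series s0 r (Lk k) B.
Proof.
move=> /good_near[r [r0 h]]; have [M [B [hM hw hs']]] := Lk_wn r0 h.
exists r, (cmod (2 ^+ k)^-1 * B); split=> //; apply: normal_series_scale.
apply: (normal_series_sum r0 hw hM) => s sr; exact/summ_hs/hs'.
Qed.

(** Reindexing by the shift turns the second half of the extra difference into another copy of the
    sum, because the sign is reversed. *)
Lemma LkS k s : good k s -> Lk k.+1 s = Lk k s.
Proof.
move=> gk; have sk := Lk_summ gk.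
have n2 : (2 : C) != 0 by rewrite pnatr_eq0.
rewrite /Lk; have -> : tsum (fun i => sgn i * ldif k.+1 (pt i) s) =
   tsum (fun i => sgn i * ldif k (pt i) s) + tsum (fun i => sgn i * ldif k (pt i) s).
  rewrite -[in X in _ = _ + X](tsum_reindex sh_bij sk) -tsumD//; last first.
    by apply: (@summ_inj _ _ _ _ (fun i => sgn i * ldif k (pt i) s)) => //; exact: bij_inj.
  by apply: eq_tsum => i; rewrite ldifS pt_sh sgn_sh; ring.
by rewrite exprS -mulr2n -mulr_natl; field.
Qed.

Lemma Lk_le k k' s : (k <= k')%N -> good k s -> Lk k' s = Lk k s.
Proof.
move=> /subnK <- gk; elim: (k' - k)%N => // n IH; rewrite addSn LkS//.
by apply: good_le gk; rewrite leq_addl.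
Qed.

(** A difference order large enough for convergence at [s]. It varies with [s], but the resulting
    value does not depend on it ([LfunE]), so that near any point a common order may be used. *)
Definition kof (s : C) : nat := (Num.trunc (2 * `|complex.Re s|)).+1.+2.

Lemma kof_good s : good (kof s) s.
Proof.
rewrite /good /kof.
have h : 2 * `|complex.Re s| < (Num.trunc (2 * `|complex.Re s|)).+1%:R.
  by apply: truncnS_gt.
have h2 := ler_norm (- complex.Re s); rewrite normrN in h2.
by move: h; set n := (Num.trunc _).+1 => h; rewrite -addn2 natrD; lra.
Qed.

Definition Lfun (s : C) : C := Lk (kof s) s.

Lemma LfunE k s : good k s -> Lfun s = Lk k s.
Proof.
move=> gk; have gs := kof_good s.
have [h|h] := leqP k (kof s); first by rewrite /Lfun (Lk_le h).
by rewrite /Lfun -(Lk_le (ltnW h)).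
Qed.

Lemma Lfun_ana s0 : analytic_at s0 Lfun.
Proof.
have gk : good (kof s0).+1 s0 by apply: goodS; apply: kof_good.
have [r [B [r0 h]]] := Lk_ana gk.
have g' : 0 < complex.Re s0 + (kof s0).+1%:R / 2 - 1 by move: gk; rewrite /good; lra.
pose r' := Num.min r ((complex.Re s0 + (kof s0).+1%:R / 2 - 1) / 2).
have r'0 : 0 < r' by rewrite lt_min r0 divr_gt0.
exists r', B; split=> //; apply: normal_series_ext (normal_series_shrink r'0 _ h); last by rewrite ge_min lexx.
move=> s; rewrite le_min => /andP[_ sr].
rewrite (@LfunE (kof s0).+1)// /good.
have := cmod_Re (s - s0); rewrite raddfB ler_norml /= => /andP[h1 _].
lra.
Qed.

Lemma Lfun_series s : 1 < complex.Re s ->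
  summ (fun i => sgn i * lterm (pt i) s) /\ Lfun s = tsum (fun i => sgn i * lterm (pt i) s).
Proof.
move=> s1; have g0 : good 0 s by rewrite /good mul0r addr0.
have E : (fun i => sgn i * ldif 0 (pt i) s) = (fun i => sgn i * lterm (pt i) s).
  by apply/funext => i; rewrite /ldif /= addr0.
split; first by rewrite -E; exact: Lk_summ.
by rewrite (LfunE g0) /Lk expr0 invr1 mul1r E.
Qed.

(* [- lnsq] is the derivative of [lterm] at [s = 0]. *)
Definition lval (w : C) : C := (w != 0)%:R.
Definition lder (w : C) : C := if w == 0 then 0 else (- lnsq w)%:C%C.

Lemma lterm_fo w : first_order (lterm w) (lval w) (lder w).
Proof.
rewrite /lval /lder; have [->|w0] := eqVneq w 0.
  by apply: first_order_ext (first_order_cst 0); exists 1; split=> // s _ _; rewrite /lterm eqxx.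
by apply: first_order_ext (first_order_exp (- lnsq w)); exists 1; split=> // s _ _; rewrite /lterm (negPf w0).
Qed.

Lemma ndif_fo k (f : nat -> C -> C) a b n : (forall j, first_order (f j) (a j) (b j)) ->
  first_order (fun s => ndif k (fun j => f j s) n) (ndif k a n) (ndif k b n).
Proof.
move=> h; elim: k n => [|k IH] n /=; first exact: h.
by apply: first_order_add => //; have := first_order_scale (-1) (IH n.+1); rewrite !mulN1r; apply: first_order_ext; exists 1; split=> // s _ _; rewrite mulN1r.
Qed.

(** The condition on [k] is that of absolute convergence at [s = 0]. Each term has a power-series
    bound [M i], so its quadratic remainder is at most [M i / r^2] times [|s|^2] and the expansions
    can be added; uniqueness identifies their coefficients with the explicit ones. *)
Lemma Lfun_fo k : (2 < k)%N ->
  [/\ summ (fun i => sgn i * ndif k (fun j => lval (pt i + j%:R)) 0),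
     summ (fun i => sgn i * ndif k (fun j => lder (pt i + j%:R)) 0) &
     first_order Lfun ((2 ^+ k)^-1 * tsum (fun i => sgn i * ndif k (fun j => lval (pt i + j%:R)) 0))
       ((2 ^+ k)^-1 * tsum (fun i => sgn i * ndif k (fun j => lder (pt i + j%:R)) 0))].
Proof.
move=> k3; have gk : good k 0.
  by rewrite /good; have : (3 : R) <= k%:R by [rewrite ler_nat]; rewrite /=; lra.
have [r [r0 h]] := good_near gk; have [M [B [hM hw hs']]] := Lk_wn r0 h.
have st i : exists a b : C, [/\ cmod a <= M i, cmod b <= M i / r,
    a = sgn i * ndif k (fun j => lval (pt i + j%:R)) 0,
    b = sgn i * ndif k (fun j => lder (pt i + j%:R)) 0 &
    forall s, cmod s <= r -> cmod (sgn i * ldif k (pt i) s - a - b * s) <= M i / r / r * cmod s ^+ 2].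
  have [v [hv e]] := normal_series_step r0 (hw i); have [w [hw' e']] := normal_series_step r0 hv.
  exists (sgn i * ldif k (pt i) 0), (v 0).
  have z0 : cmod (0 - 0 : C) <= r by rewrite subrr cmod0 ltW.
  have E s : cmod s <= r -> cmod (sgn i * ldif k (pt i) s - sgn i * ldif k (pt i) 0 - v 0 * s) <= M i / r / r * cmod s ^+ 2.
    move=> sr; have sr' : cmod (s - 0) <= r by rewrite subr0.
    rewrite e// e'// subr0.
    have -> : sgn i * ldif k (pt i) 0 + s * (v 0 + s * w s) - sgn i * ldif k (pt i) 0 - v 0 * s = s ^+ 2 * w s by ring.
    by rewrite cmodM cmodX mulrC ler_wpM2r ?exprn_ge0 ?cmod_ge0//; apply: normal_series_bound hw' sr'.
  have f1 : first_order (fun s => sgn i * ldif k (pt i) s) (sgn i * ldif k (pt i) 0) (v 0).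
    exists (M i / r / r), r; split=> // s _; rewrite subr0 => sr; exact/E/ltW.
  have f2 := first_order_scale (sgn i) (@ndif_fo k (fun j => lterm (pt i + j%:R)) _ _ 0%N (fun j => lterm_fo _)).
  have [e1 e2] := first_order_unique f1 f2.
  split=> //; first by have := normal_series_bound r0 (hw i) z0.
  by have := normal_series_bound r0 hv z0.
have Mr : rbs (fun i => M i / r) (B / r) by move=> J; rewrite -mulr_suml ler_wpM2r// invr_ge0 ltW.
have Mrr : rbs (fun i => M i / r / r) (B / r / r) by move=> J; rewrite -mulr_suml ler_wpM2r ?Mr// invr_ge0 ltW.
have s1 : summ (fun i => sgn i * ndif k (fun j => lval (pt i + j%:R)) 0).
  exists B => J; apply: le_trans (hM J); apply: ler_sum => i _.
  by have [a [b [h1 _ <- _ _]]] := st i.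
have s2 : summ (fun i => sgn i * ndif k (fun j => lder (pt i + j%:R)) 0).
  exists (B / r) => J; apply: le_trans (Mr J); apply: ler_sum => i _.
  by have [a [b [_ h1 _ <- _]]] := st i.
split=> //.
suff H : first_order (fun s => (2 ^+ k)^-1 * tsum (fun i => sgn i * ldif k (pt i) s))
   ((2 ^+ k)^-1 * tsum (fun i => sgn i * ndif k (fun j => lval (pt i + j%:R)) 0))
   ((2 ^+ k)^-1 * tsum (fun i => sgn i * ndif k (fun j => lder (pt i + j%:R)) 0)).
  apply: first_order_ext H; exists r; split=> // s _; rewrite subr0 => sr.
  rewrite (@LfunE k)// /good; have := cmod_Re s; rewrite ler_norml => /andP[h1 _].
  by move: h; rewrite raddf0; lra.
apply: first_order_scale; exists (B / r / r), r; split=> // s _; rewrite subr0 => sr.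
have sl : summ (fun i => sgn i * ldif k (pt i) s) by apply: hs'; rewrite subr0 ltW.
have := sumsD (sumsD (summ_hs sl) (sumsZ (-1) (summ_hs s1))) (sumsZ (- s) (summ_hs s2)).
set S0 := tsum _; set S1 := tsum _; set S2 := tsum _ => hh.
have -> : S0 - S1 - S2 * s = S0 + -1 * S1 + - s * S2 by ring.
apply: sums_tail hh => J; apply: le_trans (_ : _ <= \sum_(i <- J) M i / r / r * cmod s ^+ 2) _; last first.
  by rewrite -mulr_suml ler_wpM2r ?exprn_ge0 ?cmod_ge0.
apply: ler_sum => i _; have [a [b [_ _ <- <- h5]]] := st i.
apply: le_trans (h5 s (ltW sr)).
by rewrite mulN1r mulNr [s * b]mulrC.
Qed.

End GenericL.

(** * Sums over lattices and integers, and their parity relations *)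

Section LatticeSums.
Variable R : realType.
Local Notation C := R[i].

Lemma cmod_int (n : int) : cmod (n%:~R : C) = `|n%:~R|.
Proof. by rewrite -(rmorph_int (real_complex R)) cmod_real. Qed.

(** Integral test in telescoping form: each term is at most the decrease of [x^(1 - e) / (e - 1)]
    over a unit step, by [1 + u <= exp u] and [1/b <= ln b - ln a]. *)
Lemma nat_pow_sum (e : R) : 1 < e -> rbs (fun n : nat => expR (- e * ln (1 + n%:R))) (1 + (e - 1)^-1).
Proof.
move=> e1; have e0 : 0 < e - 1 by rewrite subr_gt0.
apply: rbs_nat => [n|]; first exact: expR_ge0.
case=> [|N]; first by rewrite big_nil addr_ge0// invr_ge0 ltW.
suff H : \sum_(0 <= i < N.+1) expR (- e * ln (1 + i%:R)) <= 1 + (1 - expR (- (e - 1) * ln (1 + N%:R))) / (e - 1).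
  apply: le_trans H _; rewrite lerD2l mulrBl lerBlDr mul1r lerDl mulr_ge0 ?expR_ge0// invr_ge0 ltW//.
elim: N => [|N IH].
  by rewrite big_nat1 addr0 ln1 !mulr0 expR0 subrr mul0r addr0.
rewrite big_nat_recr//=; apply: le_trans (lerD IH (lexx _)) _.
rewrite -addrA lerD2l -lerBrDl -mulrBl ler_pdivlMr//.
have a0 : 0 < 1 + N%:R :> R by rewrite ltr_wpDr.
have b0 : 0 < 1 + N.+1%:R :> R by rewrite ltr_wpDr.
set a := 1 + N%:R in a0 *; set b := 1 + N.+1%:R in b0 *.
have ba : b = a + 1 by rewrite /a /b -natr1; ring.
have -> : expR (- (e - 1) * ln a) = expR (- (e - 1) * ln b) * expR ((e - 1) * (ln b - ln a)).
  by rewrite -expRD; congr expR; ring.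
have l1 : b^-1 <= ln b - ln a.
  have h : -1 < a / b - 1 by rewrite ltrBrDr addNr divr_gt0.
  have := le_ln1Dx h; rewrite addrC subrK ln_div ?posrE//.
  have -> : a / b - 1 = - b^-1 by rewrite ba; field; rewrite -ba gt_eqF.
  by lra.
have -> : expR (- e * ln b) = expR (- (e - 1) * ln b) * b^-1.
  have -> : b^-1 = expR (- ln b) by rewrite expRN lnK.
  by rewrite -expRD; congr expR; ring.
have X0 := expR_gt0 (- (e - 1) * ln b); set X := expR _ in X0 *.
have h2 : 1 + (e - 1) * b^-1 <= expR ((e - 1) * (ln b - ln a)).
  by apply: le_trans (expR_ge1Dx _); rewrite lerD2l ler_pM2l.
have := ler_wpM2l (ltW X0) h2; rewrite mulrDr mulr1.
have -> : X / b * (e - 1) = X * ((e - 1) / b) by ring.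
move: (X * _) (X * _) => u v; lra.
Qed.

Lemma rbsD (I : choiceType) (f g : I -> R) M N : rbs f M -> rbs g N -> rbs (fun i => f i + g i) (M + N).
Proof. by move=> h k J; rewrite big_split lerD. Qed.

Lemma rbs_int (g : nat -> R) M : (forall n, 0 <= g n) -> rbs g M -> rbs (fun n : int => g `|n|%N) (M + M).
Proof.
move=> g0 h.
pose f1 (n : int) := if 0 <= n then g `|n|%N else 0.
pose f2 (n : int) := if 0 <= n then 0 else g `|n|%N.
have -> : (fun n : int => g `|n|%N) = (fun n => f1 n + f2 n).
  by apply/funext => n; rewrite /f1 /f2; case: ifP; rewrite ?addr0 ?add0r.
apply: rbsD.
  apply: (@rbs_comp _ _ _ _ g (fun n : int => `|n|%N)) => //.
    move=> m n; rewrite /f1; case: ifP => m0; rewrite ?ltxx//; case: ifP => n0; rewrite ?ltxx// => _ _ e.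
    by rewrite -(gez0_abs m0) -(gez0_abs n0) e.
  by move=> n; rewrite /f1; case: ifP.
apply: (@rbs_comp _ _ _ _ g (fun n : int => `|n|%N)) => //.
  move=> m n; rewrite /f2; case: ifP => m0; rewrite ?ltxx//; case: ifP => n0; rewrite ?ltxx// => _ _ e.
  have m1 : m <= 0 by lia.
  have n1 : n <= 0 by lia.
  by apply: oppr_inj; rewrite -(lez0_abs m1) -(lez0_abs n1) e.
by move=> n; rewrite /f2; case: ifP.
Qed.

Lemma absz_sqr (k : int) : (`|k|%N)%:R ^+ 2 = k%:~R ^+ 2 :> R.
Proof. by rewrite natr_absz intr_norm real_normK// num_real. Qed.

Definition wt (n : int) : R := 1 + (`|n|%N)%:R.

Lemma wt1 n : 1 <= wt n.
Proof. by rewrite /wt lerDl. Qed.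

Lemma wt_sum (e : R) : 1 < e -> exists B, rbs (fun n => expR (- e * ln (wt n))) B.
Proof.
move=> e1; eexists; apply: (@rbs_int (fun n : nat => expR (- e * ln (1 + n%:R)))).
  by move=> n; apply: expR_ge0.
exact: nat_pow_sum.
Qed.

Lemma wt2_sum (e : R) : 1 < e ->
  exists B, rbs (fun p : int * int => expR (- e * ln (wt p.1 * wt p.2))) B.
Proof.
move=> e1; have [B hB] := wt_sum e1.
exists (B * B).
have -> : (fun p : int * int => expR (- e * ln (wt p.1 * wt p.2))) =
    (fun p => expR (- e * ln (wt p.1)) * expR (- e * ln (wt p.2))).
  apply/funext => p; rewrite lnM ?posrE ?(lt_le_trans ltr01 (wt1 _))//.
  by rewrite mulrDr expRD.
apply: (@rbs_pair _ _ _ (fun i j => expR (- e * ln (wt i)) * expR (- e * ln (wt j)))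
   (fun i => expR (- e * ln (wt i)) * B)).
- by move=> i j; rewrite mulr_ge0 ?expR_ge0.
- by move=> i J; rewrite -mulr_sumr ler_wpM2l ?expR_ge0.
- move=> J; rewrite -mulr_suml ler_wpM2r//; apply: le_trans (hB fset0); by rewrite big_seq_fset0.
Qed.

Definition sg (n : int) : C := (-1) ^ n.

Lemma N1_neq0 : (-1 : C) != 0.
Proof. by rewrite oppr_eq0 oner_eq0. Qed.

Lemma sgD m n : sg (m + n) = sg m * sg n.
Proof. by rewrite /sg expfzDr// N1_neq0. Qed.

Lemma sg1 n : sg (n + 1) = - sg n.
Proof. by rewrite sgD /sg expr1z mulrN1. Qed.

Lemma sg_even n : sg (2 * n) = 1.
Proof. by rewrite /sg -exprz_exp; have -> : (-1 : C) ^ 2 = 1; [rewrite -exprnP sqrrN expr1n|rewrite exp1rz]. Qed.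

Lemma sg_odd n : sg (2 * n + 1) = -1.
Proof. by rewrite sg1 sg_even. Qed.

Lemma cmod_sg n : cmod (sg n) = 1.
Proof.
by case: n => n; rewrite /sg /exprz ?cmodV cmodX cmodN cmod1 expr1n ?invr1.
Qed.

Lemma int_parity (n : int) : (exists k, n = 2 * k) \/ (exists k, n = 2 * k + 1).
Proof.
have h := divz_eq n 2; have p := ltz_pmod n (isT : 0 < 2 :> int); have q := modz_ge0 n (isT : (2 : int) != 0).
have [e|e] : (n %% 2)%Z = 0 \/ (n %% 2)%Z = 1 by move: p q; lia.
- by left; exists (n %/ 2)%Z; rewrite {1}h e addr0 mulrC.
- by right; exists (n %/ 2)%Z; rewrite {1}h e mulrC.
Qed.

Section Lattice.
Variable z : C.
Hypothesis hz : 0 < complex.Im z.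

Definition lat_pt (p : int * int) : C := p.1%:~R * z + p.2%:~R.
Definition lsh (p : int * int) : int * int := (p.1, p.2 + 1).

Lemma lat_pt_bound : exists2 c : R, 0 < c &
  (forall p, lat_pt p != 0 -> c <= cmod (lat_pt p) ^+ 2) /\
  (forall p, c * (wt p.1 * wt p.2) <= 1 + cmod (lat_pt p) ^+ 2).
Proof.
have hz' := hz; set x := complex.Re z; set y := complex.Im z in hz' *.
(* From [n^2 <= 2 (m x + n)^2 + 2 x^2 m^2] and [m^2 <= |m z + n|^2 / y^2], this [D] gives
   [m^2 + n^2 <= D |m z + n|^2]. *)
pose D := 2 + (2 * x ^+ 2 + 1) / y ^+ 2.
have y2 : 0 < y ^+ 2 by rewrite exprn_gt0.
have D2 : 2 <= D by rewrite lerDl divr_ge0 ?(ltW y2)// addr_ge0// mulr_ge0// sqr_ge0.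
have D0 : 0 < D by apply: lt_le_trans D2.
have key (p : int * int) : (p.1%:~R ^+ 2 + p.2%:~R ^+ 2 : R) <= D * cmod (lat_pt p) ^+ 2.
  case: p => m n /=; rewrite cmod_sqr /lat_pt /= -!(rmorph_int (real_complex R)).
  have -> : complex.Re ((m%:~R)%:C%C * z + (n%:~R)%:C%C) = m%:~R * x + n%:~R :> R.
    by rewrite /x; case: (z) => a b /=; rewrite mul0r subr0.
  have -> : complex.Im ((m%:~R)%:C%C * z + (n%:~R)%:C%C) = m%:~R * y :> R.
    by rewrite /y; case: (z) => a b /=; rewrite mul0r !addr0.
  set M := m%:~R : R; set K := n%:~R : R.
  have -> : D * ((M * x + K) ^+ 2 + (M * y) ^+ 2) =
     2 * (M * x + K) ^+ 2 + 2 * (M * y) ^+ 2 + (2 * x ^+ 2 + 1) / y ^+ 2 * (M * x + K) ^+ 2 + (2 * x ^+ 2 + 1) * M ^+ 2.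
    by rewrite /D; field; rewrite gt_eqF.
  have h1 : 0 <= (2 * x ^+ 2 + 1) / y ^+ 2 * (M * x + K) ^+ 2.
    by rewrite mulr_ge0 ?sqr_ge0// divr_ge0 ?(ltW y2)// addr_ge0// mulr_ge0// sqr_ge0.
  have h2 := sqr_ge0 (M * y); have h3 := sqr_ge0 (2 * M * x + K).
  have : K ^+ 2 <= 2 * (M * x + K) ^+ 2 + 2 * x ^+ 2 * M ^+ 2 by rewrite -subr_ge0; apply: le_trans h3 _; rewrite le_eqVlt; apply/orP; left; apply/eqP; ring.
  by move: h1 h2; nra.
have int1 (m : int) : m != 0 -> 1 <= m%:~R ^+ 2 :> R.
  by move=> m0; rewrite -rmorphXn /= -[1]/(1%:~R) ler_int; nia.
exists D^-1; first by rewrite invr_gt0.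
split=> -[m n].
  move=> nz; rewrite -[D^-1]mulr1 ler_pdivrMl//; apply: le_trans (key (m, n)) => /=.
  have [m0|m0] := eqVneq m 0; last by apply: ler_wpDr; [exact: sqr_ge0|exact: int1].
  have [n0|n0] := eqVneq n 0; last by apply: ler_wpDl; [exact: sqr_ge0|exact: int1].
  by move: nz; rewrite /lat_pt m0 n0 mul0r addr0 eqxx.
rewrite ler_pdivrMl//=; apply: le_trans (_ : _ <= 2 + (m%:~R ^+ 2 + n%:~R ^+ 2)) _; last first.
  by rewrite mulrDr mulr1; apply: lerD => //; exact: (key (m, n)).
rewrite -!absz_sqr /wt; move: ((`|m|%N)%:R : R) ((`|n|%N)%:R : R) => a b.
have := sqr_ge0 (a - 1); have := sqr_ge0 (b - 1); have := sqr_ge0 (a - b); nra.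
Qed.

Lemma wt2_1 p : 1 <= wt p.1 * wt p.2.
Proof. by rewrite -[1]mulr1 ler_pM// wt1. Qed.

Lemma lsh_bij : bijective lsh.
Proof. by exists (fun p => (p.1, p.2 - 1)) => -[m n]; rewrite /lsh /= ?addrK ?subrK. Qed.

Lemma lat_pt_sh p : lat_pt (lsh p) = lat_pt p + 1.
Proof. by rewrite /lat_pt /lsh /= intrD addrA. Qed.

Definition lat_eta : C -> C := Lfun lat_pt (fun p => sg p.2).

Lemma lat_eta_ana s0 : analytic_at s0 lat_eta.
Proof.
have [c c0 [h1 h2]] := lat_pt_bound.
apply: (Lfun_ana c0 h1 h2 wt2_1 wt2_sum lsh_bij lat_pt_sh) => p; [exact: sg1|exact: cmod_sg].
Qed.

Lemma lat_eta_series s : 1 < complex.Re s ->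
  summ (fun p => sg p.2 * lterm (lat_pt p) s) /\ lat_eta s = tsum (fun p => sg p.2 * lterm (lat_pt p) s).
Proof.
have [c c0 [h1 h2]] := lat_pt_bound.
apply: (Lfun_series c0 h1 h2 wt2_1 wt2_sum lsh_bij lat_pt_sh) => p; [exact: sg1|exact: cmod_sg].
Qed.

Lemma lat_eta_fo k : (2 < k)%N ->
  [/\ summ (fun p => sg p.2 * ndif k (fun j => lval (lat_pt p + j%:R)) 0),
     summ (fun p => sg p.2 * ndif k (fun j => lder (lat_pt p + j%:R)) 0) &
     first_order lat_eta ((2 ^+ k)^-1 * tsum (fun p => sg p.2 * ndif k (fun j => lval (lat_pt p + j%:R)) 0))
       ((2 ^+ k)^-1 * tsum (fun p => sg p.2 * ndif k (fun j => lder (lat_pt p + j%:R)) 0))].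
Proof.
have [c c0 [h1 h2]] := lat_pt_bound.
apply: (Lfun_fo c0 h1 h2 wt2_1 wt2_sum lsh_bij lat_pt_sh) => p; [exact: sg1|exact: cmod_sg].
Qed.

Lemma lterm_summ s : 1 < complex.Re s -> summ (fun p => lterm (lat_pt p) s).
Proof.
move=> /lat_eta_series[h _]; apply: summ_mono h _ => p.
by rewrite cmodM cmod_sg mul1r.
Qed.

(** The Epstein zeta function; the origin contributes 0 through [lterm]. *)
Definition lat_zeta (s : C) : C := tsum (fun p => lterm (lat_pt p) s).

End Lattice.

Definition int_pt (n : int) : C := n%:~R.

Lemma int_pt_bound : (forall n, int_pt n != 0 -> 2^-1 <= cmod (int_pt n) ^+ 2) /\
  (forall n, 2^-1 * wt n <= 1 + cmod (int_pt n) ^+ 2).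
Proof.
have ab (k : int) : cmod (int_pt k) ^+ 2 = (`|k|%N)%:R ^+ 2 :> R.
  by rewrite /int_pt cmod_int real_normK ?num_real// absz_sqr.
split=> n; rewrite ab /wt.
  rewrite /int_pt intr_eq0 => n0; apply: le_trans (_ : _ <= 1) _; first by lra.
  by rewrite exprn_ege1// ler1n absz_gt0.
by have := sqr_ge0 ((`|n|%N)%:R - 1 : R); move: (_%:R) => a; nra.
Qed.

Lemma ish_bij : bijective (fun n : int => n + 1).
Proof. by exists (fun n => n - 1) => n; rewrite ?addrK ?subrK. Qed.

Lemma int_pt_sh n : int_pt (n + 1) = int_pt n + 1.
Proof. by rewrite /int_pt intrD. Qed.

Definition int_eta : C -> C := Lfun int_pt sg.

Lemma half_gt0 : 0 < 2^-1 :> R. Proof. by rewrite invr_gt0. Qed.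

Lemma int_eta_ana s0 : analytic_at s0 int_eta.
Proof.
have [h1 h2] := int_pt_bound.
apply: (Lfun_ana half_gt0 h1 h2 wt1 wt_sum ish_bij int_pt_sh) => p; [exact: sg1|exact: cmod_sg].
Qed.

Lemma int_eta_series s : 1 < complex.Re s ->
  summ (fun n => sg n * lterm (int_pt n) s) /\ int_eta s = tsum (fun n => sg n * lterm (int_pt n) s).
Proof.
have [h1 h2] := int_pt_bound.
apply: (Lfun_series half_gt0 h1 h2 wt1 wt_sum ish_bij int_pt_sh) => p; [exact: sg1|exact: cmod_sg].
Qed.

Lemma int_eta_fo k : (2 < k)%N ->
  [/\ summ (fun n => sg n * ndif k (fun j => lval (int_pt n + j%:R)) 0),
     summ (fun n => sg n * ndif k (fun j => lder (int_pt n + j%:R)) 0) &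
     first_order int_eta ((2 ^+ k)^-1 * tsum (fun n => sg n * ndif k (fun j => lval (int_pt n + j%:R)) 0))
       ((2 ^+ k)^-1 * tsum (fun n => sg n * ndif k (fun j => lder (int_pt n + j%:R)) 0))].
Proof.
have [h1 h2] := int_pt_bound.
apply: (Lfun_fo half_gt0 h1 h2 wt1 wt_sum ish_bij int_pt_sh) => p; [exact: sg1|exact: cmod_sg].
Qed.

Lemma iterm_summ s : 1 < complex.Re s -> summ (fun n => lterm (int_pt n) s).
Proof.
move=> /int_eta_series[h _]; apply: summ_mono h _ => p.
by rewrite cmodM cmod_sg mul1r.
Qed.

(** Both signs are summed, so this is twice the Riemann zeta function at [2 s]. *)
Definition int_zeta (s : C) : C := tsum (fun n => lterm (int_pt n) s).

Lemma lterm_scale (a w s : C) : a != 0 -> lterm (a * w) s = cexp (s * (- lnsq a)%:C%C) * lterm w s.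
Proof.
move=> a0; rewrite /lterm mulf_eq0 (negPf a0) /=; case: eqVneq => w0; first by rewrite mulr0.
rewrite -cexpD -mulrDr -rmorphD; congr (cexp (_ * _%:C%C)).
by rewrite /lnsq cmodM exprMn lnM ?posrE ?exprn_gt0 ?cmod_gt0//; ring.
Qed.

Lemma lq_nat n : lnsq (n%:R : C) = ln (n%:R ^+ 2).
Proof. by rewrite /lnsq cmod_nat. Qed.

(** [1 + (-1)^n] is 2 at even [n] and 0 at odd [n], and the even integers rescale by 2. *)
Lemma int_zeta_G1 s : 1 < complex.Re s -> int_zeta s + int_eta s = 2 * cexp (s * (- lnsq 2%:R)%:C%C) * int_zeta s.
Proof.
move=> s1; have [sG ->] := int_eta_series s1; have sZ := iterm_summ s1.
rewrite -tsumD//; apply: tsumE.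
apply: (@sums_embed _ _ _ (fun n : int => 2 * n) (fun n => 2 * cexp (s * (- lnsq 2%:R)%:C%C) * lterm (int_pt n) s)).
- by move=> m n /= h; apply: (@mulfI _ 2%:Z) h.
- exact: summZ.
- move=> n; rewrite sg_even mul1r -[RHS]mulrA -lterm_scale ?pnatr_eq0//.
  have -> : int_pt (2 * n) = 2 * int_pt n by rewrite /int_pt intrM.
  by rewrite [RHS]mulr_natl mulr2n.
- move=> k hk; have [[j e]|[j ->]] := int_parity k; first by have := hk j; rewrite e eqxx.
  by rewrite sg_odd mulN1r subrr.
- exact/sumsZ/summ_hs.
Qed.

Lemma inv_im (z : C) : 0 < complex.Im z -> 0 < complex.Im (- z^-1).
Proof.
case: z => a b /= b0.
by rewrite opprK divr_gt0// ltr_wpDl ?sqr_ge0// exprn_gt0.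
Qed.

Lemma im_neq0 (z : C) : 0 < complex.Im z -> z != 0.
Proof. by apply: contraTneq => ->; rewrite ltxx. Qed.

(** Only the points [2 m z + n] with [n] even survive, and these are [2 (m z + n/2)]. The relation
    connects [z] with [2 z] alone, which later gives access to the derivative at 0. *)
Lemma lat_zeta_dup (z s : C) : 0 < complex.Im z -> 1 < complex.Re s ->
  lat_zeta (2 * z) s + lat_eta (2 * z) s = 2 * cexp (s * (- lnsq 2%:R)%:C%C) * lat_zeta z s.
Proof.
move=> hz s1.
have hz2 : 0 < complex.Im (2 * z) by rewrite mulr_natl mulr2n raddfD addr_gt0.
have [sL ->] := lat_eta_series hz2 s1; have sZ := lterm_summ hz2 s1; have sZ' := lterm_summ hz s1.
rewrite -tsumD//; apply: tsumE.
apply: (@sums_embed _ _ _ (fun p : int * int => (p.1, 2 * p.2)) (fun p => 2 * cexp (s * (- lnsq 2%:R)%:C%C) * lterm (lat_pt z p) s)).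
- by move=> [m n] [m' n'] /= [-> h]; congr pair; apply: (@mulfI _ 2%:Z) h.
- exact: summZ.
- move=> [m n] /=; rewrite sg_even mul1r -[RHS]mulrA -lterm_scale ?pnatr_eq0//.
  have -> : lat_pt (2 * z) (m, 2 * n) = 2 * lat_pt z (m, n).
    by rewrite /lat_pt /= intrM mulrDr mulrCA.
  by rewrite [RHS]mulr_natl mulr2n.
- move=> [m k] hk /=; have [[j e]|[j ->]] := int_parity k; first by have := hk (m, j); rewrite e eqxx.
  by rewrite sg_odd mulN1r subrr.
- exact/sumsZ/summ_hs.
Qed.

Lemma swap_bij : bijective (fun p : int * int => (p.2, - p.1)).
Proof. by exists (fun p : int * int => (- p.2, p.1)) => -[m n] /=; rewrite opprK. Qed.

Lemma lat_pt_inv (z : C) p : z != 0 -> lat_pt (- z^-1) p = z^-1 * lat_pt z (p.2, - p.1).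
Proof. by move=> z0; rewrite /lat_pt /= intrN; field. Qed.

Lemma lat_zeta_inv (z s : C) : 0 < complex.Im z -> 1 < complex.Re s ->
  lat_zeta (- z^-1) s = cexp (s * (lnsq z)%:C%C) * lat_zeta z s.
Proof.
move=> hz s1; have z0 := im_neq0 hz; have sZ := lterm_summ hz s1.
rewrite /lat_zeta -[in RHS](tsum_reindex swap_bij sZ) -tsumZ; last first.
  by apply: (@summ_inj _ _ _ _ (fun p => lterm (lat_pt z p) s)) sZ; exact: bij_inj swap_bij.
apply: eq_tsum => p; rewrite lat_pt_inv// lterm_scale ?invr_eq0//; congr (cexp (_ * _%:C%C) * _).
by rewrite /lnsq cmodV exprVn lnV ?opprK// posrE exprn_gt0// cmod_gt0.
Qed.

Lemma lat_eta_inv (z s : C) : 0 < complex.Im z -> 1 < complex.Re s ->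
  lat_eta (- z^-1) s = cexp (s * (lnsq z)%:C%C) * tsum (fun p => sg p.1 * lterm (lat_pt z p) s).
Proof.
move=> hz s1; have z0 := im_neq0 hz; have sZ := lterm_summ hz s1.
have sZ1 : summ (fun p => sg p.1 * lterm (lat_pt z p) s).
  by apply: summ_mono sZ _ => p; rewrite cmodM cmod_sg mul1r.
have [_ ->] := lat_eta_series (inv_im hz) s1.
rewrite -[in RHS](tsum_reindex swap_bij sZ1) -tsumZ; last first.
  by apply: (@summ_inj _ _ _ _ (fun p => sg p.1 * lterm (lat_pt z p) s)) sZ1; exact: bij_inj swap_bij.
apply: eq_tsum => p; rewrite lat_pt_inv// lterm_scale ?invr_eq0//= mulrCA; congr (cexp (_ * _%:C%C) * _).
by rewrite /lnsq cmodV exprVn lnV ?opprK// posrE exprn_gt0// cmod_gt0.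
Qed.

Lemma shear_bij : bijective (fun p : int * int => (p.1, p.2 - p.1)).
Proof. by exists (fun p : int * int => (p.1, p.2 + p.1)) => -[m n] /=; rewrite ?addrK ?subrK. Qed.

Lemma shear1_im (z : C) : 0 < complex.Im z -> 0 < complex.Im (z + 1).
Proof. by case: z => a b /=; rewrite addr0. Qed.

Lemma sgN n : sg (- n) = sg n.
Proof.
have := sgD n (- n); rewrite subrr /sg expr0z => h.
have : sg n * sg n = 1 by rewrite -sgD -[n + n]mulr2n -mulr_natl; exact: sg_even.
by move=> e; apply: (@mulfI _ (sg n)); rewrite ?e// -cmod_eq0 cmod_sg oner_eq0.
Qed.

Lemma lat_eta_shear (z s : C) : 0 < complex.Im z -> 1 < complex.Re s ->
  lat_eta (z + 1) s = tsum (fun p => sg p.1 * sg p.2 * lterm (lat_pt z p) s).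
Proof.
move=> hz s1; have sZ := lterm_summ hz s1.
have [sL ->] := lat_eta_series (shear1_im hz) s1.
rewrite -[LHS](tsum_reindex shear_bij sL); apply: eq_tsum => -[m n] /=.
rewrite sgD sgN [sg n * _]mulrC; congr (_ * lterm _ _).
by rewrite /lat_pt /= intrD intrN; ring.
Qed.

(** The characters [1], [(-1)^n], [(-1)^(m+n)] and [(-1)^m] of the lattice modulo 2 sum to 4 on the
    doubled lattice and to 0 elsewhere; the last two are the alternating sums for [z + 1] and, up to
    a power of [|z|], for [-1/z]. *)
Lemma lat_zeta_three (z s : C) : 0 < complex.Im z -> 1 < complex.Re s ->
  lat_zeta z s + lat_eta z s + lat_eta (z + 1) s + cexp (s * (- lnsq z)%:C%C) * lat_eta (- z^-1) s
   = 4 * cexp (s * (- lnsq 2%:R)%:C%C) * lat_zeta z s.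
Proof.
move=> hz s1; rewrite lat_eta_shear// lat_eta_inv// mulrA -cexpD -mulrDr -rmorphD addNr mulr0 cexp0 mul1r.
have [sL ->] := lat_eta_series hz s1; have sZ := lterm_summ hz s1.
have sZ1 : summ (fun p => sg p.1 * lterm (lat_pt z p) s).
  by apply: summ_mono sZ _ => p; rewrite cmodM cmod_sg mul1r.
have sZ2 : summ (fun p => sg p.1 * sg p.2 * lterm (lat_pt z p) s).
  by apply: summ_mono sZ _ => p; rewrite !cmodM !cmod_sg !mul1r.
have a1 := summD sZ sL; have a2 := summD a1 sZ2.
rewrite -!tsumD//; apply: tsumE.
apply: (@sums_embed _ _ _ (fun p : int * int => (2 * p.1, 2 * p.2)) (fun p => 4 * cexp (s * (- lnsq 2%:R)%:C%C) * lterm (lat_pt z p) s)).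
- by move=> [m n] [m' n'] /= [h h']; congr pair; [apply: (@mulfI _ 2%:Z) h|apply: (@mulfI _ 2%:Z) h'].
- exact: summZ.
- move=> [m n] /=; rewrite !sg_even !mul1r -[RHS]mulrA -lterm_scale ?pnatr_eq0//.
  have -> : lat_pt z (2 * m, 2 * n) = 2 * lat_pt z (m, n).
    by rewrite /lat_pt /= !intrM mulrDr mulrA.
  ring.
- move=> [m n] hk /=; have [[i e1]|[i e1]] := int_parity m; have [[j e2]|[j e2]] := int_parity n; rewrite ?e1 ?e2 ?sg_odd ?sg_even; try ring.
  by have := hk (i, j); rewrite /= e1 e2 eqxx.
- exact/sumsZ/summ_hs.
Qed.

Lemma cmod_pow2 (s : C) : 1 < complex.Re s -> cmod (cexp (s * (- lnsq 2%:R)%:C%C)) < 4^-1.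
Proof.
move=> s1; rewrite cmod_cexp lq_nat.
have -> : complex.Re (s * (- ln (2%:R ^+ 2))%:C%C) = - (complex.Re s * ln 4).
  by case: (s) => a b /=; rewrite mulr0 subr0 mulrN -natrX.
have l4 : 0 < ln (4 : R) by rewrite ln_gt0// ltr1n.
rewrite -[ltRHS]lnK ?posrE ?invr_gt0// ltr_expR lnV ?posrE// ltrN2.
by rewrite ltr_pMl.
Qed.

(** The terms at 1 and -1 give 2, the others together at most [3/2]: each has modulus at most
    [n^-2], and the sum of [n^-2] over [n >= 2] is at most [1/4 + 1/2], telescoping after its first
    term. *)
Lemma int_zeta_neq0 (s : C) : 1 < complex.Re s -> int_zeta s != 0.
Proof.
move=> s1; have sZ := iterm_summ s1.
pose F (n : int) := if (`|n|%N <= 1)%N then 0 else lterm (int_pt n) s.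
have tz : cmod (tsum F) <= 3 / 4 + 3 / 4.
  apply: cmod_tsum; pose g (n : nat) : R := if (n <= 1)%N then 0 else n%:R ^- 2.
  have hg : rbs g (3 / 4).
    apply: rbs_nat => [n|]; first by rewrite /g; case: ifP => // _; rewrite invr_ge0 exprn_ge0.
    move=> n; have : \sum_(0 <= i < n.+3) g i <= 3 / 4 - n.+2%:R^-1.
      elim: n => [|n IH]; first by rewrite !big_nat_recr ?big_nil//= /g /=; lra.
      rewrite big_nat_recr//=; apply: le_trans (lerD IH (lexx _)) _.
      rewrite /g /= -addrA lerD2l.
      have a0 : (0 : R) < n.+2%:R by rewrite ltr0n.
      rewrite -[n.+3%:R]natr1; set a := n.+2%:R in a0 *.
      rewrite lerNr opprD opprK -subr_ge0.
      have -> : a^-1 - (a + 1) ^- 2 - (a + 1)^-1 = (a * (a + 1) ^+ 2)^-1.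
        by field; rewrite !gt_eqF// ltr_wpDl// ltW.
      by rewrite invr_ge0 mulr_ge0 ?exprn_ge0 ?addr_ge0 ?ltW.
    move=> h; apply: le_trans (_ : _ <= \sum_(0 <= i < n.+3) g i) _; last first.
      by apply: le_trans h _; rewrite gerBl invr_ge0.
    rewrite (@big_cat_nat _ _ _ n 0 n.+3)//=; last by rewrite -addn3 leq_addr.
    by rewrite lerDl sumr_ge0// => i _; rewrite /g; case: ifP => // _; rewrite invr_ge0 exprn_ge0.
  apply: (@rbs_comp _ _ _ (fun n => cmod (F n)) (fun n : int => g `|n|%N) (fun n => n)) => //.
  - by move=> n; rewrite /g; case: ifP => // _; rewrite invr_ge0 exprn_ge0.
  - move=> n; rewrite /F /g; case: ifPn; first by rewrite cmod0.
    rewrite -ltnNge => n1; rewrite /lterm; case: eqP => _; first by rewrite cmod0 invr_ge0 exprn_ge0.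
    rewrite cmod_cexp /lnsq /int_pt cmod_int real_normK ?num_real// -absz_sqr.
    set a := `|n|%N in n1 *.
    have a0 : (0 : R) < a%:R by rewrite ltr0n; lia.
    have -> : complex.Re (s * (- ln (a%:R ^+ 2))%:C%C) = - (complex.Re s * ln (a%:R ^+ 2 : R)).
      by case: (s) => x y /=; rewrite mulr0 subr0 mulrN.
    rewrite -[leRHS]lnK ?posrE ?invr_gt0 ?exprn_gt0// ler_expR lnV ?posrE ?exprn_gt0// lerN2.
    by rewrite ler_peMl ?(ltW s1)// ln_ge0// exprn_ege1// ler1n; lia.
  - by apply: rbs_int => // n; rewrite /g; case: ifP => // _; rewrite invr_ge0 exprn_ge0.
have l1 n : (`|n|%N = 1)%N -> lterm (int_pt n) s = 1.
  move=> n1; rewrite /lterm /int_pt intr_eq0 -absz_eq0 n1 /= /lnsq cmod_int real_normK ?num_real// -absz_sqr n1.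
  by rewrite expr1n ln1 oppr0 mulr0 cexp0.
have sF : summ F.
  apply: summ_mono sZ _ => n; rewrite /F; case: ifP => // _; by rewrite cmod0 cmod_ge0.
have E : int_zeta s = 2 + tsum F.
  apply: tsumE; have h := @sums_finite _ _ (fun n : int => if n \in [fset 1; -1]%fset then 1 else 0 : C) [fset 1; -1]%fset.
  rewrite big_fsetU1 ?inE//= big_seq_fset1 !inE /= in h.
  have {}h := h _; apply: eq_sums (sumsD (h _) (summ_hs sF)) => [n|n /negPf ->//].
  rewrite /F !inE; case: n => [[|[|n]]|[|n]] /=; rewrite ?add0r ?addr0//; try by rewrite l1.
  by rewrite /lterm /int_pt eqxx.
apply/eqP => z0; have : cmod (tsum F) = 2.
  have -> : tsum F = - 2%:R by apply/eqP; rewrite -subr_eq0 opprK addrC -E z0.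
  by rewrite cmodN cmod_nat.
lra.
Qed.

End LatticeSums.

(** * Sine product *)

Section Sine.
Variable R : realType.
Local Notation C := R[i].

Lemma cvgsM u v (a b : C) : cvgs u a -> cvgs v b -> cvgs (fun n => u n * v n) (a * b).
Proof.
move=> hu hv e e0; pose K := 1 + cmod a + cmod b.
have K0 : 0 < K by rewrite /K -addrA ltr_wpDr// addr_ge0// cmod_ge0.
have d0 : 0 < Num.min 1 (e / K) by rewrite lt_min ltr01 divr_gt0.
have [N hN] := hu _ d0; have [N' hN'] := hv _ d0.
exists (maxn N N') => n; rewrite geq_max => /andP[/hN + /hN'].
rewrite !lt_min => /andP[u1 ue] /andP[v1 ve].
have -> : u n * v n - a * b = (u n - a) * (v n - b) + a * (v n - b) + b * (u n - a) by ring.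
apply: le_lt_trans (cmodD _ _) _; apply: le_lt_trans (lerD (cmodD _ _) (lexx _)) _; rewrite !cmodM.
move: (cmod_ge0 a) (cmod_ge0 b) (cmod_ge0 (u n - a)) (cmod_ge0 (v n - b)).
move: ue ve; rewrite !ltr_pdivlMr//; rewrite /K.
move: (cmod a) (cmod b) (cmod (u n - a)) (cmod (v n - b)) u1 v1 => A B U V; nra.
Qed.

Lemma cvgsV u (a : C) : a != 0 -> cvgs u a -> cvgs (fun n => (u n)^-1) a^-1.
Proof. by move=> a0 /cvgsP h; apply/cvgsP; exact: (@cvgV _ _ _ _ (u : nat -> R[i]^o)). Qed.

Lemma cvgsD u v (a b : C) : cvgs u a -> cvgs v b -> cvgs (fun n => u n + v n) (a + b).
Proof.
move=> hu hv e e0; have e2 : 0 < e / 2 by rewrite divr_gt0.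
have [N hN] := hu _ e2; have [N' hN'] := hv _ e2.
exists (maxn N N') => n; rewrite geq_max => /andP[/hN h1 /hN' h2].
by rewrite opprD addrACA; apply: le_lt_trans (cmodD _ _) _; rewrite (splitr e) ltrD.
Qed.

Lemma cvgs_cst (a : C) : cvgs (fun=> a) a.
Proof. by move=> e e0; exists 0%N => n _; rewrite subrr cmod0. Qed.

Lemma cvgs_ext u v (a : C) : (forall n, u n = v n) -> cvgs u a -> cvgs v a.
Proof. by move=> /funext ->. Qed.

Lemma cvgs_ev u v (a : C) N : (forall n, (N <= n)%N -> u n = v n) -> cvgs u a -> cvgs v a.
Proof.
move=> h hu e e0; have [K hK] := hu _ e0; exists (maxn N K) => n.
by rewrite geq_max => /andP[/h <- /hK].
Qed.

Lemma rcvgM (u v : nat -> R) (a b : R) : u @ \oo --> a -> v @ \oo --> b ->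
  (fun n => u n * v n) @ \oo --> a * b.
Proof. by move=> h k; exact: cvgM. Qed.

Lemma rcvgD (u v : nat -> R) (a b : R) : u @ \oo --> a -> v @ \oo --> b ->
  (fun n => u n + v n) @ \oo --> a + b.
Proof. by move=> h k; exact: cvgD. Qed.

Lemma rcvgV (u : nat -> R) (a : R) : a != 0 -> u @ \oo --> a -> (fun n => (u n)^-1) @ \oo --> a^-1.
Proof. by move=> a0 h; exact: cvgV. Qed.

Lemma rcvg_cst (a : R) : (fun _ : nat => a) @ \oo --> a.
Proof. exact: cvg_cst. Qed.

Lemma rcvg_ev (u v : nat -> R) (a : R) N : (forall n, (N <= n)%N -> u n = v n) ->
  u @ \oo --> a -> v @ \oo --> a.
Proof.
move=> h /rcvgP hu; apply/rcvgP => e /hu[K hK]; exists (maxn N K) => n.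
by rewrite geq_max => /andP[/h <- /hK].
Qed.

Definition cE (x : C) : C := cexp ((0 +i* pi)%C * x).

Lemma cED x y : cE (x + y) = cE x * cE y.
Proof. by rewrite /cE mulrDr cexpD. Qed.

Lemma cE0 : cE 0 = 1. Proof. by rewrite /cE mulr0 cexp0. Qed.

Lemma cEN x : cE (- x) = (cE x)^-1. Proof. by rewrite /cE mulrN cexpN. Qed.

Lemma cE_neq0 x : cE x != 0. Proof. exact: cexp_neq0. Qed.

Lemma cE_real (t : R) : cE t%:C%C = (cos (pi * t) +i* sin (pi * t))%C.
Proof.
by rewrite /cE /cexp /= !mul0r !mulr0 subrr add0r expR0 !mul1r.
Qed.

Lemma cE1 : cE 1 = -1.
Proof.
have := cE_real 1; rewrite mulr1 cospi sinpi => ->.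
by apply/eqP; rewrite eq_complex /= oppr0 !eqxx.
Qed.

Lemma cE_half : cE 2^-1 = 'i%C.
Proof.
have -> : (2^-1 : C) = (2^-1 : R)%:C%C by rewrite fmorphV rmorph_nat.
by rewrite cE_real cos_pihalf sin_pihalf.
Qed.

(** This is [2 i sin (pi x)]. *)
Definition cS (x : C) : C := cE x - cE (- x).

Lemma cmod_i : cmod ('i%C : C) = 1.
Proof. by apply: (@pexpIrn _ 2) => //; rewrite ?nnegrE ?cmod_ge0// cmod_sqr /= expr0n add0r. Qed.

Lemma cS_half x : cS (x + 2^-1) = 'i%C * (cE x + cE (- x)).
Proof.
have i2 : ('i%C : C) * 'i%C = -1 by rewrite -expr2 sqr_i.
have ii : ('i%C : C)^-1 = - 'i%C.
  by apply: (@mulfI _ 'i%C); [rewrite -cmod_eq0 cmod_i oner_eq0|rewrite divff -?cmod_eq0 ?cmod_i ?oner_eq0// mulrN i2 opprK].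
rewrite /cS opprD !cED [cE (- 2^-1)]cEN cE_half ii; ring.
Qed.

Lemma cS_double x : cmod (cS (2 * x)) = cmod (cS x) * cmod (cS (x + 2^-1)).
Proof.
rewrite -cmodM cS_half mulrCA cmodM cmod_i mul1r /cS; congr cmod.
by rewrite mulr_natl mulr2n opprD !cED; ring.
Qed.

Lemma cS1 x : cmod (cS (x + 1)) = cmod (cS x).
Proof.
rewrite /cS opprD !cED [cE (- 1)]cEN cE1 invrN1 -mulrBl cmodM cmodN cmod1 mulr1.
by [].
Qed.

Lemma cSN x : cS (- x) = - cS x.
Proof. by rewrite /cS opprK opprB. Qed.

Lemma cS_mul a b : cS (a + b) * cS (a - b) = cS a ^+ 2 - cS b ^+ 2.
Proof.
rewrite /cS !opprD opprK !cED !cEN.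
by field; rewrite !cE_neq0.
Qed.

Lemma prod_shift (F : nat -> R) a m n :
  \prod_(n + a <= j < n + m) F j = \prod_(a <= j < m) F (n + j)%N.
Proof. by rewrite addnC big_addn addKn; apply: eq_bigr => j _; rewrite addnC. Qed.

Lemma prod_shift0 (F : nat -> R) m n :
  \prod_(n <= j < n + m) F j = \prod_(0 <= j < m) F (n + j)%N.
Proof. by rewrite -prod_shift addn0. Qed.

Lemma prod_shift1 (F : nat -> R) m n :
  \prod_(n.+1 <= j < n + m) F j = \prod_(1 <= j < m) F (n + j)%N.
Proof. by rewrite -prod_shift addn1. Qed.

(** Iterating the duplication formula yields the finite product with [2 ^ k] factors; powers of two
    are all that the limit requires. *)
Lemma cS_prod k x : cmod (cS x) = \prod_(0 <= j < 2 ^ k) cmod (cS ((x + j%:R) / (2 ^ k)%:R)).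
Proof.
elim: k => [|k IH]; first by rewrite expn0 big_nat1 addr0 divr1.
rewrite IH expnS mul2n -addnn (@big_cat_nat _ _ _ (2 ^ k) 0 (2 ^ k + 2 ^ k)) ?leq_addr//=.
rewrite (@prod_shift0 _ (2 ^ k)%N (2 ^ k)%N) -big_split /=.
have nz : (2 ^ k)%:R != 0 :> C by rewrite pnatr_eq0 expn_eq0.
apply: eq_bigr => j _; set n := (2 ^ k)%N in nz *.
have n2 : (n%:R + n%:R : C) != 0 by rewrite -natrD pnatr_eq0 addnn double_eq0 -(pnatr_eq0 C).
have -> : (x + j%:R) / n%:R = 2 * ((x + j%:R) / (n + n)%:R).
  by rewrite natrD; field; rewrite nz n2.
rewrite cS_double; congr (_ * cmod (cS _)).
by rewrite !natrD; field; rewrite ?nz ?n2.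
Qed.

Lemma cS_prod1 k : \prod_(1 <= j < 2 ^ k) cmod (cS (j%:R / (2 ^ k)%:R)) = (2 ^ k)%:R.
Proof.
elim: k => [|k IH]; first by rewrite expn0 big_geq.
have k0 : (0 < 2 ^ k)%N by rewrite expn_gt0.
have nz : (2 ^ k)%:R != 0 :> C by rewrite pnatr_eq0 expn_eq0.
rewrite expnS mul2n -addnn (@big_cat_nat _ _ _ (2 ^ k) 1 (2 ^ k + 2 ^ k)) ?leq_addr//=.
rewrite (@big_ltn _ _ _ (2 ^ k))//=; last by rewrite -{1}[(2 ^ k)%N]addn0 ltn_add2l.
rewrite mulrCA (@prod_shift1 _ (2 ^ k)%N (2 ^ k)%N) -big_split /=.
set n := (2 ^ k)%N in nz k0 IH *.
have n2 : (n%:R + n%:R : C) != 0 by rewrite -natrD pnatr_eq0 addnn double_eq0 -(pnatr_eq0 C).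
have -> : cmod (cS (n%:R / (n + n)%:R)) = 2.
  have -> : n%:R / (n + n)%:R = 0 + 2^-1 :> C by rewrite natrD; field; rewrite n2.
  by rewrite cS_half oppr0 cE0 cmodM cmod_i mul1r -[1 + 1]/(2%:R) cmod_nat.
rewrite [RHS]natrD -[RHS]mulr2n -[RHS]mulr_natl; congr (_ * _); rewrite -IH.
apply: eq_bigr => j _.
have -> : j%:R / n%:R = 2 * (j%:R / (n + n)%:R) :> C.
  by rewrite natrD; field; rewrite nz n2.
rewrite (cS_double (j%:R / (n + n)%:R)); congr (_ * cmod (cS _)).
by rewrite !natrD; field; rewrite ?nz ?n2.
Qed.

Lemma xcos_le_sin (t : R) : 0 <= t <= pi -> t * cos t <= sin t.
Proof.
move=> /andP[t0 t1].
have [u] := @MVT_segment R sin cos 0 t t0 (fun x _ => is_derive_sin x) (continuous_subspaceT (@continuous_sin R)).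
rewrite in_itv /= => /andP[u0 u1]; rewrite sin0 !subr0 => ->.
rewrite mulrC ler_wpM2r//.
have ht : t \in `[0, pi]%R by rewrite in_itv /= t0.
have hu : u \in `[0, pi]%R by rewrite in_itv /= u0 (le_trans u1).
have [->//|ut] := eqVneq u t.
by apply: ltW; rewrite ltr_cos// lt_neqAle ut.
Qed.

Lemma sin_le_id (t : R) : 0 <= t -> sin t <= t.
Proof.
move=> t0.
have [u _] := @MVT_segment R sin cos 0 t t0 (fun x _ => is_derive_sin x) (continuous_subspaceT (@continuous_sin R)).
by rewrite sin0 !subr0 => ->; rewrite ler_piMl// cos_le1.
Qed.

(** A weak Jordan inequality: with [t = y / 2], [sin y = 2 sin t cos t >= 2 t cos^2 t], and
    [cos^2 t >= 1/2] because [cos y >= 0]. *)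
Lemma sin_ge_half (y : R) : 0 <= y <= pi / 2 -> y / 2 <= sin y.
Proof.
move=> /andP[y0 y1]; have p0 := pi_gt0 R.
set t := y / 2; have t0 : 0 <= t by rewrite divr_ge0.
have t1 : t <= pi / 4 by rewrite /t; lra.
have st : t * cos t <= sin t by apply: xcos_le_sin; rewrite t0 /=; lra.
have ct : 0 <= cos t by apply: cos_ge0_pihalf; apply/andP; split; lra.
have c2 : 2^-1 <= cos t ^+ 2.
  have : 0 <= cos y by apply: cos_ge0_pihalf; apply/andP; split; lra.
  have -> : y = t *+ 2 by rewrite /t -mulr_natr mulfVK.
  rewrite cos_mulr2n mulr2n; lra.
have -> : y = t *+ 2 by rewrite /t -mulr_natr mulfVK.
rewrite sin_mulr2n; have := ler_wpM2l ct st.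
have h2 := ler_wpM2l t0 c2.
have -> : cos t * (t * cos t) = t * cos t ^+ 2 by ring.
move: h2 => h2 h3; rewrite mulr2n; move: h2 h3.
by move: (cos t * sin t) (t * cos t ^+ 2) => a b; lra.
Qed.

Lemma cS_real (t : R) : cmod (cS t%:C%C) = 2 * `|sin (pi * t)|.
Proof.
have -> : cS t%:C%C = (0 +i* (2 * sin (pi * t)))%C.
  rewrite /cS -rmorphN !cE_real mulrN sinN cosN; apply/eqP; rewrite eq_complex /= subrr eqxx /=.
  by apply/eqP; ring.
apply: (@pexpIrn _ 2) => //; rewrite ?nnegrE ?cmod_ge0 ?mulr_ge0//.
by rewrite cmod_sqr /= expr0n add0r !exprMn real_normK ?num_real.
Qed.

Lemma cS_ge (t : R) : 0 <= t <= 2^-1 -> 2 * t <= cmod (cS t%:C%C).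
Proof.
move=> /andP[t0 t1]; rewrite cS_real ler_wpM2l//.
have p2 := pi_ge2 R; have h : 0 <= pi * t <= pi / 2 by rewrite mulr_ge0 ?(le_trans _ p2)//= ler_wpM2l// (le_trans _ p2).
apply: le_trans (ler_norm _); apply: le_trans (sin_ge_half h).
by nra.
Qed.

Lemma cexp_taylor1 (w : C) : cmod w <= 1 -> cmod (cexp w - 1 - w) <= expR 1 * cmod w ^+ 2.
Proof. by move=> /(cexp_taylor 1); rewrite rmorph1 mulr1 mul1r normr1. Qed.

Definition ipi : C := (0 +i* pi)%C.

Lemma cmod_ipi : cmod ipi = pi.
Proof.
apply: (@pexpIrn _ 2) => //; rewrite ?nnegrE ?cmod_ge0 ?pi_ge0//.
by rewrite cmod_sqr /= expr0n add0r.
Qed.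

Lemma cS_taylor (u : C) : cmod (ipi * u) <= 1 ->
  cmod (cS u - 2 * ipi * u) <= 2 * expR 1 * cmod (ipi * u) ^+ 2.
Proof.
move=> h; have h1 := cexp_taylor1 h.
have h2 : cmod (cexp (- (ipi * u)) - 1 - (- (ipi * u))) <= expR 1 * cmod (ipi * u) ^+ 2.
  by have := @cexp_taylor1 (- (ipi * u)); rewrite cmodN; apply.
have -> : cS u - 2 * ipi * u = (cexp (ipi * u) - 1 - ipi * u) - (cexp (- (ipi * u)) - 1 - (- (ipi * u))).
  by rewrite /cS /cE -/ipi mulrN; ring.
apply: le_trans (cmodB _ _) _; rewrite -mulrA mulr_natl mulr2n; exact: lerD.
Qed.

Lemma cS_le (u : C) : cmod (ipi * u) <= 1 -> cmod (cS u) <= (2 + 2 * expR 1) * (pi * cmod u).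
Proof.
move=> h; have h1 := cS_taylor h; rewrite -cmod_ipi -cmodM.
have -> : cS u = (cS u - 2 * ipi * u) + 2 * ipi * u by ring.
apply: le_trans (cmodD _ _) _; rewrite [X in X <= _]addrC [X in _ <= X]mulrDl; apply: lerD; first by rewrite -mulrA cmodM cmod_nat.
apply: le_trans h1 _; rewrite ler_wpM2l ?mulr_ge0 ?expR_ge0//.
by rewrite expr2 ler_piMr// cmod_ge0.
Qed.

Lemma cvgs_cS (x : C) (f : nat -> nat) : (forall n, (n < f n)%N) ->
  cvgs (fun n => (f n)%:R * cS (x / (f n)%:R)) (2 * ipi * x).
Proof.
move=> hf e e0.
pose A := cmod (ipi * x); have A0 : 0 <= A by exact: cmod_ge0.
pose K := A + 2 * expR 1 * A ^+ 2 / e.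
have K0 : 0 <= K by rewrite addr_ge0// divr_ge0 ?(ltW e0)// !mulr_ge0 ?expR_ge0.
exists (Num.trunc K).+1 => n hn.
have KN : K < (f n)%:R.
  apply: lt_trans (truncnS_gt K) _; rewrite ltr_nat; exact: leq_ltn_trans hn (hf n).
set N := (f n)%:R in KN; have N0 : 0 < N by apply: le_lt_trans KN.
have NC : (f n)%:R = N%:C%C :> C by rewrite rmorph_nat.
rewrite NC; have Nz : N%:C%C != 0 :> C by rewrite -cmod_eq0 cmod_real normr_eq0 gt_eqF.
have cN : cmod N%:C%C = N by rewrite cmod_real gtr0_norm.
have hu : cmod (ipi * (x / N%:C%C)) = A / N by rewrite mulrA cmodM cmodV cN.
have hu1 : A / N <= 1 by rewrite ler_pdivrMr// mul1r; apply: ltW; apply: le_lt_trans KN; rewrite lerDl divr_ge0 ?(ltW e0)// !mulr_ge0 ?expR_ge0.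
have E (m : C) : m != 0 -> m * cS (x / m) - 2 * ipi * x = m * (cS (x / m) - 2 * ipi * (x / m)).
  by move=> mz; field.
rewrite E//.
rewrite cmodM cN; have h := @cS_taylor (x / N%:C%C); rewrite hu in h.
apply: le_lt_trans (ler_wpM2l (ltW N0) (h hu1)) _.
have -> : N * (2 * expR 1 * (A / N) ^+ 2) = (2 * expR 1 * A ^+ 2) / N by field; rewrite gt_eqF.
rewrite ltr_pdivrMr// [e * N]mulrC -ltr_pdivrMr//; apply: (le_lt_trans _ KN); by rewrite lerDr.
Qed.

(** Dominated convergence for series; the estimate is uniform in the length [N], which may therefore
    depend on [k]. *)
Lemma tannery (f : nat -> nat -> R) (M : nat -> R) B : (forall k j, 0 <= f k j <= M j) ->
  rbs M B -> (forall j, f ^~ j @ \oo --> 0) ->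
  forall e : R, 0 < e -> exists K, forall k N, (K <= k)%N -> \sum_(0 <= j < N) f k j < e.
Proof.
move=> fM hM f0 e e0; have e2 : 0 < e / 2 by rewrite divr_gt0.
have M0 j : 0 <= M j by have /andP[h /(le_trans h)] := fM 0%N j.
have bM : bsum (fun j => (M j)%:C%C : C) B.
  move=> J; apply: le_trans (hM J); apply: ler_sum => j _; by rewrite cmod_real ger0_norm.
have [J0 hJ0] := bsum_tail bM e2.
pose L := (\max_(i <- J0) i).+1.
have tl N : \sum_(L <= j < N) M j < e / 2.
  have := hJ0 [fset j in index_iota L N]%fset; rewrite (perm_big (index_iota L N)) /=; last first.
    by apply: uniq_perm; rewrite ?iota_uniq ?fset_uniq// => j; rewrite inE.
  under eq_bigr do rewrite cmod_real ger0_norm//.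
  apply; apply/fdisjointP => j; rewrite inE /= mem_index_iota => /andP[Lj _].
  apply/negP => jJ; have : (j <= \max_(i <- J0) i)%N by apply: (@leq_bigmax_seq _ _ predT (fun i => i)).
  by rewrite leqNgt Lj.
have [K hK] : exists K, forall k, (K <= k)%N -> \sum_(0 <= j < L) f k j < e / 2.
  elim: (L) (e / 2) e2 => [|l IH] d d0; first by exists 0%N => k _; rewrite big_nil.
  have d2 : 0 < d / 2 by rewrite divr_gt0.
  have [K hK] := IH _ d2; have /rcvgP/(_ _ d2)[K' hK'] := f0 l.
  exists (maxn K K') => k; rewrite geq_max => /andP[/hK h1 /hK']; rewrite subr0 => h2.
  rewrite big_nat_recr//= (splitr d) ltrD//; exact: le_lt_trans (ler_norm _) h2.
exists K => k N kK.
apply: le_lt_trans (_ : _ <= \sum_(0 <= j < L + N) f k j) _.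
  rewrite (@big_cat_nat _ _ _ N 0 (L + N)) ?leq_addl//= lerDl sumr_ge0// => j _.
  by have /andP[] := fM k j.
rewrite (@big_cat_nat _ _ _ L 0 (L + N)) ?leq_addr//= (splitr e) ltrD ?hK//.
by apply: le_lt_trans (tl (L + N)%N); apply: ler_sum => j _; have /andP[] := fM k j.
Qed.

(** One factor is exchanged at a time; all partial products are at most [exp] of the sum of the
    bounds [M i]. *)
Lemma prod_diff (I : Type) (r : seq I) (a b : I -> C) (M : I -> R) :
  (forall i, cmod (a i) <= M i) -> (forall i, cmod (b i) <= M i) ->
  cmod (\prod_(i <- r) (1 - a i) - \prod_(i <- r) (1 - b i)) <=
   expR (\sum_(i <- r) M i) * \sum_(i <- r) cmod (a i - b i).
Proof.
move=> aM bM; have bd (c : I -> C) (s : seq I) : (forall i, cmod (c i) <= M i) ->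
   cmod (\prod_(i <- s) (1 - c i)) <= expR (\sum_(i <- s) M i).
  move=> cM; rewrite cmod_prod expR_sum; apply: ler_prod => i _; rewrite cmod_ge0 /=.
  apply: le_trans (cmodB _ _) _; rewrite cmod1; apply: le_trans (expR_ge1Dx _).
  by rewrite lerD2l.
elim: r => [|i r IH]; first by rewrite !big_nil subrr cmod0 mulr0.
rewrite !big_cons; set A := \prod_(j <- r) (1 - a j); set B := \prod_(j <- r) (1 - b j).
have -> : (1 - a i) * A - (1 - b i) * B = (1 - a i) * (A - B) - (a i - b i) * B by ring.
have Mi : 0 <= M i by apply: le_trans (cmod_ge0 _) (aM i).
apply: le_trans (cmodB _ _) _; rewrite !cmodM mulrDr addrC; apply: lerD.
  rewrite mulrC ler_wpM2r ?cmod_ge0//; apply: le_trans (bd b r bM) _.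
  by rewrite ler_expR lerDr.
rewrite expRD -mulrA; apply: ler_pM; rewrite ?cmod_ge0//.
by have := bd a [:: i] aM; rewrite !big_seq1.
Qed.

(* Here [n = 2^(k+1)]; the factors [j] and [n - j] of [cS_prod] are paired. *)
Lemma cS_pairs k x : let n : C := (2 ^ k.+1)%:R in
  cmod (cS x) = cmod (cS (x / n)) * cmod (cS (x / n + 2^-1)) *
    \prod_(1 <= j < 2 ^ k) cmod (cS (j%:R / n) ^+ 2 - cS (x / n) ^+ 2).
Proof.
set n : C := (2 ^ k.+1)%:R => /=; set h := (2 ^ k)%N.
have h0 : (0 < h)%N by rewrite expn_gt0.
have nE : n = h%:R + h%:R by rewrite /n expnS mul2n -addnn natrD.
have hz : h%:R != 0 :> C by rewrite pnatr_eq0 -lt0n.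
have nz : n != 0 by rewrite /n pnatr_eq0 expn_eq0.
rewrite (cS_prod k.+1) -/n expnS mul2n -addnn -/h.
rewrite (@big_cat_nat _ _ _ h 0 (h + h)) ?leq_addr//= (@big_ltn _ _ _ 0 h)// addr0 -!mulrA; congr (_ * _).
rewrite (@big_ltn _ _ _ h)//=; last by rewrite -{1}[h]addn0 ltn_add2l.
rewrite (@prod_shift1 _ h h) mulrCA; congr (_ * _).
  by congr (cmod (cS _)); rewrite nE; field; rewrite -nE nz.
rewrite [X in _ * X]big_nat_rev /= -big_split /= big_nat [RHS]big_nat; apply: eq_bigr => j /andP[j1 j2].
rewrite -cS_mul !cmodM mulrDl [j%:R / n + _]addrC; congr (_ * _).
have -> : (x + (h + (1 + h - j.+1))%:R) / n = (x / n - j%:R / n) + 1.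
  have -> : (h + (1 + h - j.+1))%N = (h + h - j)%N by lia.
  rewrite natrB ?natrD; last by lia.
  by rewrite nE; field; rewrite -nE nz.
by rewrite cS1 -cmodN -cSN opprB.
Qed.

Lemma cS_pairs0 k : \prod_(1 <= j < 2 ^ k) (cmod (cS (j%:R / (2 ^ k.+1)%:R)) ^+ 2) = (2 ^ k)%:R.
Proof.
set n : C := (2 ^ k.+1)%:R; set h := (2 ^ k)%N.
have h0 : (0 < h)%N by rewrite expn_gt0.
have nE : n = h%:R + h%:R by rewrite /n expnS mul2n -addnn natrD.
have hz : h%:R != 0 :> C by rewrite pnatr_eq0 -lt0n.
have nz : n != 0 by rewrite /n pnatr_eq0 expn_eq0.
have := cS_prod1 k.+1; rewrite -/n expnS mul2n -addnn -/h.
rewrite (@big_cat_nat _ _ _ h 1 (h + h)) ?leq_addr//= (@big_ltn _ _ _ h)//=; last by rewrite -{1}[h]addn0 ltn_add2l.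
rewrite (@prod_shift1 _ h h) mulrCA.
rewrite [X in _ * (_ * X)]big_nat_rev /= -big_split /=.
have -> : cmod (cS (h%:R / n)) = 2.
  have -> : h%:R / n = 0 + 2^-1 :> C by rewrite nE; field; rewrite -nE nz.
  by rewrite cS_half oppr0 cE0 cmodM cmod_i mul1r -[1 + 1]/(2%:R) cmod_nat.
rewrite [in RHS]natrD -[RHS]mulr2n -[RHS]mulr_natl => /(mulfI _) <-; last by rewrite pnatr_eq0.
rewrite big_nat [RHS]big_nat; apply: eq_bigr => j /andP[j1 j2].
rewrite expr2; congr (_ * _).
have -> : (h + (1 + h - j.+1))%:R / n = - (j%:R / n) + 1.
  have -> : (h + (1 + h - j.+1))%N = (h + h - j)%N by lia.
  rewrite natrB ?natrD; last by lia.
  by rewrite nE; field; rewrite -nE nz.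
by rewrite (cS1 (- (j%:R / n))) cSN cmodN.
Qed.

Lemma cS_ge_nat k j : (j <= 2 ^ k)%N ->
  2 * (j%:R / (2 ^ k.+1)%:R) <= cmod (cS (j%:R / (2 ^ k.+1)%:R)).
Proof.
move=> jk; have n0 : (0 : R) < (2 ^ k.+1)%:R by rewrite ltr0n expn_gt0.
have := @cS_ge (j%:R / (2 ^ k.+1)%:R); rewrite rmorphM fmorphV !rmorph_nat; apply.
rewrite divr_ge0 ?ler0n//= ler_pdivrMr// expnS natrM mulrA mulVf ?pnatr_eq0// mul1r ler_nat//.
Qed.

Lemma sine_ratio x k : cmod (cS x) = (2 ^ k)%:R * cmod (cS (x / (2 ^ k.+1)%:R)) *
   cmod (cS (x / (2 ^ k.+1)%:R + 2^-1)) *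
   cmod (\prod_(1 <= j < 2 ^ k) (1 - (cS (x / (2 ^ k.+1)%:R) / cS (j%:R / (2 ^ k.+1)%:R)) ^+ 2)).
Proof.
rewrite (cS_pairs k x) -{1}(cS_pairs0 k); set n : C := (2 ^ k.+1)%:R.
rewrite cmod_prod; set A := cmod (cS (x / n)); set B := cmod (cS (x / n + 2^-1)).
have -> : forall P Q : R, P * A * B * Q = A * B * (P * Q) by move=> P Q; ring.
congr (_ * _); rewrite -big_split /= big_nat [RHS]big_nat; apply: eq_bigr => j /andP[j1 j2].
rewrite -cmodX -cmodM; congr cmod; rewrite mulrBr mulr1 expr_div_n mulrCA divff ?mulr1//.
rewrite expf_neq0// -cmod_gt0; apply: lt_le_trans (cS_ge_nat (ltnW j2)).
by rewrite mulr_gt0// divr_gt0// ltr0n// expn_gt0.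
Qed.

Lemma ltn_exp2 k : (k < 2 ^ k.+1)%N.
Proof. by apply: leq_trans (ltn_expl k (isT : (1 < 2)%N)) _; rewrite leq_exp2l. Qed.

Lemma cvgs_divexp (x : C) : cvgs (fun k => x / (2 ^ k.+1)%:R) 0.
Proof.
move=> e e0; pose K := cmod x / e; have K0 : 0 <= K by rewrite divr_ge0 ?cmod_ge0 ?ltW.
exists (Num.trunc K).+1 => k hk; rewrite subr0 cmodM cmodV cmod_nat.
have n0 : (0 : R) < (2 ^ k.+1)%:R by rewrite ltr0n expn_gt0.
rewrite ltr_pdivrMr// mulrC -ltr_pdivrMr//; apply: lt_trans (truncnS_gt K) _.
by rewrite ltr_nat; apply: leq_ltn_trans hk (ltn_exp2 k).
Qed.

Lemma cvgs_cE (u : nat -> C) : cvgs u 0 -> cvgs (fun n => cE (u n)) 1.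
Proof.
move=> hu; have h : cvgs (fun n => ipi * u n) 0.
  by have := cvgsM (cvgs_cst ipi) hu; rewrite mulr0.
move=> e e0; pose d := Num.min 1 (e / (1 + expR 1)).
have p : 0 < 1 + expR 1 :> R by rewrite addr_gt0 ?expR_gt0.
have d0 : 0 < d by rewrite lt_min ltr01 divr_gt0.
have [N hN] := h _ d0; exists N => n /hN; rewrite subr0 lt_min ltr_pdivlMr// => /andP[/ltW w1 we].
apply: le_lt_trans we; have t := cexp_taylor1 w1.
have -> : cE (u n) - 1 = (cexp (ipi * u n) - 1 - ipi * u n) + ipi * u n by rewrite /cE; ring.
apply: le_trans (cmodD _ _) _; rewrite mulrDr mulr1 addrC lerD2l; apply: le_trans t _.
by rewrite mulrC ler_wpM2r ?expR_ge0// expr2 ler_piMr// cmod_ge0.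
Qed.

Lemma cS_nat_neq0 k j : (0 < j < 2 ^ k)%N -> cS (j%:R / (2 ^ k.+1)%:R) != 0.
Proof.
move=> /andP[j0 jk]; rewrite -cmod_gt0; apply: lt_le_trans (cS_ge_nat (ltnW jk)).
by rewrite mulr_gt0// divr_gt0// ltr0n// expn_gt0.
Qed.

Lemma rbs_sqr : rbs (fun j : nat => expR (- 2 * ln (1 + j%:R)) : R) 2.
Proof.
have := @nat_pow_sum R 2; rewrite ltr1n => /(_ isT).
have -> : (1 + (2 - 1)^-1 : R) = 2 by field.
by [].
Qed.

Lemma expR_sqr (a : R) : 0 < a -> expR (- 2 * ln a) = a ^- 2.
Proof. by move=> a0; rewrite mulNr expRN expRM_natl lnK. Qed.

Lemma inv_sqr_le j : (0 < j)%N -> (j%:R : R) ^- 2 <= 4 * expR (- 2 * ln (1 + j%:R)).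
Proof.
move=> j0; have j1 : (1 : R) <= j%:R by rewrite ler1n.
have jp : (0 : R) < j%:R by rewrite ltr0n.
have qp : (0 : R) < 1 + j%:R by rewrite addr_gt0.
rewrite expR_sqr// -[4]invrK -invfM lef_pV2 ?posrE ?mulr_gt0 ?invr_gt0 ?exprn_gt0//.
by rewrite mulrC ler_pdivrMr//; nra.
Qed.

(** In [sine_ratio] the squared quotients of sines tend to [(x / j)^2] and are dominated by a
    multiple of [1 / j^2], so the finite products approach the product of the limits. The prefactor
    there tends to [2 pi |x|]. *)
Lemma sine_product (x : C) : x != 0 ->
  (fun k => \prod_(1 <= j < 2 ^ k) cmod (1 - (x / j%:R) ^+ 2)) @ \oo --> cmod (cS x) / (2 * pi * cmod x).
Proof.
move=> x0.
pose C0 : R := (2 + 2 * expR 1) * (pi * cmod x).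
have C00 : 0 <= C0 by rewrite !mulr_ge0 ?pi_ge0 ?cmod_ge0// addr_ge0// mulr_ge0 ?expR_ge0.
(* The linear bound for the sine is valid for [|pi x / 2 ^ k.+1| <= 1], which excludes finitely many
   [k]; setting [a k j] to 0 for these makes the majorant [M] hold for every [k]. *)
pose ok k j := (0 < j < 2 ^ k)%N && (cmod (ipi * (x / (2 ^ k.+1)%:R)) <= 1).
pose a k j : C := if ok k j then (cS (x / (2 ^ k.+1)%:R) / cS (j%:R / (2 ^ k.+1)%:R)) ^+ 2 else 0.
pose b j : C := if (0 < j)%N then (x / j%:R) ^+ 2 else 0.
(* [C0 ^+ 2 / j^2] dominates the quotients of sines and [cmod x ^+ 2 / j^2] their limits; the second
   factor bounds [1 / j^2] by a summable function that also makes sense at [j = 0]. *)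
pose M (j : nat) := (C0 ^+ 2 + cmod x ^+ 2) * (4 * expR (- 2 * ln (1 + j%:R))).
have M0 j : 0 <= M j by rewrite !mulr_ge0 ?expR_ge0// addr_ge0// exprn_ge0// cmod_ge0.
have aM k j : cmod (a k j) <= M j.
  rewrite /a; case: ifP => [/andP[/andP[j0 jk] w1]|_]; last by rewrite cmod0.
  apply: le_trans (_ : _ <= C0 ^+ 2 * j%:R ^- 2) _; last first.
    apply: ler_pM; rewrite ?exprn_ge0 ?invr_ge0 ?exprn_ge0//; last exact: inv_sqr_le.
    by rewrite lerDl exprn_ge0// cmod_ge0.
  rewrite cmodX -exprVn -exprMn lerXn2r ?nnegrE ?cmod_ge0 ?(divr_ge0 C00)//.
  rewrite cmodM cmodV; have n0 : (0 : R) < (2 ^ k.+1)%:R by rewrite ltr0n expn_gt0.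
  have jp : (0 : R) < j%:R by rewrite ltr0n.
  have s1 := cS_le w1; have s2 := cS_ge_nat (ltnW jk).
  have sp : 0 < cmod (cS (j%:R / (2 ^ k.+1)%:R)) by rewrite cmod_gt0 cS_nat_neq0 ?j0.
  rewrite ler_pdivrMr//; apply: le_trans s1 _; rewrite cmodM cmodV cmod_nat.
  apply: le_trans (_ : _ <= C0 / j%:R * (2 * (j%:R / (2 ^ k.+1)%:R))) _; last by rewrite ler_wpM2l// divr_ge0.
  have -> : C0 / j%:R * (2 * (j%:R / (2 ^ k.+1)%:R)) = 2 * (C0 / (2 ^ k.+1)%:R) by field; rewrite !gt_eqF.
  have -> : (2 + 2 * expR 1) * (pi * (cmod x / (2 ^ k.+1)%:R)) = C0 / (2 ^ k.+1)%:R by rewrite /C0 !mulrA.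
  by rewrite ler_peMl ?ler1n// divr_ge0// ltW.
have bM j : cmod (b j) <= M j.
  rewrite /b; case: ifP => [j0|_]; last by rewrite cmod0.
  rewrite cmodX cmodM cmodV cmod_nat exprMn exprVn; apply: ler_pM; rewrite ?exprn_ge0 ?cmod_ge0 ?invr_ge0 ?exprn_ge0//; last exact: inv_sqr_le.
  by rewrite lerDr exprn_ge0.
have hM : rbs M ((C0 ^+ 2 + cmod x ^+ 2) * (4 * 2)).
  move=> J; rewrite -!mulr_sumr !ler_wpM2l//; first by rewrite addr_ge0// exprn_ge0// cmod_ge0.
  exact: rbs_sqr.
have hw : cvgs (fun k => ipi * (x / (2 ^ k.+1)%:R)) 0.
  by have := cvgsM (cvgs_cst ipi) (@cvgs_divexp x); rewrite mulr0.
have [K1 hK1] := hw _ ltr01.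
have okP k j : (K1 <= k)%N -> (0 < j < 2 ^ k)%N -> ok k j.
  by move=> /hK1; rewrite subr0 => /ltW h1 h2; rewrite /ok h2.
have ab j : (fun k => cmod (a k j - b j)) @ \oo --> 0.
  have [j0|j0] := posnP j.
    rewrite j0; have -> : (fun k => cmod (a k 0%N - b 0%N)) = (fun=> 0); last exact: cvg_cst.
    by apply/funext => k; rewrite /a /b /ok /= subrr cmod0.
  have lim1 := cvgs_cS x ltn_exp2; have lim2 := cvgs_cS j%:R ltn_exp2.
  have nz : 2 * ipi * j%:R != 0 by rewrite -cmod_eq0 !cmodM cmod_ipi !cmod_nat gt_eqF// !mulr_gt0 ?pi_gt0 ?ltr0n.
  have l3 := cvgsM lim1 (cvgsV nz lim2); have l4 := cvgsM l3 l3.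
  have l5 : cvgs (fun k => a k j) (b j).
    have -> : b j = 2 * ipi * x * (2 * ipi * j%:R)^-1 * (2 * ipi * x * (2 * ipi * j%:R)^-1).
      have i0 : ipi != 0 by rewrite -cmod_eq0 cmod_ipi gt_eqF// pi_gt0.
      have jn : j%:R != 0 :> C by rewrite pnatr_eq0 -lt0n.
      by rewrite /b j0; field; rewrite i0 jn.
    apply: (@cvgs_ev _ _ _ (maxn K1 j)) l4 => k; rewrite geq_max => /andP[k1 jk].
    have jk' : (j < 2 ^ k)%N by apply: leq_ltn_trans jk (ltn_expl _ _).
    rewrite /a okP ?j0//.
    have n0 : (2 ^ k.+1)%:R != 0 :> C by rewrite pnatr_eq0 expn_eq0.
    have sn := @cS_nat_neq0 k j; rewrite j0 jk' in sn.
    by rewrite -expr2 -mulf_div divff// mul1r.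
  apply/rcvgP => e /l5[N hN]; exists N => k /hN; by rewrite subr0 ger0_norm ?cmod_ge0.
have hf : forall k j, 0 <= cmod (a k j - b j) <= M j + M j.
  by move=> k j; rewrite cmod_ge0 /=; apply: le_trans (cmodB _ _) _; rewrite lerD.
have T := tannery hf (rbsD hM hM) ab.
pose A k : C := \prod_(1 <= j < 2 ^ k) (1 - (cS (x / (2 ^ k.+1)%:R) / cS (j%:R / (2 ^ k.+1)%:R)) ^+ 2).
pose B k : C := \prod_(1 <= j < 2 ^ k) (1 - (x / j%:R) ^+ 2).
have AB : cvgs (fun k => B k - A k) 0.
  move=> e e0; set S := (C0 ^+ 2 + cmod x ^+ 2) * (4 * 2) in hM.
  have [K hK] := T (e / expR S) (divr_gt0 e0 (expR_gt0 _)).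
  exists (maxn K1 K) => k; rewrite geq_max => /andP[k1 k2]; rewrite subr0.
  have -> : A k = \prod_(1 <= j < 2 ^ k) (1 - a k j).
    rewrite /A big_nat [RHS]big_nat; apply: eq_bigr => j j1; by rewrite /a okP.
  have -> : B k = \prod_(1 <= j < 2 ^ k) (1 - b j).
    by rewrite /B big_nat [RHS]big_nat; apply: eq_bigr => j /andP[j1 _]; rewrite /b j1.
  rewrite cmod_distC; apply: le_lt_trans (prod_diff _ (aM k) bM) _.
  have s1 : \sum_(1 <= j < 2 ^ k) cmod (a k j - b j) < e / expR S.
    apply: le_lt_trans (hK k (2 ^ k)%N k2); rewrite [X in _ <= X]big_ltn ?expn_gt0//.
    by rewrite lerDr cmod_ge0.
  have s2 : \sum_(1 <= j < 2 ^ k) M j <= S.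
    apply: le_trans (rbs_natP (2 ^ k)%N hM); rewrite [X in _ <= X]big_ltn ?expn_gt0//.
    by rewrite lerDr.
  rewrite ltr_pdivlMr ?expR_gt0// in s1; apply: le_lt_trans s1; rewrite mulrC.
  by rewrite ler_wpM2l ?ler_expR// sumr_ge0// => j _; apply: cmod_ge0.
have limS : (fun k => (2 ^ k)%:R * cmod (cS (x / (2 ^ k.+1)%:R)) * cmod (cS (x / (2 ^ k.+1)%:R + 2^-1))) @ \oo --> 2 * pi * cmod x.
  have l1 := cvgs_cmod (cvgs_cS x ltn_exp2).
  have l2 : cvgs (fun k => cS (x / (2 ^ k.+1)%:R + 2^-1)) ('i%C * (1 + 1)).
    apply: (@cvgs_ext (fun k => 'i%C * (cE (x / (2 ^ k.+1)%:R) + cE (- (x / (2 ^ k.+1)%:R))))).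
      by move=> k; rewrite cS_half.
    apply: cvgsM (cvgs_cst _) (cvgsD (cvgs_cE (cvgs_divexp x)) _).
    apply: cvgs_cE; apply: cvgs_ext (cvgs_divexp (- x)) => k; by rewrite mulNr.
  have h := rcvgM (rcvg_cst (a := 2^-1)) (rcvgM l1 (cvgs_cmod l2)).
  have e1 : 2^-1 * (cmod (2 * ipi * x) * cmod ('i%C * (1 + 1))) = 2 * pi * cmod x.
    by rewrite !cmodM cmod_ipi cmod_i -[1 + 1]/(2%:R) cmod_nat; field.
  rewrite e1 in h; apply: (rcvg_ev (N := 0%N) _ h) => k _.
  by rewrite cmodM cmod_nat expnS natrM; field.
have limA : (fun k => cmod (A k)) @ \oo --> cmod (cS x) / (2 * pi * cmod x).
  have px : 2 * pi * cmod x != 0 by rewrite gt_eqF// !mulr_gt0 ?pi_gt0 ?cmod_gt0.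
  have h := rcvgM (rcvg_cst (a := cmod (cS x))) (rcvgV px limS).
  have pp : 0 < 2 * pi * cmod x by rewrite !mulr_gt0 ?pi_gt0 ?cmod_gt0.
  have /rcvgP/(_ _ pp)[N hN] := limS.
  apply: (rcvg_ev (N := N) _ h) => k /hN hk; rewrite (sine_ratio x k) -/(A k).
  have nz : (2 ^ k)%:R * cmod (cS (x / (2 ^ k.+1)%:R)) * cmod (cS (x / (2 ^ k.+1)%:R + 2^-1)) != 0.
    by apply: contraTneq hk => ->; rewrite sub0r normrN ger0_norm ?ltxx// !mulr_ge0 ?pi_ge0 ?cmod_ge0.
  by rewrite mulrC mulKf.
have -> : (fun k => \prod_(1 <= j < 2 ^ k) cmod (1 - (x / j%:R) ^+ 2)) = (fun k => cmod (B k)).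
  by apply/funext => k; rewrite cmod_prod.
apply/rcvgP => e e0; have e2 : 0 < e / 2 by rewrite divr_gt0.
have /rcvgP/(_ _ e2)[N hN] := limA; have [K hK] := AB _ e2.
exists (maxn N K) => k; rewrite geq_max => /andP[/hN h1 /hK]; rewrite subr0 => h2.
have -> : forall l, cmod (B k) - l = (cmod (B k) - cmod (A k)) + (cmod (A k) - l) by move=> l; ring.
apply: le_lt_trans (ler_normD _ _) _; rewrite (splitr e) ltrD//; apply: le_lt_trans h2.
rewrite ler_norml; apply/andP; split.
  by rewrite lerNl opprB lerBlDr cmod_distC; apply: le_trans (cmodD _ _); rewrite subrK.
by rewrite lerBlDr; apply: le_trans (cmodD _ _); rewrite subrK.
Qed.

End Sine.

(** * Values at 0 *)

Section Rows.
Variable R : realType.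
Local Notation C := R[i].

Lemma cvgs_sub (u : nat -> C) l (g : nat -> nat) : (forall n, (n <= g n)%N) ->
  cvgs u l -> cvgs (fun n => u (g n)) l.
Proof. by move=> hg h e /h[N hN]; exists N => n Nn; apply: hN; apply: leq_trans Nn (hg n). Qed.

Lemma rcvg_sub (u : nat -> R) (l : R) (g : nat -> nat) : (forall n, (n <= g n)%N) ->
  u @ \oo --> l -> (fun n => u (g n)) @ \oo --> l.
Proof. by move=> hg /rcvgP h; apply/rcvgP => e /h[N hN]; exists N => n Nn; apply: hN; apply: leq_trans Nn (hg n). Qed.

Lemma rcvg_cvgs (u : nat -> R) (l : R) : u @ \oo --> l -> cvgs (fun n => (u n)%:C%C) l%:C%C.
Proof. by move=> /rcvgP h e /h[N hN]; exists N => n /hN; rewrite -rmorphB cmod_real. Qed.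

Lemma sums_int_cvgs (f : int -> C) l : sums f l ->
  cvgs (fun P => \sum_(0 <= i < 4 * P) f (i%:Z - (2 * P)%:Z)) l.
Proof.
move=> h e e0; have [J hJ] := h _ e0; exists (\max_(i <- J) `|i|%N).+1 => P hP.
have inj : injective (fun i : nat => i%:Z - (2 * P)%:Z) by move=> i j /=; lia.
have -> : \sum_(0 <= i < 4 * P) f (i%:Z - (2 * P)%:Z) =
   \sum_(n <- [fset (i%:Z - (2 * P)%:Z)%R | i in [fset i in iota 0 (4 * P)]%fset]%fset) f n.
  by rewrite big_imfset ?big_fset_iota// => i j _ _; exact: inj.
apply: hJ; apply/fsubsetP => n nJ; apply/imfsetP.
have hn : (`|n| <= \max_(i <- J) `|i|)%N by apply: (@leq_bigmax_seq _ _ predT (fun i : int => `|i|%N)).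
exists (absz (n + (2 * P)%:Z)%R); last by lia.
by rewrite mem_fset_iota; lia.
Qed.

Lemma ndif_cvgs k (b : nat -> nat -> C) n : (forall j, cvgs (b ^~ j) 0) ->
  cvgs (fun m => ndif k (b m) n) 0.
Proof.
move=> h; elim: k n => [|k IH] n /=; first exact: h.
have := cvgsD (IH n) (cvgsM (cvgs_cst (-1)) (IH n.+1)); rewrite mulr0 addr0.
by apply: cvgs_ext => m; rewrite mulN1r.
Qed.

Lemma alt_parts k (a : nat -> C) N : ~~ odd N ->
  \sum_(0 <= i < N) (-1) ^+ i * ndif k.+1 a i =
  2 * (\sum_(0 <= i < N) (-1) ^+ i * ndif k a i) + (ndif k a N - ndif k a 0).
Proof.
move=> oN; rewrite /=; have E (b : nat -> C) M :
    \sum_(0 <= i < M) (-1) ^+ i * (b i - b i.+1) =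
    2 * (\sum_(0 <= i < M) (-1) ^+ i * b i) + ((-1) ^+ M * b M - b 0%N).
  elim: M => [|M IH]; first by rewrite !big_nil mulr0 add0r mul1r subrr.
  by rewrite !big_nat_recr//= IH exprS; ring.
by rewrite E -signr_odd (negPf oN) mul1r.
Qed.

Lemma sg_shift i P : sg R (i%:Z - (2 * P)%:Z) = (-1) ^+ i.
Proof.
rewrite sgD sgN; have -> : (2 * P)%:Z = 2 * P%:Z by rewrite PoszM.
by rewrite sg_even mulr1 /sg -exprnP.
Qed.

(** The [k] differences are undone by summation by parts, which doubles the alternating sum each
    time up to boundary terms. The window from [-2P] to [2P] has even length, so both ends carry the
    same sign and only [phi(2P + j) - phi(j - 2P)] has to tend to 0; for logarithmic [phi] the ends
    themselves diverge. *)
Lemma row_sum (phi : int -> C) k (T l : C) (P : nat -> nat) : (forall m, (m <= P m)%N) ->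
  sums (fun n => sg R n * ndif k (fun j => phi (n + j%:Z)) 0) T ->
  (forall j : nat, cvgs (fun m => phi ((2 * P m)%:Z + j%:Z) - phi (j%:Z - (2 * P m)%:Z)) 0) ->
  cvgs (fun m => \sum_(0 <= i < 4 * P m) (-1) ^+ i * phi (i%:Z - (2 * P m)%:Z)) l ->
  T = 2 ^+ k * l.
Proof.
move=> hP hT hb hl.
pose a m i := phi (i%:Z - (2 * P m)%:Z).
have hk : cvgs (fun m => \sum_(0 <= i < 4 * P m) (-1) ^+ i * ndif k (a m) i) T.
  apply: cvgs_ext (cvgs_sub hP (sums_int_cvgs hT)) => m; apply: eq_bigr => i _.
  rewrite sg_shift; congr (_ * _).
  have sh (V : zmodType) q (f : nat -> V) n : ndif q (fun j => f (n + j)%N) 0 = ndif q f n.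
    elim: n f => [|n IH] f; first by [].
    by rewrite -ndif_shift -IH; apply: ndif_ext => j _; rewrite addSn.
  rewrite -(sh _ k (a m) i); apply: ndif_ext => j _; rewrite /a; congr phi; rewrite PoszD; ring.
suff hk' : cvgs (fun m => \sum_(0 <= i < 4 * P m) (-1) ^+ i * ndif k (a m) i) (2 ^+ k * l).
  exact: cvgs_unique hk hk'.
elim: (k) => [|q IH]; first by rewrite mul1r.
have hbd : cvgs (fun m => ndif q (a m) (4 * P m)%N - ndif q (a m) 0) 0.
  apply: cvgs_ext (ndif_cvgs q 0 hb) => m.
  have sh (V : zmodType) (f : nat -> V) n : ndif q (fun j => f (n + j)%N) 0 = ndif q f n.
    elim: n f => [|n IH'] f; first by [].
    by rewrite -ndif_shift -IH'; apply: ndif_ext => j _; rewrite addSn.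
  have neg (f : nat -> C) n : ndif q (fun j => - f j) n = - ndif q f n.
    by rewrite -mulN1r -ndifZ; apply: ndif_ext => j _; rewrite mulN1r.
  rewrite -(sh _ (a m) (4 * P m)%N) -neg -ndifD; apply: ndif_ext => j _; rewrite /a.
  by congr (phi _ - phi _); rewrite ?PoszD; lia.
have := cvgsD (cvgsM (cvgs_cst 2) IH) hbd; rewrite addr0 mulrA -exprS.
apply: cvgs_ext => m; rewrite alt_parts//.
by rewrite -dvdn2; apply/dvdnP; exists (2 * P m)%N; lia.
Qed.

Lemma rcvg_ln (u : nat -> R) (l : R) : 0 < l -> u @ \oo --> l -> (fun n => ln (u n)) @ \oo --> ln l.
Proof. by move=> l0 h; apply: (continuous_cvg _ _ h); apply: continuous_ln. Qed.

Lemma lq_cmod (w : C) : w != 0 -> lnsq w = 2 * ln (cmod w).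
Proof. by move=> w0; rewrite /lnsq lnXn ?cmod_gt0// mulr_natl. Qed.

Lemma lqM (a b : C) : a != 0 -> b != 0 -> lnsq (a * b) = lnsq a + lnsq b.
Proof. by move=> a0 b0; rewrite /lnsq cmodM exprMn lnM// posrE exprn_gt0// cmod_gt0. Qed.

Lemma lqN (a : C) : lnsq (- a) = lnsq a. Proof. by rewrite /lnsq cmodN. Qed.

Lemma lq0 : lnsq (0 : C) = 0. Proof. by rewrite /lnsq cmod0 expr0n ln0. Qed.

Lemma lq_large (v : C) : (fun m => lnsq (v + (2 ^ m.+1)%:R) - lnsq ((2 ^ m.+1)%:R : C)) @ \oo --> (0 : R).
Proof.
have h1 : cvgs (fun m => 1 + v / (2 ^ m.+1)%:R) 1.
  by have := cvgsD (cvgs_cst 1) (cvgs_divexp v); rewrite addr0.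
have h2 := rcvg_ln ltr01 (_ : (fun m => cmod (1 + v / (2 ^ m.+1)%:R) ^+ 2) @ \oo --> (1 : R)).
have {}h2 : (fun m => ln (cmod (1 + v / (2 ^ m.+1)%:R) ^+ 2)) @ \oo --> ln (1 : R).
  by apply: h2; have := rcvgM (cvgs_cmod h1) (cvgs_cmod h1); rewrite cmod1 mulr1.
have [N hN] := h1 _ ltr01.
rewrite ln1 in h2; apply: (rcvg_ev (N := N) _ h2) => m /hN hm.
have n0 : (2 ^ m.+1)%:R != 0 :> C by rewrite pnatr_eq0 expn_eq0.
have nz : 1 + v / (2 ^ m.+1)%:R != 0.
  by apply: contraTneq hm => ->; rewrite sub0r cmodN cmod1 ltxx.
have -> : v + (2 ^ m.+1)%:R = (2 ^ m.+1)%:R * (1 + v / (2 ^ m.+1)%:R) by field.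
by rewrite lqM// addrAC subrr add0r.
Qed.

(** The logarithm of a truncated sine product with [2 P] factors. Subtracting [lamb0], its value at
    [x = 0] (where [ln 0 = 0] drops the vanishing factor), makes it converge. *)
Definition lamb (x : C) (P : nat) : R := \sum_(0 <= j < 2 * P) lnsq (x + j%:R - P%:R).

Definition lamb0 (P : nat) : R := lnsq (P%:R : C) + 2 * \sum_(1 <= j < P) lnsq (j%:R : C).

Lemma lamb_split (x : C) P : (0 < P)%N ->
  lamb x P = lnsq (x - P%:R) + lnsq x + \sum_(1 <= j < P) (lnsq (x + j%:R) + lnsq (x - j%:R)).
Proof.
move=> P0; rewrite /lamb mul2n -addnn (@big_cat_nat _ _ _ P 0 (P + P)) ?leq_addr//=.
rewrite (@big_ltn _ _ _ 0 P)// addr0 -!addrA; congr (_ + _).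
have -> : \sum_(P <= j < P + P) lnsq (x + j%:R - P%:R) = \sum_(0 <= j < P) lnsq (x + j%:R).
  rewrite -{1}[P]add0n big_addn addnK; apply: eq_bigr => j _; rewrite natrD; congr lnsq; ring.
rewrite (@big_ltn _ _ _ 0 P)// addr0 addrCA; congr (_ + _).
rewrite big_nat_rev /= addrC -big_split /= big_nat [RHS]big_nat; apply: eq_bigr => j /andP[j1 j2].
congr (_ + lnsq _); rewrite natrB; last by lia.
by rewrite natrD -[j.+1%:R]natr1; ring.
Qed.

Lemma lamb_zero P : (0 < P)%N -> lamb 0 P = lamb0 P.
Proof.
move=> P0; rewrite lamb_split// sub0r lqN lq0 addr0 /lamb0 mulr_sumr; congr (_ + _).
by apply: eq_bigr => j _; rewrite add0r sub0r lqN mulr_natl mulr2n.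
Qed.

Lemma lamb_lim (x : C) : (forall n : int, x + n%:~R != 0) -> cS x != 0 ->
  (fun m => lamb x (2 ^ m.+1) - lamb0 (2 ^ m.+1)) @ \oo --> 2 * ln (cmod (cS x) / (2 * pi)).
Proof.
move=> hx hS; have x0 : x != 0 by have := hx 0; rewrite addr0.
have hp : 0 < cmod (cS x) / (2 * pi * cmod x) by rewrite divr_gt0 ?mulr_gt0 ?pi_gt0 ?cmod_gt0.
have h1 := rcvg_ln hp (rcvg_sub leqnSn (sine_product x0)).
have h2 := lq_large (- x).
have := rcvgD (rcvgD h2 (rcvg_cst (a := lnsq x))) (rcvgM (rcvg_cst (a := 2)) h1).
have -> : 0 + lnsq x + 2 * ln (cmod (cS x) / (2 * pi * cmod x)) = 2 * ln (cmod (cS x) / (2 * pi)).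
  have -> : cmod (cS x) / (2 * pi * cmod x) = cmod (cS x) / (2 * pi) / cmod x.
    by rewrite [in LHS]invfM mulrA.
  rewrite ln_div ?posrE ?cmod_gt0// ?lq_cmod//; first by ring.
  by rewrite divr_gt0 ?mulr_gt0 ?pi_gt0 ?cmod_gt0.
apply: (rcvg_ev (N := 0%N)) => m _.
rewrite lamb_split ?expn_gt0// /lamb0.
have -> : lnsq (x - (2 ^ m.+1)%:R) = lnsq (- x + (2 ^ m.+1)%:R) by rewrite -lqN opprB addrC.
have -> : \sum_(1 <= j < 2 ^ m.+1) (lnsq (x + j%:R) + lnsq (x - j%:R)) =
   2 * ln (\prod_(1 <= j < 2 ^ m.+1) cmod (1 - (x / j%:R) ^+ 2)) + 2 * \sum_(1 <= j < 2 ^ m.+1) lnsq (j%:R : C).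
  elim: (2 ^ m.+1)%N => [|[|P] IH]; [by rewrite !big_geq// ln1; ring | by rewrite !big_geq// ln1; ring |].
  have Pz : P.+1%:R != 0 :> C by rewrite pnatr_eq0.
  have p1 : x + P.+1%:R != 0 by have := hx P.+1.
  have p2 : x - P.+1%:R != 0 by have := hx (- P.+1%:Z); rewrite intrN.
  have fz : 1 - (x / P.+1%:R) ^+ 2 = - ((x + P.+1%:R) / P.+1%:R * ((x - P.+1%:R) / P.+1%:R)).
    by field.
  have fnz : 1 - (x / P.+1%:R) ^+ 2 != 0 by rewrite fz oppr_eq0 !mulf_neq0 ?invr_eq0.
  have pp : 0 < \prod_(1 <= j < P.+1) cmod (1 - (x / j%:R) ^+ 2).
    rewrite big_nat; apply: prodr_gt0 => j /andP[j1 _]; rewrite cmod_gt0.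
    have jz : j%:R != 0 :> C by rewrite pnatr_eq0 -lt0n.
    have -> : 1 - (x / j%:R) ^+ 2 = - ((x + j%:R) / j%:R * ((x - j%:R) / j%:R)) by field.
    rewrite oppr_eq0 !mulf_neq0 ?invr_eq0//; first by have := hx j.
    by have := hx (- j%:Z); rewrite intrN.
  rewrite !(@big_nat_recr _ _ _ P.+1)//= IH lnM ?posrE ?cmod_gt0// mulrDr -lq_cmod// fz lqN.
  have lqV (a : C) : a != 0 -> lnsq a^-1 = - lnsq a.
    by move=> a0; rewrite /lnsq cmodV exprVn lnV// posrE exprn_gt0// cmod_gt0.
  by rewrite !lqM ?mulf_neq0 ?invr_eq0// !lqV//; ring.
ring.
Qed.

Lemma alt_pairs (f : nat -> C) P :
  \sum_(0 <= i < 2 * P) (-1) ^+ i * f i = \sum_(0 <= j < P) (f (2 * j)%N - f (2 * j).+1).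
Proof.
elim: P => [|P IH]; first by rewrite !big_nil.
rewrite mulnS !big_nat_recr//= IH exprS -signr_odd oddM /= expr0; ring.
Qed.

Lemma lder_boundary (w : C) (j : nat) : cvgs (fun m => lder (w + ((2 * 2 ^ m.+1)%:Z + j%:Z)%:~R) -
   lder (w + (j%:Z - (2 * 2 ^ m.+1)%:Z)%:~R)) 0.
Proof.
have h1 := rcvg_sub leqnSn (lq_large (w + j%:R)); have h2 := rcvg_sub leqnSn (lq_large (- (w + j%:R))).
have := rcvg_cvgs (rcvgD h2 (rcvgM (rcvg_cst (a := -1)) h1)); rewrite mulr0 addr0 rmorph0.
have ld (v : C) : lder v = (- lnsq v)%:C%C by rewrite /lder; case: eqP => // ->; rewrite lq0 oppr0.
apply: cvgs_ext => m; rewrite !ld -rmorphB; congr (_%:C%C).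
have -> : w + ((2 * 2 ^ m.+1)%:Z + j%:Z)%:~R = w + j%:R + (2 ^ m.+2)%:R.
  by rewrite -expnS intrD; rewrite -!pmulrn; ring.
have -> : w + (j%:Z - (2 * 2 ^ m.+1)%:Z)%:~R = - (- (w + j%:R) + (2 ^ m.+2)%:R).
  by rewrite -expnS intrD intrN; rewrite -!pmulrn; ring.
by rewrite lqN; ring.
Qed.

(** The even and odd terms are [2 (w/2 + j)] and [2 (w/2 + 1/2 + j)]: an alternating row is a
    difference of two logarithmic sine products, in which the factors 2 and the normalisations
    cancel. *)
Lemma lder_row (w : C) : (forall n : int, w + n%:~R != 0) -> cS (w / 2) != 0 -> cS (w / 2 + 2^-1) != 0 ->
  cvgs (fun m => \sum_(0 <= i < 4 * 2 ^ m.+1) (-1) ^+ i * lder (w + (i%:Z - (2 * 2 ^ m.+1)%:Z)%:~R))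
   (- 2 * ln (cmod (cS (w / 2)) / cmod (cS (w / 2 + 2^-1))))%:C%C.
Proof.
move=> hw s1 s2.
have n2 : (2 : C) != 0 by rewrite pnatr_eq0.
have hx (n : int) : w / 2 + n%:~R != 0.
  have -> : w / 2 + n%:~R = (w + (2 * n)%:~R) / 2 by rewrite intrM; field.
  by rewrite mulf_neq0 ?invr_eq0// hw.
have hx' (n : int) : w / 2 + 2^-1 + n%:~R != 0.
  have -> : w / 2 + 2^-1 + n%:~R = (w + (2 * n + 1)%:~R) / 2 by rewrite intrD intrM; field.
  by rewrite mulf_neq0 ?invr_eq0// hw.
have h := rcvgD (lamb_lim hx s1) (rcvgM (rcvg_cst (a := -1)) (lamb_lim hx' s2)).
have := rcvg_cvgs (rcvgM (rcvg_cst (a := -1)) h).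
have -> : -1 * (2 * ln (cmod (cS (w / 2)) / (2 * pi)) + -1 * (2 * ln (cmod (cS (w / 2 + 2^-1)) / (2 * pi)))) =
   - 2 * ln (cmod (cS (w / 2)) / cmod (cS (w / 2 + 2^-1))).
  have pp : 0 < 2 * pi :> R by rewrite mulr_gt0 ?pi_gt0.
  by rewrite !ln_div ?posrE ?cmod_gt0//; ring.
apply: cvgs_ext => m; rewrite -[4%N]/(2 * 2)%N -mulnA alt_pairs.
rewrite /lamb; set P := (2 ^ m.+1)%N.
have -> : forall a b c : R, -1 * (a - c + -1 * (b - c)) = - a + b by move=> a b c; ring.
rewrite -sumrN -big_split /= rmorph_sum; apply: eq_bigr => j _.
have e1 : w + ((2 * j)%:Z - (2 * P)%:Z)%:~R = 2 * (w / 2 + j%:R - P%:R).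
  by rewrite intrD intrN -!pmulrn !natrM; field.
have e2 : w + ((2 * j).+1%:Z - (2 * P)%:Z)%:~R = 2 * (w / 2 + 2^-1 + j%:R - P%:R).
  by rewrite intrD intrN -!pmulrn -[(2 * j).+1%:R]natr1 !natrM; field.
have z1 : w / 2 + j%:R - P%:R != 0 by have := hx (j%:Z - P%:Z); rewrite intrD intrN -!pmulrn addrA.
have z2 : w / 2 + 2^-1 + j%:R - P%:R != 0 by have := hx' (j%:Z - P%:Z); rewrite intrD intrN -!pmulrn addrA.
rewrite e1 e2 /lder !mulf_eq0 (negPf n2) (negPf z1) (negPf z2) /= -rmorphB; congr (_%:C%C).
by rewrite !lqM//; ring.
Qed.

(** In the row through the origin the even terms have one member fewer, so a single [lnsq 2] is left
    uncancelled; with the value of the sine product at [1/2] it gives [- 2 ln (pi / 2)]. *)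
Lemma lder_row0 :
  cvgs (fun m => \sum_(0 <= i < 4 * 2 ^ m.+1) (-1) ^+ i * lder ((i%:Z - (2 * 2 ^ m.+1)%:Z)%:~R : C))
   (- 2 * ln (pi / 2 : R))%:C%C.
Proof.
have n2 : (2 : C) != 0 by rewrite pnatr_eq0.
have hx' (n : int) : (2^-1 : C) + n%:~R != 0.
  have -> : (2^-1 : C) + n%:~R = (2 * n + 1)%:~R / 2 by rewrite intrD intrM; field.
  by rewrite mulf_neq0 ?invr_eq0// intr_eq0; lia.
have cs2 : cmod (cS (2^-1 : C)) = 2.
  by rewrite -[2^-1]add0r cS_half oppr0 cE0 cmodM cmod_i mul1r -[1 + 1]/(2%:R) cmod_nat.
have s2 : cS (2^-1 : C) != 0 by rewrite -cmod_gt0 cs2.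
have h := rcvgD (lamb_lim hx' s2) (rcvg_cst (a := 2 * ln (2 : R))).
have := rcvg_cvgs h.
have -> : 2 * ln (cmod (cS (2^-1 : C)) / (2 * pi)) + 2 * ln 2 = - 2 * ln (pi / 2) :> R.
  have pp := pi_gt0 R.
  by rewrite cs2 !ln_div ?posrE ?mulr_gt0// lnM ?posrE//; ring.
apply: cvgs_ext => m; rewrite -[4%N]/(2 * 2)%N -mulnA alt_pairs.
set P := (2 ^ m.+1)%N; have P0 : (0 < P)%N by rewrite expn_gt0.
rewrite -lamb_zero// /lamb.
have -> : 2 * ln (2 : R) = \sum_(0 <= j < 2 * P) (if j == P then lnsq (2 : C) else 0).
  have PP : (P < 2 * P)%N by rewrite mul2n -addnn -{1}[P]addn0 ltn_add2l.
  rewrite (@big_cat_nat _ _ _ P 0 (2 * P)) ?(ltnW PP)//= big_nat big1 ?add0r; last by move=> j /andP[_]; case: ltngtP.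
  rewrite big_ltn// eqxx big_nat big1 ?addr0; last by move=> j /andP[]; case: ltngtP.
  by rewrite lq_cmod// cmod_nat.
rewrite addrAC -big_split /= -sumrB rmorph_sum; apply: eq_bigr => j _.
have e1 : ((2 * j)%:Z - (2 * P)%:Z)%:~R = 2 * (j%:R - P%:R) :> C.
  by rewrite intrD intrN -!pmulrn !natrM; ring.
have e2 : ((2 * j).+1%:Z - (2 * P)%:Z)%:~R = 2 * (2^-1 + j%:R - P%:R) :> C.
  by rewrite intrD intrN -!pmulrn -[(2 * j).+1%:R]natr1 !natrM; field.
have z2 : 2^-1 + j%:R - P%:R != 0 :> C by have := hx' (j%:Z - P%:Z); rewrite intrD intrN -!pmulrn addrA.
rewrite e1 e2 /lder !mulf_eq0 (negPf n2) (negPf z2) /= add0r subr_eq0 eqr_nat [lnsq (2 * (2^-1 + _ - _))]lqM//.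
case: eqP => [->|/eqP jP]; first by rewrite subrr lq0 sub0r -rmorphN; congr (_%:C%C); ring.
have z1 : j%:R - P%:R != 0 :> C by rewrite subr_eq0 eqr_nat.
by rewrite -rmorphB lqM//; congr (_%:C%C); ring.
Qed.

End Rows.

(** * Alternating sums at s = 0, row by row *)

Section Values.
Variable R : realType.
Local Notation C := R[i].

Lemma lat_eta_rows (z : C) k (phi : C -> C) (l : int -> C) :
  summ (fun p => sg R p.2 * ndif k (fun j => phi (lat_pt z p + j%:R)) 0) ->
  (forall (m : int) (j : nat), cvgs (fun q => phi (m%:~R * z + ((2 * 2 ^ q.+1)%:Z + j%:Z)%:~R) -
     phi (m%:~R * z + (j%:Z - (2 * 2 ^ q.+1)%:Z)%:~R)) 0) ->
  (forall m : int, cvgs (fun q => \sum_(0 <= i < 4 * 2 ^ q.+1)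
     (-1) ^+ i * phi (m%:~R * z + (i%:Z - (2 * 2 ^ q.+1)%:Z)%:~R)) (l m)) ->
  sums l ((2 ^+ k)^-1 * tsum (fun p => sg R p.2 * ndif k (fun j => phi (lat_pt z p + j%:R)) 0)).
Proof.
move=> sf hb hl.
have k2 : (2 ^+ k : C) != 0 by rewrite expf_neq0// pnatr_eq0.
have h : sums (fun m => 2 ^+ k * l m) (tsum (fun p => sg R p.2 * ndif k (fun j => phi (lat_pt z p + j%:R)) 0)).
  apply: (sums_pair1 sf _ (summ_hs sf)) => m.
  have sm : summ (fun n => sg R n * ndif k (fun j => phi (lat_pt z (m, n) + j%:R)) 0).
    by apply: (@summ_inj _ _ _ (fun n => (m, n)) _ _ sf) => n n' [].
  have hm := summ_hs sm.
  suff <- : tsum (fun n => sg R n * ndif k (fun j => phi (lat_pt z (m, n) + j%:R)) 0) = 2 ^+ k * l m by [].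
  apply: (@row_sum R (fun n => phi (m%:~R * z + n%:~R)) k _ _ (fun q => 2 ^ q.+1)%N) => //.
    by move=> q; apply: ltnW (ltn_exp2 q).
  apply: eq_sums hm => n; congr (_ * _); apply: ndif_ext => j _.
  by rewrite /lat_pt /= intrD -!pmulrn addrA.
by have := sumsZ ((2 ^+ k)^-1) h; apply: eq_sums => m; rewrite mulrA mulVf ?mul1r.
Qed.

Lemma row_neq0 (z : C) (m n : int) : 0 < complex.Im z -> m != 0 -> m%:~R * z + n%:~R != 0.
Proof.
move=> hz m0; apply/eqP => /(congr1 (@complex.Im _)).
rewrite -!(rmorph_int (real_complex R)); case: z hz => a b /= hz.
rewrite mul0r !addr0 => /eqP; rewrite mulf_eq0 intr_eq0 (negPf m0) /=.
by rewrite gt_eqF.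
Qed.

Lemma lval_row0 : cvgs (fun q => \sum_(0 <= i < 4 * 2 ^ q.+1)
     (-1) ^+ i * lval ((i%:Z - (2 * 2 ^ q.+1)%:Z)%:~R : C)) (-1).
Proof.
apply: cvgs_ext (cvgs_cst (-1)) => q; set P := (2 ^ q.+1)%N.
have P0 : (0 < P)%N by rewrite expn_gt0.
rewrite -[4%N]/(2 * 2)%N -mulnA alt_pairs.
transitivity (\sum_(0 <= j < 2 * P) (if j == P then -1 : C else 0)).
  have PP : (P < 2 * P)%N by lia.
  rewrite (@big_cat_nat _ _ _ P 0 (2 * P)) ?(ltnW PP)//= big_nat big1 ?add0r; last by move=> j /andP[_]; case: ltngtP.
  by rewrite big_ltn// eqxx big_nat big1 ?addr0// => j /andP[]; case: ltngtP.
apply: eq_bigr => j _; rewrite /lval !intr_eq0.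
have -> : (2 * j).+1%:Z - (2 * P)%:Z != 0 by lia.
have -> : ((2 * j)%:Z - (2 * P)%:Z == 0) = (j == P) by lia.
by case: (j == P); rewrite ?subrr ?sub0r.
Qed.

Lemma lval_rowb (w : C) (j : nat) : (exists n : int, w = n%:~R) \/ (forall n : int, w + n%:~R != 0) ->
  cvgs (fun q => lval (w + ((2 * 2 ^ q.+1)%:Z + j%:Z)%:~R) -
     lval (w + (j%:Z - (2 * 2 ^ q.+1)%:Z)%:~R)) 0.
Proof.
case=> [[n ->]|h]; last first.
  by apply: cvgs_ext (cvgs_cst 0) => q; rewrite /lval !h subrr.
apply: (@cvgs_ev _ (fun=> 0) _ _ (`|n|%N + j)) (cvgs_cst 0) => q hq.
have hP := ltn_exp2 q; rewrite /lval -!intrD !intr_eq0.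
have -> : n + ((2 * 2 ^ q.+1)%:Z + j%:Z) != 0 by lia.
have -> : n + (j%:Z - (2 * 2 ^ q.+1)%:Z) != 0 by lia.
by rewrite subrr.
Qed.

Lemma alt_even0 (P : nat) : \sum_(0 <= i < 4 * P) (-1) ^+ i = 0 :> C.
Proof.
rewrite -[4%N]/(2 * 2)%N -mulnA; have := alt_pairs (fun=> 1 : C) (2 * P).
rewrite [RHS]big1 => [h|j _]; last by rewrite subrr.
by rewrite -[RHS]h; apply: eq_bigr => i _; rewrite mulr1.
Qed.

Definition rowd (w : C) : R := - 2 * ln (cmod (cS (w / 2)) / cmod (cS (w / 2 + 2^-1))).

Definition zrow (z : C) (m : int) : C :=
  (if m == 0 then - 2 * ln (pi / 2) else rowd (m%:~R * z))%:C%C.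

Lemma cE_eq1 (x : C) : cE x = 1 -> complex.Im x = 0.
Proof.
move=> /(congr1 (@cmod R)); rewrite cmod1 cmod_cexp => /(congr1 (@ln R)).
rewrite expRK ln1; case: x => a b /=; rewrite mul0r sub0r => /eqP.
by rewrite oppr_eq0 mulf_eq0 gt_eqF ?pi_gt0//= => /eqP.
Qed.

Lemma cS_neq0 (x : C) : complex.Im x != 0 -> cS x != 0.
Proof.
move=> hx; rewrite subr_eq0; apply: contra hx => /eqP h.
have : cE (x + x) = 1 by rewrite cED {1}h -cED addNr cE0.
move/cE_eq1; rewrite raddfD /= => /eqP; rewrite -mulr2n mulrn_eq0 /= => /eqP ->.
by rewrite eqxx.
Qed.

(** The value -1 comes from the row [m = 0], whose alternating sum of ones lacks the origin; the
    other rows sum to 0. The derivative is kept as the sum of the row limits. *)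
Lemma lat_eta_fo0 (z : C) : 0 < complex.Im z -> exists2 l, sums (zrow z) l & first_order (lat_eta z) (-1) l.
Proof.
move=> hz; have [s1 s2 h] := lat_eta_fo hz (isT : (2 < 3)%N).
have d0 (m : int) : (exists n : int, m%:~R * z = n%:~R) \/ (forall n : int, m%:~R * z + n%:~R != 0).
  have [->|m0] := eqVneq m 0; first by left; exists 0; rewrite mul0r.
  by right=> n; exact: row_neq0.
have h1 : sums (fun m : int => if m == 0 then -1 : C else 0) ((2 ^+ 3)^-1 * tsum (fun p => sg R p.2 * ndif 3 (fun j => lval (lat_pt z p + j%:R)) 0)).
  apply: lat_eta_rows => // [m j|m]; first exact: lval_rowb.
  have [->|m0] := eqVneq m 0.
    by apply: cvgs_ext lval_row0 => q; apply: eq_bigr => i _; rewrite mul0r add0r.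
  apply: cvgs_ext (cvgs_cst 0) => q; rewrite -[LHS](alt_even0 (2 ^ q.+1)); apply: eq_bigr => i _.
  by rewrite /lval row_neq0// mulr1.
have h2 : sums (zrow z) ((2 ^+ 3)^-1 * tsum (fun p => sg R p.2 * ndif 3 (fun j => lder (lat_pt z p + j%:R)) 0)).
  apply: lat_eta_rows => // [m j|m]; first exact: lder_boundary.
  rewrite /zrow; have [->|m0] := eqVneq m 0.
    by apply: cvgs_ext (@lder_row0 R) => q; apply: eq_bigr => i _; rewrite mul0r add0r.
  have im0 : complex.Im (m%:~R * z / 2) != 0.
    have -> : m%:~R * z / 2 = (m%:~R / 2)%:C%C * z.
      by rewrite rmorphM fmorphV rmorph_int rmorph_nat; ring.
    case: (z) hz => a b /= hz; rewrite mul0r addr0 mulf_neq0 ?(gt_eqF hz)//.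
    by rewrite mulf_neq0 ?intr_eq0.
  apply: lder_row; [by move=> n; exact: row_neq0|exact: cS_neq0|apply: cS_neq0].
  have e2 : (2^-1 : C) = (2^-1 : R)%:C%C by rewrite fmorphV rmorph_nat.
  have ei (w : C) : complex.Im (w + 2^-1) = complex.Im w by case: w => a b; rewrite e2 /= addr0.
  by rewrite ei.
exists ((2 ^+ 3)^-1 * tsum (fun p => sg R p.2 * ndif 3 (fun j => lder (lat_pt z p + j%:R)) 0)) => //.
have h1' := @sums_single _ _ (fun m : int => if m == 0 then -1 : C else 0) 0.
by rewrite -(sums_unique h1 (h1' _))// => m /negPf ->.
Qed.

Lemma int_eta_fo0 : first_order (@int_eta R) (-1) (- 2 * ln (pi / 2))%:C%C.
Proof.
have [s1 s2 h] := @int_eta_fo R 3 (isT : (2 < 3)%N).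
have k2 : (2 ^+ 3 : C) != 0 by rewrite expf_neq0// pnatr_eq0.
have hP (q : nat) : (q <= 2 ^ q.+1)%N by apply: ltnW (ltn_exp2 q).
have e (phi : C -> C) l : summ (fun n => sg R n * ndif 3 (fun j => phi (int_pt R n + j%:R)) 0) ->
  (forall j : nat, cvgs (fun q => phi (((2 * 2 ^ q.+1)%:Z + j%:Z)%:~R) - phi ((j%:Z - (2 * 2 ^ q.+1)%:Z)%:~R)) 0) ->
  cvgs (fun q => \sum_(0 <= i < 4 * 2 ^ q.+1) (-1) ^+ i * phi ((i%:Z - (2 * 2 ^ q.+1)%:Z)%:~R)) l ->
  (2 ^+ 3)^-1 * tsum (fun n => sg R n * ndif 3 (fun j => phi (int_pt R n + j%:R)) 0) = l.
  move=> s hb hl; suff -> : tsum (fun n => sg R n * ndif 3 (fun j => phi (int_pt R n + j%:R)) 0) = 2 ^+ 3 * l.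
    by rewrite mulrA mulVf ?mul1r.
  apply: (@row_sum R (fun n => phi n%:~R) 3 _ l (fun q => 2 ^ q.+1)%N) => //.
  apply: eq_sums (summ_hs s) => n; congr (_ * _); apply: ndif_ext => j _.
  by rewrite /int_pt intrD -pmulrn.
rewrite (e _ (-1) s1 _ (lval_row0)) in h; last first.
  move=> j; have := @lval_rowb 0 j (or_introl _ (ex_intro _ 0 erefl)).
  by apply: cvgs_ext => q; rewrite !add0r.
rewrite (e _ _ s2 _ (@lder_row0 R)) in h => // j.
by apply: cvgs_ext (lder_boundary 0 j) => q; rewrite !add0r.
Qed.

End Values.

(** * Logarithm of the eta function *)

Section LogSeries.
Variable R : realType.
Local Notation C := R[i].

Definition lgc (x : C) (j : nat) : C := - (x ^+ j.+1 / j.+1%:R).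

Lemma bsum_geo (x : C) : cmod x < 1 -> bsum (fun j => x ^+ j.+1) (cmod x / (1 - cmod x)).
Proof.
move=> x1; have p : 0 < 1 - cmod x by rewrite subr_gt0.
apply: rbs_nat => [j|n]; first exact: cmod_ge0.
rewrite ler_pdivlMr//.
have -> : (\sum_(0 <= j < n) cmod (x ^+ j.+1)) * (1 - cmod x) = cmod x - cmod x ^+ n.+1.
  elim: n => [|n IH]; first by rewrite big_nil mul0r expr1 subrr.
  by rewrite big_nat_recr//= mulrDl IH cmodX !exprS; ring.
by rewrite gerBl exprn_ge0// cmod_ge0.
Qed.

Lemma lgc_le (x : C) j : cmod (lgc x j) <= cmod (x ^+ j.+1).
Proof.
rewrite cmodN cmodM cmodV cmod_nat ler_pdivrMr// ler_peMr ?cmod_ge0//.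
by rewrite ler1n.
Qed.

Lemma bsum_lgc (x : C) : cmod x < 1 -> bsum (lgc x) (cmod x / (1 - cmod x)).
Proof. by move=> x1; apply: bsum_mono (bsum_geo x1) (lgc_le x). Qed.

Lemma bsum_deriv (x : C) : cmod x < 1 -> bsum (fun j => j.+1%:R * x ^+ j) ((1 - cmod x) ^- 2).
Proof.
move=> x1; have p : 0 < 1 - cmod x by rewrite subr_gt0.
apply: rbs_nat => [j|n]; first exact: cmod_ge0.
rewrite -[_ ^- 2]mul1r ler_pdivlMr ?exprn_gt0//.
have -> : (\sum_(0 <= j < n) cmod (j.+1%:R * x ^+ j)) * (1 - cmod x) ^+ 2 =
   1 - n.+1%:R * cmod x ^+ n + n%:R * cmod x ^+ n.+1.
  elim: n => [|n IH]; first by rewrite big_nil mul0r expr0 !mul0r addr0 mulr1 subrr.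
  rewrite big_nat_recr//= mulrDl IH cmodM cmod_nat cmodX !exprS -[n.+2%:R]natr1 -[n.+1%:R]natr1; ring.
have : n%:R * cmod x ^+ n.+1 <= n.+1%:R * cmod x ^+ n.
  rewrite exprS mulrA; apply: ler_wpM2r; first by rewrite exprn_ge0// cmod_ge0.
  apply: le_trans (_ : _ <= n%:R) _; first by rewrite ler_piMr// ltW.
  by rewrite ler_nat.
by lra.
Qed.

Lemma pow_taylor (t h : R) n : 0 <= t -> 0 <= h -> t + h <= 1 ->
  `|(t + h) ^+ n.+1 - t ^+ n.+1 - n.+1%:R * h * t ^+ n| <= (n * n.+1)%:R * h ^+ 2.
Proof.
move=> t0 h0 th; elim: n => [|n IH].
  have -> : (t + h) ^+ 1 - t ^+ 1 - 1 * h * t ^+ 0 = 0 by rewrite expr0; ring.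
  by rewrite normr0 mul0r.
have -> : (t + h) ^+ n.+2 - t ^+ n.+2 - n.+2%:R * h * t ^+ n.+1 =
   (t + h) * ((t + h) ^+ n.+1 - t ^+ n.+1 - n.+1%:R * h * t ^+ n) + n.+1%:R * h ^+ 2 * t ^+ n.
  by rewrite -[n.+2%:R]natr1 !exprS; ring.
have t1 : t <= 1 by lra.
apply: le_trans (ler_normD _ _) _; rewrite normrM (ger0_norm (addr_ge0 t0 h0)).
have h1 : (t + h) * `|(t + h) ^+ n.+1 - t ^+ n.+1 - n.+1%:R * h * t ^+ n| <= (n * n.+1)%:R * h ^+ 2.
  by apply: le_trans IH; rewrite ler_piMl.
have h2 : `|n.+1%:R * h ^+ 2 * t ^+ n| <= n.+1%:R * h ^+ 2.
  rewrite ger0_norm ?mulr_ge0 ?exprn_ge0//.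
  by rewrite ler_piMr ?mulr_ge0 ?exprn_ge0// exprn_ile1.
have h3 : 0 <= n.+1%:R * h ^+ 2 by rewrite mulr_ge0 ?exprn_ge0.
have -> : (n.+1 * n.+2)%:R * h ^+ 2 = (n * n.+1)%:R * h ^+ 2 + 2 * (n.+1%:R * h ^+ 2).
  by rewrite !natrM -[n.+2%:R]natr1 -[n.+1%:R]natr1; ring.
lra.
Qed.

(** Cutting [[0, 1]] into [n] steps bounds the total change by [n K / n^2]. This takes the place of
    a vanishing derivative. *)
Lemma flat (f : R -> C) (K h0 : R) : 0 < h0 ->
  (forall t h, 0 <= t -> 0 <= h -> h <= h0 -> t + h <= 1 -> cmod (f (t + h) - f t) <= K * h ^+ 2) ->
  f 1 = f 0.
Proof.
move=> h00 hf; apply/eqP; rewrite -subr_eq0 -cmod_eq0 eq_le cmod_ge0 andbT.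
have K0 : 0 <= K.
  pose h := Num.min h0 1; have hp : 0 < h by rewrite lt_min h00 ltr01.
  have H1 : h <= h0 by rewrite ge_min lexx.
  have H2 : 0 + h <= 1 by rewrite add0r ge_min lexx orbT.
  have H := hf 0 h (lexx _) (ltW hp) H1 H2.
  by have := le_trans (cmod_ge0 _) H; rewrite pmulr_lge0// exprn_gt0.
apply/ler_addgt0Pr => e e0; rewrite add0r.
pose n := (Num.trunc (h0^-1 + K / e)).+1.
have hn : h0^-1 + K / e < n%:R by rewrite /n; apply: truncnS_gt.
have n0 : (0 : R) < n%:R by [].
have nh : n%:R^-1 <= h0.
  rewrite -[h0]invrK lef_pV2 ?posrE ?invr_gt0//; apply: ltW; apply: le_lt_trans hn.
  by rewrite lerDl divr_ge0// ltW.
have step i : (i <= n)%N -> cmod (f (i%:R / n%:R) - f 0) <= i%:R * (K * n%:R^-1 ^+ 2).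
  elim: i => [|i IH] hi; first by rewrite !mul0r subrr cmod0.
  have -> : f (i.+1%:R / n%:R) - f 0 = (f (i%:R / n%:R + n%:R^-1) - f (i%:R / n%:R)) + (f (i%:R / n%:R) - f 0).
    by rewrite -[i.+1%:R]natr1 mulrDl mul1r; ring.
  apply: le_trans (cmodD _ _) _; rewrite -natr1 mulrDl mul1r addrC; apply: lerD; first exact: IH (ltnW hi).
  have q1 : 0 <= i%:R / n%:R :> R by rewrite divr_ge0.
  have q2 : 0 <= n%:R^-1 :> R by rewrite invr_ge0.
  apply: hf => //; rewrite -{2}[n%:R^-1]mul1r -mulrDl ler_pdivrMr// mul1r natr1 ler_nat//.
have := step n (leqnn _); rewrite divff ?gt_eqF// => H; apply: le_trans H _.
have -> : n%:R * (K * n%:R^-1 ^+ 2) = K / n%:R by field; rewrite gt_eqF.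
rewrite ler_pdivrMr// -ler_pdivrMl// mulrC; apply: ltW; apply: le_lt_trans hn.
by rewrite lerDr invr_ge0 ltW.
Qed.

Lemma Lg_taylor (x : C) : cmod x < 1 -> exists K : R, 0 <= K /\ forall t h : R, 0 <= t -> 0 <= h -> t + h <= 1 ->
  cmod (tsum (lgc ((t + h)%:C%C * x)) - tsum (lgc (t%:C%C * x)) + h%:C%C * x / (1 - t%:C%C * x)) <= K * h ^+ 2.
Proof.
move=> x1; have p : 0 < 1 - cmod x by rewrite subr_gt0.
have lt1 (t : R) : 0 <= t -> t <= 1 -> cmod (t%:C%C * x) < 1.
  move=> t0 t1; rewrite cmodM cmod_real ger0_norm//; apply: le_lt_trans x1.
  by rewrite ler_piMl// cmod_ge0.
exists ((1 - cmod x) ^- 2); split=> [|t h t0 h0 th]; first by rewrite invr_ge0 exprn_ge0// ltW.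
have t1 : t <= 1 by lra.
have a1 := lt1 _ (addr_ge0 t0 h0) th; have a2 := lt1 _ t0 t1.
have H1 : sums (lgc ((t + h)%:C%C * x)) (tsum (lgc ((t + h)%:C%C * x))) by apply: summ_hs; eexists; apply: bsum_lgc.
have H2 : sums (lgc (t%:C%C * x)) (tsum (lgc (t%:C%C * x))) by apply: summ_hs; eexists; apply: bsum_lgc.
have [_ H3] := sums_geo a2.
have H := sumsD (sumsD H1 (sumsZ (-1) H2)) (sumsZ (h%:C%C * x) H3).
have := sums_tail _ H; rewrite mulN1r; apply.
have := bsumZ (h%:C%C ^+ 2) (bsum_deriv x1).
rewrite cmodX cmod_real (ger0_norm h0) mulrC => b; apply: bsum_mono b _ => j.
have nz : j.+1%:R != 0 :> C by rewrite pnatr_eq0.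
have -> : lgc ((t + h)%:C%C * x) j + -1 * lgc (t%:C%C * x) j + h%:C%C * x * (t%:C%C * x) ^+ j =
   - ((x ^+ j.+1 / j.+1%:R) * ((t + h) ^+ j.+1 - t ^+ j.+1 - j.+1%:R * h * t ^+ j)%:C%C).
  rewrite /lgc !exprMn !rmorphB !rmorphM !rmorphXn rmorph_nat [x ^+ j.+1]exprS; field; by rewrite addrC natr1 nz.
rewrite cmodN cmodM cmod_real.
apply: le_trans (ler_wpM2l (cmod_ge0 _) (pow_taylor j t0 h0 th)) _.
rewrite !cmodM cmodV !cmod_nat !cmodX cmod_real (ger0_norm h0) natrM [cmod x ^+ _.+1]exprS.
have -> : cmod x * cmod x ^+ j / j.+1%:R * (j%:R * j.+1%:R * h ^+ 2) = cmod x * (j%:R * (h ^+ 2 * cmod x ^+ j)).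
  by field; rewrite addrC natr1 pnatr_eq0.
have hh : 0 <= h ^+ 2 * cmod x ^+ j by rewrite mulr_ge0 ?exprn_ge0 ?cmod_ge0.
apply: le_trans (_ : _ <= j%:R * (h ^+ 2 * cmod x ^+ j)) _.
  by apply: ler_piMl; [apply: mulr_ge0|exact: ltW].
have -> : h * h * (j.+1%:R * cmod x ^+ j) = j.+1%:R * (h ^+ 2 * cmod x ^+ j) by ring.
by rewrite ler_wpM2r// ler_nat.
Qed.

(** With [L] the logarithm series, [(1 - t x) exp(-L(t x))] is constant for [t] in [[0, 1]], since
    its increments are of second order, and it equals 1 at [t = 0]. *)
Lemma cexp_Lg (x : C) : cmod x < 1 -> cexp (tsum (lgc x)) = 1 - x.
Proof.
move=> x1; have p : 0 < 1 - cmod x by rewrite subr_gt0.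
have [K1 [K10 hK]] := Lg_taylor x1.
pose A := (1 - cmod x)^-1; have A0 : 0 < A by rewrite invr_gt0.
pose B := A + K1; have B0 : 0 < B by rewrite /B ltr_pwDl.
pose f (t : R) : C := (1 - t%:C%C * x) * cexp (- tsum (lgc (t%:C%C * x))).
have lt1 (t : R) : 0 <= t -> t <= 1 -> cmod (t%:C%C * x) <= cmod x.
  by move=> t0 t1; rewrite cmodM cmod_real ger0_norm// ler_piMl// cmod_ge0.
have d1 (t : R) : 0 <= t -> t <= 1 -> 1 - cmod x <= cmod (1 - t%:C%C * x).
  move=> t0 t1; have := cmod_geB 1 (- (t%:C%C * x)); rewrite cmod1 cmodN.
  by apply: le_trans; rewrite lerD2l lerN2 lt1.
pose F := 2 * expR (cmod x * A).
have hF (t : R) : 0 <= t -> t <= 1 -> cmod (f t) <= F.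
  move=> t0 t1; rewrite cmodM; apply: ler_pM; rewrite ?cmod_ge0//.
    apply: le_trans (cmodB _ _) _; rewrite cmod1 -[2]/(1 + 1) lerD2l.
    by apply: le_trans (lt1 _ t0 t1) (ltW x1).
  rewrite cmod_cexp ler_expR; apply: le_trans (ler_norm _) _; apply: le_trans (cmod_Re _) _.
  rewrite cmodN; apply: le_trans (cmod_tsum (bsum_lgc (le_lt_trans (lt1 _ t0 t1) x1))) _.
  apply: ler_pM; rewrite ?cmod_ge0 ?lt1//; first by rewrite invr_ge0 subr_ge0; apply: le_trans (lt1 _ t0 t1) (ltW x1).
  rewrite lef_pV2 ?posrE//; first by rewrite lerD2l lerN2 lt1.
  by rewrite subr_gt0; apply: le_lt_trans (lt1 _ t0 t1) x1.
pose K := K1 + A * B + (1 + A) * (expR 1 * B ^+ 2).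
suff E : f 1 = f 0.
  move: E; rewrite /f rmorph1 rmorph0 !mul1r !mul0r subr0 mul1r.
  have -> : tsum (lgc (0 : C)) = 0.
    apply: tsumE; apply: eq_sums (@sums0 R nat) => j.
    by rewrite /lgc expr0n mul0r oppr0.
  rewrite oppr0 cexp0 cexpN => E; apply/esym/eqP; rewrite -(mulfVK (cexp_neq0 (tsum (lgc x))) (1 - x)) E.
  by rewrite mul1r.
apply: (@flat f (F * K) (Num.min 1 B^-1)); first by rewrite lt_min ltr01 invr_gt0.
move=> t h t0 h0; rewrite le_min => /andP[h1 hB] th.
have t1 : t <= 1 by lra.
set u := h%:C%C * x / (1 - t%:C%C * x).
have dz : 1 - t%:C%C * x != 0 by rewrite -cmod_gt0; apply: lt_le_trans (d1 _ t0 t1).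
have uA : cmod u <= A * h.
  rewrite /u !cmodM cmodV cmod_real (ger0_norm h0) mulrC; apply: ler_pM; rewrite ?mulr_ge0 ?cmod_ge0//.
  - by rewrite invr_ge0 cmod_ge0.
  - by rewrite lef_pV2 ?posrE ?d1// cmod_gt0.
  by rewrite ler_piMr// ltW.
set e := tsum (lgc ((t + h)%:C%C * x)) - tsum (lgc (t%:C%C * x)) + u.
have he : cmod e <= K1 * h ^+ 2 := hK t h t0 h0 th.
have hh : h ^+ 2 <= h by rewrite expr2 ler_piMl.
have wB : cmod (u - e) <= B * h.
  apply: le_trans (cmodB _ _) _; rewrite mulrDl lerD//; apply: le_trans he _.
  by rewrite ler_wpM2l.
have w1 : cmod (u - e) <= 1.
  by apply: le_trans wB _; rewrite -ler_pdivlMl// mulr1.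
have := cexp_taylor1 w1; set rho := cexp (u - e) - 1 - (u - e) => hr.
(* [1 - (t + h) x] is [(1 - t x)(1 - u)], and the logarithm series changes by [e - u]; the quotient
   [f (t + h) / f t] is therefore [(1 - u) exp(u - e)], whose first-order terms in [u] cancel. *)
have -> : f (t + h) - f t = f t * (- e - u * (u - e) + (1 - u) * rho).
  rewrite /rho /f; have -> : 1 - (t + h)%:C%C * x = (1 - t%:C%C * x) * (1 - u) by rewrite /u rmorphD; field.
  rewrite /e; move: (tsum (lgc ((t + h)%:C%C * x))) (tsum (lgc (t%:C%C * x))) => a b.
  have -> : - a = - b + (u - (a - b + u)) by ring.
  rewrite cexpD; move: (cexp (u - _)) (cexp (- b)) => E1 E2; ring.
rewrite cmodM -mulrA; apply: ler_pM; rewrite ?cmod_ge0 ?hF//.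
apply: le_trans (cmodD _ _) _; apply: le_trans (_ : _ <= (K1 * h ^+ 2 + A * h * (B * h)) + (1 + A) * (expR 1 * (B * h) ^+ 2)) _; last first.
  by rewrite le_eqVlt; apply/orP; left; apply/eqP; rewrite /K; ring.
apply: lerD.
  apply: le_trans (cmodB _ _) _; rewrite cmodN lerD// cmodM.
  by apply: ler_pM; rewrite ?cmod_ge0.
rewrite cmodM; apply: ler_pM; rewrite ?cmod_ge0//.
  apply: le_trans (cmodB _ _) _; rewrite cmod1 lerD2l; apply: le_trans uA _.
  by rewrite ler_piMr// ltW.
apply: le_trans hr _; rewrite ler_wpM2l ?expR_ge0//.
by rewrite lerXn2r ?nnegrE ?cmod_ge0// mulr_ge0// ltW.
Qed.

Lemma ln_cmod1B (x : C) : cmod x < 1 -> ln (cmod (1 - x)) = complex.Re (tsum (lgc x)).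
Proof. by move=> /cexp_Lg <-; rewrite cmod_cexp expRK. Qed.

End LogSeries.

(** * The eta product and its logarithm *)

Section EtaLog.
Variable R : realType.
Local Notation C := R[i].

Definition nome (z : C) : C := cE (2 * z).

Lemma im_mul_nat (n : nat) (z : C) : complex.Im (n%:R * z) = n%:R * complex.Im z.
Proof. by rewrite -(rmorph_nat (real_complex R)); case: z => a b /=; rewrite mul0r addr0. Qed.

Lemma im_nat_gt0 (n : nat) (z : C) : (0 < n)%N -> 0 < complex.Im z -> 0 < complex.Im (n%:R * z).
Proof. by move=> n0 hz; rewrite im_mul_nat mulr_gt0// ltr0n. Qed.

Lemma cmod_cE (x : C) : cmod (cE x) = expR (- (pi * complex.Im x)).
Proof. by rewrite cmod_cexp; case: x => a b /=; rewrite mul0r sub0r. Qed.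

Lemma cmod_qv (z : C) : cmod (nome z) = expR (- (2 * pi * complex.Im z)).
Proof. by rewrite cmod_cE im_mul_nat mulrCA mulrA. Qed.

Lemma nome_lt1 (z : C) : 0 < complex.Im z -> cmod (nome z) < 1.
Proof. by move=> hz; rewrite cmod_qv expR_lt1 oppr_lt0 !mulr_gt0// pi_gt0. Qed.

Lemma cEX (x : C) n : cE x ^+ n = cE (n%:R * x).
Proof. by rewrite /cE cexpX mulrCA. Qed.

(** The logarithm of the product of [1 - q^m], as an absolutely convergent double series. Summed
    over the second index first it gives the eta product; summed over [m] first it becomes a Lambert
    series, the form suited to the limit at the real axis. *)
Definition hterm (z : C) (p : nat * nat) : C := lgc (nome z ^+ p.1.+1) p.2.
Definition eta_clog (z : C) : C := tsum (hterm z).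
Definition eta_log (z : C) : R := complex.Re (eta_clog z).

Lemma qvX_lt1 (z : C) n : 0 < complex.Im z -> cmod (nome z ^+ n.+1) <= cmod (nome z).
Proof.
move=> /nome_lt1/ltW h; rewrite cmodX exprS ler_piMr ?cmod_ge0//.
by rewrite exprn_ile1// cmod_ge0.
Qed.

Lemma bsum_hterm (z : C) : 0 < complex.Im z ->
  bsum (hterm z) (cmod (nome z) / (1 - cmod (nome z)) ^+ 2).
Proof.
move=> hz; have q1 := nome_lt1 hz; have p : 0 < 1 - cmod (nome z) by rewrite subr_gt0.
apply: (@bsum_pair _ _ _ (fun m j => lgc (nome z ^+ m.+1) j) (fun m => cmod (nome z ^+ m.+1) / (1 - cmod (nome z)))).
  move=> m; apply: bsum_le (bsum_lgc (le_lt_trans (qvX_lt1 m hz) q1)) _.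
  rewrite ler_wpM2l ?cmod_ge0// lef_pV2 ?posrE// ?lerD2l ?lerN2 ?qvX_lt1//.
  by rewrite subr_gt0; apply: le_lt_trans (qvX_lt1 m hz) q1.
move=> J; rewrite -mulr_suml expr2 invfM mulrA ler_wpM2r ?invr_ge0 ?(ltW p)//.
exact: bsum_geo.
Qed.

Lemma sums_Re (I : choiceType) (f : I -> C) l : sums f l ->
  sums (fun i => (complex.Re (f i))%:C%C) (complex.Re l)%:C%C.
Proof.
move=> h e e0; have [J hJ] := h e e0; exists J => K JK; apply: le_lt_trans (hJ K JK).
by rewrite -rmorph_sum -rmorphB cmod_real -raddf_sum -raddfB cmod_Re.
Qed.

Lemma sums_Hrows (z : C) : 0 < complex.Im z -> sums (fun m => tsum (lgc (nome z ^+ m.+1))) (eta_clog z).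
Proof.
move=> hz; have q1 := nome_lt1 hz.
have s : summ (hterm z) by eexists; apply: bsum_hterm.
apply: (sums_pair1 s _ (summ_hs s)) => m; apply: summ_hs; eexists.
exact: bsum_lgc (le_lt_trans (qvX_lt1 m hz) q1).
Qed.

Definition lnq (z : C) (m : nat) : R := ln (cmod (1 - nome z ^+ m.+1)).

Lemma sums_Hr (z : C) : 0 < complex.Im z -> sums (fun m => (lnq z m)%:C%C) (eta_log z)%:C%C.
Proof.
move=> hz; apply: eq_sums (sums_Re (sums_Hrows hz)) => m; rewrite /lnq ln_cmod1B//.
by apply: le_lt_trans (qvX_lt1 m hz) (nome_lt1 hz).
Qed.

Lemma summ_lnq (z : C) : 0 < complex.Im z -> summ (fun m => (lnq z m)%:C%C).
Proof.
move=> hz; have q1 := nome_lt1 hz; have p : 0 < 1 - cmod (nome z) by rewrite subr_gt0.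
exists (cmod (nome z) / (1 - cmod (nome z)) ^+ 2) => J.
rewrite expr2 invfM mulrA; apply: le_trans (_ : _ <= (\sum_(m <- J) cmod (nome z ^+ m.+1)) / (1 - cmod (nome z))) _; last first.
  by rewrite ler_wpM2r ?invr_ge0 ?(ltW p)//; apply: bsum_geo.
rewrite mulr_suml; apply: ler_sum => m _; have qm := le_lt_trans (qvX_lt1 m hz) q1.
rewrite cmod_real /lnq ln_cmod1B//; apply: le_trans (cmod_Re _) _; apply: le_trans (cmod_tsum (bsum_lgc qm)) _.
rewrite ler_wpM2l ?cmod_ge0// lef_pV2 ?posrE ?subr_gt0//.
by rewrite lerD2l lerN2 qvX_lt1.
Qed.

Lemma rowdN (w : C) : rowd (- w) = rowd w.
Proof.
rewrite /rowd !cS_half [- w / 2]mulNr; congr (_ * ln (_ / _)); first by rewrite cSN cmodN.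
by rewrite !cmodM opprK addrC.
Qed.

(** With [u = q^(m+1)], the two sines have moduli [|1 - u|] and [|1 + u|] times the same
    exponential; and [1 + u] is the quotient of [1 - u^2] by [1 - u], where [u^2] belongs to
    [2 z]. *)
Lemma rowd_q (z : C) m : 0 < complex.Im z ->
  rowd (m.+1%:R * (2 * z)) = - 4 * lnq z m + 2 * lnq (2 * z) m.
Proof.
move=> hz; have q1 := nome_lt1 hz; set u := nome z ^+ m.+1.
have u1 : cmod u < 1 := le_lt_trans (qvX_lt1 m hz) q1.
have n1 : 1 - u != 0.
  apply: contraTneq u1 => h; have -> : u = 1 - (1 - u) by ring.
  by rewrite h subr0 cmod1 ltxx.
have n2 : 1 + u != 0.
  apply: contraTneq u1 => h; have -> : u = (1 + u) - 1 by ring.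
  by rewrite h sub0r cmodN cmod1 ltxx.
have -> : lnq (2 * z) m = ln (cmod (1 - u)) + ln (cmod (1 + u)).
  rewrite -lnM ?posrE ?cmod_gt0// -cmodM /lnq; congr (ln (cmod _)).
  have -> : nome (2 * z) ^+ m.+1 = u * u; last by ring.
  by rewrite /u /nome -exprMn -cED; congr (cE _ ^+ _); ring.
rewrite -/u {1}/lnq -/u /rowd.
set x := m.+1%:R * (2 * z) / 2; have n02 : (2 : C) != 0 by rewrite pnatr_eq0.
have ex : x = m.+1%:R * z by rewrite /x; field.
have eu : cE x = cE (- x) * u.
  by rewrite /u /nome cEX -cED ex; congr cE; ring.
have -> : cmod (cS x) = cmod (cE (- x)) * cmod (1 - u).
  by rewrite /cS {1}eu -cmodM -cmodN; congr cmod; ring.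
have -> : cmod (cS (x + 2^-1)) = cmod (cE (- x)) * cmod (1 + u).
  by rewrite cS_half cmodM cmod_i mul1r {1}eu -cmodM; congr cmod; ring.
have e0 : 0 < cmod (cE (- x)) by rewrite cmod_gt0 cE_neq0.
rewrite ln_div ?posrE ?mulr_gt0 ?cmod_gt0 ?cE_neq0//.
by rewrite !lnM ?posrE ?cmod_gt0 ?cE_neq0//; ring.
Qed.

Lemma sums_int (f : nat -> C) (c a : C) : summ f -> sums f a ->
  sums (fun n : int => match n with Posz 0 => c | Posz m.+1 => f m | Negz m => f m end) (c + 2 * a).
Proof.
move=> sf hf.
have h0 := @sums_single R _ (fun n : int => if n == 0 then c else 0) 0 (fun i => fun h => ifN _ _ h).
have h1 : sums (fun n : int => if n is Posz m.+1 then f m else 0) a.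
  apply: (@sums_embed _ _ _ (fun m : nat => Posz m.+1) f) => //; first by move=> i j [].
  by case=> [[|m]|m] // /(_ m); rewrite eqxx.
have h2 : sums (fun n : int => if n is Negz m then f m else 0) a.
  apply: (@sums_embed _ _ _ Negz f) => //; first by move=> i j [].
  by case=> [m|m] // /(_ m); rewrite eqxx.
rewrite mulr_natl mulr2n addrA.
by apply: eq_sums (sumsD (sumsD h0 h1) h2) => -[[|m]|m] /=; rewrite ?addr0 ?add0r.
Qed.

(** Rows [m] and [-m] have equal limits, which doubles the sum over [m >= 1]. The lattice parameter
    is [2 z] because a row through [w] involves the sine at [w / 2]. *)
Lemma lat_eta_fo2 (z : C) : 0 < complex.Im z ->
  first_order (lat_eta (2 * z)) (-1) (- 2 * ln (pi / 2) - 8 * eta_log z + 4 * eta_log (2 * z))%:C%C.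
Proof.
move=> hz; have hz2 := im_nat_gt0 (isT : (0 < 2)%N) hz.
have [l hl hfo] := lat_eta_fo0 hz2; suff -> : (- 2 * ln (pi / 2) - 8 * eta_log z + 4 * eta_log (2 * z))%:C%C = l by [].
apply: sums_unique hl.
have s1 := summZ (- 4) (summ_lnq hz); have s2 := summZ 2 (summ_lnq hz2).
have h := sumsD (sumsZ (- 4) (sums_Hr hz)) (sumsZ 2 (sums_Hr hz2)).
have H := sums_int (- 2 * ln (pi / 2))%:C%C (summD s1 s2) h.
have -> : (- 2 * ln (pi / 2) - 8 * eta_log z + 4 * eta_log (2 * z))%:C%C =
  (- 2 * ln (pi / 2))%:C%C + 2 * (- 4 * (eta_log z)%:C%C + 2 * (eta_log (2 * z))%:C%C).
  move: (- 2 * ln (pi / 2)) (eta_log z) (eta_log (2 * z)) => a b c.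
  by rewrite !rmorphD !rmorphN !rmorphM !rmorph_nat; ring.
have E m : - 4 * (lnq z m)%:C%C + 2 * (lnq (2 * z) m)%:C%C = (rowd (m.+1%:R * (2 * z)))%:C%C.
  rewrite rowd_q//; move: (lnq z m) (lnq (2 * z) m) => a b.
  by rewrite rmorphD !rmorphM rmorphN !rmorph_nat.
apply: eq_sums H => -[[|m]|m]; rewrite /zrow //= E //.
by rewrite NegzE intrN mulNr rowdN.
Qed.

Lemma cvgs_cexp (u : nat -> C) l : cvgs u l -> cvgs (fun n => cexp (u n)) (cexp l).
Proof.
move=> hu.
have h : cvgs (fun n => cexp (u n - l)) 1.
  have h : cvgs (fun n => (u n - l) / ipi R) 0.
    have := cvgsM (cvgsD hu (cvgs_cst (- l))) (cvgs_cst (ipi R)^-1).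
    by rewrite subrr mul0r.
  apply: cvgs_ext (cvgs_cE h) => n; rewrite /cE mulrC mulfVK//.
  by rewrite -cmod_gt0 cmod_ipi pi_gt0.
have := cvgsM (cvgs_cst (cexp l)) h; rewrite mulr1; apply: cvgs_ext => n.
by rewrite -cexpD addrC subrK.
Qed.

Lemma eta_exp (z : C) : 0 < complex.Im z ->
  dedekind_eta z = cexp ((pi / 12)%:C%C * 'i%C * z + eta_clog z).
Proof.
move=> hz; rewrite /dedekind_eta cexpD; congr (_ * _); apply: cvg_lim => //.
apply/cvgsP; have := cvgs_cexp (sums_cvgs (sums_Hrows hz)); apply: cvgs_ext => n.
elim: n => [|n IH]; first by rewrite !big_geq// cexp0.
rewrite big_nat_recr//= cexpD IH (@big_nat_recr _ _ _ n.+1 1)//=; congr (_ * _).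
rewrite cexp_Lg; last by apply: le_lt_trans (qvX_lt1 n hz) (nome_lt1 hz).
congr (1 - _); rewrite /nome cEX /cE; congr cexp.
have -> : (0 +i* pi)%C = pi%:C%C * 'i%C :> C.
  by apply/eqP; rewrite eq_complex /=; apply/andP; split; apply/eqP; ring.
by rewrite !rmorphM !rmorph_nat; ring.
Qed.

(** The exponent is [24 / 6 = 4], and the prefactor of eta contributes [- pi Im z / 3]. The height
    [y] is a separate variable because Delta is evaluated at multiples of the point whose height
    enters. *)
Lemma ln_Delta (z : C) (y : R) : 0 < complex.Im z -> 0 < y ->
  ln (cmod (Delta z) `^ 6^-1 * y) = 4 * eta_log z - pi * complex.Im z / 3 + ln y.
Proof.
move=> hz y0; rewrite /Delta cmodX eta_exp// cmod_cexp -expRM_natl.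
rewrite lnM ?posrE ?powR_gt0 ?expR_gt0// ln_powR expRK; congr (_ + _).
rewrite raddfD /= -/(eta_log z).
have -> : complex.Re ((pi / 12)%:C%C * 'i%C * z) = - (pi / 12 * complex.Im z).
  by case: (z) => a b /=; rewrite !mul0r !mulr0 !mulr1 subrr addr0 mul0r sub0r.
by field.
Qed.

End EtaLog.

(** * The derivative of the Epstein zeta function at 0, up to a homogeneous remainder *)

Section Continuation.
Variable R : realType.
Local Notation C := R[i].

Lemma mero_cst c : mero (fun _ : C => c). Proof. by move=> s; exact/ana_mero0/ana_cst. Qed.

Lemma mero_exp (l : R) : mero (fun s : C => cexp (s * l%:C%C)).
Proof. by move=> s; exact/ana_mero0/ana_exp. Qed.

Lemma mero_mul (f g : C -> C) : mero f -> mero g -> mero (fun s => f s * g s).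
Proof. by move=> hf hg s; apply: mero0_mul. Qed.

Lemma mero_add (f g : C -> C) : mero f -> mero g -> mero (fun s => f s + g s).
Proof. by move=> hf hg s; apply: mero0_add. Qed.

Lemma mero_inv (f : C -> C) : mero f -> mero (fun s => (f s)^-1).
Proof. by move=> hf s; apply: mero0_inv. Qed.

Lemma mero_eq (f g : C -> C) : mero f -> mero g ->
  (forall s, 1 < complex.Re s -> f s = g s) -> near_off 0 (fun s => f s = g s).
Proof.
move=> hf hg h.
have : near_off 0 (fun s => f s + -1 * g s = 0).
  apply: mero_identity; first by apply: mero_add => //; apply: mero_mul => //; exact: mero_cst.
  by move=> s /h ->; rewrite mulN1r subrr.
by apply: near_off_mono => s _; rewrite mulN1r => /eqP; rewrite subr_eq0 => /eqP.
Qed.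

Definition den4 (s : C) : C := 4 * cexp (s * (- lnsq (2%:R : C))%:C%C) - 1.

Lemma den4_ana s0 : analytic_at s0 den4.
Proof. by apply: ana_add; [apply: ana_mul; [exact: ana_cst|exact: ana_exp]|exact: ana_cst]. Qed.

Lemma den4_0 : den4 0 = 3.
Proof. by rewrite /den4 mul0r cexp0; ring. Qed.

Lemma den4_neq0 s : 1 < complex.Re s -> den4 s != 0.
Proof.
move=> /cmod_pow2 h; rewrite subr_eq0; apply: contraTneq h => /(congr1 (@cmod R)).
rewrite cmodM cmod_nat cmod1 => h; rewrite -leNgt.
have : 4 * cmod (cexp (s * (- lnsq (2%:R : C))%:C%C)) = 4 * 4^-1 by rewrite h divff.
by move/mulfI => ->.
Qed.

(* The three classes of lattice points that are nonzero modulo 2 are alternating sums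
   up to the full lattice sum; solving for the latter gives this quotient. *)
Definition lat_zeta_ext (z s : C) : C :=
  (lat_eta z s + lat_eta (z + 1) s + cexp (s * (- lnsq z)%:C%C) * lat_eta (- z^-1) s) / den4 s.

Definition num4 (z s : C) : C := lat_eta z s + lat_eta (z + 1) s + cexp (s * (- lnsq z)%:C%C) * lat_eta (- z^-1) s.

Lemma num4_ana (z s0 : C) : 0 < complex.Im z -> analytic_at s0 (num4 z).
Proof.
move=> hz; apply: ana_add; first by apply: ana_add; apply: lat_eta_ana; rewrite ?shear1_im.
by apply: ana_mul; [exact: ana_exp|apply: lat_eta_ana; exact: inv_im].
Qed.

Lemma lat_zeta_ext_mero (z : C) : 0 < complex.Im z -> mero (lat_zeta_ext z).
Proof.
move=> hz; apply: (@mero_mul (num4 z)); first by move=> s; exact/ana_mero0/num4_ana.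
by apply: mero_inv => s; exact/ana_mero0/den4_ana.
Qed.

Lemma lat_zeta_ext_Zs (z s : C) : 0 < complex.Im z -> 1 < complex.Re s -> lat_zeta_ext z s = lat_zeta z s.
Proof.
move=> hz s1; have nz := den4_neq0 s1; have h := lat_zeta_three hz s1.
apply: (mulIf nz); rewrite mulfVK//; move: h; rewrite /den4 mulrBr mulr1 [lat_zeta z s * _]mulrC => <-.
move: (lat_zeta z s) (lat_eta z s) (lat_eta (z + 1) s) (cexp _ * _) => a b c d; ring.
Qed.

(** Each of the three alternating sums is -1 at 0, and [den4] is 3 there. Only the existence of the
    slope is recorded, since its direct expression would involve [eta_log] at inverted points. *)
Lemma lat_zeta_ext_fo0 (z : C) : 0 < complex.Im z -> exists d, first_order (lat_zeta_ext z) (-1) d.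
Proof.
move=> hz; have nz : den4 0 != 0 by rewrite den4_0 pnatr_eq0.
have hD : analytic_at 0 (lat_zeta_ext z) by apply: (@ana_mul _ _ (num4 z)); [exact: num4_ana|exact: ana_inv (den4_ana 0) nz].
have [d hd] := ana_fo hD; exists d; suff <- : lat_zeta_ext z 0 = -1 by [].
have [l1 _ h1] := lat_eta_fo0 hz; have [l2 _ h2] := lat_eta_fo0 (shear1_im hz); have [l3 _ h3] := lat_eta_fo0 (inv_im hz).
have [b hb] := ana_fo (num4_ana 0 hz).
have [e _] := first_order_unique hb (first_order_add (first_order_add h1 h2) (first_order_mul (first_order_exp (- lnsq z)) h3)).
by rewrite /lat_zeta_ext -/(num4 z 0) e den4_0; field.
Qed.

Definition lat_zeta_slope (z : C) : C := xget 0 [set d | first_order (lat_zeta_ext z) (-1) d].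

Lemma lat_zeta_slope_fo (z : C) : 0 < complex.Im z -> first_order (lat_zeta_ext z) (-1) (lat_zeta_slope z).
Proof. by move=> /lat_zeta_ext_fo0[d hd]; exact: (@xgetPex _ 0 [set d | first_order (lat_zeta_ext z) (-1) d] (ex_intro _ d hd)). Qed.

Lemma lq2 : lnsq (2%:R : C) = 2 * ln 2.
Proof. by rewrite lq_cmod ?pnatr_eq0// cmod_nat. Qed.

Lemma lat_zeta_slope_dup (z : C) : 0 < complex.Im z ->
  lat_zeta_slope (2 * z) + (- 2 * ln (pi / 2) - 8 * eta_log z + 4 * eta_log (2 * z))%:C%C = 2 * lat_zeta_slope z + (4 * ln 2)%:C%C.
Proof.
move=> hz; have hz2 := im_nat_gt0 (isT : (0 < 2)%N) hz.
have H : near_off 0 (fun s => lat_zeta_ext (2 * z) s + lat_eta (2 * z) s = 2 * (cexp (s * (- lnsq (2%:R : C))%:C%C) * lat_zeta_ext z s)).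
  apply: mero_eq.
  - by apply: mero_add; [exact: lat_zeta_ext_mero|move=> s; exact/ana_mero0/lat_eta_ana].
  - by apply: mero_mul; [exact: mero_cst|apply: mero_mul; [exact: mero_exp|exact: lat_zeta_ext_mero]].
  - by move=> s s1; rewrite !lat_zeta_ext_Zs// lat_zeta_dup// mulrA.
have h1 := first_order_ext H (first_order_add (lat_zeta_slope_fo hz2) (lat_eta_fo2 hz)).
have h2 := first_order_scale 2 (first_order_mul (first_order_exp (- lnsq (2%:R : C))) (lat_zeta_slope_fo hz)).
have [_ ->] := first_order_unique h1 h2; rewrite lq2 !rmorphN !rmorphM !rmorph_nat; ring.
Qed.

Lemma lat_zeta_slope_inv (z : C) : 0 < complex.Im z -> lat_zeta_slope (- z^-1) = lat_zeta_slope z - (lnsq z)%:C%C.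
Proof.
move=> hz; have hi := inv_im hz.
have H : near_off 0 (fun s => lat_zeta_ext (- z^-1) s = cexp (s * (lnsq z)%:C%C) * lat_zeta_ext z s).
  apply: mero_eq; [exact: lat_zeta_ext_mero|by apply: mero_mul; [exact: mero_exp|exact: lat_zeta_ext_mero]|].
  by move=> s s1; rewrite !lat_zeta_ext_Zs// lat_zeta_inv.
have h1 := first_order_ext H (lat_zeta_slope_fo hi); have h2 := first_order_mul (first_order_exp (lnsq z)) (lat_zeta_slope_fo hz).
have [_ ->] := first_order_unique h1 h2; ring.
Qed.

(* This is shown to equal [pi * Im z / 3]: [kron_rest (2 z) = 2 * kron_rest z], and
   inversion determines the growth of [kron_rest] at [0]. *)
Definition kron_rest (z : C) : C := lat_zeta_slope z + (4 * eta_log z + 2 * ln (2 * pi))%:C%C.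

Lemma kron_rest_dup (z : C) : 0 < complex.Im z -> kron_rest (2 * z) = 2 * kron_rest z.
Proof.
move=> /lat_zeta_slope_dup; rewrite /kron_rest; have p := pi_gt0 R.
rewrite [ln (2 * pi)]lnM ?posrE// [ln (pi / 2)]ln_div ?posrE//.
move: (lat_zeta_slope (2 * z)) (lat_zeta_slope z) (eta_log (2 * z)) (eta_log z) (ln 2) (ln pi) => d2 d h2 h a b.
rewrite !(rmorphD, rmorphN, rmorphM, rmorph_nat) => H.
have -> : d2 = 2 * d + 4 * a%:C%C - (- 2 * (b%:C%C - a%:C%C) - 8 * h%:C%C + 4 * h2%:C%C).
  by rewrite -H addrK.
ring.
Qed.

Lemma kron_rest_inv (z : C) : 0 < complex.Im z ->
  kron_rest (- z^-1) = kron_rest z + (4 * eta_log (- z^-1) - 4 * eta_log z - lnsq z)%:C%C.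
Proof.
move=> /lat_zeta_slope_inv; rewrite /kron_rest => ->.
move: (lat_zeta_slope z) (eta_log _) (eta_log z) (ln (2 * pi)) (lnsq z) => d h2 h a b.
rewrite !(rmorphD, rmorphN, rmorphM, rmorph_nat); ring.
Qed.

Lemma kron_rest_dup_exp k (z : C) : 0 < complex.Im z -> kron_rest ((2 ^ k)%:R * z) = (2 ^ k)%:R * kron_rest z.
Proof.
move=> hz; elim: k => [|k IH]; first by rewrite expn0 !mul1r.
by rewrite expnS natrM -!mulrA kron_rest_dup ?IH// im_nat_gt0// expn_gt0.
Qed.

(** Homogeneity moves [z] to [n z], inversion moves this to [-1/(n z)], and homogeneity returns to
    [-1/z]. As [k] grows all terms but the last tend to 0. *)
Lemma kron_rest_eq k (z : C) : 0 < complex.Im z -> let n : C := (2 ^ k)%:R in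
  kron_rest z = n^-1 * (n^-1 * kron_rest (- z^-1) + (4 * eta_log (n * z) + lnsq (n * z))%:C%C) -
    4 * (n^-1 * (eta_log (- z^-1 / n))%:C%C).
Proof.
move=> hz n; have n0 : n != 0 by rewrite pnatr_eq0 expn_eq0.
have z0 := im_neq0 hz.
have hn : 0 < complex.Im (n * z) by rewrite im_nat_gt0// expn_gt0.
have ev : - (n * z)^-1 = - z^-1 / n by field; rewrite z0 n0.
have hv : 0 < complex.Im (- z^-1 / n) by rewrite -ev inv_im.
have h1 := kron_rest_dup_exp k hz; have h2 := kron_rest_inv hn; have h3 := kron_rest_dup_exp k hv.
rewrite -/n in h1 h3; rewrite [n * (- z^-1 / n)]mulrC mulfVK// in h3.
rewrite ev h1 in h2; rewrite h3 h2.
move: (eta_log (- z^-1 / n)) (eta_log (n * z)) (lnsq (n * z)) (kron_rest z) => a b c d.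
rewrite !(rmorphD, rmorphN, rmorphM, rmorph_nat); field; exact: n0.
Qed.

End Continuation.

(** * The sum of inverse squares *)

Section Basel.
Variable R : realType.
Local Notation C := R[i].

Definition isq (t : R) : R := (sin t ^+ 2)^-1.

Lemma isq_double (t : R) : sin (2 * t) != 0 -> isq t + isq (t + pi / 2) = 4 * isq (2 * t).
Proof.
rewrite mulr_natl sin_mulr2n /isq sinDpihalf sin_mulr2n mulrn_eq0 /= mulf_eq0 negb_or => /andP[c0 s0].
have := cos2Dsin2 t; move: (cos t) (sin t) c0 s0 => c s c0 s0 h.
have -> : (s ^+ 2)^-1 + (c ^+ 2)^-1 = (c ^+ 2 + s ^+ 2) / (c ^+ 2 * s ^+ 2).
  by field; rewrite c0 s0.
by rewrite h -mulr_natr; field; rewrite c0 s0.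
Qed.

Definition thj (k j : nat) : R := (2 * j%:R + 1) * pi / (2 ^ k.+1)%:R.

Lemma thj_range k j : (j < 2 ^ k)%N -> 0 < thj k j < pi.
Proof.
move=> jk; have p := pi_gt0 R; have n0 : (0 : R) < (2 ^ k.+1)%:R by rewrite ltr0n expn_gt0.
apply/andP; split; first by rewrite divr_gt0// mulr_gt0// ltr_pwDr// mulr_ge0.
rewrite ltr_pdivrMr// mulrC ltr_pM2l// expnS natrM -natrM natr1 -natrM ltr_nat; lia.
Qed.

(** Repeated use of [1/sin^2 t + 1/cos^2 t = 4/sin^2 (2 t)], starting from [pi / 2]. In the first
    quadrant [1/sin^2 t] differs from [1/t^2] by at most 1, so half of this sum yields the sum of
    the inverse odd squares. *)
Lemma isq_sum k : \sum_(0 <= j < 2 ^ k) isq (thj k j) = 4 ^+ k.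
Proof.
elim: k => [|k IH].
  by rewrite big_nat1 /thj mulr0 add0r mul1r expr0 /isq sin_pihalf expr1n invr1.
rewrite expnS mul2n -addnn (@big_cat_nat _ _ _ (2 ^ k) 0 (2 ^ k + 2 ^ k)) ?leq_addr//=.
rewrite -{2}[(2 ^ k)%N]add0n big_addn addnK -big_split /= exprS -IH mulr_sumr.
rewrite big_nat [RHS]big_nat; apply: eq_bigr => j /andP[_ jk].
have n0 : (2 ^ k)%:R != 0 :> R by rewrite pnatr_eq0 expn_eq0.
have -> : thj k.+1 (j + 2 ^ k) = thj k.+1 j + pi / 2.
  by rewrite /thj natrD !expnS !natrM; field.
have e : thj k j = 2 * thj k.+1 j by rewrite /thj !expnS !natrM; field.
rewrite e isq_double// -e gt_eqF// sin_gt0_pi//; exact: thj_range.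
Qed.

Lemma isq_half k : \sum_(0 <= j < 2 ^ k) isq (thj k.+1 j) = 2 * 4 ^+ k.
Proof.
have := isq_sum k.+1; rewrite expnS mul2n -addnn (@big_cat_nat _ _ _ (2 ^ k) 0 (2 ^ k + 2 ^ k)) ?leq_addr//=.
have -> : \sum_(2 ^ k <= j < 2 ^ k + 2 ^ k) isq (thj k.+1 j) = \sum_(0 <= j < 2 ^ k) isq (thj k.+1 j).
  rewrite -{1}[(2 ^ k)%N]add0n big_addn addnK big_nat_rev /= big_nat [RHS]big_nat.
  apply: eq_bigr => j /andP[_ jk]; rewrite add0n.
  have n0 : (2 ^ k)%:R != 0 :> R by rewrite pnatr_eq0 expn_eq0.
  have -> : thj k.+1 (2 ^ k - j.+1 + 2 ^ k) = pi - thj k.+1 j.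
    rewrite /thj natrD natrB// -[j.+1%:R]natr1 !expnS !natrM; field; exact: n0.
  by rewrite /isq sinB sinpi cospi mul0r mulN1r sub0r opprK.
rewrite exprS => h; move: h; move: (\sum_(0 <= j < 2 ^ k) _) (4 ^+ k) => a b; lra.
Qed.

Lemma isq_bound (t : R) : 0 < t < pi / 2 -> (t ^+ 2)^-1 <= isq t <= 1 + (t ^+ 2)^-1.
Proof.
move=> /andP[t0 t1]; have p := pi_gt0 R.
have s0 : 0 < sin t by apply: sin_gt0_pi; apply/andP; split; lra.
have c0 : 0 <= cos t by apply: cos_ge0_pihalf; apply/andP; split; lra.
have h1 := sin_le_id (ltW t0).
have h2 : t * cos t <= sin t by apply: xcos_le_sin; apply/andP; split; lra.
have h3 := cos2Dsin2 t.
apply/andP; split.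
  rewrite /isq lef_pV2 ?posrE ?exprn_gt0//.
  by rewrite lerXn2r ?nnegrE ?(ltW s0) ?(ltW t0).
have -> : isq t = 1 + (cos t ^+ 2) / sin t ^+ 2.
  have -> : cos t ^+ 2 = 1 - sin t ^+ 2 by rewrite -h3; ring.
  by rewrite /isq; field; rewrite gt_eqF.
rewrite lerD2l -[(t ^+ 2)^-1]mul1r ler_pdivrMr ?exprn_gt0// mulrAC mul1r ler_pdivlMr ?exprn_gt0//.
by rewrite -exprMn lerXn2r ?nnegrE ?mulr_ge0 ?(ltW s0) ?(ltW t0)// mulrC.
Qed.

Definition oddS n : R := \sum_(0 <= j < n) ((2 * j%:R + 1) ^+ 2)^-1.
Definition sqS n : R := \sum_(0 <= j < n) (j.+1%:R ^+ 2)^-1.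

Lemma oddS_bound k : oddS (2 ^ k) <= pi ^+ 2 / 8 <= oddS (2 ^ k) + pi ^+ 2 / 16 / (2 ^ k)%:R.
Proof.
have p := pi_gt0 R; set n : R := (2 ^ k)%:R; have n0 : 0 < n by rewrite ltr0n expn_gt0.
have nz : n != 0 by rewrite gt_eqF.
have pz : pi != 0 :> R by rewrite gt_eqF.
have e : \sum_(0 <= j < 2 ^ k) ((thj k.+1 j) ^+ 2)^-1 = 16 * n ^+ 2 / pi ^+ 2 * oddS (2 ^ k).
  rewrite /oddS mulr_sumr; apply: eq_bigr => j _.
  have d0 : 2 * j%:R + 1 != 0 :> R by rewrite gt_eqF// ltr_pwDr// mulr_ge0.
  rewrite /thj !expnS !natrM -/n.
  have gen (a b c : R) : a != 0 -> b != 0 -> c != 0 -> (a * b / (2 * (2 * c))) ^- 2 = 16 * c ^+ 2 / b ^+ 2 * a ^- 2.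
    by move=> a0 b0 c0; field; rewrite a0 b0 c0.
  exact: gen.
have b j : (0 <= j < 2 ^ k)%N -> ((thj k.+1 j) ^+ 2)^-1 <= isq (thj k.+1 j) <= 1 + ((thj k.+1 j) ^+ 2)^-1.
  move=> /andP[_ jk]; apply: isq_bound; have /andP[h1 h2] := thj_range jk.
  have e2 : thj k j = 2 * thj k.+1 j by rewrite /thj !expnS !natrM -/n; field.
  by apply/andP; split; lra.
have h1 : 16 * n ^+ 2 / pi ^+ 2 * oddS (2 ^ k) <= 2 * 4 ^+ k.
  by rewrite -e -isq_half; apply: ler_sum_nat => j /b/andP[].
have h2 : 2 * 4 ^+ k <= n + 16 * n ^+ 2 / pi ^+ 2 * oddS (2 ^ k).
  rewrite -e -isq_half; have -> : n = \sum_(0 <= j < 2 ^ k) 1.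
    by rewrite big_const_nat subn0 iter_addr_0.
  by rewrite -big_split /=; apply: ler_sum_nat => j /b/andP[].
have e4 : 4 ^+ k = n ^+ 2 by rewrite /n natrX -exprM mulnC exprM; congr (_ ^+ k); ring.
rewrite e4 in h1 h2.
have gen (a q o : R) : 0 < a -> 0 < q -> 16 * a ^+ 2 / q ^+ 2 * o <= 2 * a ^+ 2 ->
    2 * a ^+ 2 <= a + 16 * a ^+ 2 / q ^+ 2 * o -> o <= q ^+ 2 / 8 <= o + q ^+ 2 / 16 / a.
  move=> a0 q0 g1 g2.
  have c0 : 0 < 16 * a ^+ 2 / q ^+ 2 by rewrite divr_gt0 ?mulr_gt0 ?exprn_gt0.
  have az := lt0r_neq0 a0; have qz := lt0r_neq0 q0.
  have ea : 16 * a ^+ 2 / q ^+ 2 * (q ^+ 2 / 8) = 2 * a ^+ 2 by field.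
  have eb : 16 * a ^+ 2 / q ^+ 2 * (q ^+ 2 / 16 / a) = a by field; rewrite az.
  by apply/andP; split; rewrite -(ler_pM2l c0) ?mulrDr ea ?eb// addrC.
exact: gen.
Qed.

Lemma sqS_double n : sqS (2 * n) = oddS n + sqS n / 4.
Proof.
elim: n => [|n IH]; first by rewrite muln0 /sqS /oddS !big_nil mul0r addr0.
rewrite mulnS /sqS /oddS !big_nat_recr//= -/(sqS _) -/(oddS _) -/(sqS _) IH.
rewrite -[(2 * n).+2%:R]natr1 -[(2 * n).+1%:R]natr1 -[n.+1%:R]natr1 natrM.
have h : 2 * (n%:R + 1) != 0 :> R by rewrite mulf_neq0// natr1 pnatr_eq0.
have -> : 2 * n%:R + 1 + 1 = 2 * (n%:R + 1) :> R by ring.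
rewrite [(sqS n + _) / 4]mulrDl; have -> : (2 * (n%:R + 1)) ^- 2 = (n%:R + 1) ^- 2 / 4 :> R.
  by rewrite exprMn invfM mulrC -natrX.
by rewrite addrA -!addrA; congr (_ + _); rewrite addrCA.
Qed.

Lemma rbs_sqS : rbs (fun j : nat => (j.+1%:R ^+ 2)^-1 : R) 8.
Proof.
move=> J; apply: le_trans (_ : _ <= 4 * \sum_(j <- J) expR (- 2 * ln (1 + j.+1%:R))) _.
  by rewrite mulr_sumr; apply: ler_sum => j _; apply: inv_sqr_le.
have -> : 8 = 4 * 2 :> R by ring.
apply: ler_wpM2l; first by [].
apply: le_trans (@rbs_sqr R J); apply: ler_sum => j _.
rewrite ler_expR !mulNr lerN2; apply: ler_wpM2l; first by [].
by rewrite ler_ln ?posrE ?ltr_pwDl// lerD2l ler_nat.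
Qed.

Lemma basel : sums (fun j : nat => ((j.+1%:R ^+ 2)^-1 : R)%:C%C) (pi ^+ 2 / 6 : R)%:C%C.
Proof.
have s : summ (fun j : nat => ((j.+1%:R ^+ 2)^-1 : R)%:C%C).
  exists 8 => J; apply: le_trans (rbs_sqS J); apply: ler_sum => j _.
  by rewrite cmod_real ger0_norm// invr_ge0 exprn_ge0.
have hT := summ_hs s; set T := tsum _ in hT.
have hn : cvgs (fun n => (sqS n)%:C%C) T.
  by apply: cvgs_ext (sums_cvgs hT) => n; rewrite rmorph_sum.
have a1 : cvgs (fun k => (sqS (2 ^ k))%:C%C) T.
  by apply: (cvgs_sub (g := fun k => 2 ^ k)%N) hn => k; apply/ltnW/ltn_expl.
have a2 : cvgs (fun k => (sqS (2 * 2 ^ k))%:C%C) T.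
  by apply: (cvgs_sub (g := fun k => 2 * 2 ^ k)%N) hn => k; have := ltn_expl k (isT : (1 < 2)%N); lia.
have o : cvgs (fun k => (oddS (2 ^ k))%:C%C) (pi ^+ 2 / 8 : R)%:C%C.
  move=> e e0; have := cvgs_divexp ((pi ^+ 2 / 8 : R)%:C%C : C) e0 => -[N hN].
  exists N => k /hN; rewrite subr0 cmodM cmodV cmod_nat -rmorphB !cmod_real => h.
  apply: le_lt_trans h; have /andP[h1 h2] := oddS_bound k.
  rewrite distrC ger0_norm ?subr_ge0// (ger0_norm (_ : 0 <= pi ^+ 2 / 8)); last by rewrite divr_ge0 ?sqr_ge0.
  rewrite lerBlDr addrC; apply: le_trans h2 _; rewrite lerD2l expnS natrM le_eqVlt; apply/orP; left; apply/eqP.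
  by field; rewrite pnatr_eq0 expn_eq0.
have a3 : cvgs (fun k => (sqS (2 * 2 ^ k))%:C%C) ((pi ^+ 2 / 8 : R)%:C%C + T * 4^-1).
  apply: cvgs_ext (cvgsD o (cvgsM a1 (cvgs_cst 4^-1))) => k.
  by rewrite sqS_double rmorphD rmorphM fmorphV rmorph_nat.
(* Splitting into odd and even denominators gives [T = pi^2 / 8 + T / 4]. *)
have := cvgs_unique a2 a3 => h.
suff -> : (pi ^+ 2 / 6 : R)%:C%C = T by [].
have {}h : T = (pi ^+ 2 / 8)%:C%C * (4 / 3).
  have : T * (3 / 4) = (pi ^+ 2 / 8)%:C%C.
    have -> : T * (3 / 4) = T - T * 4^-1 by field.
    by rewrite {1}h addrK.
  by move=> <-; field.
rewrite h; have -> : (4 / 3 : C) = (4 / 3 : R)%:C%C by rewrite rmorphM fmorphV !rmorph_nat.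
by rewrite -rmorphM; congr (_%:C%C); field.
Qed.

End Basel.

(** * Kronecker limit formula *)

Section Kronecker.
Variable R : realType.
Local Notation C := R[i].

(** Summation over [m] is geometric and leaves a Lambert series. *)
Lemma sums_Hcols (z : C) : 0 < complex.Im z ->
  sums (fun j : nat => - (j.+1%:R)^-1 * (nome z ^+ j.+1 / (1 - nome z ^+ j.+1))) (eta_clog z).
Proof.
move=> hz; have s : summ (hterm z) by eexists; apply: bsum_hterm.
apply: (sums_pair2 s _ (summ_hs s)) => j.
have q1 := le_lt_trans (qvX_lt1 j hz) (nome_lt1 hz).
have [_ h] := sums_geo q1; rewrite mulrA; apply: eq_sums (sumsZ (- j.+1%:R^-1 * nome z ^+ j.+1) h) => m.
by rewrite /hterm /lgc /= -mulrA -exprS -!exprM mulnC; ring.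
Qed.

Lemma cvgs_Qterm (x : C) : x != 0 ->
  cvgs (fun k => (2 ^ k.+1)%:R^-1 * (cE (2 * (x / (2 ^ k.+1)%:R)) / (1 - cE (2 * (x / (2 ^ k.+1)%:R)))))
    (- (2 * ipi R * x)^-1).
Proof.
move=> x0; have ip0 : ipi R != 0 by rewrite -cmod_gt0 cmod_ipi pi_gt0.
have L0 : 2 * ipi R * x != 0 by rewrite !mulf_neq0// pnatr_eq0.
have h2 := cvgsV L0 (cvgs_cS x ltn_exp2).
have := cvgsM (cvgs_cst (-1)) (cvgsM (cvgs_cE (cvgs_divexp x)) h2).
rewrite mulN1r mul1r; apply: cvgs_ext => k.
have n0 : (2 ^ k.+1)%:R != 0 :> C by rewrite pnatr_eq0 expn_eq0.
set u := x / _; have -> : 2 * u = u + u by rewrite mulr_natl mulr2n.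
rewrite cED /cS cEN.
have e0 := cE_neq0 u; move: (cE u) e0 ((2 ^ k.+1)%:R : C) n0 => e e0 n n0.
(* If the denominator vanishes, both sides are 0 by the convention for inverses. *)
have [h|h] := eqVneq (1 - e * e) 0.
  have -> : e - e^-1 = 0.
    by apply: (mulIf e0); rewrite mulrBl mulVf// mul0r -opprB h oppr0.
  by rewrite h !mulr0 !invr0 !mulr0.
have h' : e * e - 1 != 0 by rewrite -opprB oppr_eq0.
by field; rewrite n0 e0 h h'.
Qed.

(** From [e^(-T) / (1 - e^(-T)) <= 1/T], where [e^(-T)] is the modulus of the power of the nome. The
    bound does not depend on [n], as dominated convergence requires. *)
Lemma Qterm_bound (v : C) (n : R) j : 0 < complex.Im v -> 0 < n ->
  cmod (n%:C%C^-1 * (nome (v / n%:C%C) ^+ j.+1 / (1 - nome (v / n%:C%C) ^+ j.+1))) <=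
    (2 * pi * complex.Im v * j.+1%:R)^-1.
Proof.
move=> hv n0; have p := pi_gt0 R; have nC : n%:C%C != 0 :> C by rewrite -cmod_eq0 cmod_real normr_eq0 gt_eqF.
have im : complex.Im (v / n%:C%C) = complex.Im v / n.
  by rewrite -fmorphV; case: (v) => a b /=; rewrite mulr0 add0r.
pose T := 2 * pi * complex.Im v * j.+1%:R / n.
have T0 : 0 < T by rewrite divr_gt0 ?mulr_gt0.
have er : cmod (nome (v / n%:C%C) ^+ j.+1) = expR (- T).
  by rewrite cmodX cmod_qv im -expRM_natl; congr expR; rewrite /T; field; rewrite gt_eqF.
have r1 : expR (- T) < 1 by rewrite expR_lt1 oppr_lt0.
have d1 : 1 - expR (- T) <= cmod (1 - nome (v / n%:C%C) ^+ j.+1).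
  by apply: le_trans (cmod_geB _ _); rewrite cmodN cmod1 er.
have dp : 0 < 1 - expR (- T) by rewrite subr_gt0.
rewrite !cmodM !cmodV er cmod_real (gtr0_norm n0).
have -> : (2 * pi * complex.Im v * j.+1%:R)^-1 = n^-1 * T^-1.
  have gen (b m : R) : b != 0 -> m != 0 -> b^-1 = m^-1 * (b / m)^-1.
    by move=> b0 m0; field; rewrite b0 m0.
  by apply: gen; rewrite gt_eqF// !mulr_gt0.
rewrite ler_wpM2l ?invr_ge0 ?(ltW n0)//; apply: le_trans (_ : _ <= expR (- T) / (1 - expR (- T))) _.
  by rewrite ler_wpM2l ?expR_ge0// lef_pV2 ?posrE// (lt_le_trans dp).
rewrite ler_pdivrMr// mulrC -ler_pdivrMr ?invr_gt0// invrK.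
have -> : expR (- T) * T = expR (- T) * (1 + T) - expR (- T) by ring.
by rewrite lerD2r expRN mulrC ler_pdivrMr ?expR_gt0// mul1r expR_ge1Dx.
Qed.

(** Termwise the scaled Lambert series tends to [1 / (2 pi i v j^2)], and [Qterm_bound] divided by
    [j] is a summable majorant; the limit is then the sum of inverse squares. *)
Lemma cvgs_Hc (v : C) : 0 < complex.Im v ->
  cvgs (fun k => (2 ^ k.+1)%:R^-1 * eta_clog (v / (2 ^ k.+1)%:R)) ((2 * ipi R * v)^-1 * (pi ^+ 2 / 6)%:C%C).
Proof.
move=> hv; have p := pi_gt0 R; have v0 := im_neq0 hv.
have ip0 : ipi R != 0 by rewrite -cmod_gt0 cmod_ipi pi_gt0.
pose a := 2 * pi * complex.Im v; have a0 : 0 < a by rewrite !mulr_gt0.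
pose t k (j : nat) : C := - (j.+1%:R)^-1 * ((2 ^ k.+1)%:R^-1 * (nome (v / (2 ^ k.+1)%:R) ^+ j.+1 / (1 - nome (v / (2 ^ k.+1)%:R) ^+ j.+1))).
pose l (j : nat) : C := (2 * ipi R * v)^-1 * (j.+1%:R ^- 2)%:C%C.
have npos k : (0 : R) < (2 ^ k.+1)%:R by rewrite ltr0n expn_gt0.
have ht k : sums (t k) ((2 ^ k.+1)%:R^-1 * eta_clog (v / (2 ^ k.+1)%:R)).
  have hk : 0 < complex.Im (v / (2 ^ k.+1)%:R).
    have -> : v / (2 ^ k.+1)%:R = v * ((2 ^ k.+1)%:R^-1)%:C%C by rewrite fmorphV rmorph_nat.
    by case: (v) hv => x y /= hv; rewrite mulr0 add0r divr_gt0.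
  by apply: eq_sums (sumsZ ((2 ^ k.+1)%:R^-1) (sums_Hcols hk)) => j; rewrite /t mulrCA.
have hl : sums l ((2 * ipi R * v)^-1 * (pi ^+ 2 / 6)%:C%C) by apply: sumsZ; exact: basel.
have tb k j : cmod (t k j) <= a^-1 * (j.+1%:R ^+ 2)^-1.
  rewrite /t cmodM cmodN cmodV cmod_nat.
  have := Qterm_bound j hv (npos k); rewrite rmorph_nat => h.
  apply: le_trans (ler_wpM2l _ h) _; first by rewrite invr_ge0.
  have gen (b m : R) : b != 0 -> m != 0 -> m^-1 * (b * m)^-1 = b^-1 * (m ^+ 2)^-1.
    by move=> b0 m0; field; rewrite b0 m0.
  by rewrite -/a gen// ?gt_eqF// pnatr_eq0.
have lb j : cmod (l j) <= a^-1 * (j.+1%:R ^+ 2)^-1.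
  rewrite /l cmodM cmod_real ger0_norm ?invr_ge0 ?exprn_ge0// ler_wpM2r ?invr_ge0 ?exprn_ge0//.
  rewrite cmodV !cmodM cmod_nat cmod_ipi lef_pV2 ?posrE ?mulr_gt0 ?cmod_gt0//.
  by rewrite ler_pM2l ?mulr_gt0//; apply: le_trans (ler_norm _) (cmod_Im v).
move=> e e0.
have [K hK] : exists K, forall k N, (K <= k)%N -> \sum_(0 <= j < N) cmod (t k j - l j) < e / 2.
  apply: (@tannery R (fun k j => cmod (t k j - l j)) (fun j => 2 * a^-1 * (j.+1%:R ^+ 2)^-1) (2 * a^-1 * 8)) => //.
  - move=> k j; rewrite cmod_ge0 /=; apply: le_trans (cmodB _ _) _.
    by rewrite -mulrA mulr_natl mulr2n; apply: lerD.
  - by move=> J; rewrite -mulr_sumr ler_wpM2l ?mulr_ge0 ?invr_ge0 ?(ltW a0)//; exact: rbs_sqS.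
  - move=> j; have j0 : (j.+1%:R : C) != 0 by rewrite pnatr_eq0.
    have x0 : j.+1%:R * v != 0 by rewrite mulf_neq0.
    have := cvgsM (cvgs_cst (- j.+1%:R^-1)) (cvgs_Qterm x0).
    have -> : - j.+1%:R^-1 * - (2 * ipi R * (j.+1%:R * v))^-1 = l j.
      rewrite /l fmorphV rmorphXn rmorph_nat; move: (j.+1%:R : C) j0 => n n0.
      by field; rewrite ip0 v0 n0.
    move=> H; have := cvgs_cmod (cvgsD H (cvgs_cst (- l j))); rewrite subrr cmod0.
    apply: (rcvg_ev (N := 0%N)) => k _; congr (cmod (_ * (_ * (_ / (1 - _))) - _)).
      by rewrite /nome cEX; congr cE; ring.
    by rewrite /nome cEX; congr cE; ring.
  by rewrite divr_gt0.
exists K => k kK; apply: le_lt_trans (_ : e / 2 < e); last by lra.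
have := sumsD (ht k) (sumsZ (-1) hl); rewrite mulN1r; apply: sums_tail.
apply: rbs_nat => [j|N]; first exact: cmod_ge0.
by apply: ltW; apply: le_lt_trans (hK k N kK); apply: ler_sum => j _; rewrite mulN1r.
Qed.

Lemma cvgs_bdd (u : nat -> C) (B : R) : (forall k, cmod (u k) <= B) ->
  cvgs (fun k => (2 ^ k.+1)%:R^-1 * u k) 0.
Proof.
move=> hB e e0; have [N hN] := cvgs_divexp (B%:C%C : C) e0.
exists N => k /hN; rewrite !subr0 !cmodM cmodV cmod_nat; apply: le_lt_trans.
rewrite mulrC ler_wpM2r ?invr_ge0//; apply: le_trans (hB k) _.
by rewrite cmod_real ler_norm.
Qed.

Lemma cvgs_kexp : cvgs (fun k => (2 ^ k.+1)%:R^-1 * (k.+1%:R : C)) 0.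
Proof.
have h k : (k * k <= 4 * 2 ^ k)%N.
  elim: k => // k IH; have := ltn_expl k (isT : (1 < 2)%N).
  by rewrite expnS; nia.
move=> e e0; exists (Num.trunc (4 / e)).+1 => k hk.
rewrite subr0 cmodM cmodV !cmod_nat.
have k0 : (0 : R) < k.+1%:R by [].
have n0 : (0 : R) < (2 ^ k.+1)%:R by rewrite ltr0n expn_gt0.
have h1 : 4 / e < k.+1%:R.
  by apply: lt_le_trans (truncnS_gt _) _; rewrite ler_nat (leq_trans hk).
rewrite mulrC ltr_pdivrMr//.
have h2 : (k.+1%:R * k.+1%:R : R) <= 4 * (2 ^ k.+1)%:R by rewrite -!natrM ler_nat.
rewrite ltr_pdivrMr// in h1; rewrite -(ltr_pM2l k0); apply: le_lt_trans h2 _.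
by rewrite mulrA ltr_pM2r.
Qed.

Lemma eta_log_bound (z : C) n : (0 < n)%N -> 0 < complex.Im z ->
  cmod (eta_log (n%:R * z))%:C%C <= cmod (nome z) / (1 - cmod (nome z)) ^+ 2.
Proof.
move=> n0 hz; have hn := im_nat_gt0 n0 hz; have q1 := nome_lt1 hz.
rewrite cmod_real; apply: le_trans (cmod_Re _) _; apply: le_trans (cmod_tsum (bsum_hterm hn)) _.
have le : cmod (nome (n%:R * z)) <= cmod (nome z).
  rewrite !cmod_qv ler_expR lerN2 im_mul_nat ler_wpM2l ?mulr_ge0 ?pi_ge0//.
  by rewrite ler_peMl ?(ltW hz)// ler1n.
have q1' := le_lt_trans le q1.
apply: ler_pM; rewrite ?cmod_ge0// ?invr_ge0 ?exprn_ge0 ?subr_ge0 ?(ltW q1')//.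
rewrite lef_pV2 ?posrE ?exprn_gt0 ?subr_gt0// lerXn2r ?nnegrE ?subr_ge0 ?(ltW q1) ?(ltW q1')//.
by rewrite lerD2l lerN2.
Qed.

Lemma kron_rest_val (z : C) : 0 < complex.Im z -> kron_rest z = (pi * complex.Im z / 3)%:C%C.
Proof.
move=> hz; have hv := inv_im hz; have z0 := im_neq0 hz; have p := pi_gt0 R.
pose n k : C := (2 ^ k.+1)%:R.
have hH : cvgs (fun k => 4 * ((n k)^-1 * (eta_log (- z^-1 / n k))%:C%C)) (- (pi * complex.Im z / 3))%:C%C.
  have := cvgsM (cvgs_cst 4) (rcvg_cvgs (cvgs_Re (cvgs_Hc hv))).
  (* With [v = -1/z] the limit is [4 Re(i z pi / 12)], that is [- pi Im z / 3]. *)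
  have -> : (4 : C) * (complex.Re ((2 * ipi R * - z^-1)^-1 * (pi ^+ 2 / 6)%:C%C))%:C%C = (- (pi * complex.Im z / 3))%:C%C.
    have -> : (2 * ipi R * - z^-1)^-1 * (pi ^+ 2 / 6)%:C%C = 'i%C * z * ((2 * pi)^-1 * (pi ^+ 2 / 6))%:C%C.
      have -> : ipi R = pi%:C%C * 'i%C.
        by rewrite /ipi; apply/eqP; rewrite eq_complex /=; apply/andP; split; apply/eqP; ring.
      have i2 : ('i%C : C) * 'i%C = -1 by rewrite -expr2 sqr_i.
      have i0 : ('i%C : C) != 0 by rewrite -cmod_gt0 cmod_i.
      have iV : ('i%C : C)^-1 = - 'i%C by apply: (mulfI i0); rewrite divff// mulrN i2 opprK.
      have pz : (pi%:C%C : C) != 0 by rewrite -cmod_gt0 cmod_real normr_gt0 gt_eqF.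
      have -> : ((2 * pi)^-1 * (pi ^+ 2 / 6))%:C%C = (2 * pi%:C%C)^-1 * (pi ^+ 2 / 6)%:C%C :> C.
        rewrite rmorphM; congr (_ * _); rewrite fmorphV; congr (_^-1).
        by rewrite rmorphM rmorph_nat.
      move: ((pi ^+ 2 / 6)%:C%C) (pi%:C%C : C) => b c.
      by rewrite !invfM invrN invrK iV; ring.
    case: (z) => x y /=; rewrite -(rmorph_nat (real_complex R)) -rmorphM; congr (_%:C%C) => /=.
    by move: (pi) p => q q0; field; rewrite gt_eqF.
  apply: cvgs_ext => k; congr (_ * _).
  by rewrite /n -(rmorph_nat (real_complex R)) -fmorphV /eta_log; case: (eta_clog _) => x y /=; rewrite mul0r subr0 -rmorphM.
have h1 : cvgs (fun k => (n k)^-1 * ((n k)^-1 * kron_rest (- z^-1))) 0.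
  apply: (@cvgs_bdd _ (cmod (kron_rest (- z^-1)))) => k.
  rewrite cmodM cmodV cmod_nat ler_piMl ?cmod_ge0// invf_le1 ?ltr0n ?expn_gt0//.
  by rewrite ler1n expn_gt0.
have h2 : cvgs (fun k => (n k)^-1 * (4 * (eta_log (n k * z))%:C%C)) 0.
  apply: (@cvgs_bdd _ (4 * (cmod (nome z) / (1 - cmod (nome z)) ^+ 2))) => k.
  by rewrite cmodM cmod_nat ler_wpM2l//; apply: eta_log_bound => //; rewrite expn_gt0.
have h3 : cvgs (fun k => (n k)^-1 * (lnsq (n k * z))%:C%C) 0.
  have a1 : cvgs (fun k => (n k)^-1 * (lnsq z)%:C%C) 0.
    by apply: (@cvgs_bdd _ (cmod (lnsq z)%:C%C)).
  have := cvgsD (cvgsM (cvgs_cst (2 * ln 2)%:C%C) cvgs_kexp) a1; rewrite mulr0 addr0.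
  apply: cvgs_ext => k; have nz : n k != 0 by rewrite pnatr_eq0 expn_eq0.
  rewrite lqM// (_ : lnsq (n k) = k.+1%:R * (2 * ln 2)); last first.
    by rewrite lq_cmod// /n cmod_nat natrX lnXn// -[ln 2 *+ _]mulr_natl mulrCA.
  rewrite -/(n k); move: (n k)^-1 (2 * ln 2) (lnsq z) => a b c.
  by rewrite rmorphD rmorphM rmorph_nat; ring.
have := cvgsD (cvgsD (cvgsD h1 h2) h3) (cvgsM (cvgs_cst (-1)) hH).
rewrite !add0r mulN1r rmorphN opprK => H.
apply: cvgs_unique H; apply: cvgs_ext (cvgs_cst (kron_rest z)) => k.
rewrite {1}(kron_rest_eq k.+1 hz) -/(n k).
move: (n k)^-1 (kron_rest (- z^-1)) (eta_log (n k * z)) (lnsq (n k * z)) (eta_log (- z^-1 * _)) => m r h q g.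
rewrite !(rmorphD, rmorphM, rmorph_nat); ring.
Qed.

Lemma lat_zeta_ext_fo (z : C) : 0 < complex.Im z ->
  first_order (lat_zeta_ext z) (-1) (pi * complex.Im z / 3 - 4 * eta_log z - 2 * ln (2 * pi))%:C%C.
Proof.
move=> hz; have := lat_zeta_slope_fo hz; suff -> : lat_zeta_slope z = (pi * complex.Im z / 3 - 4 * eta_log z - 2 * ln (2 * pi))%:C%C by [].
have -> : lat_zeta_slope z = kron_rest z - (4 * eta_log z + 2 * ln (2 * pi))%:C%C by rewrite /kron_rest addrK.
by rewrite kron_rest_val// -rmorphB; congr (_%:C%C); rewrite opprD addrA.
Qed.

End Kronecker.

(** * Squarefree level *)

Section Primitive.
Variable R : realType.
Local Notation C := R[i].

Lemma gcdn_mul_prime (c M p : nat) : prime p -> ~~ (p %| M)%N ->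
  gcdn c (M * p) = (gcdn c M * (if p %| c then p else 1))%N.
Proof.
move=> pp pM; have cpM : coprime p M by rewrite prime_coprime.
case: ifP => pc; last first.
  by rewrite muln1 Gauss_gcdl// coprime_sym prime_coprime// pc.
have /dvdnP[d ->] := pc; rewrite -muln_gcdl; congr (_ * _)%N.
by rewrite ![gcdn _ M]gcdnC Gauss_gcdl// coprime_sym.
Qed.

Definition pterm (M g : nat) (z s : C) (p : int * int) : C :=
  if coprimez p.1 p.2 && (gcdn `|p.1| M == g) then lterm (lat_pt z p) s else 0.

Definition prim_sum (M g : nat) (z s : C) : C := tsum (pterm M g z s).

Lemma pterm_summ M g (z s : C) : 0 < complex.Im z -> 1 < complex.Re s -> summ (pterm M g z s).
Proof. by move=> hz s1; apply: (@summ_restr _ _ _ (fun p => coprimez p.1 p.2 && (gcdn `|p.1| M == g))); apply: lterm_summ. Qed.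

Lemma prim_sum_split M g p (z s : C) : (0 < M)%N -> prime p -> ~~ (p %| M)%N -> (g %| M)%N ->
  0 < complex.Im z -> 1 < complex.Re s ->
  prim_sum M g z s = prim_sum (M * p) (g * p) z s + prim_sum (M * p) g z s.
Proof.
move=> M0 pp pM gM hz s1.
have <- := tsumD (pterm_summ (M * p) (g * p) hz s1) (pterm_summ (M * p) g hz s1).
apply: eq_tsum => -[c d].
have p1 := prime_gt1 pp; have g0 : (0 < g)%N := dvdn_gt0 M0 gM.
rewrite /pterm /= gcdn_mul_prime//; case: (coprimez c d) => //=; rewrite ?addr0//.
case: (boolP (p %| `|c|)%N) => pc.
  rewrite eqn_pmul2r ?prime_gt0//.
  have -> : (gcdn `|c| M * p == g)%N = false.
    apply/negP => /eqP e; case/negP: pM; apply: dvdn_trans gM; rewrite -e; exact: dvdn_mull.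
  by rewrite addr0.
rewrite muln1; have -> : (gcdn `|c| M == g * p)%N = false; last by rewrite add0r.
apply/negP => /eqP e; case/negP: pM; apply: (@dvdn_trans (g * p)); first exact: dvdn_mull.
by rewrite -e dvdn_gcdr.
Qed.

Lemma coprimez_primel (p : nat) (c d : int) : prime p ->
  coprimez (p%:Z * c) d = ~~ (p %| `|d|)%N && coprimez c d.
Proof.
by move=> pp; rewrite !coprimezE abszM coprimeMl /= prime_coprime.
Qed.

Lemma coprimez_primer (p : nat) (c d : int) : prime p ->
  coprimez c (p%:Z * d) = ~~ (p %| `|c|)%N && coprimez c d.
Proof.
by move=> pp; rewrite !coprimezE abszM coprimeMr /= coprime_sym prime_coprime.
Qed.

(** The points [p c z + d] are sorted by whether [p] divides [d]. If not, [(p c, d)] is primitive of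
    level [g p]. If so, primitivity excludes [p] from [c], and [p] factors out, leaving [(c, d/p)]
    of level [g]. *)
Lemma prim_sum_mul M g p (z s : C) : (0 < M)%N -> prime p -> ~~ (p %| M)%N -> (g %| M)%N ->
  0 < complex.Im z -> 1 < complex.Re s ->
  prim_sum M g (p%:R * z) s = prim_sum (M * p) (g * p) z s + cexp (s * (- lnsq (p%:R : C))%:C%C) * prim_sum (M * p) g z s.
Proof.
move=> M0 pp pM gM hz s1; have p0 := prime_gt0 pp.
have pz : (p%:R : C) != 0 by rewrite pnatr_eq0 -lt0n.
have piz : p%:Z != 0 by rewrite eqz_nat -lt0n.
have hpz := im_nat_gt0 p0 hz.
pose T := pterm M g (p%:R * z) s; have sT : summ T by apply: pterm_summ.
pose T1 q := if (p %| `|q.2|)%N then 0 else T q.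
pose T2 q := if (p %| `|q.2|)%N then T q else 0.
have sT1 : summ T1 by apply: summ_mono sT _ => q; rewrite /T1; case: ifP; rewrite ?cmod0 ?cmod_ge0.
have sT2 : summ T2 by apply: (@summ_restr _ _ _ (fun q : int * int => (p %| `|q.2|)%N)).
have -> : prim_sum M g (p%:R * z) s = tsum T1 + tsum T2.
  rewrite -tsumD//; apply: eq_tsum => q; rewrite -/T /T1 /T2.
  by case: ifP; rewrite ?addr0 ?add0r.
congr (_ + _).
  apply: esym; apply: tsumE.
  apply: (@sums_embed _ _ _ (fun q : int * int => (p%:Z * q.1, q.2)) T1) => //; last exact: summ_hs.
  - by move=> [c d] [c' d'] /= [/(mulfI piz) -> ->].
  - move=> [c d]; rewrite /T1 /T /pterm /= coprimez_primel// abszM /= [(p * `|c|)%N]mulnC.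
    rewrite -muln_gcdl eqn_pmul2r//.
    case: (p %| `|d|)%N => //=; case: ifP => // _; congr lterm.
    by rewrite /lat_pt /= intrM -pmulrn; ring.
  - move=> [c d] hk; rewrite /pterm /=; case: ifP => // /andP[_ /eqP e].
    have pc : (p %| `|c|)%N by apply: (@dvdn_trans (g * p)); [exact: dvdn_mull|rewrite -e dvdn_gcdl].
    have /dvdzP[k kc] : (p%:Z %| c)%Z by rewrite dvdzE.
    by have := hk (k, d); rewrite /= kc mulrC eqxx.
apply: tsumE; have sB := pterm_summ (M * p) g hz s1.
have hB := sumsZ (cexp (s * (- lnsq (p%:R : C))%:C%C)) (summ_hs sB).
apply: (@sums_embed _ _ _ (fun q : int * int => (q.1, p%:Z * q.2)) _ _ _ _ _ _ _ hB).
- by move=> [c d] [c' d'] /= [-> /(mulfI piz) ->].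
- exact: summZ.
- move=> [c d]; rewrite /T2 /T /pterm /= coprimez_primer// abszM /= dvdn_mulr//.
  rewrite gcdn_mul_prime//.
  have -> : ~~ (p %| `|c|)%N && coprimez c d && (gcdn `|c| M == g) =
    coprimez c d && (gcdn `|c| M * (if (p %| `|c|)%N then p else 1) == g)%N.
    case: (coprimez c d) => /=; rewrite ?andbF//; case: ifP => pc /=; last by rewrite muln1.
    apply/esym/negP => /eqP e; case/negP: pM; apply: dvdn_trans gM; rewrite -e; exact: dvdn_mull.
  case: ifP => _; last by rewrite mulr0.
  rewrite -lterm_scale//; congr lterm; rewrite /lat_pt /= intrM -pmulrn; ring.
- move=> [c d] hk; rewrite /T2 /=; case: ifP => // pd.
  have /dvdzP[k kd] : (p%:Z %| d)%Z by rewrite dvdzE.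
  by have := hk (c, k); rewrite /= kd mulrC eqxx.
Qed.

(** Every nonzero lattice vector is its gcd times a primitive vector; the factor 2 appears because
    [int_zeta] runs over both signs. *)
Lemma prim_sum_base (z s : C) : 0 < complex.Im z -> 1 < complex.Re s ->
  2 * lat_zeta z s = int_zeta s * prim_sum 1 1 z s.
Proof.
move=> hz s1; have sZ := lterm_summ hz s1; have sP := pterm_summ 1 1 hz s1.
pose a (n : nat) : C := if n == 0%N then 0 else cexp (s * (- lnsq (n%:R : C))%:C%C).
have h1 : sums (fun n => a n * prim_sum 1 1 z s) (lat_zeta z s).
  apply: (@sums_fiber _ _ _ (fun q : int * int => gcdn `|q.1| `|q.2|) _ _ _ sZ (summ_hs sZ)) => n.
  have [->|n0] := posnP n.
    rewrite /a eqxx mul0r; apply: eq_sums (@sums0 R (int * int)%type) => -[c d] /=.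
    rewrite -leqn0 leqNgt gcdn_gt0 negb_or -!leqNgt !leqn0 !absz_eq0.
    case: ifP => // /andP[/eqP -> /eqP ->].
    by rewrite /lterm /lat_pt mul0r add0r eqxx.
  have nz : (n%:R : C) != 0 by rewrite pnatr_eq0 -lt0n.
  have niz : n%:Z != 0 by rewrite eqz_nat -lt0n.
  rewrite /a (negPf (lt0n_neq0 n0)).
  apply: (@sums_embed _ _ _ (fun q : int * int => (n%:Z * q.1, n%:Z * q.2)) _ _ _ _ _ _ _ (sumsZ _ (summ_hs sP))).
  - by move=> [c d] [c' d'] /= [/(mulfI niz) -> /(mulfI niz) ->].
  - exact: summZ.
  - move=> [c d]; rewrite /pterm /= gcdn1 eqxx andbT !abszM /= -muln_gcdr.
    rewrite -{2}[n]muln1 eqn_pmul2l// coprimezE /coprime; case: ifP => _; last by rewrite mulr0.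
    rewrite -lterm_scale//; congr lterm; rewrite /lat_pt /= !intrM -pmulrn; ring.
  - move=> [c d] hk /=; case: ifP => // /eqP e.
    have /dvdzP[i ic] : (n%:Z %| c)%Z by rewrite dvdzE -e dvdn_gcdl.
    have /dvdzP[j jd] : (n%:Z %| d)%Z by rewrite dvdzE -e dvdn_gcdr.
    by have := hk (i, j); rewrite /= ic jd ![_ * n%:Z]mulrC eqxx.
have sI := iterm_summ s1.
have h2 : sums (fun n => 2 * a n) (int_zeta s).
  apply: (@sums_fiber _ _ _ absz _ _ _ sI (summ_hs sI)) => n.
  have [->|n0] := posnP n.
    rewrite /a eqxx mulr0; apply: eq_sums (@sums0 R int) => m /=.
    by rewrite absz_eq0; case: eqP => // ->; rewrite /lterm /int_pt eqxx.
  have nz : (n%:R : C) != 0 by rewrite pnatr_eq0 -lt0n.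
  have e1 : lterm (int_pt R n) s = a n.
    by rewrite /lterm /a /int_pt -pmulrn (negPf nz) (negPf (lt0n_neq0 n0)).
  have e2 : lterm (int_pt R (- n%:Z)) s = a n.
    by rewrite -e1 /lterm /int_pt intrN oppr_eq0 lqN.
  have g1 := @sums_single R _ (fun m : int => if m == n%:Z then lterm (int_pt R m) s else 0) n.
  have g2 := @sums_single R _ (fun m : int => if m == - n%:Z then lterm (int_pt R m) s else 0) (- n%:Z).
  rewrite !eqxx e1 in g1; rewrite !eqxx e2 in g2.
  have := sumsD (g1 (fun i h => ifN _ _ h)) (g2 (fun i h => ifN _ _ h)).
  have -> : a n + a n = 2 * a n by rewrite mulr_natl mulr2n.
  move=> H; apply: eq_sums H => m.
  have -> : (`|m|%N == n) = (m == n%:Z) || (m == - n%:Z) by lia.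
  case: eqP => [->|_] /=; last by rewrite add0r.
  have -> : (n%:Z == - n%:Z) = false by lia.
  by rewrite addr0.
have := sumsZ (prim_sum 1 1 z s) h2 => h3; have := sumsZ 2 h1 => h4.
rewrite [int_zeta s * _]mulrC; apply: sums_unique h4 _; apply: eq_sums h3 => n.
by rewrite mulrCA [_ * a n]mulrC.
Qed.

Lemma big_divisors_prime (V : nmodType) (F : nat -> V) M p : (0 < M)%N -> prime p -> ~~ (p %| M)%N ->
  \sum_(d <- divisors (M * p)) F d = \sum_(d <- divisors M) (F (d * p)%N + F d).
Proof.
move=> M0 pp pM; have p0 := prime_gt0 pp; have Mp0 : (0 < M * p)%N by rewrite muln_gt0 M0.
rewrite big_split /= addrC -(big_map (fun d => d * p)%N predT F) -big_cat; apply: perm_big.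
apply: uniq_perm; rewrite ?divisors_uniq// ?cat_uniq ?divisors_uniq//=.
  rewrite map_inj_uniq ?divisors_uniq ?andbT; last by move=> i j /eqP; rewrite eqn_pmul2r// => /eqP.
  apply/hasPn => x /mapP[d _ ->]; rewrite -dvdn_divisors//; apply: contra pM.
  by apply: dvdn_trans; apply: dvdn_mull.
move=> x; rewrite mem_cat -!dvdn_divisors//; apply/idP/orP.
  have [px|px] := boolP (p %| x)%N.
    have /dvdnP[d ->] := px; rewrite dvdn_pmul2r// => dM; right.
    by apply/mapP; exists d => //; rewrite -dvdn_divisors.
  have cxp : coprime x p by rewrite coprime_sym prime_coprime.
  by rewrite Gauss_dvdl// => ?; left.
case=> [xM|/mapP[d]]; first exact: dvdn_mulr.
by rewrite -dvdn_divisors// => dM ->; rewrite dvdn_pmul2r.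
Qed.

Lemma size_divisors_prime M p : (0 < M)%N -> prime p -> ~~ (p %| M)%N ->
  size (divisors (M * p)) = (2 * size (divisors M))%N.
Proof.
move=> M0 pp pM; have := @big_divisors_prime nat (fun=> 1%N) M p M0 pp pM.
by rewrite !sum1_size => ->; rewrite big_split /= sum1_size mul2n -addnn.
Qed.

End Primitive.

(** * Induction over the primes dividing the level *)

Section SquarefreeLevel.
Variable R : realType.
Local Notation C := R[i].

Lemma squarefree_ind (P : nat -> Prop) : P 1%N ->
  (forall M p, (0 < M)%N -> squarefree M -> prime p -> ~~ (p %| M)%N -> P M -> P (M * p)%N) ->
  forall M, (0 < M)%N -> squarefree M -> P M.
Proof.
move=> P1 Pp; elim/ltn_ind => M IH M0 sf.
have [M1|M1] := leqP M 1; first by have -> : M = 1%N by lia.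
have pp := pdiv_prime M1; set p := pdiv M in pp.
have /dvdnP[m e] : (p %| M)%N := pdiv_dvd M.
have p1 := prime_gt1 pp.
have m0 : (0 < m)%N by move: M0; rewrite e muln_gt0 => /andP[].
have sm : squarefree m by move=> d dm; apply: sf; rewrite e; apply: dvdn_mulr.
rewrite e; apply: Pp => //; last by apply: IH => //; rewrite e ltn_Pmulr.
apply/negP => /dvdnP[k ek]; have h : p = 1%N; last by lia.
by apply: sf; rewrite e ek -mulnA mulnn dvdn_mull.
Qed.

Definition den2 (s : C) : C := 2 * cexp (s * (- lnsq (2%:R : C))%:C%C) - 1.

Lemma den2_ana s0 : analytic_at s0 den2.
Proof. by apply: ana_add; [apply: ana_mul; [exact: ana_cst|exact: ana_exp]|exact: ana_cst]. Qed.

Lemma den2_0 : den2 0 = 1.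
Proof. by rewrite /den2 mul0r cexp0; ring. Qed.

Lemma den2_neq0 s : 1 < complex.Re s -> den2 s != 0.
Proof.
move=> /cmod_pow2 h; rewrite subr_eq0; apply: contraTneq h => /(congr1 (@cmod R)).
rewrite cmodM cmod_nat cmod1; move: (cmod _) => x; lra.
Qed.

Definition int_zeta_ext (s : C) : C := @int_eta R s * (den2 s)^-1.

Lemma int_zeta_ext_mero : mero int_zeta_ext.
Proof.
apply: mero_mul; first by move=> s; exact/ana_mero0/int_eta_ana.
by apply: mero_inv => s; exact/ana_mero0/den2_ana.
Qed.

Lemma int_zeta_ext_Z1 s : 1 < complex.Re s -> int_zeta_ext s = int_zeta s.
Proof.
move=> s1; have nz := den2_neq0 s1; have h := int_zeta_G1 s1.
apply: (mulIf nz); rewrite mulfVK//; move: h; rewrite /den2 mulrBr mulr1 [int_zeta s * _]mulrC => <-.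
by rewrite addrC addKr.
Qed.

Lemma int_zeta_ext_ana0 : analytic_at 0 int_zeta_ext.
Proof. by apply: ana_mul; [exact: int_eta_ana|apply: ana_inv (den2_ana 0) _; rewrite den2_0 oner_eq0]. Qed.

(** For the Riemann zeta function this says [zeta(0) = -1/2] and [zeta'(0) = - ln (2 pi) / 2]. *)
Lemma int_zeta_ext_fo : first_order int_zeta_ext (-1) (- 2 * ln (2 * pi))%:C%C.
Proof.
have h := first_order_add (first_order_scale 2 (first_order_exp (- lnsq (2%:R : C)))) (first_order_cst (-1 : C)).
have e1 : 2 * 1 + -1 = 1 :> C by ring.
rewrite e1 in h; have := first_order_mul (@int_eta_fo0 R) (first_order_inv (den2_ana 0) h (oner_neq0 _)).
have p := pi_gt0 R; rewrite invr1 mulr1 lq2 [ln (pi / 2)]ln_div ?posrE// [ln (2 * pi)]lnM ?posrE//.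
move: (ln 2) (ln pi) => a b; congr (first_order _ _ _).
by rewrite !(rmorphD, rmorphN, rmorphM, rmorph_nat); field.
Qed.

Definition pcexp (p : nat) (s : C) : C := cexp (s * (- lnsq (p%:R : C))%:C%C).

Lemma pcexp_neq1 p s : prime p -> 1 < complex.Re s -> 1 - pcexp p s != 0.
Proof.
move=> pp s1; rewrite subr_eq0; have : cmod (pcexp p s) != 1; last first.
  by apply: contraNneq => <-; rewrite cmod1.
rewrite /pcexp cmod_cexp lt_eqF// expR_lt1 lq_nat.
have -> : complex.Re (s * (- ln (p%:R ^+ 2))%:C%C) = - (complex.Re s * ln (p%:R ^+ 2)).
  by case: (s) => a b /=; rewrite mulr0 subr0 mulrN.
rewrite oppr_lt0 mulr_gt0 ?(lt_trans ltr01 s1)// ln_gt0// -natrX ltr1n.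
by have := prime_gt1 pp; rewrite -mulnn; nia.
Qed.

(** [prim_sum_split] and [prim_sum_mul] are two linear equations for the sums at the two new levels,
    with determinant [1 - p^(-2s)] up to sign. As this vanishes at [s = 0], the argument continues
    each series but yields no expansion there. *)
Lemma prim_sum_mero M : (0 < M)%N -> squarefree M -> forall g (z : C), (g %| M)%N -> 0 < complex.Im z ->
  exists F, mero F /\ forall s, 1 < complex.Re s -> F s = prim_sum M g z s.
Proof.
move: M; apply: squarefree_ind => [g z|M p M0 sM pp pM IH g z gMp hz].
  rewrite dvdn1 => /eqP -> hz; exists (fun s => 2 * (lat_zeta_ext z s * (int_zeta_ext s)^-1)); split.
    apply: mero_mul; first exact: mero_cst.
    by apply: mero_mul; [exact: lat_zeta_ext_mero|apply: mero_inv; exact: int_zeta_ext_mero].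
  move=> s s1; rewrite lat_zeta_ext_Zs// int_zeta_ext_Z1// mulrA prim_sum_base//.
  by rewrite mulrAC divff ?mul1r// int_zeta_neq0.
have hpz := im_nat_gt0 (prime_gt0 pp) hz.
have key g' : (g' %| M)%N -> exists F G, [/\ mero F, mero G &
    forall s, 1 < complex.Re s -> F s = prim_sum (M * p) (g' * p) z s /\ G s = prim_sum (M * p) g' z s].
  move=> gM; have [U [mU hU]] := IH g' z gM hz; have [V [mV hV]] := IH g' _ gM hpz.
  pose G s := (U s + -1 * V s) * (1 + -1 * pcexp p s)^-1.
  have mG : mero G.
    apply: mero_mul.
      by apply: mero_add => //; apply: mero_mul => //; exact: mero_cst.
    apply: mero_inv; apply: mero_add; first exact: mero_cst.
    by apply: mero_mul; [exact: mero_cst|exact: mero_exp].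
  have eG s : 1 < complex.Re s -> G s = prim_sum (M * p) g' z s.
    move=> s1; rewrite /G hU// hV// (prim_sum_split M0 pp pM gM hz s1) (prim_sum_mul M0 pp pM gM hz s1) -/(pcexp p s).
    have nz := pcexp_neq1 pp s1; rewrite !mulN1r.
    move: (prim_sum _ _ _ _) (prim_sum _ _ _ _) (pcexp p s) nz => a b c nz; apply: (mulIf nz).
    by rewrite mulfVK//; ring.
  exists (fun s => U s + -1 * G s), G; split=> //.
    by apply: mero_add => //; apply: mero_mul => //; exact: mero_cst.
  move=> s s1; rewrite eG// hU// (prim_sum_split M0 pp pM gM hz s1); split=> //.
  by rewrite mulN1r addrK.
have [pg|pg] := boolP (p %| g)%N.
  have /dvdnP[g' e] := pg; have [|F [G [mF mG h]]] := key g'.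
    by move: gMp; rewrite e dvdn_pmul2r ?prime_gt0.
  by exists F; split=> // s /h[-> _]; rewrite e.
have [|F [G [mF mG h]]] := key g.
  have cgp : coprime g p by rewrite coprime_sym prime_coprime.
  by rewrite -(Gauss_dvdl M cgp).
by exists G; split=> // s /h[_ ->].
Qed.

(* The Eisenstein series of the cusp of level [g]; a scaling matrix there has width
   [M / g], and the factor [2^-1] accounts for the rows [v] and [- v] of one coset. *)
Definition Yterm M g (z s : C) : C :=
  cpow (g%:R / M%:R) s * (2^-1 * cpow (complex.Im z) s) * prim_sum M g z s.

Definition Ysum M (z s : C) : C := \sum_(g <- divisors M) Yterm M g z s.

Lemma Yterm_mero M g (z : C) : (0 < M)%N -> squarefree M -> (g %| M)%N -> 0 < complex.Im z ->
  exists F, mero F /\ forall s, 1 < complex.Re s -> F s = Yterm M g z s.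
Proof.
move=> M0 sM gM hz; have [F [mF hF]] := prim_sum_mero M0 sM gM hz.
exists (fun s => cpow (g%:R / M%:R) s * (2^-1 * cpow (complex.Im z) s) * F s); split.
  apply: mero_mul => //; apply: mero_mul; first exact: mero_exp.
  by apply: mero_mul; [exact: mero_cst|exact: mero_exp].
by move=> s s1; rewrite /Yterm hF.
Qed.

Lemma mero_sum_ex (r : seq nat) (T : nat -> C -> C) :
  (forall g, g \in r -> exists F, mero F /\ forall s, 1 < complex.Re s -> F s = T g s) ->
  exists F, mero F /\ forall s, 1 < complex.Re s -> F s = \sum_(g <- r) T g s.
Proof.
elim: r => [|g r IH] h.
  by exists (fun=> 0); split; [exact: mero_cst|move=> s _; rewrite big_nil].
have [F [mF hF]] : exists F, mero F /\ forall s, 1 < complex.Re s -> F s = T g s.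
  by apply: h; rewrite inE eqxx.
have [|G [mG hG]] := IH; first by move=> k kr; apply: h; rewrite inE kr orbT.
exists (fun s => F s + G s); split; first exact: mero_add.
by move=> s s1; rewrite big_cons hF// hG.
Qed.

Lemma Ysum_mero M (z : C) : (0 < M)%N -> squarefree M -> 0 < complex.Im z ->
  exists F, mero F /\ forall s, 1 < complex.Re s -> F s = Ysum M z s.
Proof.
move=> M0 sM hz; apply: (@mero_sum_ex (divisors M) (fun g => Yterm M g z)) => g.
by rewrite -dvdn_divisors// => gM; apply: Yterm_mero.
Qed.

(** The height of [p z] contributes a further [p^s]. Combined with the normalisations [(g / M)^s],
    it gives both levels lying over [g] the same factor [1 + p^s]. *)
Lemma Ysum_rec M p (z s : C) : (0 < M)%N -> prime p -> ~~ (p %| M)%N -> 0 < complex.Im z -> 1 < complex.Re s ->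
  Ysum M z s + Ysum M (p%:R * z) s = (1 + cpow p%:R s) * Ysum (M * p) z s.
Proof.
move=> M0 pp pM hz s1; rewrite /Ysum big_divisors_prime// -big_split mulr_sumr /=.
rewrite big_seq [RHS]big_seq; apply: eq_bigr => g; rewrite -dvdn_divisors// => gM.
have p0 : (0 : R) < p%:R by rewrite ltr0n prime_gt0.
have Mr : (0 : R) < M%:R by rewrite ltr0n.
have g0 : (0 : R) < g%:R by rewrite ltr0n (dvdn_gt0 M0 gM).
rewrite /Yterm (prim_sum_split M0 pp pM gM hz s1) (prim_sum_mul M0 pp pM gM hz s1) im_mul_nat cpowM//.
have -> : (g * p)%:R / (M * p)%:R = g%:R / M%:R :> R.
  by rewrite !natrM; field; rewrite !gt_eqF.
have -> : cpow (g%:R / M%:R) s = cpow p%:R s * cpow (g%:R / (M * p)%:R) s :> C.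
  rewrite natrM; move: (g%:R : R) (M%:R : R) (p%:R : R) g0 Mr p0 => a b c a0 b0 c0.
  have b1 : b != 0 := lt0r_neq0 b0; have c1 : c != 0 := lt0r_neq0 c0.
  have {1}-> : a / b = c * (a / (b * c)) by field; rewrite c1 b1.
  by rewrite cpowM// divr_gt0// mulr_gt0.
have -> : cexp (s * (- lnsq (p%:R : C))%:C%C) = (cpow p%:R s)^-1 * (cpow p%:R s)^-1.
  rewrite /cpow -cexpN -cexpD; congr cexp; rewrite lq_cmod ?pnatr_eq0 -?lt0n ?prime_gt0// cmod_nat.
  by rewrite rmorphN rmorphM rmorph_nat; ring.
have c0 : cpow p%:R s != 0 :> C := cpow_neq0 _ _.
move: (cpow p%:R s) c0 (cpow (_ / _) s) (cpow (complex.Im z) s) (prim_sum _ (g * p) z s) (prim_sum (M * p) g z s) => a a0 b c d e.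
by field.
Qed.

Definition limit_coef M (z : C) : R := (size (divisors M))%:R^-1 *
  \sum_(c <- divisors M) ln (cmod (Delta (c%:R * z)) `^ 6^-1 * complex.Im z).

(** The divisors of [M p] are [d] and [d p]. The terms at [d p] are those for [p z], except that
    [Im (p z)] carries an extra factor [p]; the resulting [ln p] is the derivative of [1 + p^s] at
    0. *)
Lemma limit_coef_rec M p (z : C) : (0 < M)%N -> prime p -> ~~ (p %| M)%N -> 0 < complex.Im z ->
  limit_coef (M * p) z = (limit_coef M z + limit_coef M (p%:R * z) - ln p%:R) / 2.
Proof.
move=> M0 pp pM hz; rewrite /limit_coef size_divisors_prime// big_divisors_prime//.
have p0 := prime_gt0 pp; have hpz := im_nat_gt0 p0 hz.
have s0 : (size (divisors M))%:R != 0 :> R.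
  rewrite pnatr_eq0 -lt0n lt0n size_eq0; apply/eqP => h.
  have : 1%N \in divisors M by rewrite -dvdn_divisors.
  by rewrite h.
have -> : ln p%:R = (size (divisors M))%:R^-1 * \sum_(c <- divisors M) (ln p%:R : R).
  by rewrite big_const_seq count_predT iter_addr_0 -[ln _ *+ _]mulr_natl mulrA mulVf ?mul1r.
have -> : \sum_(d <- divisors M) (ln (cmod (Delta ((d * p)%:R * z)) `^ 6^-1 * complex.Im z) +
      ln (cmod (Delta (d%:R * z)) `^ 6^-1 * complex.Im z)) =
    \sum_(c <- divisors M) ln (cmod (Delta (c%:R * z)) `^ 6^-1 * complex.Im z) +
    \sum_(c <- divisors M) ln (cmod (Delta (c%:R * (p%:R * z))) `^ 6^-1 * complex.Im (p%:R * z)) -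
    \sum_(c <- divisors M) ln p%:R.
  rewrite -big_split -sumrB big_seq [RHS]big_seq; apply: eq_bigr => c; rewrite -dvdn_divisors// => cM.
  have c0 := dvdn_gt0 M0 cM.
  have e : (c * p)%:R * z = c%:R * (p%:R * z) by rewrite natrM mulrA.
  have el : ln (complex.Im (p%:R * z)) = ln p%:R + ln (complex.Im z) by rewrite im_mul_nat lnM ?posrE ?ltr0n.
  rewrite /= e (ln_Delta (im_nat_gt0 c0 hpz) hz) (ln_Delta (im_nat_gt0 c0 hz) hz) (ln_Delta (im_nat_gt0 c0 hpz) hpz) el.
  have gen (a b x y : R) : a + y + (b + y) = b + y + (a + (x + y)) - x by ring.
  exact: gen.
have gen (m A B D : R) : m != 0 -> (2 * m)^-1 * (A + B - D) = (m^-1 * A + m^-1 * B - m^-1 * D) / 2.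
  by move=> m0; field.
by rewrite natrM gen.
Qed.

(** The claim covers all [z] and every meromorphic function agreeing with the series, because the
    induction step applies it at [z] and at [p z] to chosen continuations and then divides by
    [1 + p^s]. *)
Lemma Ysum_fo M : (0 < M)%N -> squarefree M -> forall (z : C) Y, 0 < complex.Im z -> mero Y ->
  (forall s, 1 < complex.Re s -> Y s = Ysum M z s) -> first_order Y 1 (limit_coef M z)%:C%C.
Proof.
move: M; apply: squarefree_ind => [z Y hz mY hY|M p M0 sM pp pM IH z Y hz mY hY].
  have D : divisors 1 = [:: 1%N] by [].
  pose F s : C := cpow (complex.Im z) s * (lat_zeta_ext z s * (int_zeta_ext s)^-1).
  have mF : mero F.
    apply: mero_mul; first exact: mero_exp.
    by apply: mero_mul; [exact: lat_zeta_ext_mero|apply: mero_inv; exact: int_zeta_ext_mero].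
  have e : near_off 0 (fun s => F s = Y s).
    apply: mero_eq => // s s1; rewrite hY// /Ysum D big_seq1 /Yterm divr1 cpow1l mul1r /F lat_zeta_ext_Zs// int_zeta_ext_Z1//.
    have h := prim_sum_base hz s1; have nz := int_zeta_neq0 s1.
    have n2 : (2 : C) != 0 by rewrite pnatr_eq0.
    have -> : prim_sum 1 1 z s = 2 * (lat_zeta z s / int_zeta s) by rewrite mulrA h mulrAC mulfV ?mul1r.
    by move: (cpow _ s) (lat_zeta z s / int_zeta s) => a b; field.
  apply: first_order_ext e _.
  have n1 : (-1 : C) != 0 by rewrite oppr_eq0 oner_eq0.
  (* In the quotient of the Epstein zeta function by [2 zeta(2 s)] the values -1 cancel to 1 and the
     two terms [2 ln (2 pi)] cancel. *)
  have := first_order_mul (first_order_exp (ln (complex.Im z))) (first_order_mul (lat_zeta_ext_fo hz) (first_order_inv int_zeta_ext_ana0 int_zeta_ext_fo n1)).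
  have -> : limit_coef 1 z = 4 * eta_log z - pi * complex.Im z / 3 + ln (complex.Im z).
    by rewrite /limit_coef D big_seq1 /= invr1 !mul1r ln_Delta.
  congr (first_order _ _ _); first by rewrite invrN1; ring.
  move: (ln (2 * pi)) (ln (complex.Im z)) (eta_log z) (pi * complex.Im z / 3) => a b c d.
  by rewrite !(rmorphD, rmorphN, rmorphM, rmorph_nat) sqrrN expr1n invrN1; field.
have p0 := prime_gt0 pp; have hpz := im_nat_gt0 p0 hz.
have [Y1 [m1 h1]] := Ysum_mero M0 sM hz; have [Y2 [m2 h2]] := Ysum_mero M0 sM hpz.
have f1 := IH z Y1 hz m1 h1; have f2 := IH _ Y2 hpz m2 h2.
pose D s : C := 1 + cpow p%:R s.
have aD : analytic_at 0 D by apply: ana_add; [exact: ana_cst|exact: ana_exp].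
have D0 : D 0 = 2 by rewrite /D cpow0r.
have n2 : (2 : C) != 0 by rewrite pnatr_eq0.
have fD := first_order_add (first_order_cst (1 : C)) (first_order_exp (ln p%:R)).
have n11 : 1 + 1 != 0 :> C by [].
have H : near_off 0 (fun s => Y1 s + Y2 s = D s * Y s).
  apply: mero_eq; first exact: mero_add.
    by apply: mero_mul => //; apply: mero_add; [exact: mero_cst|exact: mero_exp].
  by move=> s s1; rewrite h1// h2// hY// Ysum_rec.
have := first_order_mul (first_order_add f1 f2) (first_order_inv aD fD n11).
rewrite limit_coef_rec//; move: (limit_coef M z) (limit_coef M (p%:R * z)) (ln p%:R) => a b c f.
apply: (@first_order_ext _ (fun s => (Y1 s + Y2 s) * (D s)^-1)).
  have nz : D 0 != 0 by rewrite D0.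
  apply: near_off_mono (near_off_and H (near_off_nz aD nz)) => s _ [-> nzs].
  by rewrite mulrC mulKf.
move: f; congr (first_order _ _ _); first by rewrite divff.
by rewrite rmorphM fmorphV rmorphB rmorphD rmorph_nat; field.
Qed.

End SquarefreeLevel.

(** * Cusps of Gamma0(N) *)

Section TwoByTwo.
Variable T : comRingType.

Definition mk2 (a b c d : T) : 'M[T]_2 :=
  \matrix_(i < 2, j < 2) (if i == 0 then (if j == 0 then a else b) else (if j == 0 then c else d)).

Lemma mk2E a b c d : [/\ mk2 a b c d 0 0 = a, mk2 a b c d 0 1 = b, mk2 a b c d 1 0 = c & mk2 a b c d 1 1 = d].
Proof. by split; rewrite mxE. Qed.

Lemma mx2_eq (A B : 'M[T]_2) : A 0 0 = B 0 0 -> A 0 1 = B 0 1 -> A 1 0 = B 1 0 -> A 1 1 = B 1 1 -> A = B.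
Proof.
move=> h1 h2 h3 h4; apply/matrixP => i j.
have ord2 (k : 'I_2) : k = 0 \/ k = 1.
  by case: k => [[|[|k]] hk] //; [left|right]; apply: val_inj.
by case: (ord2 i) => ->; case: (ord2 j) => ->.
Qed.

Lemma mul2E (A B : 'M[T]_2) i j : (A *m B) i j = A i 0 * B 0 j + A i 1 * B 1 j.
Proof.
rewrite mxE !big_ord_recl big_ord0 addr0.
by rewrite (_ : lift ord0 ord0 = 1)//; apply: val_inj.
Qed.

Lemma det2 (A : 'M[T]_2) : \det A = A 0 0 * A 1 1 - A 0 1 * A 1 0.
Proof.
rewrite (expand_det_row A 0) !big_ord_recl big_ord0 addr0.
rewrite (_ : lift ord0 ord0 = 1); last exact: val_inj.
rewrite /cofactor /= expr0 mul1r expr1 mulN1r !det_mx11 !mxE mulrN.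
congr (_ * A _ _ - _ * A _ _); exact: val_inj.
Qed.

Lemma id2E : [/\ (1%:M : 'M[T]_2) 0 0 = 1, (1%:M : 'M[T]_2) 0 1 = 0, (1%:M : 'M[T]_2) 1 0 = 0 & (1%:M : 'M[T]_2) 1 1 = 1].
Proof. by split; rewrite mxE. Qed.

Definition adj2 (A : 'M[T]_2) : 'M[T]_2 := mk2 (A 1 1) (- A 0 1) (- A 1 0) (A 0 0).

Lemma adj2K (A : 'M[T]_2) : \det A = 1 -> A *m adj2 A = 1%:M.
Proof.
rewrite det2 => h; have [e1 e2 e3 e4] := mk2E (A 1 1) (- A 0 1) (- A 1 0) (A 0 0).
have [i1 i2 i3 i4] := id2E.
by apply: mx2_eq; rewrite mul2E ?e1 ?e2 ?e3 ?e4 ?i1 ?i2 ?i3 ?i4 -?h; ring.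
Qed.

Lemma adj2_mul (A : 'M[T]_2) : \det A = 1 -> adj2 A *m A = 1%:M.
Proof.
rewrite det2 => h; have [e1 e2 e3 e4] := mk2E (A 1 1) (- A 0 1) (- A 1 0) (A 0 0).
have [i1 i2 i3 i4] := id2E.
by apply: mx2_eq; rewrite mul2E ?e1 ?e2 ?e3 ?e4 ?i1 ?i2 ?i3 ?i4 -?h; ring.
Qed.

Lemma det_adj2 (A : 'M[T]_2) : \det (adj2 A) = \det A.
Proof.
have [e1 e2 e3 e4] := mk2E (A 1 1) (- A 0 1) (- A 1 0) (A 0 0).
by rewrite !det2 e1 e2 e3 e4; ring.
Qed.

End TwoByTwo.

Section Cusps.

(** Points of the projective line are turned into primitive integer vectors, infinity being [1/0];
    the vector is unique up to sign. *)
Definition pnum (p : option rat) : int := if p is Some q then numq q else 1.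
Definition pden (p : option rat) : int := if p is Some q then denq q else 0.
Definition ptof (a b : int) : option rat := if b == 0 then None else Some (a%:~R / b%:~R).

Lemma pnum_pden p : coprimez (pnum p) (pden p).
Proof.
case: p => [q|]; last by rewrite coprimezE /= coprime1n.
by rewrite coprimezE; apply: coprime_num_den.
Qed.

Lemma ptof_vec p : ptof (pnum p) (pden p) = p.
Proof. by case: p => [q|] //; rewrite /ptof /= denq_eq0 divq_num_den. Qed.

Lemma vec_ptof (a b : int) : coprimez a b -> exists e : int, [/\ e = 1 \/ e = -1,
  pnum (ptof a b) = e * a & pden (ptof a b) = e * b].
Proof.
rewrite coprimezE => cab; rewrite /ptof; case: eqP => [b0|/eqP b0].
  move: cab; rewrite b0 /coprime gcdn0 => /eqP ha; rewrite /pnum /pden.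
  by exists a; split; [lia|nia|rewrite mulr0].
exists (Num.sg b); rewrite /pnum /pden coprimeq_num// coprimeq_den// (negPf b0); split=> //.
  by case: (sgrP b) b0; rewrite ?eqxx// => _ _; [left|right].
by rewrite normrEsg.
Qed.

Lemma pvec_neq0 p : ~ (pnum p = 0 /\ pden p = 0).
Proof. by case: p => [q|] /=; [move=> [_ /eqP]; rewrite denq_eq0|case]. Qed.

(* [prow p M] is (-b, a) M for p = a/b; the rows attached to p are the primitive
   vectors orthogonal to (a, b). *)
Definition prow (p : option rat) (M : 'M[int]_2) : int * int :=
  (- pden p * M 0 0 + pnum p * M 1 0, - pden p * M 0 1 + pnum p * M 1 1).

Lemma actQ_ptof (M : 'M[int]_2) p : actQ M p =
  ptof (M 0 0 * pnum p + M 0 1 * pden p) (M 1 0 * pnum p + M 1 1 * pden p).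
Proof.
rewrite /actQ /mobP !mxE /ptof; case: p => [q|] /=; last first.
  by rewrite !mulr0 !addr0 !mulr1 intr_eq0.
set n := numq q; set d := denq q.
have d0 : d%:~R != 0 :> rat by rewrite intr_eq0 denq_eq0.
have eq : q = n%:~R / d%:~R by rewrite divq_num_den.
rewrite {1 2 3}eq.
have e1 : (M 1 0)%:~R * (n%:~R / d%:~R) + (M 1 1)%:~R = (M 1 0 * n + M 1 1 * d)%:~R / d%:~R :> rat.
  by rewrite intrD !intrM; field.
have e2 : (M 0 0)%:~R * (n%:~R / d%:~R) + (M 0 1)%:~R = (M 0 0 * n + M 0 1 * d)%:~R / d%:~R :> rat.
  by rewrite intrD !intrM; field.
rewrite e1 e2 mulf_eq0 invr_eq0 (negPf d0) orbF intr_eq0.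
case: eqP => // /eqP h; congr Some.
have gen (x y t : rat) : t != 0 -> y != 0 -> (x / t) / (y / t) = x / y.
  by move=> t0 y0; field; rewrite t0 y0.
by apply: gen => //; rewrite intr_eq0.
Qed.

Lemma coprimez_act (M : 'M[int]_2) (a b : int) : \det M = 1 -> coprimez a b ->
  coprimez (M 0 0 * a + M 0 1 * b) (M 1 0 * a + M 1 1 * b).
Proof.
rewrite det2 => h /coprimezP[[u v] /= uv]; apply/coprimezP.
exists (u * M 1 1 - v * M 1 0, - u * M 0 1 + v * M 0 0) => /=.
have -> : 1 = (u * a + v * b) * (M 0 0 * M 1 1 - M 0 1 * M 1 0) by rewrite h uv.
ring.
Qed.

Lemma prow_coprime p (M : 'M[int]_2) : \det M = 1 -> coprimez (prow p M).1 (prow p M).2.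
Proof.
rewrite det2 => h; have /coprimezP[[u v] /= uv] := pnum_pden p; rewrite /prow /=; apply/coprimezP.
exists (- v * M 1 1 - u * M 0 1, v * M 1 0 + u * M 0 0) => /=.
have -> : 1 = (u * pnum p + v * pden p) * (M 0 0 * M 1 1 - M 0 1 * M 1 0) by rewrite h uv.
ring.
Qed.

Lemma prow1 p : prow p 1%:M = (- pden p, pnum p).
Proof. by have [i1 i2 i3 i4] := id2E int; rewrite /prow i1 i2 i3 i4; congr (_, _); ring. Qed.

Lemma prow_mul p (A B : 'M[int]_2) : prow p (A *m B) =
  ((prow p A).1 * B 0 0 + (prow p A).2 * B 1 0, (prow p A).1 * B 0 1 + (prow p A).2 * B 1 1).
Proof. by rewrite /prow /= !mul2E; congr (_, _); ring. Qed.

Definition level N p := gcdn `|pden p| N.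

Lemma Gamma0_mul N (A B : 'M[int]_2) : Gamma0 N A -> Gamma0 N B -> Gamma0 N (A *m B).
Proof.
move=> [dA /dvdzP[a ha]] [dB /dvdzP[b hb]]; split; first by rewrite det_mulmx dA dB mulr1.
by apply/dvdzP; exists (a * B 0 0 + A 1 1 * b); rewrite mul2E ha hb; ring.
Qed.

Lemma Gamma0_adj N (A : 'M[int]_2) : Gamma0 N A -> Gamma0 N (adj2 A).
Proof.
move=> [dA /dvdzP[a ha]]; split; first by rewrite det_adj2.
by have [_ _ -> _] := mk2E (A 1 1) (- A 0 1) (- A 1 0) (A 0 0); apply/dvdzP; exists (- a); rewrite ha; ring.
Qed.

(** The hypothesis makes [m] invertible modulo [N], and neither a unit factor nor a multiple of [N]
    changes the gcd with [N]. *)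
Lemma gcd_unit_mod (N : nat) (b x m k : int) : m * x - k * N%:Z = 1 ->
  forall t : int, gcdn `|b * m + t * N%:Z| N = gcdn `|b| N.
Proof.
move=> h t; apply/eqP; rewrite eqn_dvd !dvdn_gcd !dvdn_gcdr !andbT.
have d1 : (gcdz b N%:Z %| b)%Z := dvdz_gcdl _ _; have d2 : (gcdz b N%:Z %| N%:Z)%Z := dvdz_gcdr _ _.
set g := gcdz (b * m + t * N%:Z) N%:Z.
have d3 : (g %| b * m + t * N%:Z)%Z := dvdz_gcdl _ _; have d4 : (g %| N%:Z)%Z := dvdz_gcdr _ _.
apply/andP; split.
  suff : (g %| b)%Z by rewrite dvdzE.
  have -> : b = (b * m + t * N%:Z) * x - (t * x + b * k) * N%:Z.
    have -> : (b * m + t * N%:Z) * x - (t * x + b * k) * N%:Z = b * (m * x - k * N%:Z) by ring.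
    by rewrite h mulr1.
  by apply: rpredB; [exact: dvdz_mulr|exact: dvdz_mull].
suff : (gcdz b N%:Z %| b * m + t * N%:Z)%Z by rewrite dvdzE.
by apply: rpredD; [exact: dvdz_mulr|exact: dvdz_mull].
Qed.

Lemma prow_level N p (M : 'M[int]_2) : Gamma0 N M -> gcdn `|(prow p M).1| N = level N p.
Proof.
move=> [dM /dvdzP[k hk]]; rewrite /prow /= hk mulrA mulNr -mulrN mulrC.
rewrite det2 hk in dM; have -> : - M 0 0 * pden p = pden p * (- M 0 0) by ring.
apply: (@gcd_unit_mod N _ (- M 1 1) _ (M 0 1 * k)); rewrite -dM; ring.
Qed.

Lemma level_act N p (M : 'M[int]_2) : Gamma0 N M -> level N (actQ M p) = level N p.
Proof.
move=> [dM NM]; rewrite actQ_ptof /level.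
have [e [he _ ->]] := vec_ptof (coprimez_act dM (pnum_pden p)).
have -> : absz (e * (M 1 0 * pnum p + M 1 1 * pden p)) = absz (M 1 0 * pnum p + M 1 1 * pden p).
  by case: he => ->; rewrite ?mul1r// mulN1r abszN.
have /dvdzP[k hk] := NM; rewrite det2 hk in dM.
have -> : M 1 0 * pnum p + M 1 1 * pden p = pden p * M 1 1 + (k * pnum p) * N%:Z by rewrite hk; ring.
apply: (@gcd_unit_mod N _ (M 0 0) _ (M 0 1 * k)); rewrite -dM; ring.
Qed.

Lemma bottom_row (c d : int) : coprimez c d -> exists x y, x * d - y * c = 1.
Proof. by move=> /coprimezP[[u v] /= h]; exists v, (- u); rewrite -h; ring. Qed.

(** The square of [gcd (h, k)] divides [h gcd (k, N) = N]. This serves both the classification of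
    the cusps and the computation of the width. *)
Lemma coprime_colevel N (k : int) h : (0 < N)%N -> squarefree N -> N = (h * gcdn `|k| N)%N ->
  coprimez h%:Z k.
Proof.
move=> N0 sN Nh; rewrite coprimezE /= /coprime.
have hN : (h %| N)%N by apply/dvdnP; exists (gcdn `|k| N); rewrite {1}Nh mulnC.
have d1 : (gcdn h `|k| %| gcdn `|k| N)%N.
  by rewrite dvdn_gcd dvdn_gcdr (dvdn_trans (dvdn_gcdl _ _)).
rewrite (sN (gcdn h `|k|))//; apply: (@dvdn_trans (h * gcdn `|k| N)); last by rewrite -Nh.
by rewrite -mulnn; apply: dvdn_mul => //; exact: dvdn_gcdl.
Qed.

(* For squarefree N the level gcd(c, N) is the only invariant of a primitive row (c, d)
   under right multiplication by Gamma0(N). *)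
Lemma rows_transitive N (c d c' d' : int) : (0 < N)%N -> squarefree N ->
  coprimez c d -> coprimez c' d' -> gcdn `|c| N = gcdn `|c'| N ->
  exists M, Gamma0 N M /\ c' * M 0 0 + d' * M 1 0 = c /\ c' * M 0 1 + d' * M 1 1 = d.
Proof.
move=> N0 sN cd cd' e.
have [x [y hB]] := bottom_row cd; have [x' [y' hB']] := bottom_row cd'.
set g := gcdn `|c| N in e; have gN : (g %| N)%N := dvdn_gcdr _ _.
have /dvdnP[h Nh] := gN.
have cop (k : int) : gcdn `|k| N = g -> coprimez h%:Z k.
  by move=> ek; apply: (coprime_colevel N0 sN); rewrite ek.
have ch : coprimez h%:Z (c * c') by rewrite coprimezMr !cop.
have hg : coprimez h%:Z g%:Z.
  rewrite coprimezE /= /coprime (sN (gcdn h g))// Nh -mulnn; apply: dvdn_mul; [exact: dvdn_gcdl|exact: dvdn_gcdr].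
have /coprimezP[[u v] /= uv] := ch.
pose E := x' * c - c' * x; pose n := E * v.
(* [M] is [B'^-1 U B], where [B] and [B'] complete the two rows to matrices of determinant 1 and [U]
   is upper unipotent with entry [n]. Its lower left entry is [E - n c c'], always divisible by [g];
   the choice [n = E v] makes it divisible by [N / g] as well. *)
pose M := mk2 (d' * (x + n * c) - y' * c) (d' * (y + n * d) - y' * d)
  (- c' * (x + n * c) + x' * c) (- c' * (y + n * d) + x' * d).
have [e1 e2 e3 e4] := mk2E (d' * (x + n * c) - y' * c) (d' * (y + n * d) - y' * d)
  (- c' * (x + n * c) + x' * c) (- c' * (y + n * d) + x' * d).
exists M; rewrite /M e1 e2 e3 e4; split; [split|split].
- rewrite det2 e1 e2 e3 e4.
  have -> : 1 = (x * d - y * c) * (x' * d' - y' * c') by rewrite hB hB'.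
  ring.
- rewrite e3; have -> : - c' * (x + n * c) + x' * c = E * (1 - v * (c * c')) by rewrite /n /E; ring.
  rewrite -uv addrK Nh PoszM Gauss_dvdz//; apply/andP; split.
    by rewrite mulrA dvdz_mull.
  have gc : (g%:Z %| c)%Z by rewrite dvdzE dvdn_gcdl.
  have gc' : (g%:Z %| c')%Z by rewrite dvdzE e dvdn_gcdl.
  by apply: dvdz_mulr; apply: rpredB; [exact: dvdz_mull|exact: dvdz_mulr].
- by rewrite -[RHS]mul1r -hB'; ring.
- by rewrite -[RHS]mul1r -hB'; ring.
Qed.

Lemma prow_surj N p (c d : int) : (0 < N)%N -> squarefree N -> coprimez c d ->
  gcdn `|c| N = level N p -> exists M, Gamma0 N M /\ prow p M = (c, d).
Proof.
move=> N0 sN cd e.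
have cp : coprimez (- pden p) (pnum p) by rewrite coprimeNz coprimez_sym pnum_pden.
have [|M [hM [h1 h2]]] := @rows_transitive N c d (- pden p) (pnum p) N0 sN cd cp.
  by rewrite e abszN.
by exists M; split=> //; rewrite /prow h1 h2.
Qed.

Lemma actQ_adj_prow p q (M : 'M[int]_2) : \det M = 1 ->
  prow p M = (- pden q, pnum q) -> actQ (adj2 M) p = q.
Proof.
move=> dM [h1 h2]; rewrite actQ_ptof.
have [-> -> -> ->] := mk2E (M 1 1) (- M 0 1) (- M 1 0) (M 0 0).
rewrite -[RHS]ptof_vec; congr ptof; first by rewrite -h2; ring.
by apply: oppr_inj; rewrite -h1; ring.
Qed.

Lemma level_orbit N p q : (0 < N)%N -> squarefree N -> level N p = level N q ->
  exists M, Gamma0 N M /\ actQ M p = q.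
Proof.
move=> N0 sN e; have cq : coprimez (- pden q) (pnum q) by rewrite coprimeNz coprimez_sym pnum_pden.
have [|M [hM hp]] := prow_surj (p := p) N0 sN cq; first by rewrite abszN e.
exists (adj2 M); split; first exact: Gamma0_adj.
by apply: actQ_adj_prow => //; case: hM.
Qed.

Lemma cusp_classP N p q : (0 < N)%N -> squarefree N ->
  cusp_class N p q <-> level N p = level N q.
Proof.
move=> N0 sN; split; first by move=> [M hM <-]; rewrite level_act.
by move=> /(level_orbit N0 sN)[M [hM <-]]; exists M.
Qed.

Definition cusp_at N (g : nat) : set (option rat) := cusp_class N (Some (g%:~R^-1)).

Lemma level_inv N (g : nat) : (g %| N)%N -> (0 < N)%N -> level N (Some (g%:~R^-1)) = g.
Proof.
move=> gN N0; have g0 : (0 < g)%N := dvdn_gt0 N0 gN.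
rewrite /level /pden; have := @coprimeq_den 1 g%:Z (coprime1n _).
rewrite mul1r => ->; rewrite eqz_nat (negPf (lt0n_neq0 g0)) /=.
by apply/gcdn_idPl.
Qed.

Lemma cuspsP N (c : set (option rat)) : (0 < N)%N -> squarefree N ->
  cusps N c <-> exists2 g, g \in divisors N & c = cusp_at N g.
Proof.
move=> N0 sN; split=> [[p _ <-]|[g _ ->]]; last by exists (Some g%:~R^-1).
exists (level N p); first by rewrite -dvdn_divisors// dvdn_gcdr.
have gN : (level N p %| N)%N := dvdn_gcdr _ _.
apply/seteqP; split=> q; rewrite /cusp_at => /(cusp_classP _ _ N0 sN) e; apply/cusp_classP => //.
  by rewrite level_inv.
by rewrite level_inv in e.
Qed.

Lemma cusp_at_inj N : (0 < N)%N -> squarefree N -> {in divisors N &, injective (cusp_at N)}.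
Proof.
move=> N0 sN g g'; rewrite -!dvdn_divisors// => gN g'N e.
have : cusp_at N g (Some g%:~R^-1) by apply/cusp_classP.
by rewrite e => /cusp_classP; rewrite !level_inv// => /(_ N0 sN).
Qed.

Lemma cusp_at_level N g p : (0 < N)%N -> squarefree N -> (g %| N)%N -> cusp_at N g p -> level N p = g.
Proof. by move=> N0 sN gN /cusp_classP; rewrite level_inv// => /(_ N0 sN). Qed.

(** The row attached to [p = a/b] is the functional [det ((a, b), .)]. A matrix of determinant 1
    preserves this pairing, so it fixes the column [(a, b)] up to a sign exactly when it fixes the
    row up to the same sign. *)
Lemma stab_prow N p (M : 'M[int]_2) : Gamma0 N M ->
  (actQ M p = p <-> prow p M = (- pden p, pnum p) \/ prow p M = (pden p, - pnum p)).
Proof.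
move=> [dM _]; have cM := coprimez_act dM (pnum_pden p).
have d := dM; rewrite det2 in d.
rewrite actQ_ptof; set a' := _ + _ in cM *; set b' := M 1 0 * _ + _ in cM *.
have ea : a' = M 0 0 * pnum p + M 0 1 * pden p by [].
have eb : b' = M 1 0 * pnum p + M 1 1 * pden p by [].
have key e : e = 1 \/ e = -1 -> (a' = e * pnum p /\ b' = e * pden p <-> prow p M = (- e * pden p, e * pnum p)).
  move=> he; rewrite /prow; split=> [[h1 h2]|[h1 h2]].
    congr (_, _).
      have -> : - e * pden p = - e * (pden p * (M 0 0 * M 1 1 - M 0 1 * M 1 0)) by rewrite d mulr1.
      have -> : - pden p * M 0 0 + pnum p * M 1 0 = e * (- (e * pden p) * M 0 0 + (e * pnum p) * M 1 0).
        by case: he => ->; ring.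
      by rewrite -h1 -h2 ea eb; case: he => ->; ring.
    have -> : e * pnum p = e * (pnum p * (M 0 0 * M 1 1 - M 0 1 * M 1 0)) by rewrite d mulr1.
    have -> : - pden p * M 0 1 + pnum p * M 1 1 = e * (- (e * pden p) * M 0 1 + (e * pnum p) * M 1 1).
      by case: he => ->; ring.
    by rewrite -h1 -h2 ea eb; case: he => ->; ring.
  have e2 : e * e = 1 by case: he => ->.
  have ga : e * a' = pnum p.
    have -> : e * a' = (e * pnum p) * M 0 0 - (- e * pden p) * M 0 1 by rewrite ea; ring.
    by rewrite -h1 -h2 -[RHS]mulr1 -d; ring.
  have gb : e * b' = pden p.
    have -> : e * b' = (e * pnum p) * M 1 0 - (- e * pden p) * M 1 1 by rewrite eb; ring.
    by rewrite -h1 -h2 -[RHS]mulr1 -d; ring.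
  by rewrite -ga -gb !mulrA e2 !mul1r.
split.
  move=> h; have [e [he h1 h2]] := vec_ptof cM; rewrite h in h1 h2.
  have e2 : e * e = 1 by case: he => ->.
  have /(key e he) : a' = e * pnum p /\ b' = e * pden p by rewrite h1 h2 !mulrA e2 !mul1r.
  by case: he => -> ->; [left|right]; congr (_, _); ring.
have pt1 (e : int) : e = 1 \/ e = -1 -> a' = e * pnum p /\ b' = e * pden p -> ptof a' b' = p.
  move=> he [-> ->]; rewrite -[RHS]ptof_vec /ptof.
  case: he => ->; rewrite ?mul1r// !mulN1r oppr_eq0; case: ifP => // _.
  by rewrite !intrN invrN mulrNN.
by case=> h; [apply: (pt1 1); [left|]|apply: (pt1 (-1)); [right|]] => //; apply/key; [left| |right|] => //;
  rewrite h; congr (_, _); ring.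
Qed.

End Cusps.

(** * Scaling matrices and widths of cusps *)

Section Scaling.
Variable R : realType.
Local Notation C := R[i].

Lemma invmx_adj2 (A : 'M[R]_2) : \det A = 1 -> invmx A = adj2 A.
Proof.
move=> h; have u : A \in unitmx by rewrite unitmxE h unitr1.
by rewrite -[LHS]mulmx1 -(adj2K h) mulmxA mulVmx// mul1mx.
Qed.

(** The identity plus [t] times the column [(a, b)] times the row [(-b, a)]: unipotent matrices
    fixing [(a, b)], additive in [t]. *)
Definition pmx (a b t : R) : 'M[R]_2 := mk2 (1 - t * a * b) (t * a ^+ 2) (- t * b ^+ 2) (1 + t * a * b).

Lemma pmxE a b t : [/\ pmx a b t 0 0 = 1 - t * a * b, pmx a b t 0 1 = t * a ^+ 2,
  pmx a b t 1 0 = - t * b ^+ 2 & pmx a b t 1 1 = 1 + t * a * b].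
Proof. exact: mk2E. Qed.

Lemma pmx_mul a b t u : pmx a b t * pmx a b u = pmx a b (t + u).
Proof.
have [e1 e2 e3 e4] := pmxE a b t; have [f1 f2 f3 f4] := pmxE a b u; have [g1 g2 g3 g4] := pmxE a b (t + u).
by apply: mx2_eq; rewrite mul2E ?e1 ?e2 ?e3 ?e4 ?f1 ?f2 ?f3 ?f4 ?g1 ?g2 ?g3 ?g4; ring.
Qed.

Lemma pmx0 a b : pmx a b 0 = 1.
Proof.
have [e1 e2 e3 e4] := pmxE a b 0; have [i1 i2 i3 i4] := id2E R.
by apply: mx2_eq; rewrite ?e1 ?e2 ?e3 ?e4 ?i1 ?i2 ?i3 ?i4; ring.
Qed.

Lemma pmx_exp a b t (n : int) : pmx a b t ^ n = pmx a b (n%:~R * t).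
Proof.
have h (k : nat) : pmx a b t ^+ k = pmx a b (k%:R * t).
  elim: k => [|k IH]; first by rewrite expr0 mul0r pmx0.
  by rewrite exprS IH pmx_mul -natr1; congr pmx; ring.
case: n => k; first by rewrite -exprnP h pmulrn.
rewrite NegzE -exprnN h intrN mulNr -pmulrn; set u := k.+1%:R * t.
have e1 : pmx a b u * pmx a b (- u) = 1 by rewrite pmx_mul subrr pmx0.
have e2 : pmx a b (- u) * pmx a b u = 1 by rewrite pmx_mul addNr pmx0.
have un : pmx a b u \is a GRing.unit by apply/unitrP; exists (pmx a b (- u)).
by apply: (mulrI un); rewrite divrr// e1.
Qed.

Lemma scaling_gen (sg : 'M[R]_2) (m a b : R) : \det sg = 1 -> sg 0 0 = m * a -> sg 1 0 = m * b ->
  sg *m T1 R *m invmx sg = pmx a b (m ^+ 2).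
Proof.
move=> d ha hb; rewrite invmx_adj2//; rewrite det2 ha hb in d.
have [e1 e2 e3 e4] := mk2E (sg 1 1) (- sg 0 1) (- sg 1 0) (sg 0 0).
have [g1 g2 g3 g4] := pmxE a b (m ^+ 2).
have t1 : T1 R 0 0 = 1 by rewrite mxE. have t2 : T1 R 0 1 = 1 by rewrite mxE.
have t3 : T1 R 1 0 = 0 by rewrite mxE. have t4 : T1 R 1 1 = 1 by rewrite mxE.
apply: mx2_eq; rewrite !mul2E ?e1 ?e2 ?e3 ?e4 ?g1 ?g2 ?g3 ?g4 ?t1 ?t2 ?t3 ?t4 ?ha ?hb.
- by rewrite -[X in _ = X - _]d; ring.
- ring.
- ring.
- by rewrite -[X in _ = X + _]d; ring.
Qed.

(** Sending infinity to [p] makes the first column of [sg] a multiple of the integer vector of [p];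
    by [scaling_gen] only this column matters for the conjugate of [T1]. *)
Lemma scaling_mu N p (sg : 'M[R]_2) : is_scaling N p sg ->
  exists m : R, [/\ 0 < m ^+ 2, sg 0 0 = m * (pnum p)%:~R & sg 1 0 = m * (pden p)%:~R].
Proof.
move=> [d hm _]; rewrite det2 in d.
have key : sg 0 0 * (pden p)%:~R = sg 1 0 * (pnum p)%:~R.
  move: hm; case: p => [q|] /=; case: eqP => // h.
    move=> [e]; have -> : sg 0 0 = sg 1 0 * ratr q by rewrite -e; field; exact/eqP.
    rewrite /ratr -mulrA; congr (_ * _); rewrite mulfVK// intr_eq0 denq_eq0//.
  by move=> _; rewrite mulr0 h mul0r.
have /coprimezP[[u v] /= uv] := pnum_pden p.
have uvR : u%:~R * (pnum p)%:~R + v%:~R * (pden p)%:~R = 1 :> R by rewrite -!intrM -intrD uv.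
exists (u%:~R * sg 0 0 + v%:~R * sg 1 0).
have gen (U V A B S T : R) : U * A + V * B = 1 -> S * B = T * A ->
    S = (U * S + V * T) * A /\ T = (U * S + V * T) * B.
  move=> h k; split.
    have -> : (U * S + V * T) * A = S * (U * A) + V * (T * A) by ring.
    by rewrite -k -[LHS]mulr1 -h; ring.
  have -> : (U * S + V * T) * B = U * (S * B) + T * (V * B) by ring.
  by rewrite k -[LHS]mulr1 -h; ring.
have [e1 e2] := gen _ _ _ _ _ _ uvR key.
split=> //; rewrite exprn_even_gt0//=; apply: contra_eqN d => /eqP h.
have s0 : sg 0 0 = 0 by rewrite e1 h mul0r.
have s1 : sg 1 0 = 0 by rewrite e2 h mul0r.
by rewrite s0 s1 mul0r mulr0 subrr eq_sym oner_eq0.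
Qed.

Lemma stab_width N p h : (0 < N)%N -> N = (h * level N p)%N ->
  let w := h%:Z in stab N p (mk2 (1 - w * pnum p * pden p) (w * pnum p ^+ 2) (- w * pden p ^+ 2) (1 + w * pnum p * pden p)).
Proof.
move=> N0 Nh w; set M := mk2 _ _ _ _.
have [e1 e2 e3 e4] := mk2E (1 - w * pnum p * pden p) (w * pnum p ^+ 2) (- w * pden p ^+ 2) (1 + w * pnum p * pden p).
have hM : Gamma0 N M.
  split; first by rewrite det2 e1 e2 e3 e4; ring.
  have /dvdzP[k hk] : ((level N p)%:Z %| pden p)%Z by rewrite dvdzE dvdn_gcdl.
  have e : pden p ^+ 2 = k * (level N p)%:Z * pden p by rewrite expr2 -hk.
  have eN : N%:Z = w * (level N p)%:Z by rewrite {1}Nh PoszM.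
  by rewrite e3; apply/dvdzP; exists (- k * pden p); rewrite e eN; ring.
split=> //; apply/(stab_prow p hM); left; rewrite /prow e1 e2 e3 e4; congr (_, _); ring.
Qed.

(** Both inclusions in the description of the stabilizer enter. The integral unipotent matrix of
    parameter [h = N / level] lies in the stabilizer, so [h = n m^2] with [n > 0]; conversely, the
    unipotent matrix of parameter [m^2] is integral and lies in [Gamma0 N], which forces [n = 1]. *)
Lemma scaling_width N p (sg : 'M[R]_2) m : (0 < N)%N -> squarefree N -> is_scaling N p sg ->
  0 < m ^+ 2 -> sg 0 0 = m * (pnum p)%:~R -> sg 1 0 = m * (pden p)%:~R ->
  m ^+ 2 = N%:R / (level N p)%:R.
Proof.
move=> N0 sN [d hm hset] m0 ha hb.
have gN : (level N p %| N)%N := dvdn_gcdr _ _; have g0 : (0 < level N p)%N := dvdn_gt0 N0 gN.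
have /dvdnP[h Nh] := gN.
have h0 : (0 < h)%N by move: N0; rewrite {1}Nh muln_gt0 => /andP[].
have -> : N%:R / (level N p)%:R = h%:R :> R.
  by rewrite {1}Nh natrM mulfK// pnatr_eq0 -lt0n.
rewrite (scaling_gen d ha hb) in hset.
have cab := pnum_pden p; have hw := stab_width N0 Nh; cbv zeta in hw.
have colev := coprime_colevel N0 sN Nh.
have NZ : N%:Z = h%:Z * (level N p)%:Z by rewrite {1}Nh PoszM.
have pv := @pvec_neq0 p.
set a := pnum p in cab hw hset ha hb pv; set b := pden p in cab hw hset ha hb colev pv.
have [g1 g2 g3 g4] := pmxE (a%:~R : R) b%:~R (m ^+ 2).
set W := mk2 _ _ _ _ in hw.
have [w1 w2 w3 w4] := mk2E (1 - h%:Z * a * b) (h%:Z * a ^+ 2) (- h%:Z * b ^+ 2) (1 + h%:Z * a * b).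
have [n hn] : exists n : int, map_mx intr W = pmx a%:~R b%:~R (m ^+ 2) ^ n \/
    map_mx intr W = - pmx a%:~R b%:~R (m ^+ 2) ^ n :> 'M[R]_2.
  have : [set map_mx intr M | M in stab N p] (map_mx intr W : 'M[R]_2) by exists W.
  by rewrite hset.
rewrite pmx_exp in hn; have [f1 f2 f3 f4] := pmxE (a%:~R : R) b%:~R (n%:~R * m ^+ 2).
have {}hn : map_mx intr W = pmx a%:~R b%:~R (n%:~R * m ^+ 2) :> 'M[R]_2.
  (* The minus sign is excluded by the trace, which would be both 2 and -2. *)
  case: hn => // /matrixP hn.
  have := hn 0 0; rewrite [LHS]mxE [RHS]mxE w1 f1; have := hn 1 1; rewrite [LHS]mxE [RHS]mxE w4 f4.
  rewrite intrD intrB => h1 h2; exfalso; move: h1 h2.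
  by move: ((h%:Z * a * b)%:~R) (n%:~R * m ^+ 2 * a%:~R * b%:~R) => x y; clear; lra.
have ea : h%:R * (a%:~R : R) ^+ 2 = n%:~R * m ^+ 2 * a%:~R ^+ 2.
  by move/matrixP: hn => /(_ 0 1); rewrite f2 mxE w2 rmorphM rmorphXn /= -pmulrn.
have eb : h%:R * (b%:~R : R) ^+ 2 = n%:~R * m ^+ 2 * b%:~R ^+ 2.
  move/matrixP: hn => /(_ 1 0); rewrite f3 mxE w3 rmorphM rmorphN rmorphXn /= -pmulrn !mulNr.
  by move/oppr_inj.
have hnm : h%:R = n%:~R * m ^+ 2 :> R.
  have [a0|a0] := eqVneq a 0; last by apply: (mulIf _ ea); rewrite expf_neq0// intr_eq0.
  have [b0|b0] := eqVneq b 0; first by case: pv.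
  by apply: (mulIf _ eb); rewrite expf_neq0// intr_eq0.
have n0 : (0 : int) < n.
  by rewrite -(ltr0z R) -(pmulr_lgt0 _ m0) -hnm ltr0n.
have [M [hM hMe]] : exists M, stab N p M /\ map_mx intr M = pmx a%:~R b%:~R (m ^+ 2) :> 'M[R]_2.
  have : [set map_mx intr M | M in stab N p] (pmx a%:~R b%:~R (m ^+ 2)) by rewrite hset; exists 1; left; rewrite expr1z.
  by move=> [M hM e]; exists M.
have m1 : (M 0 1)%:~R = m ^+ 2 * a%:~R ^+ 2 :> R by move/matrixP: hMe => /(_ 0 1); rewrite g2 mxE.
have m2 : (M 1 0)%:~R = - m ^+ 2 * b%:~R ^+ 2 :> R by move/matrixP: hMe => /(_ 1 0); rewrite g3 mxE.
have ma : n * M 0 1 = h%:Z * a ^+ 2.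
  apply/eqP; rewrite -(eqr_int R); apply/eqP; rewrite [LHS]intrM m1 [LHS]mulrA -hnm.
  by rewrite intrM -pmulrn expr2 [in RHS]expr2 intrM.
have mb : n * M 1 0 = - (h%:Z * b ^+ 2).
  apply/eqP; rewrite -(eqr_int R); apply/eqP; rewrite [LHS]intrM m2 mulNr mulrN [n%:~R * _]mulrA -hnm.
  by rewrite intrN intrM -pmulrn expr2 [in RHS]expr2 intrM.
have cab2 : coprimez (a ^+ 2) (b ^+ 2) by rewrite coprimezXl// coprimezXr.
have /coprimezP[[u v] /= uv] := cab2.
(* The parameter of the generator, recovered as an integer by a Bezout relation for [a^2] and [b^2].
   Since [N] divides [t b^2] and [h] is coprime to [b], [h] divides [t]; with [h = n t] this leaves
   [n = 1]. *)
pose t := u * M 0 1 - v * M 1 0.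
have ht : h%:Z = n * t.
  have -> : n * t = u * (n * M 0 1) - v * (n * M 1 0) by rewrite /t; ring.
  by rewrite ma mb -[LHS]mulr1 -uv; ring.
have M10 : M 1 0 = - t * b ^+ 2.
  by apply: (mulfI (lt0r_neq0 n0)); rewrite mb ht; ring.
have ht2 : (h%:Z %| t)%Z.
  case: hM => -[_ NM] _; move: NM; rewrite M10 NZ mulNr => NM.
  have {}NM : (h%:Z * (level N p)%:Z %| t * b ^+ 2)%Z by move: NM; rewrite rpredN.
  have : (h%:Z %| t * b ^+ 2)%Z by apply: dvdz_trans NM; apply: dvdz_mulr.
  by rewrite Gauss_dvdzl// coprimezXr.
have n1 : n = 1.
  have /dvdzP[q hq] := ht2.
  have h0' : h%:Z != 0 by rewrite eqz_nat -lt0n.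
  have : n * q = 1 by apply: (mulIf h0'); rewrite mul1r [RHS]ht hq mulrA.
  move=> e; have : (n %| 1)%Z by apply/dvdzP; exists q; rewrite mulrC e.
  by rewrite dvdz1 => /eqP; lia.
by rewrite hnm n1 mul1r.
Qed.

End Scaling.

(** * Cosets and primitive vectors *)

Section Cosets.
Variable R : realType.
Local Notation C := R[i].

Lemma sums_has_sum (I : choiceType) (A : set I) (f : I -> R[i]^o) (l : R[i]^o) :
  has_sum A f l <-> sums (fun i => if i \in A then f i else 0 : C) l.
Proof.
have E (F : I -> C) (J : {fset I}) : summability.partial_sum (F : I -> R[i]^o) J = \sum_(i <- J) F i.
  by rewrite /summability.partial_sum big_seq_fsetE.
have tF : Filter (@summability.totally I) := @filter_filter _ _ (summability.totally_filter (I := I)).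
rewrite /has_sum; split=> [/cvgrPdist_lt h e e0|h].
  have e0' : (0 : C) < e%:C%C by rewrite ltcR.
  have [J0 _ hJ] := h _ e0'; exists J0 => J /hJ /=.
  by rewrite E -cmodE ltcR cmod_distC.
apply/cvgrPdist_lt => e /pos_complex[r r0 ->]; have [J0 hJ] := h _ r0.
exists J0 => // J /= /hJ; rewrite cmod_distC => hn.
by rewrite E -(@cmodE R) ltcR.
Qed.

Definition negv (v : int * int) : int * int := (- v.1, - v.2).

Lemma negvK v : negv (negv v) = v. Proof. by case: v => a b; rewrite /negv /= !opprK. Qed.

(** A coset of the stabilizer is recorded by the row of its elements, which is common to them up to
    sign. *)
Definition coset_at N p (v : int * int) : set 'M[int]_2 :=
  [set M | Gamma0 N M /\ (prow p M = v \/ prow p M = negv v)].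

Lemma coset_at_neg N p v : coset_at N p (negv v) = coset_at N p v.
Proof.
apply/seteqP; split=> M [hM h]; split=> //; case: h => ->; rewrite ?negvK; by [left|right].
Qed.

Lemma cosetE N p (M0 : 'M[int]_2) : Gamma0 N M0 ->
  [set G *m M0 | G in stab N p] = coset_at N p (prow p M0).
Proof.
move=> hM0; apply/seteqP; split=> M.
  move=> [G [hG /(stab_prow p hG) fG] <-]; split; first exact: Gamma0_mul.
  rewrite prow_mul; case: fG => ->; [left|right]; rewrite /prow /negv /=; congr (_, _); ring.
move=> [hM hp]; have d0 : \det M0 = 1 by case: hM0.
have hG : Gamma0 N (M *m adj2 M0) by apply: Gamma0_mul => //; exact: Gamma0_adj.
exists (M *m adj2 M0); last by rewrite -mulmxA adj2_mul// mulmx1.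
split=> //; apply/(stab_prow p hG); have e := prow_mul p M0 (adj2 M0).
rewrite adj2K// prow1 in e; rewrite prow_mul; case: hp => ->; [left|right]; first by rewrite e.
by move: (prow p M0) e => [X Y] /= [e1 e2]; rewrite !mulNr -!opprD -e1 -e2 opprK.
Qed.

Lemma im_mobC (A : 'M[R]_2) (z : C) : \det A = 1 -> 0 < complex.Im z ->
  complex.Im (mobC A z) = complex.Im z / cmod ((A 1 0)%:C%C * z + (A 1 1)%:C%C) ^+ 2.
Proof.
rewrite det2 /mobC cmod_sqr; move: (A 0 0) (A 0 1) (A 1 0) (A 1 1) => a b c d; case: z => x y /= h y0.
rewrite !mul0r !subr0 !addr0.
move: (((c * x + d) ^+ 2 + (c * y) ^+ 2)^-1) => D; rewrite -[RHS]mulr1 -h; ring.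
Qed.

(** [xget] selects an unknown element of the coset, but its row is that of [M0] up to sign, and the
    modulus does not see the sign. The scaling matrix enters only through [m^2], the width. *)
Lemma eis_termE N p (sg : 'M[R]_2) (z s : C) (M0 : 'M[int]_2) : (0 < N)%N -> squarefree N ->
  is_scaling N p sg -> 0 < complex.Im z -> Gamma0 N M0 ->
  eis_term sg z s (coset_at N p (prow p M0)) =
    cpow ((level N p)%:R / N%:R) s * cpow (complex.Im z) s * lterm (lat_pt z (prow p M0)) s.
Proof.
move=> N0 sN sums hz hM0; have [m [m0 ha hb]] := scaling_mu sums.
have hm := scaling_width N0 sN sums m0 ha hb; have [d _ _] := sums.
rewrite /eis_term; set M := xget _ _.
have [hM hp] : coset_at N p (prow p M0) M by apply: (@xgetPex _ 1%:M (coset_at N p (prow p M0))); exists M0; split=> //; left.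
have dM : \det (map_mx intr M : 'M[R]_2) = 1 by case: hM => dM _; rewrite det_map_mx dM.
have dS : \det (invmx sg *m map_mx intr M) = 1 by rewrite det_mulmx invmx_adj2// det_adj2 d dM mulr1.
have [e1 e2 e3 e4] := mk2E (sg 1 1) (- sg 0 1) (- sg 1 0) (sg 0 0).
have [c1 c2] : (invmx sg *m map_mx intr M) 1 0 = m * (prow p M).1%:~R /\
    (invmx sg *m map_mx intr M) 1 1 = m * (prow p M).2%:~R.
  by rewrite invmx_adj2// !mul2E e3 e4 !mxE ha hb /prow /= !(intrD, intrM, intrN); split; ring.
rewrite im_mobC// c1 c2.
have -> : (m * (prow p M).1%:~R)%:C%C * z + (m * (prow p M).2%:~R)%:C%C = m%:C%C * lat_pt z (prow p M).
  by rewrite /lat_pt !rmorphM !rmorph_int; ring.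
have nz v : v \in [:: prow p M0; negv (prow p M0)] -> lat_pt z v != 0 /\ lnsq (lat_pt z v) = lnsq (lat_pt z (prow p M0)).
  have n0 : lat_pt z (prow p M0) != 0.
    have dM0 : \det M0 = 1 by case: hM0.
    have := prow_coprime p dM0; case: (prow p M0) => u w /= cuv.
    have [u0|u0] := eqVneq u 0; last by apply: row_neq0.
    rewrite /lat_pt u0 /= mul0r add0r intr_eq0; apply: contraTneq cuv => ->.
    by rewrite u0 coprimezE.
  have en : lat_pt z (negv (prow p M0)) = - lat_pt z (prow p M0).
    by rewrite /lat_pt /negv /= !intrN; ring.
  by rewrite !inE => /orP[|] /eqP ->; rewrite ?en ?oppr_eq0 ?lqN.
have [|n1 eq] := nz (prow p M); first by rewrite !inE; case: hp => ->; rewrite eqxx ?orbT.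
have [|n2 _] := nz (prow p M0); first by rewrite !inE eqxx.
have q0 : 0 < cmod (lat_pt z (prow p M)) ^+ 2 by rewrite exprn_gt0// cmod_gt0.
have lN : 0 < (level N p)%:R / N%:R :> R.
  by rewrite divr_gt0 ?ltr0n//; apply: dvdn_gt0 N0 _; exact: dvdn_gcdr.
rewrite cmodM exprMn cmod_real real_normK ?num_real// hm.
have -> : complex.Im z / (N%:R / (level N p)%:R * cmod (lat_pt z (prow p M)) ^+ 2) =
   (level N p)%:R / N%:R * complex.Im z * (cmod (lat_pt z (prow p M)) ^+ 2)^-1.
  by rewrite !invfM invrK; ring.
have p1 := mulr_gt0 lN hz; have p2 : 0 < (cmod (lat_pt z (prow p M)) ^+ 2)^-1 by rewrite invr_gt0.
rewrite (cpowM s p1 p2) (cpowM s lN hz); congr (_ * _).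
by rewrite /lterm (negPf n2) /cpow lnV ?posrE// -/(lnsq _) eq.
Qed.

Lemma eis_series_Yterm N p (sg : 'M[R]_2) (z s : C) : (0 < N)%N -> squarefree N ->
  is_scaling N p sg -> 0 < complex.Im z -> 1 < complex.Re s ->
  eis_series N p sg z s (Yterm N (level N p) z s).
Proof.
move=> N0 sN hsc hz s1; apply/sums_has_sum.
have sP := pterm_summ N (level N p) hz s1.
pose c := cpow ((level N p)%:R / N%:R) s * cpow (complex.Im z) s : C.
have hf := sumsZ (2^-1 * c) (summ_hs sP); have sf := summZ (2^-1 * c) sP.
have -> : Yterm N (level N p) z s = 2^-1 * c * tsum (pterm N (level N p) z s).
  by rewrite /Yterm /prim_sum /c; ring.
(* Primitive vectors are grouped by coset. A set that is not a coset receives only zero terms; a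
   coset receives exactly [v0] and its negative, each with half the weight. *)
apply: (@sums_fiber _ _ _ (coset_at N p) _ _ _ sf hf) => K.
have fibre v : pterm N (level N p) z s v != 0 -> exists M, Gamma0 N M /\ prow p M = v.
  case: v => c0 d0; rewrite /pterm /=; case: ifP; last by rewrite eqxx.
  move=> /andP[cd /eqP e] _; have [M [hM hp]] := prow_surj N0 sN cd e.
  by exists M.
case: ifPn => KS; last first.
  apply: eq_sums (@sums0 R (int * int)%type) => v; case: eqP => // hv.
  have [->|nz] := eqVneq (pterm N (level N p) z s v) 0; first by rewrite mulr0.
  have [M [hM hp]] := fibre v nz; case/negP: KS; apply/mem_set; exists M => //.
  by rewrite cosetE// hp hv.
move: KS => /set_mem[M0 hM0]; rewrite cosetE// => eK.
set v0 := prow p M0 in eK.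
have d0 : \det M0 = 1 by case: hM0.
have cv := prow_coprime p d0; have lv := prow_level p hM0.
have pe v : coprimez v.1 v.2 -> gcdn `|v.1| N = level N p -> pterm N (level N p) z s v = lterm (lat_pt z v) s.
  by move=> h1 h2; rewrite /pterm h1 h2 eqxx.
have en : lat_pt z (negv v0) = - lat_pt z v0 by rewrite /lat_pt /negv /= !intrN; ring.
have f1 : pterm N (level N p) z s v0 = lterm (lat_pt z v0) s by apply: pe.
have f2 : pterm N (level N p) z s (negv v0) = lterm (lat_pt z v0) s.
  rewrite pe /negv /= ?abszN//; last by rewrite coprimeNz coprimezN.
  by rewrite -/(negv v0) en /lterm oppr_eq0 lqN.
have vn : negv v0 != v0.
  apply: contraTneq cv; rewrite -/v0; case: (v0) => a b /= [e1 e2].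
  have -> : a = 0 by lia.
  by have -> : b = 0 by lia.
rewrite -eK eis_termE// -/c -/v0.
pose T v := 2^-1 * c * pterm N (level N p) z s v.
have g1 := @sums_single R _ (fun v => if v == v0 then T v else 0) v0.
have g2 := @sums_single R _ (fun v => if v == negv v0 then T v else 0) (negv v0).
rewrite !eqxx in g1 g2.
have := sumsD (g1 (fun i h => ifN _ _ h)) (g2 (fun i h => ifN _ _ h)).
rewrite /T f1 f2.
have -> : 2^-1 * c * lterm (lat_pt z v0) s + 2^-1 * c * lterm (lat_pt z v0) s = c * lterm (lat_pt z v0) s by field.
move=> H; apply: eq_sums H => v.
have [->|nv] := eqVneq v v0; first by rewrite eq_sym (negPf vn) addr0 eqxx.
have [->|nv'] := eqVneq v (negv v0); first by rewrite add0r coset_at_neg eqxx.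
rewrite addr0; case: eqP => // hv.
have [->|nz] := eqVneq (pterm N (level N p) z s v) 0; first by rewrite mulr0.
have [M [hM hp]] := fibre v nz.
have : coset_at N p v M0 by rewrite hv; split=> //; left.
case=> _ [|] h; first by move: nv; rewrite -h eqxx.
by move: nv'; rewrite /v0 h negvK eqxx.
Qed.

(** [F] witnesses that a continuation exists, so the one selected by [Epar] has the defining
    properties; it agrees with [F] near 0 by the identity principle and uniqueness of sums. *)
Lemma Epar_near N p (sg : 'M[R]_2) (z : C) (F : C -> C) : (0 < N)%N -> squarefree N ->
  is_scaling N p sg -> 0 < complex.Im z -> mero F ->
  (forall s, 1 < complex.Re s -> F s = Yterm N (level N p) z s) ->
  near_off 0 (fun s => Epar N p sg z s = F s).
Proof.
move=> N0 sN hsc hz mF hF.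
have [mE hE] : [set F : R[i]^o -> R[i]^o | meromorphic F /\
    forall s : R[i]^o, 1 < complex.Re s -> eis_series N p sg z s (F s)] (Epar N p sg z).
  apply: (@xgetPex _ (fun=> 0) [set F : R[i]^o -> R[i]^o | meromorphic F /\
    forall s : R[i]^o, 1 < complex.Re s -> eis_series N p sg z s (F s)]).
  exists F; split; first exact: mero_meromorphic.
  by move=> s s1; rewrite hF//; exact: eis_series_Yterm.
apply: mero_eq; [exact: meromorphic_mero|exact: mF|] => s s1; rewrite hF//.
have /sums_has_sum h1 := hE s s1.
have /sums_has_sum h2 := eis_series_Yterm N0 sN hsc hz s1.
exact: sums_unique h1 h2.
Qed.

End Cosets.

(** * The sum over all cusps near s = 0 *)

Theorem theorem5p2 (R : realType) (N : nat) (hN : (0 < N)%N)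
  (hsq : squarefree N)
  (rep : set (option rat) -> option rat)
  (hrep : forall c : set (option rat), cusps N c -> c (rep c))
  (sg : set (option rat) -> 'M[R]_2)
  (hsg : forall c : set (option rat), cusps N c ->
     is_scaling N (rep c) (sg c))
  (z : R[i]) (hz : 0 < complex.Im z) :
  (fun s : R[i]^o => \sum_(c \in cusps N) Epar N (rep c) (sg c) z s) =
  (fun s : R[i]^o =>
     1 + ((size (divisors N))%:R^-1 *
          \sum_(c <- divisors N)
            ln (cmod (Delta (c%:R * z)) `^ 6^-1 * complex.Im z))%:C%C * s)
  +O_ (0^') (fun s : R[i]^o => s ^+ 2).
Proof.
(* The continuations are chosen simultaneously for all [g], with a dummy function when [g] does not
   divide [N]. *)
have gF (g : nat) : exists F : R[i] -> R[i], (g %| N)%N -> mero F /\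
    forall s, 1 < complex.Re s -> F s = Yterm N g z s.
  have [gN|gN] := boolP (g %| N)%N; last by exists (fun=> 0).
  by have [F hF] := Yterm_mero hN hsq gN hz; exists F.
have [F hF] := choice gF.
have eC : cusps N = [set` [seq cusp_at N g | g <- divisors N]].
  apply/seteqP; split=> c; first by move=> /(cuspsP _ hN hsq)[g gN ->]; apply/mapP; exists g.
  by move=> /mapP[g gN ->]; apply/(cuspsP _ hN hsq); exists g.
have E s : \sum_(c \in cusps N) Epar N (rep c) (sg c) z s =
    \sum_(g <- divisors N) Epar N (rep (cusp_at N g)) (sg (cusp_at N g)) z s.
  rewrite -(big_map (cusp_at N) predT (fun c => Epar N (rep c) (sg c) z s)).
  rewrite [RHS]fsbig_seq; last by rewrite map_inj_in_uniq ?divisors_uniq//; exact: cusp_at_inj.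
  by rewrite eC.
have near g : g \in divisors N -> near_off 0 (fun s => Epar N (rep (cusp_at N g)) (sg (cusp_at N g)) z s = F g s).
  rewrite -dvdn_divisors// => gN; have [mF eF] := hF g gN.
  have cN : cusps N (cusp_at N g) by apply/cuspsP => //; exists g => //; rewrite -dvdn_divisors.
  have lv : level N (rep (cusp_at N g)) = g by apply: cusp_at_level => //; exact: hrep.
  by apply: (Epar_near hN hsq (hsg _ cN) hz mF) => s s1; rewrite lv eF.
pose Y s := \sum_(g <- divisors N) F g s.
have mY : mero Y /\ near_off 0 (fun s => \sum_(g <- divisors N) Epar N (rep (cusp_at N g)) (sg (cusp_at N g)) z s = Y s).
  rewrite /Y; have : {subset divisors N <= divisors N} by [].
  elim: {1 3 4 5}(divisors N) => [|g r IH] hr.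
    split; last by exists 1; split=> // s _ _; rewrite !big_nil.
    by rewrite (_ : (fun s => _) = fun=> 0); [exact: mero_cst|apply/funext => s; rewrite big_nil].
  have gN : g \in divisors N by apply: hr; rewrite inE eqxx.
  have [|mr pr] := IH; first by move=> k kr; apply: hr; rewrite inE kr orbT.
  split.
    rewrite (_ : (fun s => _) = fun s => F g s + \sum_(j <- r) F j s); last by apply/funext => s; rewrite big_cons.
    by apply: mero_add => //; have := gN; rewrite -dvdn_divisors// => /hF[].
  by apply: near_off_mono (near_off_and (near g gN) pr) => s _ [e1 e2]; rewrite !big_cons e1 e2.
have [K hK] : first_order Y 1 (limit_coef N z)%:C%C.
  apply: Ysum_fo => //; first by case: mY.
  move=> s s1; rewrite /Y /Ysum big_seq [RHS]big_seq; apply: eq_bigr => g.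
  by rewrite -dvdn_divisors// => /hF[_ ->].
(* The norm of [R[i]] takes values in [R[i]], whose order is partial; any [k] above the real
   constant [|K|] serves. *)
apply/eqaddOP; near=> k.
have kK : (`|K|)%:C%C <= k by near: k; apply: nbhs_pinfty_ge; rewrite realE lecR normr_ge0.
apply/pnP; apply: near_off_mono (near_off_and mY.2 hK) => s _ [e1 e2].
have h : `|Y s - (1 + (limit_coef N z)%:C%C * s)| <= k * `|s ^+ 2|.
  rewrite opprD addrA; apply: le_trans (_ : _ <= (`|K|)%:C%C * `|s ^+ 2|) _; last by rewrite ler_wpM2r.
  rewrite -!cmodE -rmorphM lecR cmodX; apply: le_trans e2 _.
  by rewrite ler_wpM2r ?exprn_ge0 ?cmod_ge0// ler_norm.
by rewrite -e1 -E in h; exact: h.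
Unshelve. all: by end_near.
Qed.
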